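(* Let $\Omega\subset\mathbb{R}^N$ be a smooth bounded connected open set, let $V:\Omega\to[0,+\infty]$ be a Borel function, let $Z\subset\Omega$ be the universal zero-set associated to $-\Delta+V$, and let $(D_j)_{j\in J}$ be the Sobolev-connected components of $\Omega\setminus Z$. Let $u$ be a distributional solution of the Dirichlet problem $-\Delta u+Vu=\mu$ in $\Omega$, $u=0$ on $\partial\Omega$, for some nonnegative finite Borel measure $\mu$ in $\Omega$. If there exists a Lebesgue point $x\in D_j$ of $u$ such that $\widehat u(x)=0$, then $\widehat u=0$ in $D_j$ (that is, $\widehat u(y)=0$ at every Lebesgue point $y\in D_j$ of $u$) and $\mu(D_j)=0$.
   Context: Products $Vu$ use the convention $0\cdot\infty=0$. A distributional solution of the Dirichlet problem with datum $\mu$ is a function $u\in W_0^{1,1}(\Omega)\cap L^1(\Omega;V\,dx)$ such that $\int_\Omega u(-\Delta\varphi+V\varphi)=\int_\Omega\varphi\,d\mu$ for every $\varphi\in C_c^\infty(\Omega)$. Precise representative: a point $x\in\Omega$ is a Lebesgue point of $v\in L^1(\Omega)$ if there is $c\in\mathbb{R}$ with $\lim_{r\to0}\frac{1}{|B_r|}\int_{B_r(x)}|v-c|=0$; then $\widehat v(x):=c$. Universal zero-set: $Z$ is the set of points $x\in\Omega$ such that $\widehat w(x)=0$ for every $w\in W_0^{1,2}(\Omega)\cap L^\infty(\Omega)$ with $Vw\in L^1(\Omega)$ that satisfies $-\Delta w+Vw=f$ in the sense of distributions in $\Omega$ for some nonnegative $f\in L^\infty(\Omega)$ (for such $w$ every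 point of $\Omega$ is a Lebesgue point). A set $O\subset\Omega$ is Sobolev-open if there exists a nonnegative $\xi\in W_0^{1,2}(\Omega)$ such that every point of $\Omega$ is a Lebesgue point of $\xi$ and $O=\{x\in\Omega:\widehat\xi(x)>0\}$. A set $D\subset\Omega$ is Sobolev-connected if for all disjoint Sobolev-open sets $A,B\subset\Omega$ with $D\subset A\cup B$ one has $D\subset A$ or $D\subset B$. The Sobolev-connected components $(D_j)_{j\in J}$ of $\Omega\setminus Z$ are the members of the unique finite or countably infinite decomposition of $\Omega\setminus Z$ into pairwise disjoint non-empty sets that are both Sobolev-open and Sobolev-connected. *)

(* Defs.v *)
From HB Require Import structures.
From mathcomp Require Import all_boot all_order all_algebra.
From mathcomp Require Import all_classical all_reals all_analysis.
From mathcomp Require Import measurable_realfun.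
Set Implicit Arguments.
Unset Strict Implicit.
Unset Printing Implicit Defensive.
Import Order.TTheory GRing.Theory Num.Theory.
Import numFieldNormedType.Exports.
Local Open Scope classical_set_scope.
Local Open Scope ring_scope.

(* Matrices, in particular row vectors, carry the Borel sigma-algebra. *)
HB.instance Definition _ (R : realType) (m n : nat) :=
  @isMeasurable.Build (sigma_display (@open 'M[R]_(m, n))) 'M[R]_(m, n)
    <<s (@open 'M[R]_(m, n)) >> (@sigma_algebra0 _ setT _)
    (@sigma_algebraC _ _) (@sigma_algebra_bigcup _ setT _).

Section Lebesgue_measure_rV.
Context {R : realType}.

Lemma open_measurable_mx m n (A : set 'M[R]_(m, n)) : open A -> measurable A.
Proof. by move=> oA; exact: sub_sigma_algebra. Qed.

Definition rV_cons n (p : 'rV[R]_n * R) : 'rV[R]_(1 + n) :=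
  row_mx (const_mx p.2) p.1.

Lemma preimage_rV_cons_ball n (x : 'rV[R]_(1 + n)) (e : R) :
  @rV_cons n @^-1` (ball x e) =
  (ball (rsubmx x) e) `*` (ball (x ord0 (lshift n ord0)) e).
Proof.
apply/seteqP; split => -[v t] /=.
  move=> [e0 xe]; split => /=.
    split=> // i j; have := xe i (rshift 1 j).
    by rewrite /rV_cons row_mxEr mxE.
  by have := xe ord0 (lshift n ord0); rewrite /rV_cons row_mxEl mxE.
move=> [[e0 xe] te]; split=> // i j; rewrite (ord1 i).
rewrite /rV_cons; have [k ->|k ->] := split_ordP j.
  by rewrite row_mxEl mxE (ord1 k).
by have := xe ord0 k; rewrite mxE row_mxEr.
Qed.

Lemma open_bigcup_rat_ball n (A : set 'rV[R]_n) : open A ->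
  let B (qk : 'rV[rat]_n * nat) : set 'rV[R]_n :=
    ball (map_mx ratr qk.1 : 'rV[R]_n) qk.2.+1%:R^-1 in
  A = \bigcup_(qk in [set qk | B qk `<=` A]) B qk.
Proof.
move=> oA B; apply/seteqP; split=> [x Ax|x [qk /= BA Bx]]; last exact: BA.
have /nbhs_ballP[e /= e0 eA] : nbhs x A by exact: open_nbhs_nbhs.
have [k ke] : exists k, k.+1%:R^-1 < e / 2 :> R.
  have e20 : 0 < e / 2 by rewrite divr_gt0.
  near \oo => k; exists k; near: k.
  exact: near_infty_natSinv_lt (PosNum e20).
have k0 : 0 < k.+1%:R^-1 :> R by rewrite invr_gt0.
have /choice[q xq] : forall j, exists q : rat, ball (x ord0 j) k.+1%:R^-1 (ratr q).
  move=> j; have : x ord0 j - k.+1%:R^-1 < x ord0 j + k.+1%:R^-1.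
    by rewrite ltrD2l (@lt_trans _ _ 0)// oppr_lt0.
  move=> /rat_in_itvoo[q]; rewrite in_itv/= => /andP[q1 q2]; exists q.
  by rewrite /ball/= distrC ltr_distl q1 q2.
have Bx : B (\row_j q j, k) x.
  by split=> // i j; rewrite !mxE (ord1 i); exact/ball_sym/xq.
exists (\row_j q j, k) => //= y By; apply: eA; rewrite (splitr e).
apply: (@ball_triangle _ _ (map_mx ratr (\row_j q j) : 'rV[R]_n)).
  exact: (le_ball (ltW ke) (ball_sym Bx)).
exact: (le_ball (ltW ke) By).
Unshelve. all: by end_near. Qed.

Lemma measurable_rV_cons n : measurable_fun setT (@rV_cons n).
Proof.
apply: (@measurability _ _ _ _ _ _ (@open 'rV[R]_(1 + n))) => //.
move=> _ [A oA <-]; rewrite setTI (open_bigcup_rat_ball oA) preimage_bigcup.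
rewrite bigcup_mkcond; apply: countable_bigcupT_measurable => // qk.
case: ifPn => // _; rewrite preimage_rV_cons_ball.
apply: measurableX; [apply: open_measurable_mx|apply: open_measurable].
  exact: ball_open.
exact: ball_open.
Qed.

Section lebesgue_cons.
Variables (n : nat) (m : {measure set 'rV[R]_n -> \bar R}).
Local Open Scope ereal_scope.

Definition lebesgue_cons : set 'rV[R]_(1 + n) -> \bar R :=
  pushforward (m \x lebesgue_measure) (@rV_cons n).

Let mcons := @measurable_rV_cons n.

Let lebesgue_cons0 : lebesgue_cons set0 = 0.
Proof. by rewrite /lebesgue_cons /pushforward preimage_set0 measure0. Qed.

Let lebesgue_cons_ge0 A : 0 <= lebesgue_cons A.
Proof. exact: measure_ge0. Qed.

Let lebesgue_cons_sigma_additive : semi_sigma_additive lebesgue_cons.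
Proof. exact: measure_semi_sigma_additive. Qed.

HB.instance Definition _ := isMeasure.Build _ _ _ lebesgue_cons
  lebesgue_cons0 lebesgue_cons_ge0 lebesgue_cons_sigma_additive.

End lebesgue_cons.

(* Lebesgue measure on R^n, as the iterated product of the one-dimensional
   Lebesgue measure transported along R^n * R -> R^(1 + n). *)
Fixpoint lebesgue_rV (n : nat) : {measure set 'rV[R]_n -> \bar R} :=
  match n with
  | 0 => \d_(0 : 'rV[R]_0)
  | n'.+1 => lebesgue_cons (lebesgue_rV n')
  end.

End Lebesgue_measure_rV.

Section smooth_functions.
Context {R : realType} {n : nat}.
Implicit Types (O : set 'rV[R]_n) (f : 'rV[R]_n -> R).

Definition partial (i : 'I_n) f (x : 'rV[R]_n) : R := 'D_(delta_mx 0 i) f x.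

Definition laplacian f (x : 'rV[R]_n) : R := \sum_i partial i (partial i f) x.

(* f is C^oo on R^n: all iterated partial derivatives exist and are
   continuous. *)
Definition smooth f := forall s : seq 'I_n,
  continuous (foldr partial f s) /\
  forall x i, derivable (foldr partial f s) x (delta_mx 0 i).

(* C_c^oo(O), as functions on R^n that vanish outside a compact subset of O. *)
Definition test_function O f :=
  [/\ smooth f, compact (closure [set x | f x != 0]) &
      closure [set x | f x != 0] `<=` O].

(* An open set with smooth boundary lies locally on one side of its boundary:
   near each boundary point it is a strict sublevel set of a smooth function
   whose gradient does not vanish there. *)
Definition smooth_boundary O :=
  forall a, (closure O `\` interior O) a ->
  exists (rho : 'rV[R]_n -> R) (U : set 'rV[R]_n),
    [/\ smooth rho, exists i, partial i rho a != 0, open_nbhs a U &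
        O `&` U = [set x | rho x < 0] `&` U].

Definition smooth_bounded_domain O :=
  [/\ open O, connected O, bounded_set O & smooth_boundary O].

End smooth_functions.

Section Sobolev.
Context {R : realType} {n : nat}.
Local Notation leb := (@lebesgue_rV R n).
Implicit Types (O : set 'rV[R]_n) (u v f : 'rV[R]_n -> R) (p : \bar R)
  (x : 'rV[R]_n).

(* L^p(O); elements are functions on R^n whose values outside O are
   irrelevant. *)
Definition Lp p O u := u \_ O \in Lfun leb p.

Definition Lp_dist p O u v : \bar R := 'N[leb]_p[EFin \o ((u \- v) \_ O)].

Definition weak_gradient O u (g : 'I_n -> 'rV[R]_n -> R) :=
  forall i f, test_function O f ->
  (\int[leb]_(x in O) (u x * partial i f x)%:E =
   - \int[leb]_(x in O) (g i x * f x)%:E)%E.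

(* W_0^{1,p}(O): the closure of C_c^oo(O) in W^{1,p}(O). *)
Definition W01 p O u :=
  exists g : 'I_n -> 'rV[R]_n -> R,
    [/\ Lp p O u, forall i, Lp p O (g i), weak_gradient O u g &
        forall e : R, 0 < e -> exists f,
          [/\ test_function O f, (Lp_dist p O f u < e%:E)%E &
              forall i, (Lp_dist p O (partial i f) (g i) < e%:E)%E]].

(* The norm of the library on 'rV_n is the sup norm, so Euclidean balls are
   spelled out. *)
Definition euclidean_ball x (r : R) : set 'rV[R]_n :=
  [set y | \sum_i (y 0 i - x 0 i) ^+ 2 < r ^+ 2].

Definition lebesgue_value v x (c : R) :=
  ((leb (euclidean_ball x r))^-1 *
    \int[leb]_(y in euclidean_ball x r) `|v y - c|%:E)%E @[r --> 0^'+] --> 0%E.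

Definition lebesgue_point v x := exists c, lebesgue_value v x c.

(* Precise representative; only meaningful at Lebesgue points. *)
Definition precise v x : R := xget 0 [set c | lebesgue_value v x c].

Definition sobolev_open O (A : set 'rV[R]_n) :=
  exists xi : 'rV[R]_n -> R,
    [/\ W01 2%:E O xi, forall x, O x -> 0 <= xi x,
        forall x, O x -> lebesgue_point xi x &
        A = [set x | O x /\ 0 < precise xi x]].

Definition sobolev_connected O (D : set 'rV[R]_n) :=
  D `<=` O /\
  forall A B, sobolev_open O A -> sobolev_open O B -> A `&` B = set0 ->
    D `<=` A `|` B -> D `<=` A \/ D `<=` B.

(* (D j)_j is a countable partition of E into non-empty sets that are both
   Sobolev-open and Sobolev-connected. *)
Definition sobolev_components O (E : set 'rV[R]_n) (J : Type)
    (D : J -> set 'rV[R]_n) :=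
  [/\ countable [set: J],
      forall j, [/\ D j !=set0, sobolev_open O (D j) &
                    sobolev_connected O (D j)],
      trivIset [set: J] D &
      \bigcup_j D j = E].

End Sobolev.

Section Schroedinger.
Context {R : realType} {n : nat}.
Local Notation leb := (@lebesgue_rV R n).
Implicit Types (O : set 'rV[R]_n) (V : 'rV[R]_n -> \bar R)
  (u w f phi : 'rV[R]_n -> R).
Local Open Scope ereal_scope.

(* The product of extended reals satisfies 0 * +oo = 0. *)
Definition weak_schroedinger O V u phi : \bar R :=
  \int[leb]_(x in O)
    ((u x)%:E * ((- laplacian phi x)%:E + V x * (phi x)%:E)).

Definition zero_set_competitor O V w :=
  [/\ W01 2%:E O w, Lp +oo O w,
      leb.-integrable O (fun x => V x * (w x)%:E) &
      exists f, [/\ Lp +oo O f, forall x, O x -> (0 <= f x)%R &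
        forall phi, test_function O phi ->
          weak_schroedinger O V w phi =
          \int[leb]_(x in O) (f x * phi x)%:E]].

Definition universal_zero_set O V : set 'rV[R]_n :=
  [set x | O x /\ forall w, zero_set_competitor O V w ->
             lebesgue_point w x /\ precise w x = 0%R].

Definition dirichlet_solution O V (mu : {measure set 'rV[R]_n -> \bar R}) u :=
  [/\ W01 1 O u, leb.-integrable O (fun x => V x * (u x)%:E) &
      forall phi, test_function O phi ->
        weak_schroedinger O V u phi = \int[mu]_(x in O) (phi x)%:E].

End Schroedinger.

(* Main.v *)
(* Write u^ for the precise representative.  For al > 0 let G_al f be the variational
   solution of -Delta z + (V + al) z = f in the form domain.  It satisfies the equation
   only up to a nonpositive measure; the bounded sources f >= 0 for which there is no
   defect are stable under sums, under smaller sources, under G_2 and under bounded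
   monotone limits, so there is a largest one f_0 with f_0 <= 1.  Every competitor w in
   the definition of the universal zero set solves w = G_2 (f + 2 w) with a source of
   this kind, hence w <= C G_2 f_0.

   By comparison, s = G_2 (min (u, f_0)) is at most min (u, f_0).  Split f_0 = a + b
   according to s > 0 or s = 0, and put wA = G_2 a, wB = G_2 b.  Symmetry of G_2 and
   G_2 (min (f_0, k s)) <= k s give wA wB = 0, u wB = 0 and u b = 0 almost everywhere,
   and wA^ = 0 at the points where u^ = 0.  The sets {wA^ > 0} and {wB^ > 0} are
   disjoint, Sobolev-open and cover the complement of the zero set, so a component
   containing a zero of u^ lies in {wB^ > 0}; there u^ = 0 because u wB = 0.

   Finally, test the equation of u with th * (K_d * wB).  Since u wB = 0, grad u = 0
   almost everywhere on {u = 0} and -Delta wB <= b with u b = 0, the limit d -> 0 gives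
   that the integral of th wB^ with respect to mu is nonpositive: mu {wB^ > 0} = 0.

   All the regularity needed is that z bounded with -Delta z <= C has a precise
   representative everywhere: the averages of z against a kernel K_s with
   d/ds K_s = Delta Q_s, Q_s >= 0, are monotone in s up to an error C s^2 / 4. *)
Require Import Defs.
From HB Require Import structures.
From mathcomp Require Import all_boot all_order all_algebra.
From mathcomp Require Import all_classical all_reals all_analysis.
From mathcomp Require Import measurable_realfun ess_sup_inf.
From mathcomp Require Import ring lra.
Set Implicit Arguments.
Unset Strict Implicit.
Unset Printing Implicit Defensive.
Import Order.TTheory GRing.Theory Num.Theory.
Import numFieldNormedType.Exports.
Local Open Scope classical_set_scope.
Local Open Scope ring_scope.

(** * Integrals *)

(** The form domain can be too small to detect a source: G_al f = 0 does not force f = 0. Absence of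
    defect restores this implication, and this is how u b = 0 is obtained. The shift al > 0 makes
    the form coercive in L^2 without a Poincare inequality. Two shifts occur because of the
    resolvent identity G_1 f = G_2 f + G_1 (G_2 f): a sum of two subsolutions has no defect only if
    neither summand has one. Hence G_2 maps the class of sources into itself, and since G_2 f <= 1
    for f <= 1, the maximality of f_0 applies to solutions as well: wA <= f_0 and wB <= f_0. This is
    what locates solutions relative to sources. The solution u is only in W_0^{1,1} and its datum is
    a measure, so u cannot be tested in the quadratic form. The bound s <= u rests instead on Kato's
    inequality for distributional supersolutions; the smooth boundary then makes the zero extension
    of the truncated negative part subharmonic on the whole space, hence zero. Every truncation used
    has a Lipschitz derivative, so that the chain rule passes through approximation by C^1
    functions. *)

Section Integral_calculus.
Context d (T : measurableType d) (R : realType).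
Variable mu : {measure set T -> \bar R}.
Implicit Types f g : T -> R.

(** Integrability on the whole space: functions on O are represented by their extension by zero, so
    that the calculus below needs no domain of integration. *)
Definition intg f := mu.-integrable setT (EFin \o f).

Local Notation I f := (Rintegral mu setT f).

Lemma intg_measurable f : intg f -> measurable_fun setT f.
Proof. by move=> /measurable_int /measurable_EFinP. Qed.

Lemma eq_intg f g : f =1 g -> intg f -> intg g.
Proof. by move=> /funext ->. Qed.

Lemma intg0 : intg (fun=> 0).
Proof. exact: integrable0. Qed.

Lemma intgD f g : intg f -> intg g -> intg (fun x => f x + g x).
Proof. by move=> mf mg; have := integrableD measurableT mf mg. Qed.

Lemma intgN f : intg f -> intg (fun x => - f x).
Proof. by move=> mf; have := integrableN mf. Qed.

Lemma intgB f g : intg f -> intg g -> intg (fun x => f x - g x).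
Proof. by move=> mf /intgN; exact: intgD. Qed.

Lemma intgZ (c : R) f : intg f -> intg (fun x => c * f x).
Proof. by move=> mf; have := integrableZl measurableT c mf. Qed.

Lemma intg_sum n (F : 'I_n -> T -> R) :
  (forall i, intg (F i)) -> intg (fun x => \sum_i F i x).
Proof.
move=> iF; have := @integrable_sum _ _ _ mu setT measurableT _ (index_enum 'I_n)
  predT (fun i => EFin \o F i) (fun i _ => iF i).
by apply: eq_integrable => // x _ /=; rewrite sumEFin.
Qed.

Lemma intg_norm f : intg f -> intg (fun x => `|f x|).
Proof. by move=> /integrable_norm. Qed.

Lemma intg_le f g : measurable_fun setT f -> (forall x, `|f x| <= g x) ->
  intg g -> intg f.
Proof.
move=> mf fg ig; apply: le_integrable ig => //; first exact/measurable_EFinP.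
by move=> x _ /=; rewrite lee_fin (le_trans (fg x))// ler_norm.
Qed.

Lemma intgMb (C : R) g f : measurable_fun setT g -> (forall x, `|g x| <= C) ->
  intg f -> intg (fun x => g x * f x).
Proof.
move=> mg gC iF; have mf := intg_measurable iF.
apply: (@intg_le _ (fun x => C * `|f x|)); first exact: measurable_funM.
  by move=> x; rewrite normrM ler_wpM2r.
exact/intgZ/intg_norm.
Qed.

Lemma RintD f g : intg f -> intg g -> I (fun x => f x + g x) = I f + I g.
Proof. by move=> *; exact: RintegralD. Qed.

Lemma RintB f g : intg f -> intg g -> I (fun x => f x - g x) = I f - I g.
Proof. by move=> *; exact: RintegralB. Qed.

Lemma RintZ (c : R) f : intg f -> I (fun x => c * f x) = c * I f.
Proof. by move=> *; exact: RintegralZl. Qed.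

Lemma Rint0 : I (fun=> 0) = 0.
Proof. by rewrite /Rintegral integral0. Qed.

Lemma RintN f : intg f -> I (fun x => - f x) = - I f.
Proof.
move=> iF; rewrite -(mulN1r (I f)) -RintZ//.
by congr Rintegral; apply/funext => x; rewrite mulN1r.
Qed.

Lemma Rint_sum n (F : 'I_n -> T -> R) : (forall i, intg (F i)) ->
  I (fun x => \sum_i F i x) = \sum_i I (F i).
Proof.
elim: n F => [|n ih] F iF.
  rewrite big_ord0 -[RHS]Rint0; congr Rintegral.
  by apply/funext => x; rewrite big_ord0.
rewrite big_ord_recl -ih// -RintD//; last exact: intg_sum.
by congr Rintegral; apply/funext => x; rewrite big_ord_recl.
Qed.

Lemma Rint_ge0 f : (forall x, 0 <= f x) -> 0 <= I f.
Proof. by move=> f0; exact: Rintegral_ge0. Qed.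

Lemma Rint_le f g : intg f -> intg g -> (forall x, f x <= g x) -> I f <= I g.
Proof. by move=> *; exact: le_Rintegral. Qed.

Lemma ae_Rint_eq f g : measurable_fun setT f -> measurable_fun setT g ->
  {ae mu, forall x, f x = g x} -> I f = I g.
Proof.
move=> mf mg fg; congr fine; apply: ae_eq_integral => //.
- exact/measurable_EFinP.
- exact/measurable_EFinP.
- by apply: filterS fg => x /= + _ => ->.
Qed.

Lemma ae_intg f g : measurable_fun setT g ->
  {ae mu, forall x, f x = g x} -> intg f -> intg g.
Proof.
move=> mg fg iF; have mf := intg_measurable iF; apply/integrableP; split.
  exact/measurable_EFinP.
have /integrableP[_] := iF; congr (_ < _)%E.
apply: ae_eq_integral => //.
- by apply: measurableT_comp => //; exact/measurable_EFinP.
- by apply: measurableT_comp => //; exact/measurable_EFinP.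
- by apply: filterS fg => x /= + _ => ->.
Qed.

(** Replacing f by min (f, g), which changes it only on a null set, reduces this to the pointwise
    inequality. *)
Lemma ae_Rint_le f g : intg f -> intg g -> {ae mu, forall x, f x <= g x} ->
  I f <= I g.
Proof.
move=> iF ig fg; have mf := intg_measurable iF; have mg := intg_measurable ig.
have mm : measurable_fun setT (fun x => Num.min (f x) (g x)).
  exact: measurable_minr.
have fm : {ae mu, forall x, f x = Num.min (f x) (g x)}.
  by apply: filterS fg => x fgx; rewrite min_l.
rewrite (ae_Rint_eq mf mm fm) Rint_le//; first exact: ae_intg fm _.
by move=> x; rewrite ge_min lexx orbT.
Qed.

Lemma ae_Rint_ge0 f : intg f -> {ae mu, forall x, 0 <= f x} -> 0 <= I f.
Proof. by move=> iF f0; rewrite -Rint0; apply: ae_Rint_le f0 => //; exact: intg0. Qed.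

Lemma Rint_norm f : intg f -> `|I f| <= I (fun x => `|f x|).
Proof. by move=> *; exact: le_normr_Rintegral. Qed.

Lemma EFin_Rint f : intg f -> (I f)%:E = (\int[mu]_x (f x)%:E)%E.
Proof. by move=> iF; rewrite fineK//; exact: integrable_fin_num. Qed.

Lemma Rint_eq0_ae f : intg f -> (forall x, 0 <= f x) -> I f <= 0 ->
  {ae mu, forall x, f x = 0}.
Proof.
move=> iF f0 If0.
have If : I f = 0 by apply/le_anti; rewrite If0 Rint_ge0.
have /(_ measurableT (EFin \o f)) := @ae_eq_integral_abs _ _ _ mu setT.
move=> [|+ _].
  by apply/measurable_EFinP; exact: intg_measurable.
move=> /(_ _)[]; last by move=> N [mN N0 fN]; exists N; split => // x /= fx;
  apply: fN => /= /(_ Logic.I) -[].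
have -> : (\int[mu]_x `|(EFin \o f) x|)%E = (\int[mu]_x (f x)%:E)%E.
  by apply: eq_integral => x _ /=; rewrite ger0_norm.
by rewrite -EFin_Rint// If.
Qed.

Lemma Rint_dct (F : nat -> T -> R) f g :
  (forall n, measurable_fun setT (F n)) -> measurable_fun setT f -> intg g ->
  {ae mu, forall x, F n x @[n --> \oo] --> f x} ->
  (forall n, {ae mu, forall x, `|F n x| <= g x}) ->
  intg f /\ I (F n) @[n --> \oo] --> I f.
Proof.
move=> mF mf ig Ff Fg.
have Fg' : {ae mu, forall x n, `|F n x| <= g x} by exact: ae_foralln.
have mF' n : measurable_fun setT (EFin \o F n) by exact/measurable_EFinP.
have mf' : measurable_fun setT (EFin \o f) by exact/measurable_EFinP.
have cF : {ae mu, forall x, setT x -> (F n x)%:E @[n --> \oo] --> (f x)%:E}.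
  by apply: filterS Ff => x Fx _; apply: cvg_EFin Fx; exact: nearW.
have bF : {ae mu, forall x, forall n, setT x -> (`|(F n x)%:E| <= (g x)%:E)%E}.
  by apply: filterS Fg' => x + n _; rewrite lee_fin.
have [iF _ cI] := dominated_convergence measurableT mF' mf' cF ig bF.
split=> //; have /fine_cvgP[_] : (\int[mu]_x (F n x)%:E)%E @[n --> \oo] --> (I f)%:E.
  by rewrite EFin_Rint.
by [].
Qed.

(** Integrability of the limit is part of the conclusion: this is what gives finite energy to the
    limit of a minimizing sequence and finite integral to V z. *)
Lemma Rint_fatou (F : nat -> T -> R) f (C : R) :
  (forall n, intg (F n)) -> (forall n x, 0 <= F n x) -> measurable_fun setT f ->
  {ae mu, forall x, F n x @[n --> \oo] --> f x} ->
  (forall n, I (F n) <= C) -> intg f /\ I f <= C.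
Proof.
move=> iF F0 mf Ff FC.
have mF n : measurable_fun setT (F n) by exact: intg_measurable.
have f0 : {ae mu, forall x, `|f x| = f x}.
  apply: filterS Ff => x Fx; rewrite ger0_norm//.
  by rewrite -(cvg_lim _ Fx)//; apply: limr_ge; [exact: cvgP Fx|exact: nearW].
have mE n : measurable_fun setT (EFin \o F n) by exact/measurable_EFinP.
have If : (\int[mu]_x `|(f x)%:E| <= C%:E)%E.
  apply: le_trans (_ : (\int[mu]_x (limn_einf (fun n => (F n x)%:E)) <= _)%E).
    rewrite le_eqVlt; apply/orP; left; apply/eqP; apply: ae_eq_integral => //.
    - by apply: measurableT_comp => //; exact/measurable_EFinP.
    - have -> : (fun x => limn_einf (fun n => (F n x)%:E)) =
          (fun x => (- limn_esup (fun n => - (F n x)%:E))%E).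
        apply/funext => x; rewrite -limn_einfN; congr limn_einf.
        by apply/funext => n /=; rewrite opprK.
      apply: measurableT_comp => //; apply: measurable_fun_limn_esup => n.
      by apply/measurable_EFinP; exact: measurableT_comp.
    - apply: filterS2 f0 Ff => x /= fx Fx _; rewrite fx; apply/esym.
      have cE : (F n x)%:E @[n --> \oo] --> (f x)%:E by apply: cvg_EFin Fx; exact: nearW.
      rewrite is_cvg_limn_einfE; first exact/cvg_lim.
      exact: cvgP cE.
  apply: le_trans (fatou mu measurableT mE _) _ => [n x _|].
    by rewrite lee_fin.
  rewrite limn_einf_lim; apply: lime_le; first exact: is_cvg_einfs.
  apply: nearW => n; apply: ereal_inf_le; exists (\int[mu]_x (F n x)%:E)%E.
    by exists n => //=.
  by rewrite -EFin_Rint// lee_fin.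
have iF' : intg f.
  apply/integrableP; split; first exact/measurable_EFinP.
  exact: le_lt_trans If (ltry _).
split=> //; rewrite -lee_fin EFin_Rint//; apply: le_trans If.
apply: le_integral => //; first exact: integrable_abse.
by move=> x _ /=; rewrite lee_fin ler_norm.
Qed.

End Integral_calculus.

(** * Translation invariance of Lebesgue measure on the line *)

Lemma lebesgue_measure_shift (R : realType) (c : R) (A : set R) : measurable A ->
  lebesgue_measure ((fun x => x + c) @^-1` A) = lebesgue_measure A.
Proof.
move=> mA; have mc : measurable_fun setT (fun x : R => x + c).
  by apply: measurable_funD.
pose sh : measurableTypeR R -> measurableTypeR R := fun x : R => x + c.
have msh : measurable_fun setT sh by exact: mc.
apply/esym; apply: (@lebesgue_measure_unique R (pushforward lebesgue_measure sh)) => //.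
move=> X [[a b] /= _ <-]; rewrite /pushforward.
have -> : sh @^-1` `]a, b]%classic = `]a - c, b - c]%classic.
  by apply/seteqP; split => x /=; rewrite !in_itv/= ltrBlDr lerBrDr.
rewrite !lebesgue_measure_itv /= !lte_fin ltrD2r; case: ifP => // _.
by rewrite -!EFinB; congr EFin; ring.
Qed.

Lemma ge0_integral1_shift (R : realType) (c : R) (h : R -> \bar R) :
  measurable_fun setT h -> (forall x, 0%E <= h x)%E ->
  (\int[lebesgue_measure]_x h (x + c)%R = \int[lebesgue_measure]_x h x)%E.
Proof.
move=> mh h0.
pose sh : measurableTypeR R -> measurableTypeR R := fun x : R => x + c.
have msh : measurable_fun setT sh.
  by have : measurable_fun setT (fun x : R => x + c) by exact: measurable_funD.
have := @ge0_integral_pushforward _ _ (measurableTypeR R) (measurableTypeR R) R _ msh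
  lebesgue_measure setT h measurableT mh (fun _ _ => h0 _).
rewrite preimage_setT => <-.
by apply: eq_measure_integral => A mA _; exact: lebesgue_measure_shift.
Qed.

(** * Lebesgue measure on R^n *)

Section Lebesgue_rV.
Variable R : realType.
Local Notation leb n := (@lebesgue_rV R n).

Lemma ball_rV0 n (x : 'rV[R]_n) (e : R) : e <= 0 -> ball x e = set0.
Proof. by move=> e0; apply/seteqP; split => // y [] /lt_le_trans /(_ e0); rewrite ltxx. Qed.

Lemma measurable_ball_rV n (x : 'rV[R]_n) (e : R) : measurable (ball x e).
Proof.
have [e0|e0] := ltP 0 e; last by rewrite ball_rV0.
by apply: open_measurable_mx; exact: ball_open.
Qed.

Lemma leb_ball_fin n (x : 'rV[R]_n) (e : R) : (leb n (ball x e) < +oo)%E.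
Proof.
elim: n x => [|n ih] x.
  by rewrite /= diracE; case: (_ \in _); rewrite ltry.
rewrite /= /lebesgue_cons /pushforward preimage_rV_cons_ball.
rewrite product_measure1E; [|exact: measurable_ball_rV|exact: measurable_ball].
have [e0|e0] := leP e 0.
  rewrite [X in (_ * _ X)%E](_ : _ = set0) ?measure0 ?mule0//.
  by apply/seteqP; split => // y; rewrite /ball/= => /(le_lt_trans (normr_ge0 _)); rewrite ltNge e0.
apply: lte_mul_pinfty => //; first by rewrite ge0_fin_numE.
have := @lebesgue_measure_ball R ((x : 'rV[R]_(1 + n)) ord0 (lshift n ord0)) e (ltW e0).
by rewrite /= => ->; rewrite ltry.
Qed.

Lemma bigcup_ball_rV n : \bigcup_k ball (0 : 'rV[R]_n) k%:R = setT.
Proof.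
apply/seteqP; split => // x _; have [k xk] := ltr_add_invr (ltr01 (R := R)).
exists (Num.bound `|x|) => //=; rewrite -ball_normE /= sub0r normrN.
by rewrite archi_boundP.
Qed.

Lemma sigma_finite_leb n : sigma_finite setT (leb n).
Proof.
exists (fun k => ball (0 : 'rV[R]_n) k%:R); first by rewrite bigcup_ball_rV.
move=> k; split; last exact: leb_ball_fin.
exact: measurable_ball_rV.
Qed.

(** A named copy of the Lebesgue measure, to which the sigma-finite structure required by the
    theorems of Fubini and Tonelli is attached. *)
Definition lebS n : set 'rV[R]_n -> \bar R := leb n.

HB.instance Definition _ n := isMeasure.Build _ _ _ (@lebS n)
  (measure0 (leb n)) (measure_ge0 (leb n)) (@measure_semi_sigma_additive _ _ _ (leb n)).

HB.instance Definition _ n := @Measure_isSigmaFinite.Build _ _ _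
  (@lebS n) (@sigma_finite_leb n).

Lemma measurable_coord n (i : 'I_n) :
  measurable_fun setT (fun x : 'rV[R]_n => x ord0 i).
Proof.
apply: (measurability _ (RGenOpens.measurableE R)) => _ [_ [a [b ->]] <-].
rewrite setTI; apply: open_measurable_mx.
by apply: open_comp => // x _; exact: coord_continuous.
Qed.

Lemma continuous_measurable_rV n (f : 'rV[R]_n -> R) :
  continuous f -> measurable_fun setT f.
Proof.
move=> cf; apply: (measurability _ (RGenOpens.measurableE R)) => _ [_ [a [b ->]] <-].
rewrite setTI; apply: open_measurable_mx.
by apply: open_comp => // x _; exact: cf.
Qed.

(** A ball of the sup norm is a finite intersection of conditions on single coordinates, and every
    open set is a countable union of such balls. *)
Lemma measurable_to_rV d (T : measurableType d) n (f : T -> 'rV[R]_n) :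
  (forall i, measurable_fun setT (fun x => f x ord0 i)) -> measurable_fun setT f.
Proof.
move=> mf; apply: (@measurability _ _ _ _ _ _ (@open 'rV[R]_n)) => //.
move=> _ [A oA <-]; rewrite setTI (open_bigcup_rat_ball oA) preimage_bigcup.
rewrite bigcup_mkcond; apply: countable_bigcupT_measurable => // qk.
case: ifPn => // _.
set e := qk.2.+1%:R^-1.
have -> : f @^-1` ball (map_mx ratr qk.1 : 'rV[R]_n) e =
   \bigcap_(i in [set: 'I_n]) ((fun x => f x ord0 i) @^-1` ball (ratr (qk.1 ord0 i) : R) e).
  apply/seteqP; split => x /=.
    by move=> [_ h] i _ /=; have := h ord0 i; rewrite mxE.
  move=> h; split; first by rewrite invr_gt0.
  by move=> i j; rewrite (ord1 i) mxE; exact: h.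
apply: fin_bigcap_measurable => // i _.
by rewrite -[X in measurable X]setTI; apply: mf => //; exact: measurable_ball.
Qed.

Lemma measurable_sub_rV n :
  measurable_fun setT (fun p : 'rV[R]_n * 'rV[R]_n => p.1 - p.2).
Proof.
apply: measurable_to_rV => i.
rewrite (_ : (fun _ => _) = fun p : 'rV[R]_n * 'rV[R]_n => p.1 ord0 i - p.2 ord0 i).
  apply: measurable_funB.
    by apply: (measurableT_comp (@measurable_coord n i)).
  by apply: (measurableT_comp (@measurable_coord n i)).
by apply/funext => p; rewrite !mxE.
Qed.

Lemma measurable_shift_rV n (c : 'rV[R]_n) : measurable_fun setT (fun x : 'rV[R]_n => x + c).
Proof.
apply: measurable_to_rV => i.
rewrite (_ : (fun _ => _) = fun p : 'rV[R]_n => p ord0 i + c ord0 i).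
  by apply: measurable_funD => //; exact: measurable_coord.
by apply/funext => p; rewrite !mxE.
Qed.

Lemma rV_consD n (p : 'rV[R]_n * R) (c : 'rV[R]_(1 + n)) :
  rV_cons p + c = rV_cons (p.1 + rsubmx c, p.2 + c ord0 (lshift n ord0)).
Proof.
rewrite /rV_cons -[in LHS](hsubmxK c) add_row_mx; congr row_mx.
by apply/rowP => k; rewrite !mxE (ord1 k).
Qed.

Local Open Scope ereal_scope.

(** Induction on the dimension: by Tonelli, the first coordinate is translated by the
    one-dimensional invariance and the remaining ones by the induction hypothesis. *)
Lemma ge0_integral_shift n (c : 'rV[R]_n) (f : 'rV[R]_n -> \bar R) :
  measurable_fun setT f -> (forall x, 0 <= f x) ->
  \int[leb n]_x f (x + c)%R = \int[leb n]_x f x.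
Proof.
elim: n c f => [|n ih] c f mf f0.
  by apply: eq_integral => x _; rewrite (thinmx0 c) addr0.
have mg : measurable_fun setT (fun x : 'rV[R]_n.+1 => f (x + c)%R).
  by apply: measurableT_comp => //; exact: measurable_shift_rV.
have mcons := @measurable_rV_cons R n.
rewrite /= /lebesgue_cons !ge0_integral_pushforward//.
rewrite !preimage_setT.
pose c1 : 'rV[R]_n := rsubmx (c : 'rV[R]_(1 + n)).
pose c0 : R := (c : 'rV[R]_(1 + n)) ord0 (lshift n ord0).
have fE p : f (rV_cons p + c)%R = f (rV_cons (p.1 + c1, p.2 + c0)%R).
  by rewrite rV_consD.
under eq_integral do rewrite /= fE.
pose g := fun p => f (rV_cons p).
have mg1 : measurable_fun setT g by exact: measurableT_comp.
have msh : measurable_fun setT (fun x : R => x + c0)%R by exact: measurable_funD.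
have mp : measurable_fun setT (fun p : 'rV[R]_n * R => (p.1 + c1, p.2 + c0)%R).
  apply: measurable_fun_pair.
    by apply: (measurableT_comp (@measurable_shift_rV n c1)).
  by apply: (measurableT_comp msh).
have mg2 : measurable_fun setT (fun p : 'rV[R]_n * R => g (p.1 + c1, p.2 + c0)%R).
  exact: measurableT_comp mg1 mp.
have prodE (h : 'rV[R]_n * R -> \bar R) : measurable_fun setT h -> (forall p, 0 <= h p) ->
    \int[leb n \x lebesgue_measure]_p h p = \int[leb n]_x \int[lebesgue_measure]_y h (x, y).
  move=> mh h0; have := @fubini_tonelli1 _ _ _ _ R (@lebS n) lebesgue_measure _ mh h0.
  by rewrite /fubini_F /= => <-; apply: eq_measure_integral.
have -> := prodE (fun p : 'rV[R]_n * R => g (p.1 + c1, p.2 + c0)%R) mg2 (fun=> f0 _).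
have -> := prodE g mg1 (fun=> f0 _).
have sh1 := @ge0_integral1_shift R c0.
rewrite /=.
under eq_integral => x _.
  rewrite (sh1 (fun y => g (x + c1, y)%R) (measurable_fun_pair2 _ mg1) (fun=> f0 _)).
  over.
rewrite (ih c1 (fun x => \int[lebesgue_measure]_y g (x, y)))//.
  exact: (@measurable_fun_fubini_tonelli_F _ _ _ _ R lebesgue_measure g mg1 (fun=> f0 _)).
by move=> x; apply: integral_ge0 => y _; exact: f0.
Qed.

Lemma integral_shift n (c : 'rV[R]_n) (f : 'rV[R]_n -> \bar R) :
  measurable_fun setT f -> \int[leb n]_x f (x + c)%R = \int[leb n]_x f x.
Proof.
move=> mf; rewrite integralE [RHS]integralE; congr (_ - _).
  rewrite -[RHS](ge0_integral_shift c (measurable_funepos mf) _)//.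
  by apply: eq_integral => x _; rewrite !funeposE.
rewrite -[RHS](ge0_integral_shift c (measurable_funeneg mf) _)//.
by apply: eq_integral => x _; rewrite !funenegE.
Qed.

Local Close Scope ereal_scope.

Lemma Rint_shift n (c : 'rV[R]_n) (f : 'rV[R]_n -> R) :
  measurable_fun setT f ->
  Rintegral (leb n) setT (fun x => f (x + c)) = Rintegral (leb n) setT f.
Proof.
move=> mf; congr fine; apply: (integral_shift c (f := EFin \o f)).
exact/measurable_EFinP.
Qed.

Lemma intg_shift n (c : 'rV[R]_n) (f : 'rV[R]_n -> R) :
  intg (leb n) f -> intg (leb n) (fun x => f (x + c)).
Proof.
move=> iF; have mf := intg_measurable iF; apply/integrableP; split.
  by apply/measurable_EFinP; apply: measurableT_comp => //; exact: measurable_shift_rV.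
have /integrableP[_] := iF; congr (_ < _)%E; apply/esym.
apply: (integral_shift c (f := fun x => (`|(f x)%:E|)%E)).
by apply: measurableT_comp => //; exact/measurable_EFinP.
Qed.

(** * Exchange of integrations against a bounded kernel *)

Section Fubini.
Variables (n : nat) (a z : 'rV[R]_n -> R) (G : 'rV[R]_n * 'rV[R]_n -> R) (C : R).
Hypotheses (ia : intg (leb n) a) (iz : intg (leb n) z).
Hypotheses (mG : measurable_fun setT G) (GC : forall p, `|G p| <= C).

Let F (p : 'rV[R]_n * 'rV[R]_n) : R := a p.1 * G p * z p.2.

Let mF : measurable_fun setT F.
Proof.
apply: measurable_funM; first apply: measurable_funM => //.
  by apply: measurableT_comp => //; exact: intg_measurable ia.
by apply: measurableT_comp => //; exact: intg_measurable iz.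
Qed.

Let iF : ((@lebS n) \x (@lebS n))%E.-integrable setT (EFin \o F).
Proof.
apply/integrable12ltyP; first exact/measurable_EFinP.
have C0 : 0 <= C by exact: le_trans (normr_ge0 _) (GC (0, 0)).
pose A := Rintegral (leb n) setT (fun y => `|z y|).
have ina : intg (leb n) (fun x => C * A * `|a x|) by exact/intgZ/intg_norm.
apply: (@le_lt_trans _ _ (\int[leb n]_x (C * A * `|a x|)%:E)%E); last first.
  by rewrite -(EFin_Rint ina) ltry.
have m2 : measurable_fun setT (fun p => `|(F p)%:E|%E).
  by apply: measurableT_comp => //; exact/measurable_EFinP.
apply: ge0_le_integral => //.
- by move=> x _; exact: integral_ge0.
- exact: (@measurable_fun_fubini_tonelli_F _ _ _ _ R (@lebS n) _ m2).
- by apply/measurable_EFinP; exact: intg_measurable ina.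
move=> x _; have inz : intg (leb n) (fun y => C * `|a x| * `|z y|).
  exact/intgZ/intg_norm.
have -> : C * A * `|a x| = Rintegral (leb n) setT (fun y => C * `|a x| * `|z y|).
  by rewrite RintZ -/A; [ring|exact: intg_norm].
rewrite (EFin_Rint inz); apply: ge0_le_integral => //.
- exact: (measurable_fun_pair2 x m2).
- by apply/measurable_EFinP; exact: intg_measurable inz.
move=> y _; rewrite /F /= lee_fin !normrM ler_wpM2r// mulrC.
by rewrite ler_wpM2r.
Qed.

Lemma intg_section x : intg (leb n) (fun y => G (x, y) * z y).
Proof.
apply: (@intgMb _ _ _ _ C) => //.
exact: measurable_fun_pair2.
Qed.

Lemma Rint_swap :
  Rintegral (leb n) setT (fun x => a x * Rintegral (leb n) setT (fun y => G (x, y) * z y)) =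
  Rintegral (leb n) setT (fun y => z y * Rintegral (leb n) setT (fun x => G (x, y) * a x)).
Proof.
congr fine; have := @Fubini _ _ _ _ R (@lebS n) (@lebS n) _ iF => /=.
rewrite (eq_integral (fun x => (a x * Rintegral (leb n) setT (fun y => G (x, y) * z y))%:E)).
  move=> ->; apply: eq_integral => y _.
  have ix : intg (leb n) (fun x => G (x, y) * a x).
    by apply: (@intgMb _ _ _ _ C) => //; exact: measurable_fun_pair1.
  rewrite -RintZ// EFin_Rint; last exact: intgZ.
  by apply: eq_integral => x _; rewrite /F /=; congr EFin; ring.
move=> x _; rewrite -RintZ; last exact: intg_section.
rewrite EFin_Rint; last exact/intgZ/intg_section.
by apply: eq_integral => y _; rewrite /F /=; congr EFin; ring.
Qed.

End Fubini.

End Lebesgue_rV.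

(** * Differential calculus *)

Section Directional_derivatives.
Context {R : realType} {N : nat}.
Implicit Types (f g : 'rV[R]_N -> R) (x v : 'rV[R]_N).

(** Directional derivatives become derivatives along a line, where the mean value theorem, the chain
    rule and Fermat's rule are available. *)
Lemma is_derive_line f x v df :
  is_derive x v f df <-> is_derive (0 : R) (1 : R) (fun t : R => f (t *: v + x)) df.
Proof.
have E : (fun h : R => h^-1 *: (((fun t : R => f (t *: v + x)) \o shift 0) (h *: (1 : R)) - f (0 *: v + x))) =
    (fun h : R => h^-1 *: ((f \o shift x) (h *: v) - f x)).
  apply/funext => h /=; rewrite scale0r add0r addr0.
  by have -> : h *: (1 : R) = h by rewrite /GRing.scale /= mulr1.
split => -[ex val]; constructor.
- by rewrite /derivable E.
- by rewrite -val /derive E.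
- by move: ex; rewrite /derivable E.
- by move: val; rewrite /derive E.
Qed.

Lemma is_derive_lineT f v (df : 'rV[R]_N -> R) :
  (forall x, is_derive x v f (df x)) ->
  forall x (t : R), is_derive t (1 : R) (fun t : R => f (t *: v + x)) (df (t *: v + x)).
Proof.
move=> H x t; have := H (t *: v + x) => /is_derive_line.
have -> : (fun s : R => f (s *: v + (t *: v + x))) = (fun s : R => f (s *: v + x)) \o shift t.
  by apply/funext => s /=; rewrite scalerDl addrA.
have E : (fun h : R => h^-1 *: ((((fun s : R => f (s *: v + x)) \o shift t) \o shift 0) (h *: (1 : R))
      - ((fun s : R => f (s *: v + x)) \o shift t) 0)) =
    (fun h : R => h^-1 *: (((fun s : R => f (s *: v + x)) \o shift t) (h *: (1 : R)) -
      f (t *: v + x))).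
  by apply/funext => h /=; rewrite addr0 add0r.
move=> [ex val]; constructor.
- by move: ex; rewrite /derivable E.
- by move: val; rewrite /derive E.
Qed.

Lemma is_derive_mvt f v (df : 'rV[R]_N -> R) x (t : R) :
  (forall x, is_derive x v f (df x)) ->
  exists2 c : R, `|c| <= `|t| & f (t *: v + x) - f x = t * df (c *: v + x).
Proof.
move=> H; have L := is_derive_lineT H x.
have cL a b : {within `[a, b], continuous (fun t : R => f (t *: v + x))}.
  apply: continuous_subspaceT => s.
  by apply: differentiable_continuous; apply/derivable1_diffP; have [] := L s.
have [t0|t0] := leP 0 t.
  have [c] := @MVT_segment R _ _ 0 t t0 (fun s _ => L s) (cL 0 t).
  rewrite in_itv /= => /andP[c0 ct]; rewrite scale0r add0r subr0 => ->.
  by exists c; rewrite ?ger0_norm// mulrC.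
have [c] := @MVT_segment R _ _ t 0 (ltW t0) (fun s _ => L s) (cL t 0).
rewrite in_itv /= => /andP[ct c0]; rewrite scale0r add0r sub0r => E.
exists c; first by rewrite !ler0_norm ?(ltW t0)// lerNr opprK.
by rewrite -opprB E; ring.
Qed.

Lemma is_deriveD' f g x v df dg : is_derive x v f df -> is_derive x v g dg ->
  is_derive x v (fun y => f y + g y) (df + dg).
Proof. by move=> ? ?; exact: is_deriveD. Qed.

Lemma is_deriveM' f g x v df dg : is_derive x v f df -> is_derive x v g dg ->
  is_derive x v (fun y => f y * g y) (f x * dg + g x * df).
Proof. by move=> ? ?; exact: is_deriveM. Qed.

Lemma is_deriveZ' (c : R) f x v df : is_derive x v f df ->
  is_derive x v (fun y => c * f y) (c * df).
Proof. by move=> ?; exact: is_deriveZ. Qed.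

Lemma is_derive_sum' n (f : 'I_n -> 'rV[R]_N -> R) x v (df : 'I_n -> R) :
  (forall i, is_derive x v (f i) (df i)) ->
  is_derive x v (fun y => \sum_i f i y) (\sum_i df i).
Proof.
move=> H; have := is_derive_sum H.
by congr is_derive; apply/funext => y; rewrite fct_sumE.
Qed.

Lemma is_derive_comp' (h : R -> R) f x v dh df :
  is_derive (f x) 1 h dh -> is_derive x v f df ->
  is_derive x v (fun y => h (f y)) (dh * df).
Proof.
move=> Hh /is_derive_line Hf; apply/is_derive_line.
have := @is_derive1_comp R h (fun t : R => f (t *: v + x)) 0 dh df.
by rewrite /= scale0r add0r; apply.
Qed.

Lemma is_derive_shift' f x c v df : is_derive (x + c) v f df ->
  is_derive x v (fun y => f (y + c)) df.
Proof.
move=> /is_derive_line H; apply/is_derive_line.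
by under eq_fun do rewrite -addrA.
Qed.

Lemma is_derive_coord (i j : 'I_N) x :
  is_derive x (delta_mx 0 i) (fun y : 'rV[R]_N => y 0 j) (i == j)%:R.
Proof.
apply/is_derive_line.
have -> : (fun t : R => (t *: delta_mx 0 i + x) 0 j) = (fun t : R => (i == j)%:R * t + x 0 j).
  by apply/funext => t; rewrite !mxE eqxx /= mulrC (eq_sym j).
set k : R := (i == j)%:R.
have E : k = k *: (1 : R) + 0 by rewrite addr0 /GRing.scale /= mulr1.
rewrite [X in is_derive _ _ _ X]E.
by apply: (@is_deriveD _ _ _ (fun t : R => k *: t)); apply: (@is_deriveZ _ _ _ id).
Qed.

(** Fermat's rule on a line. It makes every term carrying a nonnegative cutoff or its gradient
    vanish where the cutoff does, with no description of its support. *)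
Lemma is_derive_min0 f v (df : 'rV[R]_N -> R) x :
  (forall y, is_derive y v f (df y)) -> (forall y, 0 <= f y) -> f x = 0 -> df x = 0.
Proof.
move=> H f0 fx0; have L := is_derive_lineT H x.
have m1 : -1 <= 1 :> R by lra.
have [] := @derive1_at_min R (fun t : R => f (t *: v + x)) (-1) 1 0 m1.
- by move=> t _; have [] := L t.
- by rewrite in_itv /= ltrN10 ltr01.
- by move=> t _; rewrite scale0r add0r fx0.
by move=> _; have [_ ->] := L 0; rewrite scale0r add0r.
Qed.

End Directional_derivatives.

Section Continuity.
Context {R : realType} {T : topologicalType}.
Implicit Types f g : T -> R.

Lemma contD f g : continuous f -> continuous g -> continuous (fun x => f x + g x).
Proof. by move=> cf cg x; exact: cvgD (cf x) (cg x). Qed.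

Lemma contM f g : continuous f -> continuous g -> continuous (fun x => f x * g x).
Proof. by move=> cf cg x; exact: cvgM (cf x) (cg x). Qed.

Lemma contN f : continuous f -> continuous (fun x => - f x).
Proof. by move=> cf x; exact: cvgN (cf x). Qed.

Lemma cont_sum n (F : 'I_n -> T -> R) : (forall i, continuous (F i)) ->
  continuous (fun x => \sum_i F i x).
Proof.
elim: n F => [|n ih] F cF.
  by under eq_fun do rewrite big_ord0; exact: cst_continuous.
by under eq_fun do rewrite big_ord_recl; apply: contD => //; exact: ih.
Qed.

Lemma cont_comp (U : topologicalType) (h : U -> T) f : continuous h -> continuous f ->
  continuous (fun x => f (h x)).
Proof. by move=> ch cf x; apply: (@continuous_comp _ _ _ h f); [exact: ch|exact: cf]. Qed.

End Continuity.

(** * C^1 functions, compact supports and integration by parts *)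

Section C1.
Context {R : realType} {N : nat}.
Implicit Types (f g : 'rV[R]_N -> R) (x v : 'rV[R]_N) (O : set 'rV[R]_N).
Local Notation leb := (@lebesgue_rV R N).

(** The gradient is a parameter, so that the calculus rules produce closed forms; [C1gE] identifies
    them with [partial] afterwards. *)
Definition C1g f (df : 'I_N -> 'rV[R]_N -> R) :=
  [/\ continuous f, forall i, continuous (df i) &
      forall i x, is_derive x (delta_mx 0 i) f (df i x)].

Definition C1 f := C1g f (fun i => partial i f).

Lemma C1gE f df i : C1g f df -> partial i f = df i.
Proof. by move=> [_ _ H]; apply/funext => x; have [] := H i x. Qed.

Lemma C1gW f df : C1g f df -> C1 f.
Proof.
move=> H; rewrite /C1; have -> // : (fun i => partial i f) = df.
by apply/funext => i; exact: C1gE.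
Qed.

Lemma C1g_cst (c : R) : C1g (fun=> c) (fun _ _ => 0).
Proof.
split; last by move=> i x; exact: is_derive_cst.
  exact: cst_continuous.
by move=> i; exact: cst_continuous.
Qed.

Lemma C1gD f df g dg : C1g f df -> C1g g dg ->
  C1g (fun x => f x + g x) (fun i x => df i x + dg i x).
Proof.
move=> [cf cdf Hf] [cg cdg Hg]; split.
- by move=> x; exact: cvgD (cf x) (cg x).
- by move=> i x; exact: cvgD (cdf i x) (cdg i x).
- by move=> i x; exact: is_deriveD'.
Qed.

Lemma C1gM f df g dg : C1g f df -> C1g g dg ->
  C1g (fun x => f x * g x) (fun i x => f x * dg i x + g x * df i x).
Proof.
move=> [cf cdf Hf] [cg cdg Hg]; split.
- by move=> x; exact: cvgM (cf x) (cg x).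
- by move=> i; exact: contD (contM cf (cdg i)) (contM cg (cdf i)).
- by move=> i x; exact: is_deriveM'.
Qed.

Lemma C1gZ (c : R) f df : C1g f df ->
  C1g (fun x => c * f x) (fun i x => c * df i x).
Proof.
move=> [cf cdf Hf]; split.
- by move=> x; apply: cvgM (cf x); exact: cvg_cst.
- by move=> i x; apply: cvgM (cdf i x); exact: cvg_cst.
- by move=> i x; exact: is_deriveZ'.
Qed.

Lemma C1g_comp (h dh : R -> R) f df : continuous dh ->
  (forall t : R, is_derive t (1 : R) h (dh t)) -> C1g f df ->
  C1g (fun x => h (f x)) (fun i x => dh (f x) * df i x).
Proof.
move=> cdh Hh [cf cdf Hf]; have ch : continuous h.
  by move=> t; apply: differentiable_continuous; apply/derivable1_diffP; have [] := Hh t.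
split.
- by move=> x; apply: (@continuous_comp _ _ _ f h x (cf x) (ch _)).
- move=> i x; apply: cvgM (cdf i x).
  exact: (@continuous_comp _ _ _ f dh x (cf x) (cdh _)).
- by move=> i x; exact: is_derive_comp'.
Qed.

Lemma C1g_shift f df (c : 'rV[R]_N) : C1g f df -> C1g (fun x => f (x + c)) (fun i x => df i (x + c)).
Proof.
move=> [cf cdf Hf]; have csh : continuous (fun y : 'rV[R]_N => y + c).
  by move=> x; apply: continuousD; [exact: cvg_id|exact: cst_continuous].
split; [exact: cont_comp csh cf|by move=> i; exact: cont_comp csh (cdf i)|].
by move=> i x; exact: is_derive_shift'.
Qed.

(** Any compact set carrying f will do, not only the closure of its support: this makes the class
    stable under products and compositions at once. [csupp_test] returns to the notion used in
    [test_function]. *)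
Definition csupp O f := exists K, [/\ compact K, K `<=` O & forall x, ~ K x -> f x = 0].

Lemma csuppS O O' f : O `<=` O' -> csupp O f -> csupp O' f.
Proof. by move=> OO' [K [cK KO Kf]]; exists K; split=> // x /KO /OO'. Qed.

Lemma csuppM O f g : csupp O f -> csupp O (fun x => f x * g x).
Proof. by move=> [K [cK KO Kf]]; exists K; split=> // x /Kf ->; rewrite mul0r. Qed.

Lemma csuppMr O f g : csupp O f -> csupp O (fun x => g x * f x).
Proof. by move=> [K [cK KO Kf]]; exists K; split=> // x /Kf ->; rewrite mulr0. Qed.

Lemma csupp_comp O f (h : R -> R) : h 0 = 0 -> csupp O f -> csupp O (fun x => h (f x)).
Proof. by move=> h0 [K [cK KO Kf]]; exists K; split=> // x /Kf ->. Qed.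

Lemma csupp_le O f g : (forall x, f x = 0 -> g x = 0) -> csupp O f -> csupp O g.
Proof. by move=> fg [K [cK KO Kf]]; exists K; split=> // x /Kf /fg. Qed.

Lemma csuppD O f g : csupp O f -> csupp O g -> csupp O (fun x => f x + g x).
Proof.
move=> [K [cK KO Kf]] [L [cL LO Lg]]; exists (K `|` L); split.
- exact: compactU.
- by move=> x [/KO|/LO].
- by move=> x /not_orP[/Kf -> /Lg ->]; rewrite addr0.
Qed.

Lemma csupp_partial O f df i : C1g f df -> csupp O f -> csupp O (df i).
Proof.
move=> [_ _ H] [K [cK KO Kf]]; exists K; split=> // x nKx.
have oK : open (~` K) by apply: closed_openC; exact: compact_closed (@norm_hausdorff _ _) cK.
have fn : \near x, (fun=> 0 : R) x = f x.
  have : nbhs x (~` K) by exact: open_nbhs_nbhs.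
  by apply: filterS => y /Kf.
have H0 := near_eq_is_derive fn (is_derive_cst (0 : R) x (delta_mx 0 i)).
by have [_ <-] := H i x; have [_ ->] := H0.
Qed.

Lemma csupp_bounded O f : continuous f -> csupp O f -> exists2 C, 0 <= C & forall x, `|f x| <= C.
Proof.
move=> cf [K [cK KO Kf]].
have : compact (f @` K).
  by apply: continuous_compact cK; exact: continuous_subspaceT.
move=> /compact_bounded [M [_ HM]]; exists (`|M| + 1); first by rewrite addr_ge0.
move=> x; have [Kx|nKx] := pselect (K x); last by rewrite Kf// normr0 addr_ge0.
apply: (HM (`|M| + 1)); last by exists x.
by rewrite (le_lt_trans (ler_norm _))// ltrDl.
Qed.

Lemma compact_subball (K : set 'rV[R]_N) : compact K ->
  exists2 r : R, 0 < r & K `<=` ball 0 r.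
Proof.
move=> /compact_bounded [M [_ HM]]; exists (`|M| + 2); first by rewrite ltr_wpDl.
move=> x Kx; rewrite -ball_normE /= sub0r normrN.
have := HM (`|M| + 1) _ x Kx; rewrite (le_lt_trans (ler_norm _)) ?ltrDl//.
by move=> /(_ isT) /le_lt_trans; apply; rewrite ltrD2l; lra.
Qed.

Lemma indic_ball_intg (x : 'rV[R]_N) (r : R) : intg leb (fun y => \1_(ball x r) y).
Proof.
apply/integrableP; split; first by apply/measurable_EFinP; apply: measurable_indic; exact: measurable_ball_rV.
rewrite (eq_integral (fun y => (\1_(ball x r) y)%:E)) => [|y _]; last by rewrite /= ger0_norm.
by rewrite integral_indic ?setIT//; [exact: leb_ball_fin|exact: measurable_ball_rV].
Qed.

Lemma intg_bounded_ball f (r C : R) : measurable_fun setT f ->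
  (forall x, `|f x| <= C) -> (forall x, ~ ball 0 r x -> f x = 0) -> intg leb f.
Proof.
move=> mf fC f0; apply: (@intg_le _ _ _ _ _ (fun y => C * \1_(ball (0 : 'rV[R]_N) r) y)) => //.
  move=> x; rewrite indicE; case: (boolP (x \in _)) => [_|]; first by rewrite mulr1.
  by rewrite notin_setE => /f0 ->; rewrite normr0 mulr0.
exact/intgZ/indic_ball_intg.
Qed.

Lemma csupp_intg O f : continuous f -> csupp O f -> intg leb f.
Proof.
move=> cf sf; have [C C0 fC] := csupp_bounded cf sf.
have [K [cK KO Kf]] := sf; have [r r0 Kr] := compact_subball cK.
apply: (@intg_bounded_ball _ r C) => //; first exact: continuous_measurable_rV.
by move=> x nx; apply: Kf => /Kr.
Qed.

Lemma csupp_uniform O f : continuous f -> csupp O f -> forall e : R, 0 < e ->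
  exists2 d : R, 0 < d & forall x y, `|x - y| < d -> `|f x - f y| < e.
Proof.
move=> cf [K [cK KO Kf]] e e0.
have /(_ _ (0^'+ : set_system R) (fun (d : R) x => forall y, `|x - y| < d -> `|f x - f y| < e)) :=
  (compact_near_coveringP K).1 cK.
have F : Filter (0^'+ : set_system R) by exact: at_right_proper_filter.
move=> /(_ F) []; first move=> x Kx.
  have /cvgrPdist_lt /(_ (e / 2)) := cf x.
  rewrite divr_gt0// => /(_ isT) /nbhs_ballP [d /= d0 dH].
  exists (ball x (d / 2), [set t : R | t < d / 2]).
    split; first by apply: nbhsx_ballx; rewrite divr_gt0.
    by apply: nbhs_right_lt; rewrite divr_gt0.
  move=> [y t] /= [xy td] z yz.
  have y1 : ball x d y by apply: le_ball xy; lra.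
  have z1 : ball x d z.
    rewrite (splitr d); apply: ball_triangle xy _; rewrite -ball_normE /=.
    exact: lt_trans yz td.
  have := dH _ y1; have := dH _ z1.
  rewrite (_ : f y - f z = (f x - f z) - (f x - f y)); last ring.
  move=> a b; rewrite (le_lt_trans (ler_normB _ _))//; lra.
move=> d /= d0 dH; have d20 : 0 < d / 2 by rewrite divr_gt0.
have key x y : K x -> `|x - y| < d / 2 -> `|f x - f y| < e.
  move=> Kx xy; apply: (dH (d / 2) _ _ x Kx) => //.
  by rewrite /= sub0r normrN gtr0_norm//; lra.
exists (d / 2) => // x y xy.
have [Kx|nKx] := pselect (K x); first exact: key.
have [Ky|nKy] := pselect (K y); first by rewrite distrC; apply: key => //; rewrite distrC.
by rewrite !Kf// subrr normr0.
Qed.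

Lemma compact_open_dist (K O : set 'rV[R]_N) : compact K -> open O -> K `<=` O ->
  exists2 d : R, 0 < d & forall x, K x -> ball x d `<=` O.
Proof.
move=> cK oO KO.
have /(_ _ (0^'+ : set_system R) (fun (d : R) x => ball x d `<=` O)) :=
  (compact_near_coveringP K).1 cK.
have F : Filter (0^'+ : set_system R) by exact: at_right_proper_filter.
move=> /(_ F) []; first move=> x /KO Ox.
  have /nbhs_ballP [d /= d0 dH] : nbhs x O by exact: open_nbhs_nbhs.
  exists (ball x (d / 2), [set t : R | t < d / 2]).
    split; first by apply: nbhsx_ballx; rewrite divr_gt0.
    by apply: nbhs_right_lt; rewrite divr_gt0.
  move=> [y t] /= [xy td] z yz; apply: dH; rewrite (splitr d).
  by apply: ball_triangle xy _; apply: le_ball yz; exact: ltW.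
move=> d /= d0 dH; have d20 : 0 < d / 2 by rewrite divr_gt0.
exists (d / 2) => // x Kx; apply: (dH (d / 2) _ _ x Kx) => //.
by rewrite /= sub0r normrN gtr0_norm//; lra.
Qed.

Lemma delta_norm (i : 'I_N) (t : R) : `|t *: (delta_mx 0 i : 'rV[R]_N)| <= `|t|.
Proof.
rewrite normrZ ler_piMr// /Num.norm /= mx_normrE.
apply: bigmax_le => //= k _; rewrite mxE; case: (_ && _) => /=; rewrite ?normr1 ?normr0//.
Qed.

(** By translation invariance the difference quotients of f have integral zero, and they converge
    uniformly to the derivative inside a fixed ball; no iterated integral is needed. *)
Lemma C1_ibp f df i : C1g f df -> csupp setT f -> Rintegral leb setT (df i) = 0.
Proof.
move=> Cf sf; have [cf cdf Hf] := Cf; have sdf := csupp_partial i Cf sf.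
have idf := csupp_intg (cdf i) sdf; have iF := csupp_intg cf sf.
have [K [cK _ Kf]] := sf; have [K' [cK' _ Kdf]] := sdf.
have [r r0 Kr] := compact_subball cK; have [r' r'0 Kr'] := compact_subball cK'.
pose e : 'rV[R]_N := delta_mx 0 i.
apply/eqP; rewrite -normr_le0; apply/ler_addgt0Pr => eps eps0.
(* The margin 1 in the radius absorbs the translation, whose length t is at most 1. *)
pose B : set 'rV[R]_N := ball 0 (r + r' + 1).
pose M := Rintegral leb setT (fun y => \1_B y) + 1.
have M0 : 0 < M by rewrite ltr_wpDl// Rint_ge0.
have [d d0 dH] := csupp_uniform (cdf i) sdf (divr_gt0 eps0 M0).
pose t := Num.min (d / 2) 1.
have t0 : 0 < t by rewrite lt_min ltr01 divr_gt0.
have td : t < d by rewrite (@le_lt_trans _ _ (d / 2)) ?ge_min ?lexx//; lra.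
have t1 : t <= 1 by rewrite ge_min lexx orbT.
have ish : intg leb (fun x => f (x + t *: e)) by exact: intg_shift.
have E0 : Rintegral leb setT (fun x => t^-1 * (f (x + t *: e) - f x)) = 0.
  rewrite RintZ; last exact: intgB.
  by rewrite RintB// (Rint_shift _ (intg_measurable iF)) subrr mulr0.
have iq : intg leb (fun x => t^-1 * (f (x + t *: e) - f x)) by exact/intgZ/intgB.
rewrite add0r -(subr0 (Rintegral _ _ _)) -[X in _ - X]E0 -RintB//.
apply: le_trans (Rint_norm (intgB idf iq)) _.
apply: (@le_trans _ _ (Rintegral leb setT (fun x => eps / M * \1_B x))).
  apply: Rint_le; first exact/intg_norm/intgB.
    exact/intgZ/indic_ball_intg.
  move=> x; have [c ct E] := is_derive_mvt x t (Hf i).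
  rewrite (addrC x) E mulrA mulVf ?gt_eqF// mul1r.
  have dc : `|df i x - df i (c *: e + x)| < eps / M.
    apply: dH; rewrite opprD addrCA subrr addr0 normrN.
    by rewrite (le_lt_trans (delta_norm _ _))// (le_lt_trans ct)// gtr0_norm.
  rewrite indicE; case: (boolP (x \in B)) => [_|]; first by rewrite mulr1 ltW.
  rewrite notin_setE => nB; rewrite mulr0.
  have n1 : r + r' + 1 <= `|x| by rewrite leNgt; apply/negP => xr; apply: nB; rewrite /B -ball_normE /= sub0r normrN.
  have n2 : `|x| <= `|c *: e + x| + 1.
    rewrite -[X in `|X| <= _](addKr (c *: e)) addrC (le_trans (ler_normD _ _))//.
    by rewrite lerD2l normrN (le_trans (delta_norm _ _))// (le_trans ct)// gtr0_norm.
  rewrite (Kdf x); last by move=> /Kr'; rewrite -ball_normE /= sub0r normrN => ?; lra.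
  rewrite (Kdf (c *: e + x)) ?subrr ?normr0//.
  by move=> /Kr'; rewrite -ball_normE /= sub0r normrN => ?; lra.
rewrite RintZ; last exact: indic_ball_intg.
rewrite mulrAC ler_pdivrMr// ler_pM2l// /M lerDl; lra.
Qed.

End C1.

(** * Differentiation under the integral sign *)

Section Derivative_under_integral.
Context d (T : measurableType d) (R : realType) (mu : {measure set T -> \bar R}).

Lemma is_derive_Rint (F dF : R -> T -> R) (a u v : R) (G : T -> R) :
  u < a < v ->
  (forall x, u < x < v -> intg mu (F x)) ->
  (forall x y, u < x < v -> is_derive x (1 : R) (F ^~ y) (dF x y)) ->
  intg mu G -> (forall x y, u < x < v -> `|dF x y| <= G y) ->
  is_derive a (1 : R) (fun x => Rintegral mu setT (F x)) (Rintegral mu setT (dF a)).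
Proof.
move=> auv iF HF iG FG.
have Ia : `]u, v[%classic a by rewrite /= in_itv.
have iF' x : `]u, v[%classic x -> mu.-integrable setT (EFin \o F x).
  by rewrite /= in_itv /=; exact: iF.
have dF' x y : `]u, v[%classic x -> setT y -> derivable (F ^~ y) x 1.
  by rewrite /= in_itv /= => /(HF x y)[].
have G0 y : 0 <= G y by exact: le_trans (normr_ge0 _) (FG a y auv).
have GF x y : `]u, v[%classic x -> setT y -> `|partial1of2 F x y| <= G y.
  rewrite /= in_itv /= => xuv _; rewrite partial1of2E.
  by have [_ ->] := HF x y xuv; exact: FG.
have der := @derivable_under_integral R _ T mu F setT measurableT a u v Ia iF' dF' G G0 iG GF.
have val := @differentiation_under_integral R _ T mu F setT measurableT a u v Ia iF' dF' G G0 iG GF.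
split=> //; rewrite -derive1E val; congr Rintegral; apply/funext => y.
by rewrite partial1of2E; have [_ ->] := HF a y auv.
Qed.

End Derivative_under_integral.

(** * Bump functions and convolution *)

Section Bump.
Variable R : realType.
Implicit Types (m : nat) (y t : R).

(* [bump 0] is exp (-1/y); the span of the family is stable under
   differentiation, whence the smoothness of all its members. *)
Definition bump m y : R := if 0 < y then y^-1 ^+ m * expR (- y^-1) else 0.

Lemma bump_ge0 m y : 0 <= bump m y.
Proof.
rewrite /bump; case: ifP => // y0.
by rewrite mulr_ge0 ?expR_ge0// exprn_ge0// invr_ge0 ltW.
Qed.

Lemma bump_gt0 m y : 0 < y -> 0 < bump m y.
Proof. by move=> y0; rewrite /bump y0 mulr_gt0 ?expR_gt0// exprn_gt0// invr_gt0. Qed.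

Lemma bump0 m y : y <= 0 -> bump m y = 0.
Proof. by rewrite /bump leNgt => /negbTE ->. Qed.

(** From exp t >= t^(n+1) / (n+1)! at t = 1/y. The case k = 0 gives the bound (m+1)! for y <= 1, the
    case k = 1 the quadratic decay that makes [bump m] differentiable at 0. *)
Lemma bump_le m k y : bump m y <= (m + k).+1`!%:R * `|y| ^+ k.+1.
Proof.
have [y0|y0] := ltP 0 y; last by rewrite bump0// mulr_ge0// exprn_ge0.
rewrite /bump y0 gtr0_norm//.
have i0 : 0 <= y^-1 by rewrite invr_ge0 ltW.
have := expR_ge1Dxn (m + k) i0.
set F := (m + k).+1`!%:R; have F0 : 0 < F :> R by rewrite ltr0n fact_gt0.
move=> E; rewrite expRN.
have E' : y^-1 ^+ (m + k).+1 / F <= expR y^-1 by apply: le_trans E; rewrite lerDr.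
have p0 : 0 < y^-1 ^+ (m + k).+1 / F by rewrite divr_gt0// exprn_gt0// invr_gt0.
apply: (@le_trans _ _ (y^-1 ^+ m * (y^-1 ^+ (m + k).+1 / F)^-1)).
  rewrite ler_wpM2l ?exprn_ge0// lef_pV2// posrE//.
  exact: expR_gt0.
rewrite invf_div mulrC -mulrA ler_pM2l// -addnS exprD invfM mulrAC mulVf ?mul1r.
  by rewrite exprVn invrK.
by rewrite expf_neq0// invr_eq0 gt_eqF.
Qed.

Lemma bump_le_cst m y : y <= 1 -> bump m y <= m.+1`!%:R.
Proof.
move=> y1; have [y0|y0] := ltP 0 y; last by rewrite bump0.
have := bump_le m 0 y; rewrite addn0 expr1 gtr0_norm// => /le_trans; apply.
by rewrite ler_piMr// ler0n.
Qed.

Lemma is_derive_quadratic (f : R -> R) y (C : R) :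
  (forall h, `|h| < 1 -> `|f (y + h) - f y| <= C * h ^+ 2) -> is_derive y (1 : R) f 0.
Proof.
move=> H.
have C0 : 0 <= C.
  have := H (1 / 2); rewrite ger0_norm; last lra.
  move=> /(_ ltac:(lra)) /(le_trans (normr_ge0 _)).
  by rewrite pmulr_lge0// exprn_gt0//; lra.
have L : h^-1 *: ((f \o shift y) (h *: (1 : R)) - f y) @[h --> 0^'] --> (0 : R).
  apply/cvgrPdist_le => e e0; near=> h.
  rewrite sub0r normrN /= /GRing.scale /= mulr1 (addrC h) normrM.
  have h0 : h != 0 by near: h; exact: nbhs_dnbhs_neq.
  have h1 : `|h| < 1.
    by near: h; apply: dnbhs0_lt.
  have he : `|h| < e / (C + 1).
    by near: h; apply: dnbhs0_lt; rewrite divr_gt0// ltr_wpDl.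
  rewrite normfV ler_pdivrMl ?normr_gt0//.
  apply: le_trans (H h h1) _.
  rewrite -real_normK ?num_real// expr2 mulrA mulrC ler_wpM2l//.
  apply: (@le_trans _ _ ((C + 1) * `|h|)); first by rewrite ler_wpM2r// lerDl.
  by rewrite mulrC -ler_pdivlMr ?ltr_wpDl// ltW.
by split; [apply/cvg_ex; exists 0|exact/cvg_lim].
Unshelve. all: by end_near. Qed.

Lemma is_derive_bump m y : is_derive y (1 : R) (bump m) (bump m.+2 y - m%:R * bump m.+1 y).
Proof.
have [y0|y0|<-] := ltgtP 0 y.
- have nE : \near y, (fun t => t^-1 ^+ m * expR (- t^-1)) y = bump m y.
    near=> t; rewrite /bump ifT//; near: t; exact: lt_nbhsr.
  apply: near_eq_is_derive nE _.
  have yn : y != 0 by rewrite gt_eqF.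
  have dV : is_derive y (1 : R) (fun t => t^-1) (- y ^- 2 *: (1 : R)).
    exact: (@is_deriveV R id y 1 1).
  have dX : is_derive y (1 : R) (fun t => t^-1 ^+ m) ((m%:R * y^-1 ^+ m.-1) *: (- y ^- 2 *: (1 : R))).
    have := @is_deriveX _ _ (fun t : R => t^-1) m y 1 _ dV.
    congr is_derive; apply/funext => t; elim: (m) => [|k ih]; first by rewrite !expr0.
    by rewrite !exprS -ih.
  have dE : is_derive y (1 : R) (fun t => expR (- t^-1)) (expR (- y^-1) * (- (- y ^- 2 *: (1 : R)))).
    exact: (@is_derive1_comp R expR (fun t => - t^-1)).
  have := @is_deriveM _ _ _ _ y 1 _ _ dX dE; congr is_derive.
  rewrite /bump y0 /GRing.scale /= -exprVn.
  set p := y^-1; set e := expR (- p).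
  by case: m {dX} => [|m] /=; rewrite ?exprS ?expr0; ring.
- rewrite !bump0 ?(ltW y0)// mulr0 subr0.
  have nE : \near y, (fun=> 0 : R) y = bump m y.
    near=> t; rewrite bump0//; apply: ltW; near: t; exact: lt_nbhsl.
  by apply: near_eq_is_derive nE _; exact: is_derive_cst.
- rewrite !bump0// mulr0 subr0.
  apply: (@is_derive_quadratic _ _ (m + 1).+1`!%:R) => h h1.
  rewrite add0r (bump0 _ (lexx 0)) subr0 ger0_norm ?bump_ge0//.
  by have := bump_le m 1 h; rewrite real_normK ?num_real.
Unshelve. all: by end_near. Qed.

Lemma continuous_bump m : continuous (bump m).
Proof.
move=> y; apply: differentiable_continuous; apply/derivable1_diffP.
by have [] := is_derive_bump m y.
Qed.

End Bump.

(** * Smooth functions and radial bumps *)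

Section Smooth.
Context {R : realType} {N : nat}.
Implicit Types (f g : 'rV[R]_N -> R) (x v c : 'rV[R]_N) (O : set 'rV[R]_N).

Lemma smooth_coind (P : ('rV[R]_N -> R) -> Prop) :
  (forall f, P f -> C1 f /\ forall i, P (partial i f)) -> forall f, P f -> smooth f.
Proof.
move=> HP f Pf s; have : P (foldr partial f s).
  by elim: s => //= i s ih; have [_] := HP _ ih; exact.
by move=> /HP[[cf _ H] _]; split=> // x i; have [] := H i x.
Qed.

Lemma smooth_partial f i : smooth f -> smooth (partial i f).
Proof. by move=> sf s; have := sf (rcons s i); rewrite foldr_rcons. Qed.

Lemma smooth_C1 f : smooth f -> C1 f.
Proof.
move=> sf; split.
- by have [] := sf [::].
- by move=> i; have [] := sf [:: i].
- by move=> i x; have [_ /(_ x i)] := sf [::]; exact: derivableP.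
Qed.

(** The algebra generated by B. If the partial derivatives of the generators stay in it, Leibniz'
    rule keeps those of all its elements in it, and smoothness follows from [smooth_coind]. *)
Inductive alg (B : ('rV[R]_N -> R) -> Prop) : ('rV[R]_N -> R) -> Prop :=
| alg_base f : B f -> alg B f
| alg_cst (c : R) : alg B (fun=> c)
| alg_add f g : alg B f -> alg B g -> alg B (fun x => f x + g x)
| alg_mul f g : alg B f -> alg B g -> alg B (fun x => f x * g x).

Lemma alg_smooth B : (forall f, B f -> C1 f /\ forall i, alg B (partial i f)) ->
  forall f, alg B f -> smooth f.
Proof.
move=> HB; apply: smooth_coind => f; elim=> {f} [f Bf|c|f g _ [Cf pf] _ [Cg pg]|f g af [Cf pf] ag [Cg pg]].
- exact: HB.
- split; first exact: C1gW (C1g_cst c).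
  by move=> i; rewrite (C1gE i (C1g_cst c)); exact: alg_cst.
- split; first exact: C1gW (C1gD Cf Cg).
  by move=> i; rewrite (C1gE i (C1gD Cf Cg)); exact: alg_add.
- split; first exact: C1gW (C1gM Cf Cg).
  by move=> i; rewrite (C1gE i (C1gM Cf Cg)); apply: alg_add; exact: alg_mul.
Qed.

Lemma smooth_closed f : smooth f -> C1 f /\ forall i, alg smooth (partial i f).
Proof. by move=> sf; split; [exact: smooth_C1|move=> i; apply: alg_base; exact: smooth_partial]. Qed.

Lemma smoothM f g : smooth f -> smooth g -> smooth (fun x => f x * g x).
Proof. by move=> sf sg; apply: (alg_smooth smooth_closed); apply: alg_mul; exact: alg_base. Qed.

Lemma smoothZ (c : R) f : smooth f -> smooth (fun x => c * f x).
Proof.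
move=> sf; apply: (alg_smooth smooth_closed); apply: (alg_mul (alg_cst _ c)).
exact: alg_base.
Qed.

Lemma smooth_shift f c : smooth f -> smooth (fun x => f (x + c)).
Proof.
move=> sf; apply: (@smooth_coind (fun h => exists2 g, smooth g & h = fun x => g (x + c))); last by exists f.
move=> _ [g sg ->]; have Cg := smooth_C1 sg; split; first exact: C1gW (C1g_shift c Cg).
move=> i; rewrite (C1gE i (C1g_shift c Cg)); exists (partial i g); last by [].
exact: smooth_partial.
Qed.

Lemma csupp_test O f : smooth f -> csupp O f -> test_function O f.
Proof.
move=> sf [K [cK KO Kf]].
have cl : closure [set x | f x != 0] `<=` K.
  rewrite (_ : K = closure K); last first.
    by apply/closure_id; exact: compact_closed (@norm_hausdorff _ _) cK.
  apply: closure_subset => x /= fx; apply: contrapT => /Kf fx0.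
  by rewrite fx0 eqxx in fx.
split=> //; last exact: subset_trans cl KO.
by apply: subclosed_compact cK cl; exact: closed_closure.
Qed.

Lemma test_smooth O f : test_function O f -> smooth f.
Proof. by case. Qed.

Lemma test_csupp O f : test_function O f -> csupp O f.
Proof.
move=> [sf cf clO]; exists (closure [set x | f x != 0]); split=> // x nx.
by apply/eqP; apply: contrapT => /negP fx; apply: nx; exact: subset_closure.
Qed.

(** The squared Euclidean norm, whereas [|x|] is the sup norm; [nsq_norm] and [nsq_le_norm] compare
    the two, at the price of a factor N. *)
Definition nsq x : R := \sum_i (x 0 i) ^+ 2.

Lemma nsq_ge0 x : 0 <= nsq x.
Proof. by apply: sumr_ge0 => i _; exact: sqr_ge0. Qed.

Lemma nsqN x : nsq (- x) = nsq x.
Proof. by apply: eq_bigr => i _; rewrite mxE sqrrN. Qed.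

Lemma nsq_norm x : `|x| ^+ 2 <= nsq x.
Proof.
have [->|x0] := eqVneq x 0; first by rewrite normr0 expr0n nsq_ge0.
have /mx_norm_neq0[i E] : mx_norm x != 0 by apply: contra_neq x0 => /mx_norm_eq0.
have -> : `|x| = `|x i.1 i.2| by [].
rewrite real_normK ?num_real// /nsq (bigD1 i.2)//= (ord1 i.1) lerDl.
by apply: sumr_ge0 => j _; exact: sqr_ge0.
Qed.

Lemma nsq_le_norm x : nsq x <= N%:R * `|x| ^+ 2.
Proof.
apply: (@le_trans _ _ (\sum_(i < N) `|x| ^+ 2)).
  apply: ler_sum => i _; rewrite -[leLHS]real_normK ?num_real// lerXn2r ?nnegrE//.
  by rewrite {2}/Num.norm /= mx_normrE; exact: (le_bigmax _ _ (0, i)).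
by rewrite sumr_const card_ord mulr_natl.
Qed.

Lemma C1g_coord j : C1g (fun x : 'rV[R]_N => x 0 j) (fun i _ => (i == j)%:R).
Proof.
split; first exact: coord_continuous.
  by move=> i; exact: cst_continuous.
by move=> i x; exact: is_derive_coord.
Qed.

Lemma C1g_nsq : C1g nsq (fun i x => 2 * x 0 i).
Proof.
split.
- apply: cont_sum => i; under eq_fun do rewrite expr2.
  by apply: contM; exact: coord_continuous.
- move=> i; apply: contM; [exact: cst_continuous|exact: coord_continuous].
- move=> i x.
  have H j : is_derive x (delta_mx 0 i) (fun y : 'rV[R]_N => y 0 j ^+ 2) ((i == j)%:R * (2 * x 0 j)).
    under eq_fun do rewrite expr2.
    have := is_deriveM' (is_derive_coord i j x) (is_derive_coord i j x); congr is_derive; ring.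
  have := is_derive_sum' H; congr is_derive.
  rewrite (bigD1 i)//= eqxx mul1r big1 ?addr0// => j ji.
  by rewrite eq_sym (negbTE ji) mul0r.
Qed.

Definition rbump m (s : R) x := bump m (1 - nsq x / s ^+ 2).

Lemma C1g_rbump m s : C1g (rbump m s)
  (fun i x => (rbump m.+2 s x - m%:R * rbump m.+1 s x) * (- (2 / s ^+ 2) * x 0 i)).
Proof.
have C2 : C1g (fun x => 1 + - (s ^+ 2)^-1 * nsq x) (fun i x => 0 + - (s ^+ 2)^-1 * (2 * x 0 i)).
  by apply: C1gD; [exact: C1g_cst|apply: C1gZ; exact: C1g_nsq].
have := C1g_comp (h := bump m) (dh := fun y => bump m.+2 y - m%:R * bump m.+1 y) _ (is_derive_bump m) C2.
have cb : continuous (fun y : R => bump m.+2 y - m%:R * bump m.+1 y).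
  apply: contD; first exact: continuous_bump.
  apply: contN; apply: contM; [exact: cst_continuous|exact: continuous_bump].
move=> /(_ cb); congr C1g.
  by apply/funext => x; rewrite /rbump; congr bump; rewrite mulNr mulrC.
apply/funext => i; apply/funext => x; rewrite /rbump.
have -> : 1 - nsq x / s ^+ 2 = 1 + - (s ^+ 2)^-1 * nsq x by rewrite mulNr mulrC.
by rewrite add0r; ring.
Qed.

Lemma rbump_smooth m s : smooth (rbump m s).
Proof.
pose B f := (exists m s, f = rbump m s) \/ exists j, f = fun x : 'rV[R]_N => x 0 j.
apply: (@alg_smooth B); last by apply: alg_base; left; exists m, s.
move=> _ [[k [t ->]]|[j ->]].
- split; first exact: C1gW (C1g_rbump k t).
  move=> i; rewrite (C1gE i (C1g_rbump k t)); apply: alg_mul.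
    apply: alg_add; first by apply: alg_base; left; exists k.+2, t.
    rewrite (_ : (fun x => _) = fun x => (- k%:R) * rbump k.+1 t x).
      by apply: alg_mul; [exact: alg_cst|apply: alg_base; left; exists k.+1, t].
    by apply/funext => x; rewrite mulNr.
  by apply: alg_mul; [exact: alg_cst|apply: alg_base; right; exists i].
- split; first exact: C1gW (C1g_coord j).
  by move=> i; rewrite (C1gE i (C1g_coord j)); exact: alg_cst.
Qed.

Lemma rbump_ge0 m s x : 0 <= rbump m s x.
Proof. exact: bump_ge0. Qed.

Lemma rbumpN m s x : rbump m s (- x) = rbump m s x.
Proof. by rewrite /rbump nsqN. Qed.

Lemma rbump_le m s x : rbump m s x <= m.+1`!%:R.
Proof.
apply: bump_le_cst; rewrite lerBlDr lerDl mulr_ge0 ?nsq_ge0// invr_ge0.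
exact: sqr_ge0.
Qed.

Lemma rbump0 m s x : 0 < s -> s <= `|x| -> rbump m s x = 0.
Proof.
move=> s0 sx; apply: bump0; rewrite subr_le0 ler_pdivlMr ?exprn_gt0// mul1r.
by apply: le_trans (nsq_norm x); rewrite lerXn2r// nnegrE// ltW.
Qed.

Lemma closed_ball_compact c (r : R) : compact [set x : 'rV[R]_N | `|x - c| <= r].
Proof.
apply: bounded_closed_compact.
  exists (`|c| + `|r|); split; first exact: num_real.
  move=> M cM x /= xc; rewrite -(subrK c x) (le_trans (ler_normD _ _))//.
  by rewrite (le_trans _ (ltW cM))// addrC lerD2l (le_trans xc)// ler_norm.
rewrite (_ : [set x | _] = (fun x : 'rV[R]_N => `|x - c|) @^-1` [set t | t <= r])//.
apply: closed_comp; last exact: closed_le.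
move=> x _; apply: cont_comp; last exact: norm_continuous.
by move=> y; apply: continuousB; [exact: cvg_id|exact: cst_continuous].
Qed.

End Smooth.

(** * Truncation functions *)

Section Theta.
Variable R : realType.
Implicit Types s t : R.

(* [Theta] is a C^2 convex substitute for the positive part, with [Theta t = 0]
   for [t <= 0] and [t - Theta t] bounded for [t >= 0]. *)
Definition Theta t : R := Num.max t 0 - atan (Num.max t 0).
(** The derivative of [Theta], followed by its own derivative. For large n, [Psi (n t)] approximates
    the indicator of {t > 0}. *)
Definition Psi t : R := (Num.max t 0) ^+ 2 / (1 + (Num.max t 0) ^+ 2).
Definition dPsi t : R := 2 * Num.max t 0 / (1 + (Num.max t 0) ^+ 2) ^+ 2.

Let sq1 (a : R) : 0 < 1 + a ^+ 2.
Proof. by rewrite ltr_pwDl// sqr_ge0. Qed.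

Lemma Theta0 t : t <= 0 -> Theta t = 0.
Proof. by move=> t0; rewrite /Theta max_r// atan0 subr0. Qed.

Lemma Psi0 t : t <= 0 -> Psi t = 0.
Proof. by move=> t0; rewrite /Psi max_r// expr0n mul0r. Qed.

Lemma Psi_ge0 t : 0 <= Psi t.
Proof. by rewrite divr_ge0 ?sqr_ge0// ltW. Qed.

Lemma Psi_gt0 t : 0 < t -> 0 < Psi t.
Proof. by move=> t0; rewrite /Psi max_l ?ltW// divr_gt0// exprn_gt0. Qed.

Lemma Psi_le1 t : Psi t <= 1.
Proof. by rewrite ler_pdivrMr// mul1r lerDr. Qed.

Lemma Psi_norm t : `|Psi t| <= 1.
Proof. by rewrite ger0_norm ?Psi_ge0// Psi_le1. Qed.

Lemma dPsi_ge0 t : 0 <= dPsi t.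
Proof. by rewrite divr_ge0 ?sqr_ge0// mulr_ge0// le_max lexx orbT. Qed.

Lemma dPsi_norm t : `|dPsi t| <= 1.
Proof.
rewrite ger0_norm ?dPsi_ge0// ler_pdivrMr ?exprn_gt0// mul1r.
set a := Num.max t 0; have a0 : 0 <= a by rewrite le_max lexx orbT.
by have := sqr_ge0 (1 - a); nra.
Qed.

Lemma maxr0_continuous : continuous (fun t : R => Num.max t 0).
Proof.
move=> t; apply: (@continuous_max R R id (fun=> 0) t).
  exact: cvg_id.
exact: cst_continuous.
Qed.

Let cden : continuous (fun t => 1 + (Num.max t 0) ^+ 2).
Proof.
apply: contD; first exact: cst_continuous.
by apply: (contM maxr0_continuous maxr0_continuous).
Qed.

Let near_pos t : 0 < t -> \near t, t = Num.max t 0.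
Proof. by move=> t0; near=> s; rewrite max_l// ltW//; near: s; exact: lt_nbhsr.
Unshelve. all: by end_near. Qed.

Lemma is_derive_Psi t : is_derive t (1 : R) Psi (dPsi t).
Proof.
have [t0|t0|<-] := ltgtP 0 t.
- have nE : \near t, (fun s => 1 + - (1 + s ^+ 2)^-1) t = Psi t.
    near=> s; rewrite /Psi max_l; last by apply: ltW; near: s; exact: lt_nbhsr.
    by field; rewrite gt_eqF.
  apply: near_eq_is_derive nE _.
  have d1 : is_derive t (1 : R) (fun s => 1 + s ^+ 2) (0 + (t * 1 + t * 1)).
    have dd := @is_deriveM _ _ id id t 1 _ _ (is_derive_id t 1) (is_derive_id t 1).
    have := is_deriveD (is_derive_cst (1 : R) t 1) dd; congr is_derive.
  have n0 : 1 + t ^+ 2 != 0 by rewrite gt_eqF.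
  have d2 := @is_deriveV R _ t _ _ n0 d1.
  have := @is_deriveD _ _ _ _ _ t 1 _ _ (is_derive_cst (1 : R) t 1) (@is_deriveN _ _ _ _ t 1 _ d2).
  congr is_derive; rewrite /dPsi max_l ?ltW// /GRing.scale /=.
  by field.
- rewrite /dPsi max_r ?ltW// mulr0 mul0r.
  have nE : \near t, (fun=> 0 : R) t = Psi t.
    near=> s; rewrite Psi0//; apply: ltW; near: s; exact: lt_nbhsl.
  by apply: near_eq_is_derive nE _; exact: is_derive_cst.
- rewrite /dPsi max_r// mulr0 mul0r; apply: (@is_derive_quadratic _ _ _ 1) => h _.
  rewrite add0r (Psi0 (lexx 0)) subr0 ger0_norm ?Psi_ge0// mul1r.
  rewrite ler_pdivrMr//; have [h0|h0] := leP 0 h.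
    by have := sqr_ge0 h; nra.
  by rewrite expr0n/= addr0 mulr1 sqr_ge0.
Unshelve. all: by end_near. Qed.

Let mvt0 (f df : R -> R) : (forall t, is_derive t (1 : R) f (df t)) ->
  forall s t, exists2 c : R, f t - f s = df c * (t - s) & (s <= c <= t) || (t <= c <= s).
Proof.
move=> H s t.
have cf a b : {within `[a, b], continuous f}.
  apply: continuous_subspaceT => x; apply: differentiable_continuous.
  by apply/derivable1_diffP; have [] := H x.
have [st|ts] := leP s t.
  have [c] := @MVT_segment R f df s t st (fun x _ => H x) (cf s t).
  by rewrite in_itv /= => cst ->; exists c; rewrite ?cst.
have [c] := @MVT_segment R f df t s (ltW ts) (fun x _ => H x) (cf t s).
rewrite in_itv /= => cst E; exists c; last by rewrite cst orbT.
by rewrite -opprB E; ring.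
Qed.

Let is_derive_theta t : is_derive t (1 : R) (fun s => s - atan s) (t ^+ 2 / (1 + t ^+ 2)).
Proof.
have := @is_deriveB _ _ _ id atan t 1 _ _ (is_derive_id t 1) (is_derive1_atan t).
by congr is_derive; field; rewrite gt_eqF.
Qed.

Lemma is_derive_Theta t : is_derive t (1 : R) Theta (Psi t).
Proof.
have [t0|t0|<-] := ltgtP 0 t.
- have nE : \near t, (fun s => s - atan s) t = Theta t.
    near=> s; rewrite /Theta max_l//; apply: ltW; near: s; exact: lt_nbhsr.
  by apply: near_eq_is_derive nE _; rewrite /Psi max_l ?ltW//; exact: is_derive_theta.
- rewrite Psi0 ?ltW//.
  have nE : \near t, (fun=> 0 : R) t = Theta t.
    near=> s; rewrite Theta0//; apply: ltW; near: s; exact: lt_nbhsl.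
  by apply: near_eq_is_derive nE _; exact: is_derive_cst.
- rewrite Psi0//; apply: (@is_derive_quadratic _ _ _ 1) => h h1.
  rewrite add0r (Theta0 (lexx 0)) subr0 mul1r.
  have [h0|h0] := leP 0 h; last by rewrite (Theta0 (ltW h0)) normr0 exprn_even_ge0.
  rewrite /Theta max_l//.
  have [c] := mvt0 is_derive_theta 0 h.
  rewrite atan0 !subr0 => -> /orP[/andP[c0 ch]|/andP[hc c0]]; last first.
    have -> : h = 0 by lra.
    by rewrite mulr0 normr0; exact: sqr_ge0.
  rewrite ger0_norm in h1 => //.
  have cp : 0 <= c ^+ 2 / (1 + c ^+ 2) by rewrite divr_ge0 ?sqr_ge0// ltW.
  have cl : c ^+ 2 / (1 + c ^+ 2) <= h by rewrite ler_pdivrMr//; nra.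
  rewrite ger0_norm; last exact: mulr_ge0.
  by rewrite (expr2 h); exact: ler_wpM2r.
Unshelve. all: by end_near. Qed.

Lemma Theta_continuous : continuous Theta.
Proof.
move=> t; apply: differentiable_continuous; apply/derivable1_diffP.
by have [] := is_derive_Theta t.
Qed.

Lemma Theta_lip s t : `|Theta t - Theta s| <= `|t - s|.
Proof.
have [c -> _] := mvt0 is_derive_Theta s t.
by rewrite normrM ler_piMl// Psi_norm.
Qed.

Lemma Psi_lip s t : `|Psi t - Psi s| <= `|t - s|.
Proof.
have [c -> _] := mvt0 is_derive_Psi s t.
by rewrite normrM ler_piMl// dPsi_norm.
Qed.

Lemma Theta_ge0 t : 0 <= Theta t.
Proof.
have [t0|t0] := leP t 0; first by rewrite Theta0.
have [c] := mvt0 is_derive_Theta 0 t.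
rewrite (Theta0 (lexx 0)) !subr0 => -> _.
by rewrite mulr_ge0 ?Psi_ge0// ltW.
Qed.

Lemma Theta_le t : 0 <= t -> Theta t <= t.
Proof.
move=> t0; have := Theta_lip 0 t; rewrite (Theta0 (lexx 0)) !subr0 (ger0_norm t0).
by apply: le_trans; exact: ler_norm.
Qed.

(** The gap is atan t, and 2 is a convenient bound for pi / 2. *)
Lemma Theta_gap t : 0 <= t -> t - Theta t <= 2.
Proof.
move=> t0; rewrite /Theta max_l// opprB addrC subrK.
by rewrite ltW// (lt_trans (atan_ltpi2 t))// pihalf_lt2.
Qed.

End Theta.

(** * Convolution with compactly supported kernels *)

Section Convolution.
Context {R : realType} {N : nat}.
Local Notation leb := (@lebesgue_rV R N).
Local Notation I f := (Rintegral leb setT f).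
Implicit Types (k z f a : 'rV[R]_N -> R).

Definition conv k z (x : 'rV[R]_N) : R := I (fun y => k (x - y) * z y).

Section kernel.
Variables k z : 'rV[R]_N -> R.
Hypotheses (ck : continuous k) (sk : csupp setT k) (iz : intg leb z).

Let msub : measurable_fun setT (fun p : 'rV[R]_N * 'rV[R]_N => k (p.1 - p.2)).
Proof.
apply: measurableT_comp; first exact: continuous_measurable_rV.
exact: measurable_sub_rV.
Qed.

Lemma conv_intg_section x : intg leb (fun y => k (x - y) * z y).
Proof.
have [C C0 kC] := csupp_bounded ck sk.
exact: (intg_section iz msub (fun p => kC _)).
Qed.

Lemma conv_continuous : continuous (conv k z).
Proof.
suff H (x : 'rV[R]_N) : conv k z y @[y --> x] --> conv k z x by [].
have F : ProperFilter (nbhs x) by exact: nbhs_pfilter.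
apply: (proj2 (@cvgrPdist_lt _ _ _ (nbhs x) _ (conv k z) (conv k z x))) => e e0.
pose M := I (fun y => `|z y|) + 1.
have M0 : 0 < M by rewrite ltr_wpDl// Rint_ge0.
have [d d0 dH] := csupp_uniform ck sk (divr_gt0 e0 M0).
apply/nbhs_ballP; exists d => //= x' xx'.
rewrite /conv -RintB; [|exact: conv_intg_section|exact: conv_intg_section].
have ib := intgB (conv_intg_section x) (conv_intg_section x').
apply: le_lt_trans (Rint_norm ib) _.
apply: (@le_lt_trans _ _ (I (fun y => e / M * `|z y|))).
  apply: Rint_le; first exact: intg_norm.
    exact/intgZ/intg_norm.
  move=> y; rewrite -mulrBl normrM ler_wpM2r// ltW// dH//.
  by rewrite opprB addrA subrK; move: xx'; rewrite -ball_normE.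
rewrite RintZ; last exact: intg_norm.
by rewrite mulrAC ltr_pdivrMr// ltr_pM2l// /M ltrDl.
Qed.

End kernel.

Lemma conv_C1g k dk z : C1g k dk -> csupp setT k -> intg leb z ->
  C1g (conv k z) (fun i => conv (dk i) z).
Proof.
move=> Ck sk iz; have [ck cdk Hk] := Ck.
have sdk i : csupp setT (dk i) by exact: csupp_partial Ck sk.
split; first exact: conv_continuous.
  by move=> i; exact: conv_continuous.
move=> i x; apply/is_derive_line.
have [C C0 dC] := csupp_bounded (cdk i) (sdk i).
pose e : 'rV[R]_N := delta_mx 0 i.
have := @is_derive_Rint _ _ _ leb (fun t y => k (t *: e + x - y) * z y)
  (fun t y => dk i (t *: e + x - y) * z y) 0 (-1) 1 (fun y => C * `|z y|).
rewrite scale0r add0r; apply.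
- by rewrite ltrN10 ltr01.
- by move=> t _; exact: conv_intg_section.
- move=> t y _; have := is_derive_lineT (Hk i) (x - y) t.
  move=> /(fun h => @is_deriveZ _ _ _ _ (z y) _ _ _ h).
  rewrite /GRing.scale /= mulrC -addrA; congr is_derive.
  by apply/funext => u; rewrite -addrA mulrC.
- exact/intgZ/intg_norm.
- by move=> t y _; rewrite normrM ler_wpM2r.
Qed.

Lemma conv_smooth k z : smooth k -> csupp setT k -> intg leb z -> smooth (conv k z).
Proof.
move=> sk ck iz.
apply: (@smooth_coind _ _ (fun h => exists k', [/\ smooth k', csupp setT k' & h = conv k' z])); last by exists k.
move=> _ [k' [sk' ck' ->]]; have Cc := conv_C1g (smooth_C1 sk') ck' iz.
split; first exact: C1gW Cc.
move=> i; rewrite (C1gE i Cc); exists (partial i k'); split.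
- exact: smooth_partial.
- exact: csupp_partial (smooth_C1 sk') ck'.
- by [].
Qed.

Lemma convB k z z' x : continuous k -> csupp setT k -> intg leb z -> intg leb z' ->
  conv k (fun y => z y - z' y) x = conv k z x - conv k z' x.
Proof.
move=> ck sk iz iz'; rewrite /conv -RintB; [|exact: conv_intg_section|exact: conv_intg_section].
by congr Rintegral; apply/funext => y; rewrite mulrBr.
Qed.

Lemma convD k z z' x : continuous k -> csupp setT k -> intg leb z -> intg leb z' ->
  conv k (fun y => z y + z' y) x = conv k z x + conv k z' x.
Proof.
move=> ck sk iz iz'; rewrite /conv -RintD; [|exact: conv_intg_section|exact: conv_intg_section].
by congr Rintegral; apply/funext => y; rewrite mulrDr.
Qed.

Lemma convZ k c z x : continuous k -> csupp setT k -> intg leb z ->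
  conv k (fun y => c * z y) x = c * conv k z x.
Proof.
move=> ck sk iz; rewrite /conv -RintZ; last exact: conv_intg_section.
by congr Rintegral; apply/funext => y; ring.
Qed.

Lemma conv_le k z z' x : continuous k -> csupp setT k -> intg leb z -> intg leb z' ->
  (forall y, 0 <= k y) -> {ae leb, forall y, z y <= z' y} -> conv k z x <= conv k z' x.
Proof.
move=> ck sk iz iz' k0 zz'; apply: ae_Rint_le.
- exact: conv_intg_section.
- exact: conv_intg_section.
- by apply: filterS zz' => y; exact: ler_wpM2l.
Qed.

Lemma conv_ge0 k z x : continuous k -> csupp setT k -> intg leb z ->
  (forall y, 0 <= k y) -> {ae leb, forall y, 0 <= z y} -> 0 <= conv k z x.
Proof.
move=> ck sk iz k0 z0; apply: ae_Rint_ge0; first exact: conv_intg_section.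
by apply: filterS z0 => y; exact: mulr_ge0.
Qed.

Lemma conv_norm k z x : continuous k -> csupp setT k -> intg leb z ->
  (forall y, 0 <= k y) -> `|conv k z x| <= conv k (fun y => `|z y|) x.
Proof.
move=> ck sk iz k0; apply: le_trans (Rint_norm (conv_intg_section ck sk iz x)) _.
rewrite le_eqVlt; apply/orP; left; apply/eqP; congr Rintegral.
by apply/funext => y; rewrite normrM ger0_norm.
Qed.

Lemma conv_swap k z a : continuous k -> csupp setT k -> intg leb z -> intg leb a ->
  (forall x, k (- x) = k x) ->
  I (fun x => a x * conv k z x) = I (fun x => z x * conv k a x).
Proof.
move=> ck sk iz ia ke.
have [C C0 kC] := csupp_bounded ck sk.
have mG : measurable_fun setT (fun p : 'rV[R]_N * 'rV[R]_N => k (p.1 - p.2)).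
  apply: measurableT_comp; first exact: continuous_measurable_rV.
  exact: measurable_sub_rV.
rewrite (Rint_swap ia iz mG (fun p => kC _)) /=.
congr Rintegral; apply/funext => y; congr (_ * _); rewrite /conv.
by congr Rintegral; apply/funext => x; rewrite -ke opprB.
Qed.

Definition off (r : R) z := forall x, r <= `|x| -> z x = 0.

Lemma conv_off k z r s : off r z -> off s k -> off (r + s) (conv k z).
Proof.
move=> z0 k0 x rsx; rewrite -[RHS](Rint0 leb); congr Rintegral; apply/funext => y.
have [ry|yr] := leP r `|y|; first by rewrite z0// mulr0.
rewrite k0 ?mul0r//; have := ler_normD (x - y) y; rewrite subrK; lra.
Qed.

Lemma off_csupp r f : off r f -> csupp setT f.
Proof.
move=> f0; exists [set x | `|x - 0| <= r]; split=> //; first exact: closed_ball_compact.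
by move=> x /= /negP; rewrite -ltNge subr0 => /ltW /f0.
Qed.

Lemma csupp_off O f : csupp O f -> exists2 r, 0 < r & off r f.
Proof.
move=> [K [cK _ Kf]]; have [r r0 Kr] := compact_subball cK; exists r => // x rx.
by apply: Kf => /Kr; rewrite -ball_normE /= sub0r normrN ltNge rx.
Qed.

Lemma intg_off f r C : measurable_fun setT f -> (forall x, `|f x| <= C) -> off r f ->
  intg leb f.
Proof.
move=> mf fC f0; apply: (intg_bounded_ball (r := r) mf fC) => x nx; apply: f0.
by rewrite leNgt; apply/negP => xr; apply: nx; rewrite -ball_normE /= sub0r normrN.
Qed.

Lemma conv_intg k z : continuous k -> csupp setT k -> intg leb z ->
  (exists r, off r z) -> intg leb (conv k z).
Proof.
move=> ck sk iz [r z0]; have [s s0 k0] := csupp_off sk.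
have cc := conv_continuous ck sk iz.
exact: csupp_intg cc (off_csupp (conv_off z0 k0)).
Qed.

Lemma Rint_conv k z : continuous k -> csupp setT k -> intg leb z ->
  (exists r, off r z) -> (forall x, k (- x) = k x) -> I (conv k z) = I z * I k.
Proof.
move=> ck sk iz [r z0] ke; have [s s0 k0] := csupp_off sk.
(* The constant 1 is not integrable; it is replaced by the indicator of a ball large enough to equal
   1 wherever the supports of z and k can reach. *)
pose b : 'rV[R]_N -> R := fun x => \1_(ball (0 : 'rV[R]_N) (r + s + s)) x.
have ib : intg leb b by exact: indic_ball_intg.
have bE x : `|x| < r + s + s -> b x = 1.
  by move=> xr; rewrite /b indicE mem_set// -ball_normE /= sub0r normrN.
have := conv_swap ck sk iz ib ke.
have -> : (fun x => b x * conv k z x) = conv k z.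
  apply/funext => x; have [xr|rx] := ltP `|x| (r + s); first by rewrite bE ?mul1r//; lra.
  by rewrite (conv_off z0 k0 rx) mulr0.
move=> ->; rewrite mulrC -RintZ//; congr Rintegral; apply/funext => y.
have [ry|yr] := leP r `|y|; first by rewrite z0// mul0r mulr0.
rewrite mulrC; congr (_ * _); rewrite /conv.
rewrite -[RHS](Rint_shift (- y)); last exact: continuous_measurable_rV.
congr Rintegral; apply/funext => x; rewrite -ke opprB.
have [xs|sx] := ltP `|x - y| s; last by rewrite k0// mul0r.
rewrite bE ?mulr1//; have := ler_normD (x - y) y; rewrite subrK; lra.
Qed.

End Convolution.

(** * The mollifying kernel *)

Section Kernel.
Context {R : realType} {N : nat}.
Local Notation leb := (@lebesgue_rV R N).
Local Notation I f := (Rintegral leb setT f).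
Implicit Types (x y c : 'rV[R]_N) (s r : R) (z : 'rV[R]_N -> R).

Lemma leb_ball_gt0 n (x : 'rV[R]_n) (e : R) : 0 < e ->
  (0 < @lebesgue_rV R n (ball x e))%E.
Proof.
move=> e0; elim: n x => [|n ih] x.
  rewrite /= diracE mem_set ?lte01//; split=> // i; by case.
rewrite /= /lebesgue_cons /pushforward preimage_rV_cons_ball.
rewrite product_measure1E; [|exact: measurable_ball_rV|exact: measurable_ball].
have := @lebesgue_measure_ball R ((x : 'rV[R]_(1 + n)) ord0 (lshift n ord0)) e (ltW e0).
by rewrite /= => ->; rewrite mule_gt0 ?ih// lte_fin mulrn_wgt0.
Qed.

Lemma rbump_cont m s : continuous (@rbump R N m s).
Proof. by have [] := C1g_rbump (R := R) (N := N) m s. Qed.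

Lemma rbump_off m s : 0 < s -> off s (@rbump R N m s).
Proof. by move=> s0 x; exact: rbump0. Qed.

Lemma rbump_intg m s : 0 < s -> intg leb (rbump m s).
Proof.
move=> s0; exact: csupp_intg (@rbump_cont m s) (off_csupp (rbump_off m s0)).
Qed.

Definition mass0 : R := I (rbump 2 1).

Lemma ae_ball_contra (P : 'rV[R]_N -> Prop) (x : 'rV[R]_N) (r : R) : 0 < r ->
  {ae leb, forall y, P y} -> exists2 y, ball x r y & P y.
Proof.
move=> r0 aeP; apply: contrapT => nP.
have sub : ball x r `<=` [set y | ~ P y].
  by move=> y yB Py; apply: nP; exists y.
have [M [mM M0 PM]] := aeP.
have : (leb (ball x r) <= leb M)%E.
  apply: le_measure; rewrite ?inE//; first exact: measurable_ball_rV.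
  exact: subset_trans sub PM.
by rewrite M0 leNgt leb_ball_gt0.
Qed.

Lemma mass0_gt0 : 0 < mass0.
Proof.
rewrite ltNge; apply/negP => m0.
have ae0 := Rint_eq0_ae (rbump_intg 2 (@ltr01 R)) (rbump_ge0 2 1) m0.
have r0 : 0 < (N%:R + 1)^-1 :> R by rewrite invr_gt0 ltr_wpDl.
have [y yB] := ae_ball_contra 0 r0 ae0.
apply/eqP; rewrite gt_eqF//; apply: bump_gt0.
rewrite expr1n divr1 subr_gt0 (le_lt_trans (nsq_le_norm y))//.
move: yB; rewrite -ball_normE /= sub0r normrN => yr.
have N0 : 0 <= N%:R :> R by [].
have N1 : 0 < N%:R + 1 :> R by rewrite ltr_wpDl.
have yr1 : `|y| * (N%:R + 1) < 1 by rewrite -ltr_pdivlMr// div1r.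
have := normr_ge0 y; nra.
Qed.

(** Scaling gives d/ds K_s = - div ((x / s) K_s). Since the derivative of [bump 0] is [bump 2], the
    field (x / s) K_s is minus the gradient of Q_s; whence the index 2 in [K] and 0 in [Q]. *)
Definition K s x : R := mass0^-1 * (s^-1 ^+ N * rbump 2 s x).
Definition Q s x : R := mass0^-1 * (s * s^-1 ^+ N / 2 * rbump 0 s x).
(* [dK] is both the derivative of [K] in [s] and the Laplacian of [Q]. *)
Definition dK s x : R := mass0^-1 *
  (- (N%:R * s^-1 ^+ N.+1) * rbump 2 s x +
   s^-1 ^+ N * ((rbump 4 s x - 2 * rbump 3 s x) * (2 * nsq x * s^-1 ^+ 3))).

Lemma K_smooth s : smooth (K s).
Proof. by apply: smoothZ; apply: smoothZ; exact: rbump_smooth. Qed.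

Lemma Q_smooth s : smooth (Q s).
Proof. by apply: smoothZ; apply: smoothZ; exact: rbump_smooth. Qed.

Lemma K_cont s : continuous (K s).
Proof. by have [] := smooth_C1 (K_smooth s). Qed.

Lemma K_ge0 s x : 0 < s -> 0 <= K s x.
Proof.
move=> s0; rewrite mulr_ge0 ?invr_ge0 ?(ltW mass0_gt0)// mulr_ge0 ?rbump_ge0//.
by rewrite exprn_ge0// invr_ge0 ltW.
Qed.

Lemma Q_ge0 s x : 0 < s -> 0 <= Q s x.
Proof.
move=> s0; rewrite mulr_ge0 ?invr_ge0 ?(ltW mass0_gt0)// mulr_ge0 ?rbump_ge0//.
by rewrite divr_ge0// mulr_ge0 ?(ltW s0)// exprn_ge0// invr_ge0 ltW.
Qed.

Lemma KN s x : K s (- x) = K s x.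
Proof. by rewrite /K rbumpN. Qed.

Lemma K_off s : 0 < s -> off s (K s).
Proof. by move=> s0 x sx; rewrite /K rbump0// !mulr0. Qed.

Lemma Q_off s : 0 < s -> off s (Q s).
Proof. by move=> s0 x sx; rewrite /Q rbump0// !mulr0. Qed.

Lemma K_csuppT s : 0 < s -> csupp setT (K s).
Proof. by move=> s0; exact: off_csupp (K_off s0). Qed.

Lemma K_intg s : 0 < s -> intg leb (K s).
Proof. by move=> s0; exact: csupp_intg (@K_cont s) (K_csuppT s0). Qed.

Lemma off_csupp_shift f s c O : off s f -> (forall x, `|x - c| <= s -> O x) ->
  csupp O (fun x => f (x - c)).
Proof.
move=> f0 H; exists [set x | `|x - c| <= s]; split=> //.
  exact: closed_ball_compact.
by move=> x /= /negP; rewrite -ltNge => /ltW; exact: f0.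
Qed.

Lemma K_test s c O : 0 < s -> (forall x, `|x - c| <= s -> O x) ->
  test_function O (fun x => K s (x - c)).
Proof.
move=> s0 H; apply: csupp_test; first by apply: smooth_shift; exact: K_smooth.
exact: off_csupp_shift (K_off s0) H.
Qed.

Lemma Q_test s c O : 0 < s -> (forall x, `|x - c| <= s -> O x) ->
  test_function O (fun x => Q s (x - c)).
Proof.
move=> s0 H; apply: csupp_test; first by apply: smooth_shift; exact: Q_smooth.
exact: off_csupp_shift (Q_off s0) H.
Qed.

Lemma K_le s x : 0 < s -> K s x <= mass0^-1 * 6 * s^-1 ^+ N.
Proof.
move=> s0; rewrite /K -mulrA ler_wpM2l ?invr_ge0 ?(ltW mass0_gt0)// mulrC.
rewrite ler_wpM2r//; last exact: rbump_le.
by rewrite exprn_ge0// invr_ge0 ltW.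
Qed.

(** On the Euclidean ball of radius s / 2 the argument of the bump is at least 3/4, which bounds K_s
    there from below by a multiple of s^-N. *)
Definition kap : R := mass0^-1 * expR (- (3 / 4)^-1).

Lemma kap_gt0 : 0 < kap.
Proof. by rewrite mulr_gt0 ?invr_gt0 ?mass0_gt0// expR_gt0. Qed.

Lemma K_ge s x : 0 < s -> nsq x <= s ^+ 2 / 4 -> kap * s^-1 ^+ N <= K s x.
Proof.
move=> s0 xs; rewrite /kap /K -mulrA ler_wpM2l ?invr_ge0 ?(ltW mass0_gt0)// mulrC.
rewrite ler_wpM2l//; first by rewrite exprn_ge0// invr_ge0 ltW.
rewrite /rbump; set y := 1 - _.
have y34 : 3 / 4 <= y.
  have : nsq x / s ^+ 2 <= 1 / 4 by rewrite ler_pdivrMr ?exprn_gt0//; lra.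
  by rewrite /y; lra.
have y1 : y <= 1.
  by rewrite lerBlDr lerDl mulr_ge0 ?nsq_ge0// invr_ge0 sqr_ge0.
have y0 : 0 < y by lra.
rewrite /bump y0; apply: (@le_trans _ _ (expR (- y^-1))).
  by rewrite ler_expR lerN2 lef_pV2// posrE//; lra.
rewrite ler_peMl ?expR_ge0// exprn_ege1// invf_ge1//.
Qed.

Lemma rbump02 s x : rbump 0 s x <= rbump 2 s x.
Proof.
rewrite /rbump; set y := 1 - _.
have y1 : y <= 1.
  by rewrite lerBlDr lerDl mulr_ge0 ?nsq_ge0// invr_ge0 sqr_ge0.
rewrite /bump; case: ifPn => // y0; rewrite expr0 ler_wpM2r ?expR_ge0//.
by rewrite exprn_ege1// invf_ge1.
Qed.

(** Consequently Q_t has integral at most t / 2; integrating C t / 2 in t produces the error C s^2 /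
    4 in the monotonicity of averages. *)
Lemma Q_le s x : 0 < s -> Q s x <= s / 2 * K s x.
Proof.
move=> s0; have -> : s / 2 * K s x = mass0^-1 * (s * s^-1 ^+ N / 2 * rbump 2 s x).
  by rewrite /K; ring.
rewrite /Q ler_wpM2l ?invr_ge0 ?(ltW mass0_gt0)// ler_wpM2l ?rbump02//.
by rewrite divr_ge0// mulr_ge0 ?(ltW s0)// exprn_ge0// invr_ge0 ltW.
Qed.

Lemma partial_Q s i : s != 0 ->
  partial i (Q s) = fun x => - (mass0^-1 * s^-1 ^+ N.+1) * (rbump 2 s x * x 0 i).
Proof.
move=> s0; have H := C1gZ mass0^-1 (C1gZ (s * s^-1 ^+ N / 2) (C1g_rbump (R := R) (N := N) 0 s)).
rewrite (C1gE i H); apply/funext => x; rewrite mul0r subr0 [s^-1 ^+ N.+1]exprS.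
by field; rewrite s0 gt_eqF ?mass0_gt0.
Qed.

Lemma laplacian_Q s x : s != 0 -> laplacian (Q s) x = dK s x.
Proof.
move=> s0; rewrite /laplacian.
have m0 : mass0 != 0 by rewrite gt_eqF ?mass0_gt0.
have E i : partial i (partial i (Q s)) x = - (mass0^-1 * s^-1 ^+ N.+1) *
    (rbump 2 s x + x 0 i * ((rbump 4 s x - 2%:R * rbump 3 s x) * (- (2 / s ^+ 2) * x 0 i))).
  rewrite (partial_Q i s0).
  have H := C1gZ (- (mass0^-1 * s^-1 ^+ N.+1)) (C1gM (C1g_rbump (R := R) (N := N) 2 s) (C1g_coord i)).
  by rewrite (C1gE i H) /= eqxx mulr1.
under eq_bigr do rewrite E.
rewrite -mulr_sumr big_split /= sumr_const card_ord -[X in X + _]mulr_natl.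
have -> : \sum_(i < N) x 0 i * ((rbump 4 s x - 2%:R * rbump 3 s x) * (- (2 / s ^+ 2) * x 0 i)) =
    (rbump 4 s x - 2%:R * rbump 3 s x) * (- (2 / s ^+ 2)) * nsq x.
  by rewrite /nsq mulr_sumr; apply: eq_bigr => i _; ring.
rewrite /dK [s^-1 ^+ N.+1]exprS; field; by rewrite s0 m0.
Qed.

Lemma is_derive_K s x : 0 < s -> is_derive s (1 : R) (fun s => K s x) (dK s x).
Proof.
move=> s0; have sn : s != 0 by rewrite gt_eqF.
have dV : is_derive s (1 : R) (fun s => s^-1) (- s ^- 2 *: (1 : R)).
  exact: (@is_deriveV R id s _ _ sn (is_derive_id s 1)).
have dX m : is_derive s (1 : R) (fun s => s^-1 ^+ m) (- (m%:R * s^-1 ^+ m.+1)).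
  have := @is_deriveX _ _ (fun t : R => t^-1) m s 1 _ dV.
  congr is_derive.
    apply/funext => t; elim: (m) => [|k ih]; first by rewrite !expr0.
    by rewrite !exprS -ih.
  rewrite /GRing.scale /= mulr1 -exprVn; case: (m) => [|k]; first by rewrite !mul0r oppr0.
  by rewrite /= !exprS; ring.
have dB m : is_derive s (1 : R) (fun s => rbump m s x)
    ((rbump m.+2 s x - m%:R * rbump m.+1 s x) * (2 * nsq x * s^-1 ^+ 3)).
  have d1 : is_derive s (1 : R) (fun s => 1 - nsq x / s ^+ 2) (2 * nsq x * s^-1 ^+ 3).
    have := @is_deriveB _ _ _ _ _ s 1 _ _ (is_derive_cst (1 : R) s 1)
       (@is_deriveZ _ _ _ (fun s : R => s^-1 ^+ 2) (nsq x) s 1 _ (dX 2)).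
    congr is_derive; last by rewrite /GRing.scale /=; ring.
    by apply/funext => t; rewrite -exprVn.
  have := @is_derive1_comp R (bump m) (fun s => 1 - nsq x / s ^+ 2) s _ _ (is_derive_bump m _) d1.
  by [].
have := @is_deriveZ _ _ _ _ mass0^-1 s 1 _ (@is_deriveM _ _ _ _ s 1 _ _ (dX N) (dB 2)).
congr is_derive.
by rewrite /dK /GRing.scale /=; ring.
Qed.

(** The numbers 6, 24 and 120 are the bounds 3!, 4! and 5! of [rbump 2], [rbump 3] and [rbump 4]. *)
Definition CK : R := mass0^-1 * (N%:R * 6 + 2 * (120 + 2 * 24)).

Lemma dK_le s x : 0 < s -> `|dK s x| <= CK * s^-1 ^+ N.+1.
Proof.
move=> s0; have m0 := mass0_gt0.
have p0 : 0 < s^-1 by rewrite invr_gt0.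
have pN : 0 <= s^-1 ^+ N by rewrite exprn_ge0// ltW.
rewrite /dK /CK normrM (ger0_norm (ltW _)) ?invr_gt0// -[leRHS]mulrA ler_wpM2l ?invr_ge0 ?(ltW m0)//.
have B m : 0 <= rbump m s x <= m.+1`!%:R by rewrite rbump_ge0 rbump_le.
have T m : `|rbump m s x * (2 * nsq x * s^-1 ^+ 3)| <= m.+1`!%:R * (2 * s^-1).
  have [xs|sx] := leP (nsq x) (s ^+ 2).
    rewrite normrM; apply: ler_pM => //.
      by rewrite ger0_norm ?rbump_ge0// rbump_le.
    rewrite ger0_norm; last by rewrite !mulr_ge0 ?nsq_ge0 ?(ltW p0).
    have -> : 2 * s^-1 = 2 * s ^+ 2 * s^-1 ^+ 3 :> R by field; rewrite gt_eqF.
    by rewrite ler_wpM2r ?exprn_ge0 ?(ltW p0)// ler_wpM2l.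
  rewrite (_ : rbump m s x = 0) ?mul0r ?normr0 ?mulr_ge0 ?(ltW p0)//.
  by apply: bump0; rewrite subr_le0 ler_pdivlMr ?exprn_gt0// mul1r ltW.
have /andP[a1 a2] : 0 <= rbump 2 s x <= 6 := B 2%N.
have T3 : `|rbump 3 s x * (2 * nsq x * s^-1 ^+ 3)| <= 24 * (2 * s^-1) := T 3%N.
have T4 : `|rbump 4 s x * (2 * nsq x * s^-1 ^+ 3)| <= 120 * (2 * s^-1) := T 4%N.
apply: le_trans (ler_normD _ _) _.
rewrite [s^-1 ^+ N.+1]exprS [leRHS]mulrDl; apply: lerD.
  set P := N%:R * _; have P0 : 0 <= P by rewrite !mulr_ge0 ?(ltW p0).
  rewrite normrM normrN (ger0_norm a1) (ger0_norm P0).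
  by rewrite [leRHS]mulrAC ler_wpM2l.
rewrite normrM (ger0_norm pN) [leRHS]mulrA [leLHS]mulrC ler_wpM2r//.
set t := 2 * nsq x * s^-1 ^+ 3 in T3 T4 *.
have -> : (rbump 4 s x - 2 * rbump 3 s x) * t = rbump 4 s x * t - 2 * (rbump 3 s x * t) by ring.
apply: le_trans (ler_normB _ _) _.
rewrite (@normrM _ 2) (ger0_norm (ler0n R 2)).
have -> : 2 * (120 + 2 * 24) * s^-1 = 120 * (2 * s^-1) + 2 * (24 * (2 * s^-1)) by ring.
by rewrite lerD// ler_wpM2l.
Qed.

Lemma dK_measurable s : measurable_fun setT (dK s).
Proof.
have mb m : measurable_fun setT (@rbump R N m s).
  by apply: continuous_measurable_rV; exact: rbump_cont.
have mn : measurable_fun setT (@nsq R N).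
  by apply: continuous_measurable_rV; have [] := C1g_nsq (R := R) (N := N).
apply: measurable_funM => //; apply: measurable_funD; first exact: measurable_funM.
apply: measurable_funM => //; apply: measurable_funM.
  by apply: measurable_funB => //; exact: measurable_funM.
by apply: measurable_funM => //; exact: measurable_funM.
Qed.

Lemma is_derive_convK z x s : intg leb z -> 0 < s ->
  is_derive s (1 : R) (fun s => conv (K s) z x) (I (fun y => dK s (x - y) * z y)).
Proof.
move=> iz s0.
apply: (@is_derive_Rint _ _ _ leb (fun s y => K s (x - y) * z y)
  (fun s y => dK s (x - y) * z y) s (s / 2) (2 * s)
  (fun y => CK * (s / 2)^-1 ^+ N.+1 * `|z y|)).
- by apply/andP; split; lra.
- move=> t /andP[t1 t2]; apply: conv_intg_section => //; first exact: K_cont.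
  by apply: K_csuppT; lra.
- move=> t y /andP[t1 t2]; have t0 : 0 < t by lra.
  have := @is_deriveZ _ _ _ _ (z y) t 1 _ (is_derive_K (x - y) t0).
  rewrite /GRing.scale /= mulrC; congr is_derive.
  by apply/funext => u; rewrite /= mulrC.
- exact/intgZ/intg_norm.
- move=> t y /andP[t1 t2]; have t0 : 0 < t by lra.
  rewrite normrM ler_wpM2r//; apply: le_trans (dK_le _ t0) _.
  have C0 : 0 <= CK.
    by rewrite mulr_ge0 ?invr_ge0 ?(ltW mass0_gt0)// addr_ge0 ?mulr_ge0// ?addr_ge0 ?mulr_ge0//; lra.
  rewrite ler_wpM2l// lerXn2r ?nnegrE ?invr_ge0//; try lra.
  by rewrite lef_pV2 ?posrE//; lra.
Qed.

(* Rescaling the kernel is a diffusion: d/ds K_s = Laplacian of Q_s, so convolution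
   with K_s of a function with Laplacian bounded below is almost nondecreasing in s. *)
Lemma convK_mono z x s r (A : R) : intg leb z -> 0 < s -> s <= r ->
  (forall t, s <= t <= r -> - (A * t / 2) <= I (fun y => laplacian (Q t) (x - y) * z y)) ->
  conv (K s) z x + A * s ^+ 2 / 4 <= conv (K r) z x + A * r ^+ 2 / 4.
Proof.
move=> iz s0 sr H.
pose F (t : R) := conv (K t) z x + A / 4 * (t * t).
have dF (t : R) : 0 < t -> is_derive t (1 : R) F (I (fun y => dK t (x - y) * z y) + A / 4 * (t + t)).
  move=> t0; apply: is_deriveD; first exact: is_derive_convK.
  have := @is_deriveZ _ _ _ _ (A / 4) t 1 _ (@is_deriveM _ _ id id t 1 _ _ (is_derive_id t 1) (is_derive_id t 1)).
  by congr is_derive; rewrite /GRing.scale /= mulr1.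
have dFi t : t \in `]s, r[ -> is_derive t (1 : R) F (I (fun y => dK t (x - y) * z y) + A / 4 * (t + t)).
  by rewrite in_itv /= => /andP[st _]; apply: dF; lra.
have cF : {within `[s, r], continuous F}.
  apply: derivable_within_continuous => t; rewrite in_itv /= => /andP[st _].
  by have [] := dF t (lt_le_trans s0 st).
have [c] := @MVT_segment R F _ s r sr dFi cF.
rewrite in_itv /= => /andP[sc cr] E.
have c0 : 0 < c by lra.
have := H c; rewrite sc cr => /(_ isT).
have -> : I (fun y => laplacian (Q c) (x - y) * z y) = I (fun y => dK c (x - y) * z y).
  by congr Rintegral; apply/funext => y; rewrite laplacian_Q// gt_eqF.
move=> Hc; have : 0 <= F r - F s.
  by rewrite E mulr_ge0; lra.
have AE (t : R) : A * t ^+ 2 / 4 = A / 4 * (t * t) by ring.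
by rewrite subr_ge0 !AE.
Qed.

End Kernel.

(** * Approximation of the identity in L^1 *)

Section Mollification.
Context {R : realType} {N : nat}.
Local Notation leb := (@lebesgue_rV R N).
Local Notation I f := (Rintegral leb setT f).
Implicit Types (x y c : 'rV[R]_N) (s r : R) (z f k : 'rV[R]_N -> R).

Lemma partial_even k dk i x : C1g k dk -> (forall y, k (- y) = k y) ->
  dk i (- x) = - dk i x.
Proof.
move=> [_ _ H] ke.
have L := (is_derive_line _ _ _ _).1 (H i (- x)).
have L2 := (is_derive_line _ _ _ _).1 (H i x).
have E : (fun t : R => k (t *: delta_mx 0 i + x)) =
    (fun t : R => k (t *: delta_mx 0 i + - x)) \o (fun t : R => - t).
  by apply/funext => t /=; rewrite -ke opprD scaleNr.
have L' : is_derive ((fun t : R => - t) 0) (1 : R) (fun t : R => k (t *: delta_mx 0 i + - x)) (dk i (- x)).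
  by rewrite oppr0.
have dN : is_derive (0 : R) (1 : R) (fun t : R => - t) (- 1) by exact: is_deriveNid.
have L3 := @is_derive1_comp R _ (fun t : R => - t) 0 _ _ L' dN.
rewrite -E in L3; have [_ <-] := L2; have [_ ->] := L3.
by rewrite mulrN1 opprK.
Qed.

Lemma dKN s x : dK s (- x) = dK s x.
Proof. by rewrite /dK !rbumpN nsqN. Qed.

Lemma laplacian_cont f : smooth f -> continuous (laplacian f).
Proof.
move=> sf; apply: cont_sum => i.
by have [_ H _] := smooth_C1 (smooth_partial i sf); exact: H.
Qed.

Lemma laplacian_csupp O f : smooth f -> csupp O f -> csupp O (laplacian f).
Proof.
move=> sf cf; have H i : csupp O (partial i (partial i f)).
  apply: (csupp_partial i (smooth_C1 (smooth_partial i sf))).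
  exact: csupp_partial (smooth_C1 sf) cf.
have [K [cK KO Kf]] := cf; exists K; split=> // x nKx.
rewrite /laplacian big1// => i _.
have oK : open (~` K) by apply: closed_openC; exact: compact_closed (@norm_hausdorff _ _) cK.
have cp : csupp (K : set 'rV[R]_N) f by exists K; split.
have := csupp_partial i (smooth_C1 (smooth_partial i sf)) (csupp_partial i (smooth_C1 sf) cp).
by move=> [K' [_ K'K K'0]]; apply: K'0 => /K'K.
Qed.

Lemma laplacian_int0 f : smooth f -> csupp setT f -> I (laplacian f) = 0.
Proof.
move=> sf cf.
have Cp i := smooth_C1 (smooth_partial i sf).
have sp i : csupp setT (partial i f) by exact: csupp_partial (smooth_C1 sf) cf.
have -> : laplacian f = fun x => \sum_i partial i (partial i f) x by [].
rewrite Rint_sum => [|i].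
  by rewrite big1// => i _; exact: C1_ibp (Cp i) (sp i).
by have [_ H _] := Cp i; exact: csupp_intg (H i) (csupp_partial i (Cp i) (sp i)).
Qed.

Lemma lapQ_int0 s : 0 < s -> I (dK s : 'rV[R]_N -> R) = 0.
Proof.
move=> s0; rewrite -(laplacian_int0 (@Q_smooth R N s) (off_csupp (Q_off s0))).
by congr Rintegral; apply/funext => x; rewrite laplacian_Q ?gt_eqF.
Qed.

Lemma dK_off s : 0 < s -> off s (dK s : 'rV[R]_N -> R).
Proof. by move=> s0 x sx; rewrite /dK !rbump0// !mulr0 subr0 mul0r mulr0 addr0 mulr0. Qed.

(** Instead of a change of variables: the derivative of the mass in s is the integral of a
    Laplacian, hence zero. [convK_mono] with A = 0 is applied at the origin to plus and minus the
    indicator of a large ball. *)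
Let K_mass_le s r : 0 < s -> s <= r -> I (K s : 'rV[R]_N -> R) = I (K r : 'rV[R]_N -> R).
Proof.
move=> s0 sr; pose b (x : 'rV[R]_N) : R := \1_(ball (0 : 'rV[R]_N) (r + 1)) x.
have ib : intg leb b by exact: indic_ball_intg.
have bE (f : 'rV[R]_N -> R) t : off t f -> t <= r -> forall c : R, (forall y, f (- y) = f y) ->
    I (fun y => f (0 - y) * (c * b y)) = I (fun y => f y * c).
  move=> f0 tr c fe; congr Rintegral; apply/funext => y; rewrite sub0r fe.
  have [yt|ty] := ltP `|y| t; last by rewrite f0// !mul0r.
  rewrite /b indicE mem_set ?mulr1// -ball_normE /= sub0r normrN.
  by rewrite (lt_trans yt)// (le_lt_trans tr)// ltrDl.
have M (c : R) : c * I (K s : 'rV[R]_N -> R) <= c * I (K r : 'rV[R]_N -> R).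
  have := @convK_mono R N (fun y => c * b y) 0 s r 0 (intgZ c ib) s0 sr.
  rewrite !mul0r !addr0 /conv (bE (K s) s (K_off s0) sr c (KN s)).
  rewrite (bE (K r) r (K_off (lt_le_trans s0 sr)) (lexx _) c (KN r)).
  have EZ t : 0 < t -> I (fun y => K t y * c) = c * I (K t : 'rV[R]_N -> R).
    move=> t0; rewrite -RintZ; last exact: K_intg.
    by congr Rintegral; apply/funext => y; rewrite mulrC.
  rewrite !EZ ?(lt_le_trans s0 sr)//; apply => t /andP[st tr].
  have t0 : 0 < t by exact: lt_le_trans st.
  have -> : I (fun y : 'rV[R]_N => laplacian (Q t) (0 - y) * (c * b y)) =
      I (fun y : 'rV[R]_N => dK t (0 - y) * (c * b y)).
    by congr Rintegral; apply/funext => y; rewrite laplacian_Q ?gt_eqF.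
  rewrite (bE (dK t) t (dK_off t0) tr c (dKN t)).
  have -> : I (fun y : 'rV[R]_N => dK t y * c) = c * I (dK t : 'rV[R]_N -> R).
    rewrite -RintZ; first by congr Rintegral; apply/funext => y; rewrite mulrC.
    apply: (intg_off (r := t)) (dK_off t0); first exact: dK_measurable.
    by move=> x; exact: dK_le.
  by rewrite lapQ_int0// !mul0r mulr0 oppr0.
apply/le_anti; have := M 1; rewrite !mul1r => ->.
by have := M (-1); rewrite !mulN1r lerN2.
Qed.

Lemma K_mass s : 0 < s -> I (K s : 'rV[R]_N -> R) = 1.
Proof.
move=> s0; have -> : I (K s : 'rV[R]_N -> R) = I (K 1 : 'rV[R]_N -> R).
  have [s1|s1] := leP s 1; first exact: K_mass_le.
  by apply/esym; apply: K_mass_le => //; exact: ltW.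
rewrite /K RintZ; last by under eq_fun do rewrite invr1 expr1n mul1r; exact: rbump_intg.
under eq_fun do rewrite invr1 expr1n mul1r.
by rewrite -/mass0 mulVf// gt_eqF// mass0_gt0.
Qed.

Lemma K_mass_shift s x : 0 < s -> I (fun y => K s (x - y)) = 1.
Proof.
move=> s0; have -> : (fun y : 'rV[R]_N => K s (x - y)) = fun y => K s (y + - x).
  by apply/funext => y; rewrite -KN opprB.
rewrite (Rint_shift (- x)); first exact: K_mass.
exact: continuous_measurable_rV (@K_cont R N s).
Qed.

Lemma K_intg_shift s x : 0 < s -> intg leb (fun y => K s (x - y)).
Proof.
move=> s0; have -> : (fun y : 'rV[R]_N => K s (x - y)) = fun y => K s (y + - x).
  by apply/funext => y; rewrite -KN opprB.
by apply: intg_shift; exact: K_intg.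
Qed.

Lemma convK_le z x s (C : R) : 0 < s -> intg leb z -> {ae leb, forall y, z y <= C} ->
  conv (K s) z x <= C.
Proof.
move=> s0 iz zC; rewrite -[leRHS]mulr1 -(K_mass_shift x s0) -RintZ; last exact: K_intg_shift.
apply: ae_Rint_le.
- exact: conv_intg_section (@K_cont R N s) (K_csuppT s0) iz _.
- exact/intgZ/K_intg_shift.
- by apply: filterS zC => y zy; rewrite mulrC ler_wpM2r// K_ge0.
Qed.

Lemma convK_norm_le z x s (C : R) : 0 < s -> intg leb z -> {ae leb, forall y, `|z y| <= C} ->
  `|conv (K s) z x| <= C.
Proof.
move=> s0 iz zC.
apply: le_trans (conv_norm x (@K_cont R N s) (K_csuppT s0) iz _) _; first by move=> y; exact: K_ge0.
by apply: convK_le => //; exact: intg_norm.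
Qed.

Lemma convK_unif f s x (d e : R) : 0 < s -> s <= d -> intg leb f ->
  (forall y, `|x - y| < d -> `|f x - f y| <= e) -> `|conv (K s) f x - f x| <= e.
Proof.
move=> s0 sd iF H.
have -> : f x = I (fun y => f x * K s (x - y)).
  by rewrite RintZ ?K_mass_shift ?mulr1//; exact: K_intg_shift.
have i1 := conv_intg_section (@K_cont R N s) (K_csuppT s0) iF x.
have i2 : intg leb (fun y => f x * K s (x - y)) by exact/intgZ/K_intg_shift.
rewrite /conv -RintB//; apply: le_trans (Rint_norm (intgB i1 i2)) _.
rewrite -[leRHS]mulr1 -(K_mass_shift x s0) -RintZ; last exact: K_intg_shift.
apply: Rint_le; first exact/intg_norm/intgB.
  exact/intgZ/K_intg_shift.
move=> y; rewrite (mulrC (f x)) -mulrBr normrM mulrC (ger0_norm (K_ge0 _ s0)).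
have [xy|dy] := ltP `|x - y| s; last by rewrite K_off// !mulr0.
by rewrite ler_wpM2r ?K_ge0// distrC H// (lt_le_trans xy).
Qed.

(** Approximation in L^1 by continuous functions of compact support is carried as a hypothesis: it
    holds by construction for Sobolev functions and their gradients, and mollification needs nothing
    more. *)
Definition appr z := [/\ intg leb z, exists r, off r z &
  forall e : R, 0 < e -> exists f, [/\ continuous f, csupp setT f &
    I (fun x => `|z x - f x|) < e]].

Lemma convK_intg z s : 0 < s -> intg leb z -> (exists r, off r z) -> intg leb (conv (K s) z).
Proof. by move=> s0 iz oz; exact: conv_intg (@K_cont R N s) (K_csuppT s0) iz oz. Qed.

Lemma convK_L1 z s : 0 < s -> intg leb z -> (exists r, off r z) ->
  I (fun x => `|conv (K s) z x|) <= I (fun x => `|z x|).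
Proof.
move=> s0 iz [r oz]; have on : exists r, off r (fun x => `|z x|).
  by exists r => x rx; rewrite oz// normr0.
have := Rint_conv (@K_cont R N s) (K_csuppT s0) (intg_norm iz) on (@KN R N s).
rewrite K_mass// mulr1 => <-; apply: Rint_le.
- by apply: intg_norm; apply: convK_intg => //; exists r.
- by apply: convK_intg => //; exact: intg_norm.
- by move=> x; apply: conv_norm (@K_cont R N s) (K_csuppT s0) iz _ => y; exact: K_ge0.
Qed.

Lemma moll_L1 z : appr z -> forall e : R, 0 < e -> exists2 d : R, 0 < d &
  forall s, 0 < s < d -> I (fun x => `|conv (K s) z x - z x|) < e.
Proof.
move=> [iz [rz oz] az] e e0.
have e40 : 0 < e / 4 by rewrite divr_gt0.
have [f [cf sf zf]] := az _ e40.
have [r r0 orf] := csupp_off sf; have iF := csupp_intg cf sf.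
pose b (x : 'rV[R]_N) : R := \1_(ball (0 : 'rV[R]_N) (r + 2)) x.
have ib : intg leb b by exact: indic_ball_intg.
pose M := I b + 1; have M0 : 0 < M by rewrite ltr_wpDl// Rint_ge0.
have [d d0 dH] := csupp_uniform cf sf (divr_gt0 e40 M0).
exists (Num.min d 1); first by rewrite lt_min d0 ltr01.
move=> s /andP[s0]; rewrite lt_min => /andP[sd s1].
have cK := @K_cont R N s; have sK := K_csuppT (N := N) s0.
have izf := intgB iz iF.
have ozf : exists r, off r (fun x => z x - f x).
  exists (Num.max rz r) => x; rewrite ge_max => /andP[x1 x2].
  by rewrite oz// orf// subrr.
have i1 : intg leb (conv (K s) (fun x => z x - f x)) by exact: convK_intg.
have i2 : intg leb (conv (K s) f) by apply: convK_intg => //; exists r.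
have izc : intg leb (conv (K s) z) by apply: convK_intg => //; exists rz.
apply: (@le_lt_trans _ _ (I (fun x => `|conv (K s) (fun x => z x - f x) x|) +
   I (fun x => `|conv (K s) f x - f x|) + I (fun x => `|z x - f x|))).
  rewrite -RintD; [|exact: intg_norm|exact/intg_norm/intgB].
  rewrite -RintD; [|by apply: intgD; apply: intg_norm => //; exact: intgB|exact: intg_norm].
  apply: Rint_le; first exact/intg_norm/intgB.
    apply: intgD; last exact: intg_norm.
    by apply: intgD; apply: intg_norm => //; exact: intgB.
  move=> x; rewrite convB//.
  have -> : conv (K s) z x - z x = (conv (K s) z x - conv (K s) f x) +
     (conv (K s) f x - f x) - (z x - f x) by ring.
  by rewrite (le_trans (ler_normB _ _))// lerD2r ler_normD.
have L1 := convK_L1 s0 izf ozf.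
have L2 : I (fun x => `|conv (K s) f x - f x|) <= e / 4.
  apply: (@le_trans _ _ (I (fun x => e / 4 / M * b x))).
    apply: Rint_le; first exact/intg_norm/intgB.
      exact: intgZ.
    move=> x; have [xr|rx] := ltP `|x| (r + s).
      rewrite /b indicE mem_set; last by rewrite -ball_normE /= sub0r normrN; lra.
      rewrite mulr1; apply: (@convK_unif _ _ _ d) => //; first exact: ltW.
      by move=> y xy; rewrite ltW// dH.
    rewrite (conv_off orf (K_off s0) rx) orf; last lra.
    rewrite subrr normr0 mulr_ge0// divr_ge0 ?ltW//.
  rewrite RintZ// mulrAC ler_pdivrMr// ler_pM2l// /M; lra.
have := le_trans L1 (ltW zf); lra.
Qed.

End Mollification.

Section Dominated_L1.
Context d (T : measurableType d) (R : realType) (mu : {measure set T -> \bar R}).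
Local Notation I f := (Rintegral mu setT f).

(** G is split at height n: below n the smallness of h in L^1 suffices, above n its bound C does,
    because that part of G has small integral. It spares the extraction of subsequences converging
    almost everywhere. *)
Lemma bounded_L1_weight (G : T -> R) (C : R) : intg mu G -> forall e : R, 0 < e ->
  exists2 d : R, 0 < d & forall h : T -> R, intg mu h -> (forall x, `|h x| <= C) ->
    I (fun x => `|h x|) < d -> I (fun x => `|h x * G x|) < e.
Proof.
move=> iG e e0; have mG := intg_measurable iG.
pose C1 := `|C| + 1; have C10 : 0 < C1 by rewrite ltr_wpDl.
pose F n (x : T) : R := if n%:R < `|G x| then `|G x| else 0.
have mF n : measurable_fun setT (F n).
  apply: measurable_fun_ifT => //; last by apply: measurableT_comp.
  by apply: measurable_fun_ltr => //; apply: measurableT_comp.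
have Fl n x : `|F n x| <= `|G x| by rewrite /F; case: ifP => _; rewrite ?normr0 ?normr_id.
have F0 : {ae mu, forall x, F n x @[n --> \oo] --> (0 : R)}.
  apply: aeW => x; apply/cvgrPdist_lt => /= t t0; near=> n.
  rewrite /F ifF ?subrr ?normr0//; apply/negbTE; rewrite -leNgt.
  near: n; exists (Num.bound `|G x|) => // n /= nb.
  by rewrite (le_trans (ltW (archi_boundP (normr_ge0 _))))// ler_nat.
have [_ cF] := Rint_dct mF (@measurable_cst _ _ _ _ _ (0 : R)) (intg_norm iG) F0 (fun n => aeW _ (Fl n)).
have iF n : intg mu (F n) by exact: intg_le (mF n) (Fl n) (intg_norm iG).
have e20 : 0 < e / 2 / C1 by rewrite !divr_gt0.
move/cvgrPdist_lt : cF => /(_ _ e20) [n _ /(_ n (leqnn n))].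
rewrite Rint0 sub0r normrN => /(le_lt_trans (ler_norm _)) Fn.
exists (e / 2 / (n%:R + 1)); first by rewrite !divr_gt0// ltr_wpDl.
move=> h ih hC hd.
have mh := intg_measurable ih.
have ihG : intg mu (fun x => h x * G x) by exact: intgMb mh hC iG.
apply: (@le_lt_trans _ _ (I (fun x => n%:R * `|h x| + C1 * F n x))).
  apply: Rint_le; first exact: intg_norm.
    by apply: intgD; apply: intgZ => //; exact: intg_norm.
  move=> x; rewrite normrM /F; case: ltP => nG.
    rewrite -[leLHS]add0r lerD ?mulr_ge0// ler_wpM2r// (le_trans (hC x))//.
    by rewrite (le_trans (ler_norm _))// /C1 lerDl.
  by rewrite mulr0 addr0 mulrC ler_wpM2r.
rewrite RintD; [|exact/intgZ/intg_norm|exact: intgZ].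
rewrite !RintZ//; last exact: intg_norm.
have a1 : n%:R * I (fun x => `|h x|) <= e / 2.
  apply: (@le_trans _ _ ((n%:R + 1) * I (fun x => `|h x|))).
    by rewrite ler_wpM2r ?Rint_ge0// lerDl.
  by rewrite mulrC -ler_pdivlMr ?ltr_wpDl// ltW.
have a2 : C1 * I (F n) < e / 2 by rewrite mulrC -ltr_pdivlMr.
lra.
Unshelve. all: by end_near. Qed.

End Dominated_L1.

(** * Sobolev spaces *)

Section Square_integrable.
Context d (T : measurableType d) (R : realType) (mu : {measure set T -> \bar R}).
Local Notation I f := (Rintegral mu setT f).
Implicit Types (f g h z w : T -> R).

Definition L2 z := measurable_fun setT z /\ intg mu (fun x => z x ^+ 2).

Lemma L2M z w : L2 z -> L2 w -> intg mu (fun x => z x * w x).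
Proof.
move=> [mz iz] [mw iw]; apply: (intg_le (g := fun x => z x ^+ 2 + w x ^+ 2)).
- exact: measurable_funM.
- move=> x; rewrite ler_norml; have := sqr_ge0 (z x); have := sqr_ge0 (w x).
  have := sqr_ge0 (z x + w x); have := sqr_ge0 (z x - w x); rewrite [(z x + w x) ^+ 2]sqrrD [(z x - w x) ^+ 2]sqrrB => *.
  by apply/andP; split; lra.
- exact: intgD.
Qed.

Lemma L2D z w : L2 z -> L2 w -> L2 (fun x => z x + w x).
Proof.
move=> Lz Lw; have [mz iz] := Lz; have [mw iw] := Lw.
split; first exact: measurable_funD.
apply: (eq_intg (f := fun x => z x ^+ 2 + 2 * (z x * w x) + w x ^+ 2)) => [x|]; first by ring.
by apply: intgD => //; apply: intgD => //; apply: intgZ; exact: L2M.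
Qed.

Lemma L2Z (c : R) z : L2 z -> L2 (fun x => c * z x).
Proof.
move=> [mz iz]; split; first exact: measurable_funM.
by apply: (eq_intg (f := fun x => c ^+ 2 * z x ^+ 2)) => [x|]; [rewrite exprMn|exact: intgZ].
Qed.

Lemma L2B z w : L2 z -> L2 w -> L2 (fun x => z x - w x).
Proof.
move=> Lz /(L2Z (-1)) Lw; have := L2D Lz Lw; congr L2.
by apply/funext => x; rewrite mulN1r.
Qed.

Lemma L2_le z w : measurable_fun setT z -> (forall x, `|z x| <= `|w x|) -> L2 w -> L2 z.
Proof.
move=> mz zw [mw iw]; split=> //; apply: (intg_le (g := fun x => w x ^+ 2)) => //.
  by under eq_fun do rewrite expr2; exact: measurable_funM.
move=> x; rewrite ger0_norm ?sqr_ge0// -[z x ^+ 2]real_normK ?num_real//.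
by rewrite -[w x ^+ 2]real_normK ?num_real// lerXn2r ?nnegrE.
Qed.

Lemma L2_bounded z (C : R) w : measurable_fun setT w -> (forall x, `|w x| <= C) -> L2 z ->
  L2 (fun x => w x * z x).
Proof.
move=> mw wC Lz; have [mz _] := Lz; apply: (L2_le (w := fun x => C * z x)).
- exact: measurable_funM.
- by move=> x; rewrite !normrM ler_wpM2r// (le_trans (wC x))// ler_norm.
- exact: L2Z.
Qed.

Lemma young_norm (a b t : R) : 0 < t -> `|a * b| <= (a ^+ 2 / t + t * b ^+ 2) / 2.
Proof.
move=> t0; rewrite normrM -[a ^+ 2]real_normK ?num_real// -[b ^+ 2]real_normK ?num_real//.
set x := `|a|; set y := `|b|.
rewrite ler_pdivlMr//; have -> : x ^+ 2 / t + t * y ^+ 2 = (x ^+ 2 + (t * y) ^+ 2) / t.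
  by field; rewrite gt_eqF.
rewrite ler_pdivlMr//; have := sqr_ge0 (x - t * y); rewrite sqrrB; lra.
Qed.

Lemma L2_weight G : L2 G -> forall e : R, 0 < e -> exists2 d : R, 0 < d &
  forall h, L2 h -> I (fun x => h x ^+ 2) < d -> I (fun x => `|h x * G x|) < e.
Proof.
move=> LG e e0; have [mG iG] := LG.
pose M := I (fun x => G x ^+ 2) + 1.
have M0 : 0 < M by rewrite ltr_wpDl// Rint_ge0// => x; exact: sqr_ge0.
pose t := e / M; have t0 : 0 < t by rewrite divr_gt0.
exists (t * e); first by rewrite mulr_gt0.
move=> h Lh hd; have [mh ih] := Lh.
apply: (@le_lt_trans _ _ (I (fun x => (1 / 2 / t) * h x ^+ 2 + (t / 2) * G x ^+ 2))).
  apply: Rint_le; first exact/intg_norm/L2M.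
    by apply: intgD; exact: intgZ.
  move=> x; apply: le_trans (young_norm (h x) (G x) t0) _.
  by rewrite le_eqVlt; apply/orP; left; apply/eqP; field; rewrite gt_eqF.
rewrite RintD; [|exact: intgZ|exact: intgZ]; rewrite !RintZ//.
have a1 : 1 / 2 / t * I (fun x => h x ^+ 2) < e / 2.
  rewrite mulrC !mulrA mulr1 ltr_pdivrMr// mulrAC ltr_pdivrMr//; lra.
have a2 : t / 2 * I (fun x => G x ^+ 2) <= e / 2.
  rewrite /t; have -> : e / M / 2 * I (fun x => G x ^+ 2) = e / 2 * (I (fun x => G x ^+ 2) / M) by ring.
  rewrite ler_piMr ?divr_ge0 ?(ltW e0)// ler_pdivrMr// mul1r /M lerDl//.
lra.
Qed.

End Square_integrable.

(** * The classes W_0^{1,1} and W_0^{1,2} *)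

Section Sobolev_spaces.
Context {R : realType} {N : nat}.
Local Notation leb := (@lebesgue_rV R N).
Local Notation I f := (Rintegral leb setT f).
Local Notation L2 := (L2 leb).
Variables (O : set 'rV[R]_N) (r0 : R).
Hypotheses (oO : open O) (rO : forall x, O x -> `|x| < r0).
Implicit Types (x y c : 'rV[R]_N) (s r : R) (z f k : 'rV[R]_N -> R)
  (g : 'I_N -> 'rV[R]_N -> R).

Definition zo z := forall x, ~ O x -> z x = 0.

Lemma zo_off z : zo z -> off r0 z.
Proof. by move=> z0 x rx; apply: z0 => /rO; rewrite ltNge rx. Qed.

Lemma csupp_zo f : csupp O f -> zo f.
Proof. by move=> [K [cK KO Kf]] x nO; apply: Kf => /KO. Qed.

Definition C1c f := C1 f /\ csupp O f.

Lemma C1c_cont f : C1c f -> continuous f.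
Proof. by move=> [[]]. Qed.

Lemma C1c_pcont f i : C1c f -> continuous (partial i f).
Proof. by move=> [[_ H _] _]; exact: H. Qed.

Lemma C1c_pcsupp f i : C1c f -> csupp O (partial i f).
Proof. by move=> [Cf sf]; exact: csupp_partial Cf sf. Qed.

Lemma csuppT f : csupp O f -> csupp setT f.
Proof. exact: csuppS. Qed.

Lemma test_C1c f : test_function O f -> C1c f.
Proof. by move=> tf; split; [exact: smooth_C1 (test_smooth tf)|exact: test_csupp]. Qed.

Lemma ccs_L2 f : continuous f -> csupp O f -> L2 f.
Proof.
move=> cf sf; split; first exact: continuous_measurable_rV.
under eq_fun do rewrite expr2.
exact: csupp_intg (contM cf cf) (csuppM _ sf).
Qed.

Let bO x : R := \1_(ball (0 : 'rV[R]_N) r0) x.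
Let ib : intg leb bO. Proof. exact: indic_ball_intg. Qed.
Let b1 x : O x -> bO x = 1.
Proof. by move=> /rO xr; rewrite /bO indicE mem_set// -ball_normE /= sub0r normrN. Qed.
Let L2b : L2 bO.
Proof.
split; first exact: intg_measurable ib.
apply: eq_intg ib => x; rewrite /bO indicE; case: (_ \in _); rewrite ?expr0n ?expr1n//.
Qed.

Lemma L2_zo_intg z : zo z -> L2 z -> intg leb z.
Proof.
move=> z0 Lz; apply: eq_intg (L2M Lz L2b) => x.
by have [Ox|/z0 ->] := pselect (O x); rewrite ?mul0r// b1// mulr1.
Qed.

Lemma zo_bounded_intg z (C : R) : measurable_fun setT z -> (forall x, `|z x| <= C) -> zo z ->
  intg leb z.
Proof. by move=> mz zC /zo_off z0; exact: intg_off mz zC z0. Qed.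

Lemma zo_bounded_L2 z (C : R) : measurable_fun setT z -> (forall x, `|z x| <= C) -> zo z -> L2 z.
Proof.
move=> mz zC z0; split=> //; under eq_fun do rewrite expr2.
exact: intgMb mz zC (zo_bounded_intg mz zC z0).
Qed.

Lemma L2_L1 (e : R) : 0 < e -> exists2 d : R, 0 < d &
  forall h, L2 h -> zo h -> I (fun x => h x ^+ 2) < d -> I (fun x => `|h x|) < e.
Proof.
move=> e0; have [d d0 H] := L2_weight L2b e0; exists d => // h Lh h0 hd.
have := H h Lh hd; congr (_ < _); congr Rintegral; apply/funext => x.
by have [Ox|/h0 ->] := pselect (O x); rewrite ?mul0r// b1// mulr1.
Qed.

(* [S1 z g] and [S2 z g]: [z] belongs to W_0^{1,1}, resp. W_0^{1,2}, with weak
   gradient [g]; approximation by C^1 functions suffices by mollification. *)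
Definition S1 z g := [/\ intg leb z, forall i, intg leb (g i), zo z, forall i, zo (g i) &
  forall e : R, 0 < e -> exists f, [/\ C1c f, I (fun x => `|f x - z x|) < e &
    forall i, I (fun x => `|partial i f x - g i x|) < e]].

Definition S2 z g := [/\ L2 z, forall i, L2 (g i), zo z, forall i, zo (g i) &
  forall e : R, 0 < e -> exists f, [/\ C1c f, I (fun x => (f x - z x) ^+ 2) < e &
    forall i, I (fun x => (partial i f x - g i x) ^+ 2) < e]].

Lemma C1c_intg f : C1c f -> intg leb f.
Proof. by move=> Cf; exact: csupp_intg (C1c_cont Cf) (csuppT (proj2 Cf)). Qed.

Lemma C1c_pintg f i : C1c f -> intg leb (partial i f).
Proof. by move=> Cf; exact: csupp_intg (C1c_pcont Cf) (csuppT (C1c_pcsupp i Cf)). Qed.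

Lemma C1c_L2 f : C1c f -> L2 f.
Proof. by move=> Cf; exact: ccs_L2 (C1c_cont Cf) (proj2 Cf). Qed.

Lemma C1c_pL2 f i : C1c f -> L2 (partial i f).
Proof. by move=> Cf; exact: ccs_L2 (C1c_pcont Cf) (C1c_pcsupp i Cf). Qed.

Lemma zoB z w : zo z -> zo w -> zo (fun x => z x - w x).
Proof. by move=> z0 w0 x nO; rewrite z0// w0// subrr. Qed.

Lemma S2_S1 z g : S2 z g -> S1 z g.
Proof.
move=> [Lz Lg z0 g0 H]; split=> //.
- exact: L2_zo_intg.
- by move=> i; exact: L2_zo_intg.
move=> e e0; have [d d0 Hd] := L2_L1 e0; have [f [Cf fz fg]] := H d d0.
exists f; split=> //.
  by apply: Hd => //; [exact: L2B (C1c_L2 Cf) Lz|exact: zoB (csupp_zo (proj2 Cf)) z0].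
move=> i; apply: Hd => //; first exact: L2B (C1c_pL2 i Cf) (Lg i).
exact: zoB (csupp_zo (C1c_pcsupp i Cf)) (g0 i).
Qed.

Lemma C1c_S2 f : C1c f -> S2 f (fun i => partial i f).
Proof.
move=> Cf; split.
- exact: C1c_L2.
- by move=> i; exact: C1c_pL2.
- exact: csupp_zo (proj2 Cf).
- by move=> i; exact: csupp_zo (C1c_pcsupp i Cf).
move=> e e0; exists f; split=> // [|i].
  by under eq_Rintegral do rewrite subrr expr0n /=; rewrite Rint0.
by under eq_Rintegral do rewrite subrr expr0n /=; rewrite Rint0.
Qed.

Lemma S1_appr z g : S1 z g -> appr z /\ forall i, appr (g i).
Proof.
move=> [iz ig z0 g0 H]; split=> [|i]; split=> //.
- by exists r0; exact: zo_off.
- move=> e e0; have [f [Cf fz _]] := H e e0; exists f; split.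
  + exact: C1c_cont Cf.
  + exact: csuppT (proj2 Cf).
  + by under eq_fun do rewrite distrC.
- by exists r0; exact: zo_off.
- move=> e e0; have [f [Cf _ /(_ i) fg]] := H e e0; exists (partial i f); split.
  + exact: C1c_pcont Cf.
  + exact: csuppT (C1c_pcsupp i Cf).
  + by under eq_fun do rewrite distrC.
Qed.

Lemma S1_ae z z' g : S1 z g -> measurable_fun setT z' -> zo z' ->
  {ae leb, forall x, z x = z' x} -> S1 z' g.
Proof.
move=> [iz ig z0 g0 H] mz' z'0 zz'; have iz' := ae_intg mz' zz' iz; split=> //.
move=> e e0; have [f [Cf fz fg]] := H e e0; exists f; split=> //.
apply: le_lt_trans fz; apply: ae_Rint_le.
- by apply/intg_norm/intgB => //; exact: C1c_intg.
- by apply/intg_norm/intgB => //; exact: C1c_intg.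
- by apply: filterS zz' => x ->.
Qed.

Lemma S2_ae z z' g : S2 z g -> measurable_fun setT z' -> zo z' ->
  {ae leb, forall x, z x = z' x} -> S2 z' g.
Proof.
move=> [Lz Lg z0 g0 H] mz' z'0 zz'; have [mz iz] := Lz.
have Lz' : L2 z'.
  split=> //; apply: ae_intg iz; first by under eq_fun do rewrite expr2; exact: measurable_funM.
  by apply: filterS zz' => x ->.
split=> // e e0; have [f [Cf fz fg]] := H e e0; exists f; split=> //.
apply: le_lt_trans fz; apply: ae_Rint_le.
- by have [_] := L2B (C1c_L2 Cf) Lz'.
- by have [_] := L2B (C1c_L2 Cf) Lz.
- by apply: filterS zz' => x ->.
Qed.

Lemma C1cD f f' : C1c f -> C1c f' -> C1c (fun x => f x + f' x).
Proof. by move=> [Cf sf] [Cf' sf']; split; [exact: C1gW (C1gD Cf Cf')|exact: csuppD]. Qed.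

Lemma C1cZ (c : R) f : C1c f -> C1c (fun x => c * f x).
Proof. by move=> [Cf sf]; split; [exact: C1gW (C1gZ c Cf)|exact: csuppMr]. Qed.

Lemma S1D z g z' g' : S1 z g -> S1 z' g' ->
  S1 (fun x => z x + z' x) (fun i x => g i x + g' i x).
Proof.
move=> [iz ig z0 g0 H] [iz' ig' z'0 g'0 H']; split.
- exact: intgD.
- by move=> i; exact: intgD.
- by move=> x nO; rewrite z0// z'0// addr0.
- by move=> i x nO; rewrite g0// g'0// addr0.
move=> e e0; have e20 : 0 < e / 2 by rewrite divr_gt0.
have [f [Cf fz fg]] := H _ e20; have [f' [Cf' fz' fg']] := H' _ e20.
have key (a b c d : 'rV[R]_N -> R) : intg leb a -> intg leb b -> intg leb c -> intg leb d ->
    I (fun x => `|a x - c x|) < e / 2 -> I (fun x => `|b x - d x|) < e / 2 ->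
    I (fun x => `|a x + b x - (c x + d x)|) < e.
  move=> ia ib' ic id h1 h2.
  apply: (@le_lt_trans _ _ (I (fun x => `|a x - c x|) + I (fun x => `|b x - d x|))); last lra.
  rewrite -RintD; [|exact/intg_norm/intgB|exact/intg_norm/intgB].
  apply: Rint_le; first by apply/intg_norm/intgB; exact: intgD.
    by apply: intgD; exact/intg_norm/intgB.
  by move=> x; rewrite opprD addrACA ler_normD.
exists (fun x => f x + f' x); split; first exact: C1cD.
  by apply: key => //; exact: C1c_intg.
move=> i; rewrite (C1gE i (C1gD (proj1 Cf) (proj1 Cf'))).
by apply: key => //; exact: C1c_pintg.
Qed.

Lemma S1Z (c : R) z g : S1 z g -> S1 (fun x => c * z x) (fun i x => c * g i x).
Proof.
move=> [iz ig z0 g0 H]; split.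
- exact: intgZ.
- by move=> i; exact: intgZ.
- by move=> x nO; rewrite z0// mulr0.
- by move=> i x nO; rewrite g0// mulr0.
move=> e e0; have c0 : 0 < `|c| + 1 by rewrite ltr_wpDl.
have [f [Cf fz fg]] := H _ (divr_gt0 e0 c0).
have key (a b : 'rV[R]_N -> R) : intg leb a -> intg leb b ->
    I (fun x => `|a x - b x|) < e / (`|c| + 1) -> I (fun x => `|c * a x - c * b x|) < e.
  move=> ia ib' h.
  have -> : I (fun x => `|c * a x - c * b x|) = `|c| * I (fun x => `|a x - b x|).
    rewrite -RintZ; last exact/intg_norm/intgB.
    by congr Rintegral; apply/funext => x; rewrite -mulrBr normrM.
  move: h; rewrite ltr_pdivlMr// mulrDr mulr1 mulrC => h.
  by apply: le_lt_trans h; rewrite lerDl Rint_ge0.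
exists (fun x => c * f x); split; first exact: C1cZ.
  by apply: key => //; exact: C1c_intg.
move=> i; rewrite (C1gE i (C1gZ c (proj1 Cf))).
by apply: key => //; exact: C1c_pintg.
Qed.

Lemma S1B z g z' g' : S1 z g -> S1 z' g' ->
  S1 (fun x => z x - z' x) (fun i x => g i x - g' i x).
Proof.
move=> S /(S1Z (-1)) S'; have := S1D S S'; congr S1.
  by apply/funext => x; rewrite mulN1r.
by apply/funext => i; apply/funext => x; rewrite mulN1r.
Qed.

Lemma S2D z g z' g' : S2 z g -> S2 z' g' ->
  S2 (fun x => z x + z' x) (fun i x => g i x + g' i x).
Proof.
move=> [iz ig z0 g0 H] [iz' ig' z'0 g'0 H']; split.
- exact: L2D.
- by move=> i; exact: L2D.
- by move=> x nO; rewrite z0// z'0// addr0.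
- by move=> i x nO; rewrite g0// g'0// addr0.
move=> e e0; have e40 : 0 < e / 4 by rewrite divr_gt0.
have [f [Cf fz fg]] := H _ e40; have [f' [Cf' fz' fg']] := H' _ e40.
have key (a b c d : 'rV[R]_N -> R) : L2 a -> L2 b -> L2 c -> L2 d ->
    I (fun x => (a x - c x) ^+ 2) < e / 4 -> I (fun x => (b x - d x) ^+ 2) < e / 4 ->
    I (fun x => (a x + b x - (c x + d x)) ^+ 2) < e.
  move=> ia ib' ic id h1 h2.
  have [[_ iac] [_ ibd]] := (L2B ia ic, L2B ib' id).
  have [_ iabcd] := L2B (L2D ia ib') (L2D ic id).
  apply: (@le_lt_trans _ _ (2 * I (fun x => (a x - c x) ^+ 2) + 2 * I (fun x => (b x - d x) ^+ 2))); last lra.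
  rewrite -!RintZ// -RintD; [|exact: intgZ|exact: intgZ].
  apply: Rint_le => //; first by apply: intgD; exact: intgZ.
  move=> x; have := sqr_ge0 ((a x - c x) - (b x - d x)).
  have -> : a x + b x - (c x + d x) = (a x - c x) + (b x - d x) by ring.
  by rewrite sqrrB sqrrD => h; lra.
exists (fun x => f x + f' x); split; first exact: C1cD.
  by apply: key => //; exact: C1c_L2.
move=> i; rewrite (C1gE i (C1gD (proj1 Cf) (proj1 Cf'))).
by apply: key => //; exact: C1c_pL2.
Qed.

Lemma S2Z (c : R) z g : S2 z g -> S2 (fun x => c * z x) (fun i x => c * g i x).
Proof.
move=> [iz ig z0 g0 H]; split.
- exact: L2Z.
- by move=> i; exact: L2Z.
- by move=> x nO; rewrite z0// mulr0.
- by move=> i x nO; rewrite g0// mulr0.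
move=> e e0; have c0 : 0 < c ^+ 2 + 1 by rewrite ltr_wpDl// sqr_ge0.
have [f [Cf fz fg]] := H _ (divr_gt0 e0 c0).
have key (a b : 'rV[R]_N -> R) : L2 a -> L2 b ->
    I (fun x => (a x - b x) ^+ 2) < e / (c ^+ 2 + 1) -> I (fun x => (c * a x - c * b x) ^+ 2) < e.
  move=> ia ib' h; have [_ iab] := L2B ia ib'.
  have -> : I (fun x => (c * a x - c * b x) ^+ 2) = c ^+ 2 * I (fun x => (a x - b x) ^+ 2).
    by rewrite -RintZ//; congr Rintegral; apply/funext => x; rewrite -mulrBr exprMn.
  move: h; rewrite ltr_pdivlMr// mulrDr mulr1 mulrC => h.
  by apply: le_lt_trans h; rewrite lerDl Rint_ge0// => x; exact: sqr_ge0.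
exists (fun x => c * f x); split; first exact: C1cZ.
  by apply: key => //; exact: C1c_L2.
move=> i; rewrite (C1gE i (C1gZ c (proj1 Cf))).
by apply: key => //; exact: C1c_pL2.
Qed.

(** X need not vanish near the boundary of O: the boundary term is absent because z is a limit of
    functions with compact support in O, and this is how zero trace is used throughout. *)
Lemma S1_ibp z g (X : 'rV[R]_N -> R) (dX : 'I_N -> 'rV[R]_N -> R) (C : R) i :
  S1 z g -> C1g X dX -> (forall x, `|X x| <= C) -> (forall x, `|dX i x| <= C) ->
  I (fun x => z x * dX i x) = - I (fun x => g i x * X x).
Proof.
move=> [iz ig _ _ H] CX XC dXC; have [cX cdX _] := CX.
have mX := continuous_measurable_rV cX; have mdX := continuous_measurable_rV (cdX i).
have ibm (a h : 'rV[R]_N -> R) : intg leb a -> measurable_fun setT h -> (forall x, `|h x| <= C) ->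
    intg leb (fun x => a x * h x).
  move=> ia mh hC; apply: eq_intg (intgMb mh hC ia) => x; exact: mulrC.
apply/eqP; rewrite -subr_eq0 opprK -normr_le0; apply/ler_addgt0Pr => e e0; rewrite add0r.
have C10 : 0 < `|C| + 1 by rewrite ltr_wpDl.
have e20 : 0 < e / 2 / (`|C| + 1) by rewrite !divr_gt0.
have [f [Cf fz /(_ i) fg]] := H _ e20.
have E0 : I (fun x => f x * dX i x) + I (fun x => partial i f x * X x) = 0.
  rewrite -RintD; [|by apply: ibm => //; exact: C1c_intg|by apply: ibm => //; exact: C1c_pintg].
  have Cm := C1gM (proj1 Cf) CX.
  have := C1_ibp i Cm (csuppM X (csuppT (proj2 Cf))).
  by move=> <-; congr Rintegral; apply/funext => x; rewrite (mulrC (X x)).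
rewrite -(subr0 (_ + _)) -E0 opprD addrACA.
rewrite -RintB; [|exact: ibm|by apply: ibm => //; exact: C1c_intg].
rewrite -RintB; [|exact: ibm|by apply: ibm => //; exact: C1c_pintg].
have bnd (a a' h : 'rV[R]_N -> R) : intg leb a -> intg leb a' -> measurable_fun setT h ->
    (forall x, `|h x| <= C) -> I (fun x => `|a' x - a x|) < e / 2 / (`|C| + 1) ->
    `|I (fun x => a x * h x - a' x * h x)| <= e / 2.
  move=> ia ia' mh hC l.
  have i1 : intg leb (fun x => a x * h x - a' x * h x) by apply: intgB; exact: ibm.
  apply: le_trans (Rint_norm i1) _.
  apply: (@le_trans _ _ (I (fun x => (`|C| + 1) * `|a' x - a x|))).
    apply: Rint_le; first exact: intg_norm.
      exact/intgZ/intg_norm/intgB.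
    move=> x; rewrite -mulrBl normrM distrC mulrC ler_wpM2r// (le_trans (hC x))//.
    by rewrite (le_trans (ler_norm _))// lerDl.
  rewrite RintZ; last exact/intg_norm/intgB.
  by rewrite mulrC -ler_pdivlMr// ltW.
rewrite (le_trans (ler_normD _ _))// (splitr e) lerD//; apply: bnd => //.
  exact: C1c_intg.
exact: C1c_pintg.
Qed.

Lemma S1_laplacian z g f : S1 z g -> smooth f -> (forall i, exists C : R, forall x,
    `|partial i f x| <= C /\ `|partial i (partial i f) x| <= C) ->
  I (fun x => z x * laplacian f x) = - \sum_i I (fun x => g i x * partial i f x).
Proof.
move=> Sz sf H; have [iz _ _ _ _] := Sz.
have -> : (fun x => z x * laplacian f x) = fun x => \sum_i z x * partial i (partial i f) x.
  by apply/funext => x; rewrite mulr_sumr.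
rewrite Rint_sum => [|i].
  rewrite -sumrN; apply: eq_bigr => i _; have [C HC] := H i.
  apply: (S1_ibp (C := C) Sz (smooth_C1 (smooth_partial i sf))) => x; first by have [] := HC x.
  by have [] := HC x.
have [C HC] := H i; have [_ cp _] := smooth_C1 (smooth_partial i sf).
apply: eq_intg (intgMb (C := C) (continuous_measurable_rV (cp i)) _ iz) => [x|x]; first exact: mulrC.
by have [] := HC x.
Qed.

Lemma csupp_smooth_bound f i : smooth f -> csupp setT f -> exists C : R, forall x,
  `|partial i f x| <= C /\ `|partial i (partial i f) x| <= C.
Proof.
move=> sf cf; have C1f := smooth_C1 sf; have C2f := smooth_C1 (smooth_partial i sf).
have sp := csupp_partial i C1f cf; have spp := csupp_partial i C2f sp.
have [_ c1 _] := C1f; have [_ c2 _] := C2f.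
have [C C0 HC] := csupp_bounded (c1 i) sp; have [C' C'0 HC'] := csupp_bounded (c2 i) spp.
exists (C + C') => x; split.
  by rewrite (le_trans (HC x))// lerDl.
by rewrite (le_trans (HC' x))// lerDr.
Qed.

(** The kernel may cross the boundary: the zero extension of z has the zero extension of g as its
    gradient on the whole space. *)
Lemma conv_partial z g i s : S1 z g -> 0 < s ->
  conv (partial i (K s)) z = conv (K s) (g i).
Proof.
move=> Sz s0; apply/funext => x.
have CK := smooth_C1 (@K_smooth R N s).
have CKx := C1g_shift (- x) CK.
have sK := K_csuppT (N := N) s0; have [_ cK _] := CK.
have [C C0 HC] := csupp_bounded (@K_cont R N s) sK.
have [C' C'0 HC'] := csupp_bounded (cK i) (csupp_partial i CK sK).
have := @S1_ibp z g _ _ (C + C') i Sz CKx.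
move=> H.
have {H}E : I (fun y => z y * partial i (K s) (y - x)) = - I (fun y => g i y * K s (y - x)).
  apply: H.
  - by move=> y; rewrite (le_trans (HC _))// lerDl.
  - by move=> y; rewrite (le_trans (HC' _))// lerDr.
have {}E := congr1 (fun t => - t) E; rewrite opprK -RintN in E; last first.
  have [iz _ _ _ _] := Sz.
  apply: eq_intg (intgMb _ (fun y => HC' (y - x)) iz) => [y|]; first exact: mulrC.
  by apply: measurableT_comp; [exact: continuous_measurable_rV|exact: measurable_shift_rV].
transitivity (I (fun y => - (z y * partial i (K s) (y - x)))).
  rewrite /conv; congr Rintegral; apply/funext => y.
  rewrite -(opprB y x) (partial_even _ _ CK (@KN R N s)); ring.
rewrite E; congr Rintegral; apply/funext => y.
by rewrite -KN opprB mulrC.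
Qed.

Lemma convK_C1g z g s : S1 z g -> 0 < s -> C1g (conv (K s) z) (fun i => conv (K s) (g i)).
Proof.
move=> Sz s0; have [iz _ _ _ _] := Sz.
have := conv_C1g (smooth_C1 (@K_smooth R N s)) (K_csuppT s0) iz.
congr C1g; apply/funext => i; exact: conv_partial.
Qed.

Lemma C1c_test f : C1c f -> forall e : R, 0 < e -> exists f',
  [/\ test_function O f', forall x, `|f' x - f x| <= e,
      forall i x, `|partial i f' x - partial i f x| <= e &
      exists2 s : R, 0 < s & f' = conv (K s) f].
Proof.
move=> Cf e e0; have [Cf1 sf] := Cf; have [K0 [cK KO Kf]] := sf.
have [d d0 dH] := compact_open_dist cK oO KO.
have [d1 d10 H1] := csupp_uniform (C1c_cont Cf) sf e0.
have /choice [dp Hp] : forall i, exists d : R, 0 < d /\ forall x y, `|x - y| < d ->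
    `|partial i f x - partial i f y| < e.
  by move=> i; have [d2 ? ?] := csupp_uniform (C1c_pcont (i := i) Cf) (C1c_pcsupp i Cf) e0; exists d2.
pose dm := \big[Num.min/d1]_i dp i.
have dm0 : 0 < dm.
  by rewrite /dm; elim/big_ind: _ => // [x y x0 y0|i _]; [rewrite lt_min x0 y0|have [] := Hp i].
(* Below the distance from the support to the complement of O, so that the mollification keeps a
   compact support in O, and below a common modulus of continuity for f and its partial
   derivatives. *)
pose s := Num.min (d / 2) dm.
have s0 : 0 < s by rewrite lt_min dm0 divr_gt0.
have sd : s < d by rewrite /s (le_lt_trans (_ : _ <= d / 2)) ?ge_min ?lexx//; lra.
have sm : s <= dm by rewrite ge_min lexx orbT.
have Sf := S2_S1 (C1c_S2 Cf); have iF := C1c_intg Cf.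
exists (conv (K s) f); split.
- apply: csupp_test; first exact: conv_smooth (@K_smooth R N s) (K_csuppT s0) iF.
  have cc := conv_continuous (@K_cont R N s) (K_csuppT s0) iF.
  pose L := [set x : 'rV[R]_N | exists2 y, K0 y & `|x - y| <= s].
  have [r r00 oc] : exists2 r, 0 < r & off r (conv (K s) f).
    have [r r00 rf] := csupp_off sf; exists (r + s); first by rewrite addr_gt0.
    exact: conv_off rf (K_off s0).
  have LO : closure L `<=` O.
    move=> x clx; have [y [[k Kk yk] xy]] : L `&` ball x (d - s) !=set0.
      by apply: clx; apply: nbhsx_ballx; rewrite subr_gt0.
    apply: (dH k Kk); rewrite -ball_normE /=.
    rewrite (_ : k - x = - (y - k) - (x - y)); last by rewrite !opprB addrA subrK.
    move: xy; rewrite -ball_normE /= => xy.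
    by rewrite (le_lt_trans (ler_normB _ _))// normrN; lra.
  exists (closure L); split=> //.
    have bL : closure L `<=` [set x : 'rV[R]_N | `|x - 0| <= r0].
      by move=> x /LO /rO /ltW /=; rewrite subr0.
    have bc := @closed_ball_compact R N 0 r0.
    by apply: subclosed_compact bc bL; exact: closed_closure.
  move=> x nL; rewrite -[RHS](Rint0 leb); congr Rintegral; apply/funext => y.
  have [Ky|/Kf ->] := pselect (K0 y); last by rewrite mulr0.
  rewrite K_off ?mul0r// leNgt; apply/negP => xy; apply: nL; apply: subset_closure.
  by exists y => //; exact: ltW.
- move=> x; apply: (@convK_unif _ _ _ _ _ d1) => //.
    by rewrite (le_trans sm)// /dm bigmin_le_id.
  by move=> y xy; rewrite ltW// H1.
- move=> i x; rewrite (C1gE i (convK_C1g Sf s0)).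
  apply: (@convK_unif _ _ _ _ _ (dp i)) => //.
  - by rewrite (le_trans sm)// /dm bigmin_le.
  - exact: C1c_pintg.
  - by move=> y xy; have [_ H] := Hp i; rewrite ltW// H.
- by exists s.
Qed.

End Sobolev_spaces.

(** * Almost everywhere limits of rapidly Cauchy sequences *)

Section Fast_Cauchy.
Context d (T : measurableType d) (R : realType) (mu : {measure set T -> \bar R}).
Local Notation I f := (Rintegral mu setT f).

Lemma sum_half n : \sum_(0 <= k < n) (2^-1 : R) ^+ k <= 2.
Proof.
suff -> : \sum_(0 <= k < n) (2^-1 : R) ^+ k = 2 - 2 * 2^-1 ^+ n.
  by rewrite gerBl mulr_ge0// exprn_ge0.
elim: n => [|n ih]; first by rewrite big_geq// expr0; lra.
by rewrite big_nat_recr//= ih exprS; field.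
Qed.

(** The argument of Riesz and Fischer: the increments have a summable integral, so the sequence
    converges almost everywhere. The limit is taken as an upper limit, which is measurable and
    vanishes wherever all the F n do. *)
Lemma fast_cauchy (F : nat -> T -> R) (c : R) : (forall n, intg mu (F n)) ->
  (forall n, I (fun x => `|F n.+1 x - F n x|) <= c * 2^-1 ^+ n) ->
  exists G : T -> R, [/\ measurable_fun setT G,
    {ae mu, forall x, F n x @[n --> \oo] --> G x} &
    forall x, (forall n, F n x = 0) -> G x = 0].
Proof.
move=> iF HF; have mF n := intg_measurable (iF n).
have ih n : intg mu (fun x => `|F n.+1 x - F n x|) by exact/intg_norm/intgB.
pose h n x := `|F n.+1 x - F n x|.
have mh n : measurable_fun setT (EFin \o h n) by apply/measurable_EFinP; exact: intg_measurable (ih n).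
have hh0 n x : 0 <= h n x by exact: normr_ge0.
pose hs x := (\sum_(0 <= n <oo) (h n x)%:E)%E.
have mhs : measurable_fun setT hs.
  have := @ge0_emeasurable_sum _ _ R setT (fun n x => (h n x)%:E) xpredT.
  by apply=> [k x _ _|k _]; [rewrite lee_fin hh0|exact: mh].
have hs0 x : (0 <= hs x)%E by apply: nneseries_ge0 => n _ _; rewrite lee_fin hh0.
have c0 : 0 <= c.
  by have := HF 0%N; rewrite expr0 mulr1; apply: le_trans; exact: Rint_ge0.
have ihs : mu.-integrable setT hs.
  apply/integrableP; split=> //.
  have -> : (\int[mu]_x `|hs x|)%E = (\int[mu]_x hs x)%E.
    by apply: eq_integral => x _; rewrite gee0_abs.
  rewrite (integral_nneseries mu measurableT mh) => [|n x _]; last by rewrite lee_fin hh0.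
  apply: (@le_lt_trans _ _ (c * 2)%:E); last exact: ltry.
  apply: lime_le.
    by apply: is_cvg_nneseries => n _ _; apply: integral_ge0 => x _; rewrite lee_fin hh0.
  apply: nearW => n; have -> : (\sum_(0 <= k < n) \int[mu]_x (h k x)%:E)%E =
      (\sum_(0 <= k < n) I (h k))%:E.
    by rewrite -sumEFin; apply: eq_bigr => k _; exact/esym/(EFin_Rint (ih k)).
  rewrite lee_fin; apply: (@le_trans _ _ (\sum_(0 <= k < n) c * 2^-1 ^+ k)).
    by apply: ler_sum => k _; exact: HF.
  by rewrite -mulr_sumr ler_wpM2l// sum_half.
exists (fun x => fine (limn_esup (fun n => (F n x)%:E))); split.
- apply: measurableT_comp => //; apply: measurable_fun_limn_esup => n.
  exact/measurable_EFinP.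
- have fs := integrable_ae measurableT ihs.
  apply: filterS fs => x /(_ Logic.I) fx.
  have nc : cvgn [normed series (telescope (fun n => F n x))].
    apply: nondecreasing_is_cvgn; first by apply: nondecreasing_series => *; exact: normr_ge0.
    exists (fine (hs x)) => _ [n _ <-]; rewrite -lee_fin fineK//.
    rewrite /series /= -sumEFin.
    by apply: (@nneseries_lim_ge _ (fun n => (h n x)%:E) xpredT) => k _ _; rewrite lee_fin hh0.
  have := normed_cvg nc; rewrite telescopeK => cF.
  have {cF} cF : cvgn (fun n => F n x).
    have /cvg_ex[/= l cl] := cF; apply: (@cvgP _ _ (l + F 0%N x)).
    have -> : (fun n => F n x) = fun n => (F n x - F 0%N x) + F 0%N x.
      by apply/funext => n; rewrite subrK.
    by apply: cvgD cl _; exact: cvg_cst.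
  have cE : (F n x)%:E @[n --> \oo] --> (limn (fun n => F n x))%:E.
    by apply: cvg_EFin => //; exact: nearW.
  rewrite is_cvg_limn_esupE; last exact: cvgP cE.
  by rewrite (cvg_lim _ cE).
move=> x F0; have -> : (fun n => (F n x)%:E) = fun=> 0%E by apply/funext => n; rewrite F0.
have c0E : (fun=> 0%E : \bar R) n @[n --> \oo] --> (0%E : \bar R) by exact: cvg_cst.
by rewrite is_cvg_limn_esupE; [rewrite (cvg_lim _ c0E)|exact: cvgP c0E].
Qed.

End Fast_Cauchy.

(** * Chain rule, products and closedness *)

Section Chain_rule.
Context {R : realType} {N : nat}.
Local Notation leb := (@lebesgue_rV R N).
Local Notation I f := (Rintegral leb setT f).
Local Notation L2 := (L2 leb).
Implicit Types (z f : 'rV[R]_N -> R) (g : 'I_N -> 'rV[R]_N -> R) (Ps dPs : R -> R).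

(** Truncations with a bounded Lipschitz derivative, for which the chain rule survives limits in L^1
    and L^2. Differentiability everywhere excludes the positive part, whose role is taken by
    [Theta], and that of the indicator by [Psi]. *)
Definition adm Ps dPs (L : R) := [/\ Ps 0 = 0, forall t : R, is_derive t (1 : R) Ps (dPs t),
  forall t, `|dPs t| <= L & forall s t, `|dPs s - dPs t| <= L * `|s - t|].

Lemma derive_lip Ps dPs (L : R) : (forall t : R, is_derive t (1 : R) Ps (dPs t)) ->
  (forall t, `|dPs t| <= L) -> forall s t, `|Ps s - Ps t| <= L * `|s - t|.
Proof.
move=> dP bP; have cP : continuous Ps.
  move=> t; apply: differentiable_continuous; apply/derivable1_diffP.
  by have [] := dP t.
suff H s t : s <= t -> `|Ps t - Ps s| <= L * `|t - s|.
  by move=> s t; have [/H|/ltW/H//] := leP s t; rewrite distrC [`|s - t|]distrC.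
move=> st; have [c _ ->] := @MVT_segment R Ps dPs s t st (fun x _ => dP x) (continuous_subspaceT cP).
by rewrite normrM ler_wpM2r.
Qed.

Lemma lip_continuous Ps (L : R) : (forall s t, `|Ps s - Ps t| <= L * `|s - t|) -> continuous Ps.
Proof.
move=> H t; apply/cvgrPdist_lt => e e0.
have L0 : 0 < `|L| + 1 by rewrite ltr_wpDl.
exists (e / (`|L| + 1)) => /=; first exact: divr_gt0.
move=> s /= ts; apply: (le_lt_trans (H t s)).
apply: (@le_lt_trans _ _ ((`|L| + 1) * `|t - s|)).
  by rewrite ler_wpM2r// (le_trans (ler_norm _))// lerDl.
by rewrite mulrC -ltr_pdivlMr.
Qed.

Lemma adm_lip Ps dPs L : adm Ps dPs L -> forall s t, `|Ps s - Ps t| <= L * `|s - t|.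
Proof. by move=> [_ dP bP _]; exact: derive_lip dP bP. Qed.

Lemma adm_le Ps dPs L t : adm Ps dPs L -> `|Ps t| <= L * `|t|.
Proof. by move=> aP; have := adm_lip aP t 0; have [-> _ _ _] := aP; rewrite !subr0. Qed.

Lemma adm_L0 Ps dPs L : adm Ps dPs L -> 0 <= L.
Proof. by move=> [_ _ /(_ 0) H _]; exact: le_trans H. Qed.

Lemma adm_cont Ps dPs L : adm Ps dPs L -> continuous Ps.
Proof. by move=> /adm_lip; exact: lip_continuous. Qed.

Lemma adm_dcont Ps dPs L : adm Ps dPs L -> continuous dPs.
Proof. by move=> [_ _ _]; exact: lip_continuous. Qed.

Lemma adm_id : adm id (fun=> 1) 1.
Proof.
split=> [//|t|t|s t]; first exact: is_derive_id.
  by rewrite normr1.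
by rewrite subrr normr0 mul1r.
Qed.

Lemma admD P1 dP1 L1 P2 dP2 L2 : adm P1 dP1 L1 -> adm P2 dP2 L2 ->
  adm (fun t => P1 t + P2 t) (fun t => dP1 t + dP2 t) (L1 + L2).
Proof.
move=> [a0 a1 a2 a3] [b0 b1 b2 b3]; split.
- by rewrite a0 b0 addr0.
- move=> t; exact: (is_deriveD (a1 t) (b1 t)).
- by move=> t; rewrite (le_trans (ler_normD _ _))// lerD.
- by move=> s t; rewrite opprD addrACA (le_trans (ler_normD _ _))// mulrDl lerD.
Qed.

Lemma admZ (a : R) Ps dPs L : adm Ps dPs L ->
  adm (fun t => a * Ps t) (fun t => a * dPs t) (`|a| * L).
Proof.
move=> [a0 a1 a2 a3]; split.
- by rewrite a0 mulr0.
- move=> t; have := is_deriveZ a (a1 t); congr is_derive.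
- by move=> t; rewrite normrM ler_wpM2l.
- by move=> s t; rewrite -mulrBr normrM -mulrA ler_wpM2l.
Qed.

Lemma adm_aff (a b : R) Ps dPs L : Ps b = 0 -> adm Ps dPs L ->
  adm (fun t => Ps (a * t + b)) (fun t => a * dPs (a * t + b)) (L * (`|a| + `|a| ^+ 2)).
Proof.
move=> Pb aP; have L0 := adm_L0 aP; have [a0 a1 a2 a3] := aP; split.
- by rewrite mulr0 add0r.
- move=> t; have d1 : is_derive t (1 : R) (fun t => a * t + b) (a * 1 + 0).
    exact: (is_deriveD (is_deriveZ a (is_derive_id t (1 : R))) (is_derive_cst b t 1)).
  have := @is_derive1_comp R Ps (fun t => a * t + b) t _ _ (a1 _) d1.
  by congr is_derive; rewrite addr0 mulr1 mulrC.
- move=> t; rewrite normrM mulrC [leRHS]mulrDr ler_wpDr ?mulr_ge0 ?exprn_ge0//.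
  by rewrite ler_wpM2r.
- move=> s t; rewrite -mulrBr normrM.
  apply: (@le_trans _ _ (`|a| * (L * `|a * s + b - (a * t + b)|))); first by rewrite ler_wpM2l.
  have -> : a * s + b - (a * t + b) = a * (s - t) by ring.
  rewrite normrM !mulrA; apply: ler_wpM2r; first exact: normr_ge0.
  by rewrite mulrDr expr2 !mulrA (mulrC L) lerDr mulr_ge0// mulr_ge0.
Qed.

Lemma dPsi_lip (s t : R) : `|dPsi s - dPsi t| <= 8 * `|s - t|.
Proof.
have sq1 (a : R) : 0 < 1 + a ^+ 2 by rewrite ltr_pwDl// sqr_ge0.
pose r (a : R) := 2 * a / (1 + a ^+ 2) ^+ 2.
pose dr (a : R) := (2 - 6 * a ^+ 2) / (1 + a ^+ 2) ^+ 3.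
have r1 a : is_derive a (1 : R) r (dr a).
  have n0 : (1 + a ^+ 2) ^+ 2 != 0 by rewrite expf_neq0// gt_eqF.
  have dd := @is_deriveM _ _ id id a 1 _ _ (is_derive_id a 1) (is_derive_id a 1).
  have d1 : is_derive a (1 : R) (fun s => 1 + s ^+ 2) (0 + (a * 1 + a * 1)).
    by have := is_deriveD (is_derive_cst (1 : R) a 1) dd; congr is_derive.
  have d2 : is_derive a (1 : R) (fun s => (1 + s ^+ 2) ^+ 2) (4 * a * (1 + a ^+ 2)).
    have := @is_deriveM _ _ _ _ a 1 _ _ d1 d1; congr is_derive.
    by rewrite /GRing.scale /=; ring.
  have d3 := @is_deriveV R _ a _ _ n0 d2.
  have d4 : is_derive a (1 : R) (fun s => 2 * s) 2.
    by have := is_deriveZ (2 : R) (is_derive_id a (1 : R)); congr is_derive; rewrite /GRing.scale /= mulr1.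
  have := @is_deriveM _ _ _ _ a 1 _ _ d4 d3.
  congr is_derive; rewrite /dr /GRing.scale /=; field.
  by rewrite !gt_eqF.
have r2 a : `|dr a| <= 8.
  rewrite /dr normrM normfV ler_pdivrMr ?normr_gt0 ?expf_neq0 ?gt_eqF//.
  rewrite (@ger0_norm _ ((1 + a ^+ 2) ^+ 3)) ?ler_norml; last by rewrite exprn_ge0// ltW.
  have := sqr_ge0 a; set q := a ^+ 2 => q0; rewrite !exprS expr0 mulr1.
  by apply/andP; split; nra.
have H := derive_lip r1 r2; rewrite /dPsi.
apply: (le_trans (H (Num.max s 0) (Num.max t 0))).
rewrite ler_wpM2l// /Num.max; do 2 case: ifPn; rewrite -?leNgt => a b.
- by rewrite subrr normr0.
- by rewrite sub0r normrN ger0_norm// ltr0_norm ?subr_lt0; lra.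
- by rewrite subr0 ger0_norm// ger0_norm; lra.
- by [].
Qed.

Lemma adm_Psi : adm (@Psi R) (@dPsi R) 8.
Proof.
split; [exact: Psi0|exact: is_derive_Psi| |exact: dPsi_lip].
by move=> t; rewrite (le_trans (dPsi_norm t))// ler1n.
Qed.

Lemma adm_Theta : adm (@Theta R) (@Psi R) 1.
Proof.
split; [exact: Theta0|exact: is_derive_Theta|exact: Psi_norm|].
by move=> s t; rewrite mul1r; exact: Psi_lip.
Qed.

(** T t = t - Theta (t - 1) + Theta (- t - 1). The corrections vanish on [-1, 1]; beyond it
    [Theta_gap] leaves at most 1 + 2 = 3. *)
Lemma truncation : exists T dT L, [/\ adm T dT L, forall t, `|T t| <= 3 &
  forall t, `|t| <= 1 -> T t = t /\ dT t = 1].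
Proof.
have aT := adm_Theta.
have a1 : adm (fun t => Theta (1 * t + -1)) _ _ := adm_aff 1 (Theta0 (lerN10 R)) aT.
have a2 : adm (fun t => Theta (-1 * t + -1)) _ _ := adm_aff (-1) (Theta0 (lerN10 R)) aT.
have a := admD (admD adm_id (admZ (-1) a1)) a2.
eexists _, _, _; split; first exact: a.
- move=> t /=; rewrite mul1r !mulN1r.
  have [t1|t1] := leP 1 t.
    rewrite (@Theta0 _ (- t - 1)); last lra.
    have t10 : 0 <= t - 1 by lra.
    have := Theta_le t10; have := Theta_gap t10; have := Theta_ge0 (t - 1) => h1 h2 h3.
    by rewrite ger0_norm; lra.
  rewrite (@Theta0 _ (t - 1)); last lra.
  have [t2|t2] := leP (- 1) t.
    by rewrite (@Theta0 _ (- t - 1)) ?ler_norml; lra.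
  have t10 : 0 <= - t - 1 by lra.
  have := Theta_le t10; have := Theta_gap t10; have := Theta_ge0 (- t - 1) => h1 h2 h3.
  by rewrite ler0_norm; lra.
move=> t; rewrite ler_norml => /andP[t1 t2] /=; rewrite mul1r !mulN1r.
have t3 : t - 1 <= 0 by lra.
have t4 : - t - 1 <= 0 by lra.
by rewrite !(Theta0 t3) !(Theta0 t4) !(Psi0 t3) !(Psi0 t4); split; lra.
Qed.

Lemma fin_small (P : 'I_N -> R -> Prop) : (forall i, exists2 d, 0 < d & P i d) ->
  (forall i d d', 0 < d' -> d' <= d -> P i d -> P i d') -> exists2 d, 0 < d & forall i, P i d.
Proof.
move=> H mP; have /choice[dp Hp] : forall i, exists d, 0 < d /\ P i d.
  by move=> i; have [d d0 Pd] := H i; exists d.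
have d0 : 0 < \big[Num.min/(1 : R)]_i dp i.
  by elim/big_ind: _ => // [x y x0 y0|i _]; [rewrite lt_min x0 y0|have [] := Hp i].
exists (\big[Num.min/(1 : R)]_i dp i) => // i; have [_ Pi] := Hp i.
by apply: mP Pi => //; exact: bigmin_le.
Qed.

Variables (O : set 'rV[R]_N) (r0 : R).
Hypotheses (oO : open O) (rO : forall x, O x -> `|x| < r0).
Local Notation S1 := (S1 O).
Local Notation S2 := (S2 O).

Lemma C1c_adm Ps dPs L f : adm Ps dPs L -> C1c O f ->
  C1c O (fun x => Ps (f x)) /\ forall i, partial i (fun x => Ps (f x)) = fun x => dPs (f x) * partial i f x.
Proof.
move=> aP [Cf sf]; have [P0 dP _ _] := aP.
have C := C1g_comp (adm_dcont aP) dP Cf; split=> [|i]; last by rewrite (C1gE i C).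
by split; [exact: C1gW C|exact: csupp_comp].
Qed.

(** The gradient error splits into dPs (f) (partial f - g), small in L^1, and (dPs (f) - dPs (z)) g,
    where a bounded factor small in L^1 meets the fixed weight g, as in [bounded_L1_weight]. *)
Lemma S1_chain Ps dPs L z g : adm Ps dPs L -> S1 z g ->
  S1 (fun x => Ps (z x)) (fun i x => dPs (z x) * g i x).
Proof.
move=> aP Sz; have [iz ig z0 g0 H] := Sz; have [P0 dP bP lP] := aP; have L0 := adm_L0 aP.
have mz := intg_measurable iz.
have mPz : measurable_fun setT (fun x => Ps (z x)).
  by apply: measurableT_comp mz; exact: continuous_measurable_fun (adm_cont aP).
have mdPz : measurable_fun setT (fun x => dPs (z x)).
  by apply: measurableT_comp mz; exact: continuous_measurable_fun (adm_dcont aP).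
split.
- apply: (intg_le mPz) (intgZ L (intg_norm iz)) => x; exact: adm_le aP.
- by move=> i; exact: intgMb mdPz (fun x => bP (z x)) (ig i).
- by move=> x nO; rewrite z0// P0.
- by move=> i x nO; rewrite g0// mulr0.
move=> e e0.
pose e' := e / 2 / (L + 1); have L1 : 0 < L + 1 by rewrite ltr_wpDl.
have e'0 : 0 < e' by rewrite !divr_gt0.
have Le (t : R) : t < e' -> 0 <= t -> L * t < e / 2.
  move=> te t0; apply: (@le_lt_trans _ _ ((L + 1) * t)); first by rewrite ler_wpM2r// lerDl.
  by rewrite mulrC -ltr_pdivlMr.
have [d d0 Hd] : exists2 d : R, 0 < d & forall i (h : 'rV[R]_N -> R), intg leb h ->
    (forall x, `|h x| <= L + L) -> I (fun x => `|h x|) < d -> I (fun x => `|h x * g i x|) < e / 2.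
  apply: (@fin_small (fun i d => forall (h : 'rV[R]_N -> R), intg leb h ->
    (forall x, `|h x| <= L + L) -> I (fun x => `|h x|) < d -> I (fun x => `|h x * g i x|) < e / 2)).
    by move=> i; apply: bounded_L1_weight => //; rewrite divr_gt0.
  by move=> i d d' _ dd' h k ik kL kd; apply: h => //; exact: lt_le_trans dd'.
pose m := Num.min e' (d / (L + 1)).
have m0 : 0 < m by rewrite lt_min e'0 divr_gt0.
have [f [Cf fz fg]] := H _ m0; move: fz; rewrite lt_min => /andP[fz1 fz2].
have [CP pP] := C1c_adm aP Cf; exists (fun x => Ps (f x)).
have If0 : 0 <= I (fun x => `|f x - z x|) by exact: Rint_ge0.
have ifz : intg leb (fun x => `|f x - z x|) by apply/intg_norm/intgB => //; exact: C1c_intg Cf.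
have iPz : intg leb (fun x => Ps (z x)).
  apply: (intg_le mPz) (intgZ L (intg_norm iz)) => x; exact: adm_le aP.
split=> //.
- apply: (@le_lt_trans _ _ (L * I (fun x => `|f x - z x|))).
    rewrite -RintZ//; apply: Rint_le; [|exact: intgZ|by move=> x; exact: adm_lip aP _ _].
    by apply/intg_norm/intgB => //; exact: C1c_intg CP.
  by apply: lt_le_trans (Le _ fz1 If0) _; lra.
move=> i; rewrite pP; have := fg i; rewrite lt_min => /andP[fg1 fg2].
pose h x := dPs (f x) - dPs (z x).
have cf := C1c_cont Cf.
have mdf : measurable_fun setT (fun x => dPs (f x)).
  by apply: continuous_measurable_rV; exact: cont_comp cf (adm_dcont aP).
have mh : measurable_fun setT h by exact: measurable_funB.
have hL x : `|h x| <= L + L by rewrite (le_trans (ler_normB _ _))// lerD.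
have hf x : `|h x| <= L * `|f x - z x| by exact: lP.
have ih : intg leb h by apply: (intg_le mh hf); exact: intgZ.
have Ih : I (fun x => `|h x|) < d.
  apply: (@le_lt_trans _ _ (L * I (fun x => `|f x - z x|))).
    by rewrite -RintZ//; apply: Rint_le => //; [exact: intg_norm|exact: intgZ].
  apply: (@le_lt_trans _ _ ((L + 1) * I (fun x => `|f x - z x|))).
    by rewrite ler_wpM2r// lerDl.
  by rewrite mulrC -ltr_pdivlMr.
have ifg : intg leb (fun x => `|partial i f x - g i x|).
  by apply/intg_norm/intgB => //; exact: C1c_pintg Cf.
have ihg : intg leb (fun x => `|h x * g i x|) by exact/intg_norm/(intgMb mh hL).
apply: (@le_lt_trans _ _ (L * I (fun x => `|partial i f x - g i x|) + I (fun x => `|h x * g i x|))); last first.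
  have := Le _ fg1 (Rint_ge0 _ (fun x => normr_ge0 _)); have := Hd i h ih hL Ih; lra.
rewrite -RintZ// -RintD//; last exact: intgZ.
apply: Rint_le => [| |x].
- apply/intg_norm/intgB; last exact: intgMb mdPz (fun x => bP (z x)) (ig i).
  by apply: (intgMb mdf) => //; exact: C1c_pintg Cf.
- by apply: intgD => //; exact: intgZ.
have -> : dPs (f x) * partial i f x - dPs (z x) * g i x =
  dPs (f x) * (partial i f x - g i x) + h x * g i x by rewrite /h; ring.
by rewrite (le_trans (ler_normD _ _))// lerD2r normrM ler_wpM2r.
Qed.

(** The approximants have the explicit form Ps (f): with Ps a bounded truncation they are uniformly
    bounded, which [bil_bounded] requires. *)
Lemma S2_chain_appr Ps dPs L z g : adm Ps dPs L -> S2 z g -> forall e : R, 0 < e ->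
  exists f, [/\ C1c O f, I (fun x => (f x - z x) ^+ 2) < e,
    I (fun x => (Ps (f x) - Ps (z x)) ^+ 2) < e &
    forall i, I (fun x => (partial i (fun y => Ps (f y)) x - dPs (z x) * g i x) ^+ 2) < e].
Proof.
move=> aP Sz; have [Lz Lg z0 g0 H] := Sz; have [P0 dP bP lP] := aP; have L0 := adm_L0 aP.
have [mz iz] := Lz.
have mPz : measurable_fun setT (fun x => Ps (z x)).
  by apply: measurableT_comp mz; exact: continuous_measurable_fun (adm_cont aP).
have mdPz : measurable_fun setT (fun x => dPs (z x)).
  by apply: measurableT_comp mz; exact: continuous_measurable_fun (adm_dcont aP).
have LPz : L2 (fun x => Ps (z x)).
  apply: (L2_le mPz) (L2Z L Lz) => x; rewrite normrM ger0_norm//; exact: adm_le aP.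
move=> e e0.
pose e' := e / 4 / (L ^+ 2 + 1); have L1 : 0 < L ^+ 2 + 1 by rewrite ltr_wpDl// sqr_ge0.
have e'0 : 0 < e' by rewrite !divr_gt0.
have Le (t : R) : t < e' -> 0 <= t -> L ^+ 2 * t < e / 4.
  move=> te t0; apply: (@le_lt_trans _ _ ((L ^+ 2 + 1) * t)); first by rewrite ler_wpM2r// lerDl.
  by rewrite mulrC -ltr_pdivlMr.
have [d d0 Hd] : exists2 d : R, 0 < d & forall i (h : 'rV[R]_N -> R), intg leb h ->
    (forall x, `|h x| <= (L + L) ^+ 2) -> I (fun x => `|h x|) < d ->
    I (fun x => `|h x * g i x ^+ 2|) < e / 4.
  apply: (@fin_small (fun i d => forall (h : 'rV[R]_N -> R), intg leb h ->
    (forall x, `|h x| <= (L + L) ^+ 2) -> I (fun x => `|h x|) < d ->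
    I (fun x => `|h x * g i x ^+ 2|) < e / 4)).
    by move=> i; apply: bounded_L1_weight; [have [_] := Lg i|rewrite divr_gt0].
  by move=> i d d' _ dd' h k ik kL kd; apply: h => //; exact: lt_le_trans dd'.
pose m := Num.min e (Num.min e' (d / (L ^+ 2 + 1))).
have m0 : 0 < m by rewrite !lt_min e0 e'0 divr_gt0.
have [f [Cf fz fg]] := H _ m0; move: fz; rewrite !lt_min => /and3P[fz0 fz1 fz2].
have [CP pP] := C1c_adm aP Cf; exists f.
have If0 : 0 <= I (fun x => (f x - z x) ^+ 2) by apply: Rint_ge0 => x; exact: sqr_ge0.
have [_ ifz] : L2 (fun x => f x - z x) by apply: L2B => //; exact: C1c_L2 Cf.
have sqle (a b : R) : 0 <= b -> `|a| <= b -> a ^+ 2 <= b ^+ 2.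
  by move=> b0 ab; rewrite -(real_normK (num_real a)) lerXn2r ?nnegrE.
split=> //.
- apply: (@le_lt_trans _ _ (L ^+ 2 * I (fun x => (f x - z x) ^+ 2))).
    rewrite -RintZ//; apply: Rint_le; [|exact: intgZ|].
      by have [] := L2B (C1c_L2 CP) LPz.
    move=> x; rewrite -(real_normK (num_real (f x - z x))) -exprMn.
    by apply: sqle; [exact: mulr_ge0|exact: adm_lip aP _ _].
  by apply: lt_le_trans (Le _ fz1 If0) _; lra.
move=> i; rewrite pP; have := fg i; rewrite !lt_min => /and3P[_ fg1 fg2].
pose h x := (dPs (f x) - dPs (z x)) ^+ 2.
have cf := C1c_cont Cf.
have mdf : measurable_fun setT (fun x => dPs (f x)).
  by apply: continuous_measurable_rV; exact: cont_comp cf (adm_dcont aP).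
have mh0 : measurable_fun setT (fun x => dPs (f x) - dPs (z x)) by exact: measurable_funB.
have mh : measurable_fun setT h by rewrite /h; under eq_fun do rewrite expr2; exact: measurable_funM.
have h0 x : `|h x| = h x by rewrite ger0_norm ?sqr_ge0.
have hL x : `|h x| <= (L + L) ^+ 2.
  rewrite h0; apply: sqle; first exact: addr_ge0.
  by rewrite (le_trans (ler_normB _ _))// lerD.
have hf x : `|h x| <= L ^+ 2 * (f x - z x) ^+ 2.
  rewrite h0 -(real_normK (num_real (f x - z x))) -exprMn.
  by apply: sqle; [exact: mulr_ge0|exact: lP].
have ih : intg leb h by apply: (intg_le mh hf); exact: intgZ.
have Ih : I (fun x => `|h x|) < d.
  apply: (@le_lt_trans _ _ (L ^+ 2 * I (fun x => (f x - z x) ^+ 2))).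
    by rewrite -RintZ//; apply: Rint_le => //; [exact: intg_norm|exact: intgZ].
  apply: (@le_lt_trans _ _ ((L ^+ 2 + 1) * I (fun x => (f x - z x) ^+ 2))).
    by rewrite ler_wpM2r// lerDl.
  by rewrite mulrC -ltr_pdivlMr.
have [_ ifg] : L2 (fun x => partial i f x - g i x) by apply: L2B => //; exact: C1c_pL2 Cf.
have [_ ig2] := Lg i.
have ihg : intg leb (fun x => `|h x * g i x ^+ 2|) by exact/intg_norm/(intgMb mh hL).
apply: (@le_lt_trans _ _ (2 * (L ^+ 2 * I (fun x => (partial i f x - g i x) ^+ 2)) +
    2 * I (fun x => `|h x * g i x ^+ 2|))); last first.
  have := Le _ fg1 (Rint_ge0 _ (fun x => sqr_ge0 _)); have := Hd i h ih hL Ih; lra.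
rewrite -!RintZ//; last exact: intgZ.
rewrite -RintD//; [|exact/intgZ/intgZ|exact: intgZ].
apply: Rint_le => [| |x].
- have [_] : L2 (fun x => dPs (f x) * partial i f x - dPs (z x) * g i x); last by [].
  apply: L2B; last exact: L2_bounded mdPz (fun x => bP (z x)) (Lg i).
  by apply: (L2_bounded mdf) => //; exact: C1c_pL2 Cf.
- by apply: intgD; [exact/intgZ/intgZ|exact: intgZ].
have -> : dPs (f x) * partial i f x - dPs (z x) * g i x =
  dPs (f x) * (partial i f x - g i x) + (dPs (f x) - dPs (z x)) * g i x by ring.
set A := dPs (f x) * _; set B := (dPs (f x) - _) * _.
apply: (@le_trans _ _ (2 * A ^+ 2 + 2 * B ^+ 2)).
  by rewrite sqrrD; have := sqr_ge0 (A - B); rewrite sqrrB; lra.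
rewrite lerD// ler_wpM2l//.
  rewrite /A exprMn ler_wpM2r ?sqr_ge0// -(real_normK (num_real (dPs _))).
  by rewrite lerXn2r ?nnegrE.
by rewrite /B exprMn ler_norm.
Qed.

Lemma S2_chain Ps dPs L z g : adm Ps dPs L -> S2 z g ->
  S2 (fun x => Ps (z x)) (fun i x => dPs (z x) * g i x).
Proof.
move=> aP Sz; have [Lz Lg z0 g0 _] := Sz; have [P0 dP bP lP] := aP; have L0 := adm_L0 aP.
have [mz iz] := Lz.
have mPz : measurable_fun setT (fun x => Ps (z x)).
  by apply: measurableT_comp mz; exact: continuous_measurable_fun (adm_cont aP).
have mdPz : measurable_fun setT (fun x => dPs (z x)).
  by apply: measurableT_comp mz; exact: continuous_measurable_fun (adm_dcont aP).
split.
- by apply: (L2_le mPz) (L2Z L Lz) => x; rewrite normrM ger0_norm//; exact: adm_le aP.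
- by move=> i; exact: L2_bounded mdPz (fun x => bP (z x)) (Lg i).
- by move=> x nO; rewrite z0// P0.
- by move=> i x nO; rewrite g0// mulr0.
move=> e e0; have [f [Cf _ fz fg]] := S2_chain_appr aP Sz e0.
by have [CP _] := C1c_adm aP Cf; exists (fun x => Ps (f x)).
Qed.

Lemma S2_mul z g phi dphi (C : R) : C1g phi dphi -> (forall x, `|phi x| <= C) ->
  (forall i x, `|dphi i x| <= C) -> S2 z g ->
  S2 (fun x => phi x * z x) (fun i x => phi x * g i x + dphi i x * z x).
Proof.
move=> Cp pC dpC [Lz Lg z0 g0 H]; have [cp cdp _] := Cp.
have mp := continuous_measurable_rV cp; have mdp i := continuous_measurable_rV (cdp i).
have LG i : L2 (fun x => phi x * g i x + dphi i x * z x).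
  by apply: L2D; [exact: L2_bounded mp pC _|exact: L2_bounded (mdp i) (dpC i) _].
have Lpz : L2 (fun x => phi x * z x) by exact: L2_bounded mp pC _.
split=> //.
- by move=> x nO; rewrite z0// mulr0.
- by move=> i x nO; rewrite g0// z0// !mulr0 addr0.
move=> e e0; have C1 : 0 < C ^+ 2 + 1 by rewrite ltr_wpDl// sqr_ge0.
have e'0 : 0 < e / 4 / (C ^+ 2 + 1) by rewrite !divr_gt0.
have [f [Cf fz fg]] := H _ e'0.
have Cm := C1gM Cp (proj1 Cf).
have Cpf : C1c O (fun x => phi x * f x).
  by split; [exact: C1gW Cm|exact: csuppMr (proj2 Cf)].
have Le (t : R) : t < e / 4 / (C ^+ 2 + 1) -> 0 <= t -> C ^+ 2 * t < e / 4.
  move=> te t0; apply: (@le_lt_trans _ _ ((C ^+ 2 + 1) * t)); first by rewrite ler_wpM2r// lerDl.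
  by rewrite mulrC -ltr_pdivlMr.
have key (a b c : 'rV[R]_N -> R) : measurable_fun setT c -> (forall x, `|c x| <= C) ->
    L2 a -> L2 b -> I (fun x => (a x - b x) ^+ 2) < e / 4 / (C ^+ 2 + 1) ->
    I (fun x => (c x * a x - c x * b x) ^+ 2) < e / 4.
  move=> mc cC La Lb ab; have [_ iab] := L2B La Lb.
  apply: (@le_lt_trans _ _ (C ^+ 2 * I (fun x => (a x - b x) ^+ 2))); last first.
    by apply: Le ab _; apply: Rint_ge0 => x; exact: sqr_ge0.
  rewrite -RintZ//; apply: Rint_le.
  - by have [] := L2B (L2_bounded mc cC La) (L2_bounded mc cC Lb).
  - exact: intgZ.
  move=> x; rewrite -mulrBr exprMn ler_wpM2r ?sqr_ge0// -(real_normK (num_real (c x))).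
  by rewrite lerXn2r ?nnegrE// (le_trans _ (cC x)).
exists (fun x => phi x * f x); split=> //.
  apply: lt_le_trans (key _ _ _ mp pC (C1c_L2 Cf) Lz fz) _; lra.
move=> i; rewrite (C1gE i Cm).
have k1 := key _ _ _ mp pC (C1c_pL2 i Cf) (Lg i) (fg i).
have k2 := key _ _ _ (mdp i) (dpC i) (C1c_L2 Cf) Lz fz.
have [_ i1] := L2B (L2_bounded mp pC (C1c_pL2 i Cf)) (L2_bounded mp pC (Lg i)).
have [_ i2] := L2B (L2_bounded (mdp i) (dpC i) (C1c_L2 Cf)) (L2_bounded (mdp i) (dpC i) Lz).
apply: (@le_lt_trans _ _ (2 * I (fun x => (phi x * partial i f x - phi x * g i x) ^+ 2) +
  2 * I (fun x => (dphi i x * f x - dphi i x * z x) ^+ 2))); last lra.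
rewrite -!RintZ// -RintD; [|exact: intgZ|exact: intgZ].
apply: Rint_le.
- have [] // := L2B (_ : L2 (fun x => phi x * partial i f x + f x * dphi i x)) (LG i).
  apply: L2D; first exact: L2_bounded mp pC (C1c_pL2 i Cf).
  by under eq_fun do rewrite mulrC; exact: L2_bounded (mdp i) (dpC i) (C1c_L2 Cf).
- by apply: intgD; exact: intgZ.
move=> x; set A := phi x * partial i f x - phi x * g i x; set B := dphi i x * f x - _.
have -> : phi x * partial i f x + f x * dphi i x - (phi x * g i x + dphi i x * z x) = A + B.
  by rewrite /A /B; ring.
by rewrite sqrrD; have := sqr_ge0 (A - B); rewrite sqrrB; lra.
Qed.

Lemma S2_closed z g : L2 z -> (forall i, L2 (g i)) -> zo O z -> (forall i, zo O (g i)) ->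
  (forall e : R, 0 < e -> exists z' g', [/\ S2 z' g', I (fun x => (z' x - z x) ^+ 2) < e &
    forall i, I (fun x => (g' i x - g i x) ^+ 2) < e]) -> S2 z g.
Proof.
move=> Lz Lg z0 g0 H; split=> // e e0; have e40 : 0 < e / 4 by rewrite divr_gt0.
have [z' [g' [Sz' zz' gg']]] := H _ e40.
have [Lz' Lg' _ _ H'] := Sz'; have [f [Cf fz fg]] := H' _ e40.
have key (a b c : 'rV[R]_N -> R) : L2 a -> L2 b -> L2 c ->
    I (fun x => (a x - b x) ^+ 2) < e / 4 -> I (fun x => (b x - c x) ^+ 2) < e / 4 ->
    I (fun x => (a x - c x) ^+ 2) < e.
  move=> La Lb Lc ab bc; have [[_ i1] [_ i2]] := (L2B La Lb, L2B Lb Lc).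
  apply: (@le_lt_trans _ _ (2 * I (fun x => (a x - b x) ^+ 2) + 2 * I (fun x => (b x - c x) ^+ 2))); last lra.
  rewrite -!RintZ// -RintD; [|exact: intgZ|exact: intgZ].
  apply: Rint_le; [by have [] := L2B La Lc|by apply: intgD; exact: intgZ|move=> x].
  have -> : a x - c x = (a x - b x) + (b x - c x) by ring.
  set A := a x - b x; set B := b x - c x.
  by rewrite sqrrD; have := sqr_ge0 (A - B); rewrite sqrrB; lra.
exists f; split=> //; first exact: key (C1c_L2 Cf) Lz' Lz fz zz'.
by move=> i; exact: key (C1c_pL2 i Cf) (Lg' i) (Lg i) (fg i) (gg' i).
Qed.

End Chain_rule.

(** * Variational solutions *)

Section Energy.
Context {R : realType} {N : nat}.
Local Notation leb := (@lebesgue_rV R N).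
Local Notation I f := (Rintegral leb setT f).
Local Notation L2 := (L2 leb).
Variables (O : set 'rV[R]_N) (r0 : R) (Vr : 'rV[R]_N -> R) (Y : set 'rV[R]_N).
Hypotheses (oO : open O) (rO : forall x, O x -> `|x| < r0).
Hypotheses (mV : measurable_fun setT Vr) (V0 : forall x, 0 <= Vr x).
Local Notation S1 := (S1 O).
Local Notation S2 := (S2 O).
Implicit Types (z p f : 'rV[R]_N -> R) (g h : 'I_N -> 'rV[R]_N -> R) (al t : R).

(* The form domain of -Delta + V, where [Vr] is the finite part of the potential
   and [Y] the set on which it is infinite. *)
Definition Hs z g := [/\ S2 z g, intg leb (fun x => Vr x * z x ^+ 2) &
  {ae leb, forall x, Y x -> z x = 0}].

Definition en al z g p h x : R := (Vr x + al) * (z x * p x) + \sum_i g i x * h i x.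
Definition af al z g p h : R := I (en al z g p h).

Lemma Vprod_intg z p : measurable_fun setT z -> measurable_fun setT p ->
  intg leb (fun x => Vr x * z x ^+ 2) -> intg leb (fun x => Vr x * p x ^+ 2) ->
  intg leb (fun x => Vr x * (z x * p x)).
Proof.
move=> mz mp iz ip; apply: (intg_le (g := fun x => Vr x * z x ^+ 2 + Vr x * p x ^+ 2)).
- by apply: measurable_funM => //; exact: measurable_funM.
- move=> x; rewrite normrM ger0_norm// -mulrDr ler_wpM2l// ler_norml.
  have := sqr_ge0 (z x + p x); have := sqr_ge0 (z x - p x); rewrite sqrrB sqrrD.
  by have := sqr_ge0 (z x); have := sqr_ge0 (p x) => *; apply/andP; split; lra.
- exact: intgD.
Qed.

Lemma Vsq_ge0 z x : 0 <= Vr x * z x ^+ 2.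
Proof. by rewrite mulr_ge0 ?sqr_ge0. Qed.

Lemma Vsq_norm z x : `|Vr x * z x ^+ 2| = Vr x * z x ^+ 2.
Proof. by rewrite ger0_norm// Vsq_ge0. Qed.

Lemma HsL2 z g : Hs z g -> L2 z. Proof. by move=> [[]]. Qed.
Lemma HsL2g z g i : Hs z g -> L2 (g i). Proof. by move=> [[]]. Qed.
Lemma HsS2 z g : Hs z g -> S2 z g. Proof. by move=> []. Qed.
Lemma Hs_meas z g : Hs z g -> measurable_fun setT z. Proof. by move=> [[[]]]. Qed.
Lemma Hs_zo z g : Hs z g -> zo O z. Proof. by move=> [[]]. Qed.

Lemma Hs_intg z g : Hs z g -> intg leb z.
Proof. by move=> Hz; exact (L2_zo_intg rO (Hs_zo Hz) (HsL2 Hz)). Qed.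

Lemma en_intg al z g p h : Hs z g -> Hs p h -> intg leb (en al z g p h).
Proof.
move=> Hz Hp; have [_ iz _] := Hz; have [_ ip _] := Hp.
apply: intgD; last by apply: intg_sum => i; exact: L2M (HsL2g i Hz) (HsL2g i Hp).
apply: (eq_intg (f := fun x => Vr x * (z x * p x) + al * (z x * p x))) => [x|].
  by rewrite -mulrDl.
apply: intgD; last by apply: intgZ; exact: L2M (HsL2 Hz) (HsL2 Hp).
exact: Vprod_intg (Hs_meas Hz) (Hs_meas Hp) iz ip.
Qed.

Lemma Hs_lin t z g p h : Hs z g -> Hs p h ->
  Hs (fun x => z x + t * p x) (fun i x => g i x + t * h i x).
Proof.
move=> Hz Hp; have [Sz iz z0] := Hz; have [Sp ip p0] := Hp; split.
- exact: S2D Sz (S2Z t Sp).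
- have := Vprod_intg (Hs_meas Hz) (Hs_meas Hp) iz ip => izp.
  apply: (eq_intg (f := fun x => Vr x * z x ^+ 2 + (2 * t * (Vr x * (z x * p x)) + t ^+ 2 * (Vr x * p x ^+ 2)))).
    by move=> x; ring.
  by apply: intgD => //; apply: intgD; exact: intgZ.
- by apply: filterS2 z0 p0 => x zx px Yx; rewrite zx// px// mulr0 addr0.
Qed.

Lemma af_sym al z g p h : af al z g p h = af al p h z g.
Proof.
congr Rintegral; apply/funext => x; rewrite /en (mulrC (z x)); congr (_ + _).
by apply: eq_bigr => i _; rewrite mulrC.
Qed.

Lemma af_lin al t z g p h q k : Hs z g -> Hs p h -> Hs q k ->
  af al (fun x => z x + t * p x) (fun i x => g i x + t * h i x) q k =
  af al z g q k + t * af al p h q k.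
Proof.
move=> Hz Hp Hq; rewrite /af -RintZ ?en_intg// -RintD ?en_intg//; last exact/intgZ/en_intg.
congr Rintegral; apply/funext => x; rewrite /en mulrDr mulr_sumr addrACA -big_split /=.
congr (_ + _); first by ring.
by apply: eq_bigr => i _; ring.
Qed.

Lemma af_lin_sq al t z g p h : Hs z g -> Hs p h ->
  af al (fun x => z x + t * p x) (fun i x => g i x + t * h i x)
        (fun x => z x + t * p x) (fun i x => g i x + t * h i x) =
  af al z g z g + 2 * t * af al z g p h + t ^+ 2 * af al p h p h.
Proof.
move=> Hz Hp; have Hl := Hs_lin t Hz Hp.
rewrite af_lin// (af_sym al z) (af_sym al p) !af_lin// (af_sym al p h z); ring.
Qed.

Lemma en_ge al z g x : al * z x ^+ 2 + Vr x * z x ^+ 2 <= en al z g z g x.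
Proof.
rewrite /en -expr2 -mulrDl (addrC al) lerDl.
by apply: sumr_ge0 => i _; rewrite -expr2 sqr_ge0.
Qed.

Lemma en_ge_g al z g x i : 0 <= al -> g i x ^+ 2 <= en al z g z g x.
Proof.
move=> al0; rewrite /en (bigD1 i)//= -expr2 addrCA -expr2 lerDl addr_ge0//.
  by rewrite mulr_ge0 ?sqr_ge0// addr_ge0.
by apply: sumr_ge0 => k _; rewrite -expr2 sqr_ge0.
Qed.

Lemma en_ge0 al z g x : 0 <= al -> 0 <= en al z g z g x.
Proof.
by move=> al0; apply: le_trans (en_ge _ _ _ _); rewrite addr_ge0// mulr_ge0 ?sqr_ge0.
Qed.

Lemma af_ge0 al z g : 0 <= al -> 0 <= af al z g z g.
Proof. by move=> al0; apply: Rint_ge0 => x; exact: en_ge0. Qed.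

Lemma af_cauchy al t z g p h : 0 <= al -> Hs z g -> Hs p h ->
  2 * t * `|af al z g p h| <= af al z g z g + t ^+ 2 * af al p h p h.
Proof.
move=> al0 Hz Hp; have := af_lin_sq al t Hz Hp; have := af_lin_sq al (- t) Hz Hp.
have := af_ge0 (fun x => z x + t * p x) (fun i x => g i x + t * h i x) al0.
have := af_ge0 (fun x => z x + - t * p x) (fun i x => g i x + - t * h i x) al0.
set A := af _ _ _ _ _; set B := af _ _ _ _ _ => A0 B0 AE BE; rewrite AE in A0; rewrite BE in B0.
move: A0 B0; rewrite sqrrN mulrN mulNr.
set a := af _ z g p h => A0 B0.
by have [a0|a0] := leP 0 a; [rewrite ger0_norm|rewrite ltr0_norm]; lra.
Qed.

(** Young's inequality with weight 2^-n, against the indicator of a ball containing O, turns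
    increments of order 4^-n in the squared norm into increments of order 2^-n in L^1. *)
Lemma L2_fast (F : nat -> 'rV[R]_N -> R) (c : R) : (forall n, L2 (F n)) -> (forall n, zo O (F n)) ->
  (forall n, I (fun x => (F n.+1 x - F n x) ^+ 2) <= c * (2^-1 ^+ n) ^+ 2) ->
  exists G : 'rV[R]_N -> R, [/\ measurable_fun setT G, zo O G &
    {ae leb, forall x, F n x @[n --> \oo] --> G x}].
Proof.
move=> LF F0 HF; pose bO x : R := \1_(ball (0 : 'rV[R]_N) r0) x.
have b1 x : O x -> bO x = 1.
  by move=> /rO xr; rewrite /bO indicE mem_set// -ball_normE /= sub0r normrN.
have ib : intg leb (fun x => bO x ^+ 2).
  apply: eq_intg (indic_ball_intg 0 r0) => x.
  by rewrite /bO indicE; case: (_ \in _); rewrite ?expr0n ?expr1n.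
have iF n := L2_zo_intg rO (F0 n) (LF n).
have [G [mG FG G0]] : exists G : 'rV[R]_N -> R, [/\ measurable_fun setT G,
    {ae leb, forall x, F n x @[n --> \oo] --> G x} &
    forall x, (forall n, F n x = 0) -> G x = 0].
  apply: (@fast_cauchy _ _ _ _ F ((c + I (fun x => bO x ^+ 2)) / 2)) => // n.
  have [mh ih] := L2B (LF n.+1) (LF n).
  set t := 2^-1 ^+ n; have t0 : 0 < t by rewrite exprn_gt0.
  apply: (@le_trans _ _ (I (fun x => (1 / 2 / t) * (F n.+1 x - F n x) ^+ 2 + (t / 2) * bO x ^+ 2))).
    apply: Rint_le => [| |x].
    - by apply/intg_norm/intgB.
    - by apply: intgD; exact: intgZ.
    have {1}-> : F n.+1 x - F n x = (F n.+1 x - F n x) * bO x.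
      have [Ox|nO] := pselect (O x); first by rewrite b1// mulr1.
      by rewrite !F0// subrr mul0r.
    apply: le_trans (young_norm _ _ t0) _.
    set a := (F n.+1 x - F n x) ^+ 2; have b01 : bO x ^+ 2 <= 1.
      by rewrite /bO indicE; case: (_ \in _); rewrite ?expr0n ?expr1n.
    have a0 : 0 <= a by exact: sqr_ge0.
    have bb : bO x ^+ 2 ^+ 2 <= bO x ^+ 2.
      by rewrite expr2 ler_piMr ?sqr_ge0.
    have ta : 0 <= a / t by rewrite divr_ge0// ltW.
    have tab : a * bO x ^+ 2 / t <= a / t by rewrite ler_wpM2r ?ler_piMr// invr_ge0 ltW.
    have -> : 1 / 2 / t * a = (a / t) / 2 by field; rewrite gt_eqF.
    lra.
  rewrite RintD; [|exact: intgZ|exact: intgZ]; rewrite !RintZ//.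
  have := HF n; rewrite -/t; set A := I _ => HA; set B := I _.
  have -> : (c + B) / 2 * t = 1 / 2 / t * (c * t ^+ 2) + t / 2 * B by field; rewrite gt_eqF.
  by rewrite lerD2r ler_wpM2l// divr_ge0 ?ltW.
by exists G; split=> // x nO; apply: G0 => n; exact: F0.
Qed.

(* [z] is the variational solution of -Delta z + (V + al) z = f. *)
Definition sol al f z := exists g, [/\ Hs z g, L2 f &
  forall p h, Hs p h -> af al z g p h = I (fun x => f x * p x)].

Lemma Hs0 : Hs (fun=> 0) (fun _ _ => 0).
Proof.
have C0 : C1c O (fun=> 0 : R).
  split; first exact: C1gW (C1g_cst 0).
  by exists set0; split=> //; exact: compact0.
split.
- have := C1c_S2 C0; congr S2; apply/funext => i; exact: C1gE (C1g_cst 0).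
- by apply: eq_intg (intg0 leb) => x; rewrite expr0n mulr0.
- exact: aeW.
Qed.

Lemma le_geometric_eq0 (x C : R) : (forall n, `|x| <= C * 2^-1 ^+ n) -> x = 0.
Proof.
move=> H; apply/eqP; rewrite -normr_eq0; apply/eqP/le_anti; rewrite normr_ge0 andbT.
have c0 : C * 2^-1 ^+ n @[n --> \oo] --> C * 0.
  by apply: cvgM; [exact: cvg_cst|apply: cvg_expr; rewrite ger0_norm; lra].
rewrite mulr0 in c0; rewrite -(cvg_lim _ c0)//; apply: limr_ge; first exact: cvgP c0.
by apply: nearW => n; exact: H.
Qed.

(** The direct method for the energy J, with no prior completeness of the form domain: the
    minimizing sequence is chosen within 4^-n of the infimum, so that it is geometrically Cauchy,
    and Fatou's lemma places its limit in the domain. *)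
Lemma sol_ex al f : 0 < al -> L2 f -> exists z, sol al f z.
Proof.
move=> al0 Lf; have [mf iF] := Lf; have al0' := ltW al0.
pose J z g := af al z g z g - 2 * I (fun x => f x * z x).
pose E := [set r : R | exists z g, Hs z g /\ r = J z g].
have lbE : lbound E (- I (fun x => f x ^+ 2 / al)).
  move=> _ [z [g [Hz ->]]]; rewrite /J /af.
  have ifz : intg leb (fun x => f x * z x) by exact: L2M Lf (HsL2 Hz).
  have ifa : intg leb (fun x => f x ^+ 2 / al).
    by apply: eq_intg (intgZ al^-1 iF) => x; rewrite mulrC.
  rewrite -RintZ// -RintB ?en_intg//; last exact: intgZ.
  rewrite -RintN//; apply: Rint_le => [| |x].
  - exact: intgN.
  - by apply: intgB; [exact: en_intg|exact: intgZ].
  have := en_ge al z g x; have Vz : 0 <= Vr x * z x ^+ 2 by rewrite mulr_ge0 ?sqr_ge0.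
  have := sqr_ge0 (f x - al * z x); have -> : (f x - al * z x) ^+ 2 =
    al * (f x ^+ 2 / al - 2 * (f x * z x) + al * z x ^+ 2) by field; rewrite gt_eqF.
  rewrite pmulr_rge0//; set a := f x ^+ 2 / al; set b := f x * z x; set c := al * z x ^+ 2.
  set e := en _ _ _ _ _ _; lra.
have hE : has_inf E.
  split; last by exists (- I (fun x => f x ^+ 2 / al)).
  by exists (J (fun=> 0) (fun _ _ => 0)); exists (fun=> 0), (fun _ _ => 0); split=> //; exact: Hs0.
have tau0 n : 0 < (2^-1 : R) ^+ n by rewrite exprn_gt0.
have /choice[w Hw] : forall n, exists w : ('rV[R]_N -> R) * ('I_N -> 'rV[R]_N -> R),
    Hs w.1 w.2 /\ J w.1 w.2 < inf E + (2^-1 ^+ n) ^+ 2.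
  move=> n; have [_ [z [g [Hz ->]]] H] := inf_adherent (exprn_gt0 2 (tau0 n)) hE.
  by exists (z, g).
pose zn n := (w n).1; pose gn n := (w n).2.
have HH n : Hs (zn n) (gn n) by have [] := Hw n.
have Jn n : J (zn n) (gn n) < inf E + (2^-1 ^+ n) ^+ 2 by have [] := Hw n.
have Jge z g : Hs z g -> inf E <= J z g.
  by move=> Hz; apply: ge_inf; [case: hE|exists z, g].
have Il t z g p h : Hs z g -> Hs p h -> I (fun x => f x * (z x + t * p x)) =
    I (fun x => f x * z x) + t * I (fun x => f x * p x).
  move=> Hz Hp; have i1 := L2M Lf (HsL2 Hz); have i2 := L2M Lf (HsL2 Hp).
  rewrite -RintZ// -RintD//; last exact: intgZ.
  by congr Rintegral; apply/funext => x; ring.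
have Jlin t z g p h : Hs z g -> Hs p h -> J (fun x => z x + t * p x) (fun i x => g i x + t * h i x) =
    J z g + 2 * t * (af al z g p h - I (fun x => f x * p x)) + t ^+ 2 * af al p h p h.
  by move=> Hz Hp; rewrite /J (af_lin_sq al t Hz Hp) (Il t _ _ _ _ Hz Hp); ring.
pose D n m x := zn n x + -1 * zn m x; pose DG n m i x := gn n i x + -1 * gn m i x.
have HD n m : Hs (D n m) (DG n m) by exact: Hs_lin (HH n) (HH m).
(* The midpoint of z_n and z_m cannot go below the infimum; the parallelogram identity then bounds
   the energy of their difference. *)
have QD n m : af al (D n m) (DG n m) (D n m) (DG n m) <= 2 * (2^-1 ^+ n) ^+ 2 + 2 * (2^-1 ^+ m) ^+ 2.
  have Hh := Hs_lin 2^-1 (HH m) (HD n m).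
  have := Jge _ _ Hh; rewrite (Jlin _ _ _ _ _ (HH m) (HD n m)).
  have Jm := Jn m; have := Jn n.
  have E1 : J (zn n) (gn n) = J (zn m) (gn m) + 2 * 1 * (af al (zn m) (gn m) (D n m) (DG n m) -
      I (fun x => f x * D n m x)) + 1 ^+ 2 * af al (D n m) (DG n m) (D n m) (DG n m).
    rewrite -(Jlin _ _ _ _ _ (HH m) (HD n m)); congr J.
      by apply/funext => x; rewrite /D; ring.
    by apply/funext => i; apply/funext => x; rewrite /DG; ring.
  rewrite E1; move: Jm; set a := J _ _; set b := af _ _ _ _ _; set c := I _; set d := af _ _ _ _ _.
  set s := (2^-1 ^+ n) ^+ 2; set r := (2^-1 ^+ m) ^+ 2; set e := inf E; lra.
have QD1 n m : (n <= m)%N -> af al (D n m) (DG n m) (D n m) (DG n m) <= 4 * (2^-1 ^+ n) ^+ 2.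
  move=> nm; apply: le_trans (QD n m) _.
  have : (2^-1 : R) ^+ m ^+ 2 <= (2^-1 ^+ n) ^+ 2.
    by rewrite lerXn2r ?nnegrE ?(ltW (tau0 _))// ler_wiXn2l//; lra.
  set s := (2^-1 ^+ n) ^+ 2; set r := (2^-1 ^+ m) ^+ 2; lra.
have Lzn n := HsL2 (HH n).
have [z [mz z0 cz]] : exists G : 'rV[R]_N -> R, [/\ measurable_fun setT G, zo O G &
    {ae leb, forall x, zn n x @[n --> \oo] --> G x}].
  apply: (@L2_fast zn (4 / al)) => // n; first by have [[]] := HH n.
  have [_ id] := L2B (Lzn n.+1) (Lzn n).
  rewrite mulrAC ler_pdivlMr// mulrC -RintZ//.
  apply: le_trans (QD1 n n.+1 (leqnSn n)); apply: Rint_le => [| |x].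
  - exact: intgZ.
  - exact: en_intg.
  apply: le_trans (en_ge _ _ _ _); rewrite /D (_ : zn n.+1 x - zn n x = - (zn n x + -1 * zn n.+1 x)); last by ring.
  by rewrite sqrrN lerDl mulr_ge0 ?sqr_ge0.
have /choice[g Hg] : forall i, exists G : 'rV[R]_N -> R, [/\ measurable_fun setT G, zo O G &
    {ae leb, forall x, gn n i x @[n --> \oo] --> G x}].
  move=> i; apply: (@L2_fast (fun n => gn n i) 4) => // n.
  - exact: HsL2g (HH n).
  - by have [[]] := HH n.
  have [_ id] := L2B (HsL2g i (HH n.+1)) (HsL2g i (HH n)).
  apply: le_trans (QD1 n n.+1 (leqnSn n)); apply: Rint_le => [//| |x].
    exact: en_intg.
  apply: le_trans (en_ge_g _ _ _ i al0'); rewrite /DG (_ : gn n.+1 i x - gn n i x = - (gn n i x + -1 * gn n.+1 i x)); last by ring.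
  by rewrite sqrrN.
have mg i : measurable_fun setT (g i) by have [] := Hg i.
have g0 i : zo O (g i) by have [] := Hg i.
have cg : {ae leb, forall x, forall i, gn n i x @[n --> \oo] --> g i x}.
  have cg i : {ae leb, forall x, gn n i x @[n --> \oo] --> g i x} by have [] := Hg i.
  exact: filter_forall cg.
pose d n x := zn n x + -1 * z x; pose dg n i x := gn n i x + -1 * g i x.
have mzn n := Hs_meas (HH n).
have mgn n i : measurable_fun setT (gn n i) by have [] := HsL2g i (HH n).
have md n : measurable_fun setT (d n) by apply: measurable_funD => //; exact: measurable_funM.
have mdg n i : measurable_fun setT (dg n i) by apply: measurable_funD => //; exact: measurable_funM.
(* Fatou's lemma in m with n fixed, as D n (m + n) tends to z_n - z. *)
have Qd n : intg leb (en al (d n) (dg n) (d n) (dg n)) /\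
    I (en al (d n) (dg n) (d n) (dg n)) <= 4 * (2^-1 ^+ n) ^+ 2.
  apply: (@Rint_fatou _ _ _ _ (fun m => en al (D n (m + n)) (DG n (m + n)) (D n (m + n)) (DG n (m + n)))).
  - by move=> m; exact: en_intg.
  - by move=> m x; exact: en_ge0.
  - apply: measurable_funD.
      by apply: measurable_funM; [exact: measurable_funD|exact: measurable_funM].
    by apply: measurable_sum => i; exact: measurable_funM.
  - apply: filterS2 cz cg => x cz cg.
    have czn : zn (m + n)%N x @[m --> \oo] --> z x by rewrite (cvg_shiftn n (fun m => zn m x)).
    have cgn i : gn (m + n)%N i x @[m --> \oo] --> g i x by rewrite (cvg_shiftn n (fun m => gn m i x)).
    have cD : D n (m + n)%N x @[m --> \oo] --> d n x.
      by apply: cvgD; [exact: cvg_cst|apply: cvgM; [exact: cvg_cst|]].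
    have cDG i : DG n (m + n)%N i x @[m --> \oo] --> dg n i x.
      by apply: cvgD; [exact: cvg_cst|apply: cvgM; [exact: cvg_cst|exact: cgn]].
    apply: cvgD; first by apply: cvgM; [exact: cvg_cst|exact: cvgM].
    by apply: cvg_big => [|i _]; [exact: add_continuous|exact: cvgM].
  - by move=> m; apply: QD1; exact: leq_addl.
have Ld n : L2 (d n).
  split=> //; have [ie _] := Qd n; apply: (intg_le (g := fun x => al^-1 * en al (d n) (dg n) (d n) (dg n) x)).
  - by under eq_fun do rewrite expr2; exact: measurable_funM.
  - move=> x; rewrite ger0_norm ?sqr_ge0// mulrC ler_pdivlMr// mulrC.
    by apply: le_trans (en_ge _ _ _ _); rewrite lerDl mulr_ge0 ?sqr_ge0.
  - exact: intgZ.
have Ldg n i : L2 (dg n i).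
  split=> //; have [ie _] := Qd n; apply: (intg_le (g := en al (d n) (dg n) (d n) (dg n))) => //.
  - by under eq_fun do rewrite expr2; exact: measurable_funM.
  - by move=> x; rewrite ger0_norm ?sqr_ge0//; exact: en_ge_g.
have iVd n : intg leb (fun x => Vr x * d n x ^+ 2).
  have [ie _] := Qd n; apply: (intg_le (g := en al (d n) (dg n) (d n) (dg n))) => //.
  - by apply: measurable_funM => //; under eq_fun do rewrite expr2; exact: measurable_funM.
  - move=> x; rewrite Vsq_norm; apply: le_trans (en_ge _ _ _ _).
    by rewrite lerDr mulr_ge0 ?sqr_ge0.
have Lz : L2 z.
  have := L2B (Lzn 0%N) (Ld 0%N); congr L2; apply/funext => x; rewrite /d; ring.
have Lg i : L2 (g i).
  have := L2B (HsL2g i (HH 0%N)) (Ldg 0%N i); congr L2; apply/funext => x; rewrite /dg; ring.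
have Hz : Hs z g.
  split.
  - apply: S2_closed => // e e0.
    have [n Hn] : exists n, 4 * (2^-1 ^+ n) ^+ 2 < e * Num.min 1 al.
      have c0 : 4 * (2^-1 ^+ n * 2^-1 ^+ n) @[n --> \oo] --> 4 * (0 * 0 : R).
        apply: cvgM; first exact: cvg_cst.
        by apply: cvgM; apply: cvg_expr; rewrite ger0_norm; lra.
      have e0' : 4 * (0 * 0) < e * Num.min 1 al by rewrite !mulr0 mulr_gt0// lt_min ltr01.
      have [n _ Hn] := cvgr_lt _ c0 _ e0'; exists n; rewrite expr2; exact: (Hn n (leqnn n)).
    have [ie Qn] := Qd n; have Qe := le_lt_trans Qn Hn.
    exists (zn n), (gn n); split; first exact: HsS2.
    + have := Ld n; rewrite /d => -[_ id].
      have -> : I (fun x => (zn n x - z x) ^+ 2) = I (fun x => d n x ^+ 2).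
        by congr Rintegral; apply/funext => x; rewrite /d mulN1r.
      rewrite -(ltr_pM2l al0) -RintZ//.
      apply: (@le_lt_trans _ _ (I (en al (d n) (dg n) (d n) (dg n)))).
        apply: Rint_le => [||x]; [exact: intgZ|exact: ie|].
        by apply: le_trans (en_ge _ _ _ _); rewrite lerDl mulr_ge0 ?sqr_ge0.
      by apply: lt_le_trans Qe _; rewrite mulrC ler_wpM2r ?(ltW e0)// ge_min lexx orbT.
    + move=> i; have [_ idg] := Ldg n i.
      have -> : I (fun x => (gn n i x - g i x) ^+ 2) = I (fun x => dg n i x ^+ 2).
        by congr Rintegral; apply/funext => x; rewrite /dg mulN1r.
      apply: (@le_lt_trans _ _ (I (en al (d n) (dg n) (d n) (dg n)))).
        by apply: Rint_le => // x; exact: en_ge_g.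
      by apply: lt_le_trans Qe _; rewrite ler_piMr ?(ltW e0)// ge_min lexx.
  - have [_ iV _] := HH 0%N.
    have iX := Vprod_intg (mzn 0%N) (md 0%N) iV (iVd 0%N).
    apply: (eq_intg (f := fun x => Vr x * zn 0%N x ^+ 2 + (-2 * (Vr x * (zn 0%N x * d 0%N x)) + Vr x * d 0%N x ^+ 2))).
      by move=> x; rewrite /d; ring.
    by apply: intgD => //; apply: intgD => //; exact: intgZ.
  - have zn0 : {ae leb, forall x, forall n, Y x -> zn n x = 0}.
      by apply: ae_foralln => n; have [] := HH n.
    apply: filterS2 cz zn0 => x cx zx Yx.
    rewrite -(cvg_lim _ cx)// (_ : (fun n => zn n x) = fun=> 0) ?lim_cst//.
    by apply/funext => n; exact: zx.
exists z, g; split=> // p h Hp.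
apply/eqP; rewrite -subr_eq0; apply/eqP.
pose Qp := af al p h p h; have Qp0 : 0 <= Qp by exact: af_ge0.
apply: (@le_geometric_eq0 _ (Qp + 3)) => n.
set tau := 2^-1 ^+ n; have t0 : 0 < tau by exact: tau0.
have Hd : Hs (d n) (dg n) by exact: Hs_lin (HH n) Hz.
have az : af al z g p h = af al (zn n) (gn n) p h - af al (d n) (dg n) p h.
  rewrite (af_lin al (-1) (HH n) Hz Hp); ring.
have := af_cauchy tau al0' Hd Hp; have [_] := Qd n; rewrite -/(af _ _ _ _ _) -/tau -/Qp.
set ad := af al (d n) _ p h => Qdn adp.
have ad' : 2 * tau * `|ad| <= tau * (tau * (4 + Qp)) by rewrite expr2 in adp Qdn; lra.
have {ad'} ad' : 2 * `|ad| <= tau * (4 + Qp).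
  by rewrite -(ler_pM2l t0); apply: le_trans ad'; lra.
rewrite az; set an := af al (zn n) _ p h.
(* The function z_n minimizes J up to tau^2. Varying it by tau p and by - tau p gives the Euler
   equation up to an error of order tau. *)
have := Jge _ _ (Hs_lin tau (HH n) Hp); rewrite (Jlin _ _ _ _ _ (HH n) Hp).
have := Jge _ _ (Hs_lin (- tau) (HH n) Hp); rewrite (Jlin _ _ _ _ _ (HH n) Hp).
have := Jn n; rewrite -/tau -/an -/Qp sqrrN; set If := I _; set e := J _ _; set ie := inf E.
move=> h1 h2 h3.
have k1 : tau * (- (2 * (an - If))) <= tau * (tau * (1 + Qp)) by rewrite expr2 in h1 h2 h3; lra.
have k2 : tau * (2 * (an - If)) <= tau * (tau * (1 + Qp)) by rewrite expr2 in h1 h2 h3; lra.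
rewrite !(ler_pM2l t0) in k1 k2.
have k3 : `|2 * (an - If)| <= tau * (1 + Qp) by rewrite ler_norml; apply/andP; split; lra.
rewrite normrM ger0_norm// in k3.
have -> : an - ad - If = (an - If) - ad by ring.
by apply: le_trans (ler_normB _ _) _; lra.
Qed.

Lemma Hs_chain Ps dPs L z g : adm Ps dPs L -> Hs z g ->
  Hs (fun x => Ps (z x)) (fun i x => dPs (z x) * g i x).
Proof.
move=> aP [Sz iz z0]; have SP := S2_chain aP Sz; split=> //.
- apply: (intg_le (g := fun x => L ^+ 2 * (Vr x * z x ^+ 2))); last exact: intgZ.
    have [[mP _] _ _ _ _] := SP; apply: measurable_funM => //.
    by under eq_fun do rewrite expr2; exact: measurable_funM.
  move=> x; rewrite (Vsq_norm (fun x => Ps (z x)) x) [leRHS]mulrCA ler_wpM2l//.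
  rewrite -(real_normK (num_real (Ps _))) -(real_normK (num_real (z x))) -exprMn.
  by rewrite lerXn2r ?nnegrE ?mulr_ge0 ?(adm_L0 aP)// (adm_le _ aP).
- by apply: filterS z0 => x H /H ->; have [] := aP.
Qed.

Lemma Hs_mul z g phi dphi (C : R) : C1g phi dphi -> (forall x, `|phi x| <= C) ->
  (forall i x, `|dphi i x| <= C) -> Hs z g ->
  Hs (fun x => phi x * z x) (fun i x => phi x * g i x + dphi i x * z x).
Proof.
move=> Cp pC dpC [Sz iz z0]; have SP := S2_mul Cp pC dpC Sz; split=> //.
- have [cp _ _] := Cp; have C0 : 0 <= C by apply: le_trans (pC 0).
  apply: (intg_le (g := fun x => C ^+ 2 * (Vr x * z x ^+ 2))); last exact: intgZ.
    have [[mP _] _ _ _ _] := SP; apply: measurable_funM => //.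
    by under eq_fun do rewrite expr2; exact: measurable_funM.
  move=> x; rewrite (Vsq_norm (fun x => phi x * z x) x) [leRHS]mulrCA ler_wpM2l// exprMn ler_wpM2r ?sqr_ge0//.
  by rewrite -(real_normK (num_real (phi _))) lerXn2r ?nnegrE.
- by apply: filterS z0 => x H /H ->; rewrite mulr0.
Qed.

Lemma sol_meas al f z : sol al f z -> measurable_fun setT z.
Proof. by move=> [g [Hz _ _]]; exact: Hs_meas Hz. Qed.

Lemma sol_zo al f z : sol al f z -> zo O z.
Proof. by move=> [g [[[]]]]. Qed.

Lemma sol_intg al f z : sol al f z -> intg leb z.
Proof. by move=> Sz; have [g [Hz _ _]] := Sz; exact (L2_zo_intg rO (sol_zo Sz) (HsL2 Hz)). Qed.

Lemma sol_lin al t f z f' z' : sol al f z -> sol al f' z' ->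
  sol al (fun x => f x + t * f' x) (fun x => z x + t * z' x).
Proof.
move=> [g [Hz Lf E]] [g' [Hz' Lf' E']]; exists (fun i x => g i x + t * g' i x); split.
- exact: Hs_lin.
- by apply: L2D => //; exact: L2Z.
move=> p h Hp; rewrite af_lin// (E _ _ Hp) (E' _ _ Hp).
have i1 := L2M Lf (HsL2 Hp); have i2 := L2M Lf' (HsL2 Hp).
rewrite -RintZ// -RintD//; last exact: intgZ.
by congr Rintegral; apply/funext => x; ring.
Qed.

Lemma sol0 al : sol al (fun=> 0) (fun=> 0).
Proof.
exists (fun _ _ => 0); split; first exact: Hs0.
  exact: HsL2 Hs0.
move=> p h Hp; congr Rintegral; apply/funext => x; rewrite /en !mul0r mulr0 add0r.
by rewrite big1// => i _; rewrite mul0r.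
Qed.

Lemma af_eq0 al z g : 0 < al -> Hs z g -> af al z g z g <= 0 -> {ae leb, forall x, z x = 0}.
Proof.
move=> al0 Hz Q0; have [_ iz2] := HsL2 Hz.
have : {ae leb, forall x, z x ^+ 2 = 0}.
  apply: Rint_eq0_ae => //; first by move=> x; exact: sqr_ge0.
  rewrite -(pmulr_rle0 _ al0) -RintZ//; apply: le_trans Q0; apply: Rint_le => [||x].
  - exact: intgZ.
  - exact: en_intg.
  by apply: le_trans (en_ge _ _ _ _); rewrite lerDl mulr_ge0 ?sqr_ge0.
by apply: filterS => x /eqP; rewrite sqrf_eq0 => /eqP.
Qed.

Lemma sol_uniq al f z z' : 0 < al -> sol al f z -> sol al f z' -> {ae leb, forall x, z x = z' x}.
Proof.
move=> al0 Sz Sz'; have [g [Hd Ld E]] := sol_lin (-1) Sz Sz'.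
have : {ae leb, forall x, z x + -1 * z' x = 0}.
  apply: (af_eq0 al0 Hd); rewrite (E _ _ Hd) -(Rint0 leb) le_eqVlt; apply/orP; left; apply/eqP.
  by congr Rintegral; apply/funext => x; ring.
by apply: filterS => x; rewrite mulN1r => /eqP; rewrite subr_eq0 => /eqP.
Qed.

Lemma sol_ae al f f' z z' : sol al f z -> measurable_fun setT f' ->
  {ae leb, forall x, f x = f' x} -> measurable_fun setT z' -> zo O z' ->
  {ae leb, forall x, z x = z' x} -> sol al f' z'.
Proof.
move=> [g [Hz Lf E]] mf' ff' mz' z'0 zz'; have [Sz iz z0] := Hz.
have Lf' : L2 f'.
  have [mf iF] := Lf; split=> //; apply: ae_intg iF.
    by under eq_fun do rewrite expr2; exact: measurable_funM.
  by apply: filterS ff' => x ->.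
have Hz' : Hs z' g.
  split; first exact: S2_ae Sz mz' z'0 zz'.
    apply: ae_intg iz; last by apply: filterS zz' => x ->.
    by apply: measurable_funM => //; under eq_fun do rewrite expr2; exact: measurable_funM.
  by apply: filterS2 z0 zz' => x H <-.
exists g; split=> // p h Hp.
transitivity (af al z g p h).
  apply: ae_Rint_eq; [| |by apply: filterS zz' => x zx; rewrite /en zx].
    exact: intg_measurable (en_intg al Hz' Hp).
  exact: intg_measurable (en_intg al Hz Hp).
rewrite (E _ _ Hp); apply: ae_Rint_eq.
- exact/intg_measurable/(L2M Lf (HsL2 Hp)).
- exact/intg_measurable/(L2M Lf' (HsL2 Hp)).
- by apply: filterS ff' => x ->.
Qed.

Lemma Psi_mul_ge0 (t : R) : 0 <= t * Psi t.
Proof.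
by have [t0|/ltW/Psi0 ->] := leP 0 t; rewrite ?mulr0// mulr_ge0// Psi_ge0.
Qed.

Lemma Psi_mul_eq0 (t : R) : t * Psi t = 0 -> t <= 0.
Proof.
move=> H; rewrite leNgt; apply/negP => t0; have := mulr_gt0 t0 (Psi_gt0 t0).
by rewrite H ltxx.
Qed.

(** Test with Psi (z - M / al), which vanishes at z = 0 because M >= 0; the gradient and potential
    terms are then nonnegative. *)
Lemma sol_le al f z (M : R) : 0 < al -> 0 <= M -> sol al f z ->
  {ae leb, forall x, f x <= M} -> {ae leb, forall x, z x <= M / al}.
Proof.
move=> al0 M0 Sz fM; have [g [Hz Lf E]] := Sz.
pose c := M / al; have c0 : 0 <= c by rewrite divr_ge0// ltW.
have aP := adm_aff 1 (Psi0 (_ : - c <= 0)) (@adm_Psi R).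
have {}aP : adm (fun t => Psi (1 * t + - c)) (fun t => 1 * dPsi (1 * t + - c)) (8 * (`|1| + `|1| ^+ 2)).
  by apply: aP; rewrite oppr_le0.
have Hp := Hs_chain aP Hz; set p := fun x => Psi _ in Hp; set h := fun i x => _ in Hp.
have pE x : p x = Psi (z x - c) by rewrite /p mul1r.
have Lp := HsL2 Hp; have p0 x : 0 <= p x by rewrite pE Psi_ge0.
have ip := Hs_intg Hp.
have izp : intg leb (fun x => z x * p x) by exact: L2M (HsL2 Hz) Lp.
have iap : intg leb (fun x => al * (z x * p x)) by exact: intgZ.
have le1 : I (fun x => al * (z x * p x)) <= I (fun x => M * p x).
  apply: (@le_trans _ _ (af al z g p h)).
    apply: Rint_le => // [|x]; first exact: en_intg.
    rewrite /en mulrDl addrAC addrC lerDl addr_ge0//.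
      apply: mulr_ge0 => //; rewrite pE; have [zx|zx] := leP (z x) c.
        by rewrite Psi0 ?mulr0// subr_le0.
      by rewrite mulr_ge0 ?Psi_ge0// (le_trans c0)// ltW.
    by apply: sumr_ge0 => i _; rewrite /h mulrCA mulr_ge0 ?mul1r ?dPsi_ge0// -expr2 sqr_ge0.
  rewrite E//; apply: ae_Rint_le; first exact: L2M Lf Lp.
    exact: intgZ.
  by apply: filterS fM => x fx; rewrite ler_wpM2r.
have : {ae leb, forall x, al * ((z x - c) * Psi (z x - c)) = 0}.
  have EE x : al * ((z x - c) * Psi (z x - c)) = al * (z x * p x) - M * p x.
    by rewrite pE /c; field; rewrite gt_eqF.
  apply: Rint_eq0_ae.
  - by apply: eq_intg (intgB iap (intgZ M ip)) => x; rewrite EE.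
  - by move=> x; rewrite mulr_ge0 ?Psi_mul_ge0 ?ltW.
  - by under eq_Rintegral do rewrite EE; rewrite RintB// ?subr_le0//; exact: intgZ.
apply: filterS => x /eqP; rewrite mulf_eq0 gt_eqF//= => /eqP /Psi_mul_eq0.
by rewrite subr_le0.
Qed.

Lemma sol_le0 al f z : 0 < al -> sol al f z ->
  {ae leb, forall x, f x <= 0} -> {ae leb, forall x, z x <= 0}.
Proof. by move=> al0 Sz /(sol_le al0 (lexx 0) Sz); rewrite mul0r. Qed.

Lemma sol_mono al f z f' z' : 0 < al -> sol al f z -> sol al f' z' ->
  {ae leb, forall x, f x <= f' x} -> {ae leb, forall x, z x <= z' x}.
Proof.
move=> al0 Sz Sz' ff'; have Sd := sol_lin (-1) Sz Sz'.
have : {ae leb, forall x, z x + -1 * z' x <= 0}.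
  by apply: sol_le0 Sd _ => //; apply: filterS ff' => x; rewrite mulN1r subr_le0.
by apply: filterS => x; rewrite mulN1r subr_le0.
Qed.

Lemma sol_ge0 al f z : 0 < al -> sol al f z ->
  {ae leb, forall x, 0 <= f x} -> {ae leb, forall x, 0 <= z x}.
Proof. by move=> al0 Sz; exact: sol_mono al0 (sol0 al) Sz. Qed.

Lemma sol_symm al f z f' z' : sol al f z -> sol al f' z' ->
  I (fun x => f x * z' x) = I (fun x => f' x * z x).
Proof.
move=> [g [Hz Lf E]] [g' [Hz' Lf' E']].
by rewrite -(E _ _ Hz') -(E' _ _ Hz) af_sym.
Qed.

Let aPn n : adm (fun t : R => Psi (n.+1%:R * t + 0)) (fun t => n.+1%:R * dPsi (n.+1%:R * t + 0)) _ :=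
  adm_aff n.+1%:R (Psi0 (lexx 0)) (@adm_Psi R).

Lemma Psi_cvg1 (t : R) : 0 < t -> Psi (n.+1%:R * t + 0) @[n --> \oo] --> (1 : R).
Proof.
move=> t0; have H n : `|1 - Psi (n.+1%:R * t + 0)| <= t^-1 ^+ 2 * n.+1%:R^-1.
  have nt : 0 < n.+1%:R * t by rewrite mulr_gt0.
  have nt2 : 0 < 1 + (n.+1%:R * t) ^+ 2 by rewrite ltr_pwDl ?sqr_ge0.
  have -> : 1 - Psi (n.+1%:R * t + 0) = (1 + (n.+1%:R * t) ^+ 2)^-1.
    rewrite /Psi addr0 max_l ?(ltW nt)//; move: nt2; set a := n.+1%:R * t => nt2.
    by field; rewrite gt_eqF.
  rewrite ger0_norm ?invr_ge0 ?(ltW nt2)// exprVn -invfM lef_pV2 ?posrE//; last first.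
    by rewrite mulr_gt0// exprn_gt0.
  rewrite exprMn mulrC (le_trans _ (_ : n.+1%:R ^+ 2 * t ^+ 2 <= _))//; last by rewrite lerDr.
  by rewrite ler_wpM2r ?sqr_ge0// expr2 ler_peMr// ler1n.
apply/cvgrPdist_le => e e0.
have c0 : t^-1 ^+ 2 * n.+1%:R^-1 @[n --> \oo] --> t^-1 ^+ 2 * 0.
  by apply: cvgM; [exact: cvg_cst|exact: cvg_harmonic].
rewrite mulr0 in c0; near=> n; apply: le_trans (H n) _.
by near: n; exact: (cvgr_le _ c0 _ e0).
Unshelve. all: by end_near. Qed.

(** Test with Psi (n z), an approximation of the indicator of {z > 0}: the gradient term is
    nonnegative, and Fatou's lemma yields the integrability of V z, of which the form domain
    controls only the quadratic version. *)
Lemma sol_L1 al f z : 0 < al -> sol al f z -> zo O f ->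
  {ae leb, forall x, 0 <= f x} ->
  intg leb (fun x => (Vr x + al) * z x) /\ I (fun x => (Vr x + al) * z x) <= I f.
Proof.
move=> al0 Sz f0 fpos; have [g [Hz Lf E]] := Sz; have zpos := sol_ge0 al0 Sz fpos.
have mz := Hs_meas Hz; have iF := L2_zo_intg rO f0 Lf.
pose p n x := Psi (n.+1%:R * z x + 0).
have Hp n : Hs (p n) _ := Hs_chain (aPn n) Hz.
have zp n x : 0 <= z x * p n x.
  by have := Psi_mul_ge0 (n.+1%:R * z x); rewrite -mulrA pmulr_rge0// /p addr0.
have izp n : intg leb (fun x => (Vr x + al) * (z x * p n x)).
  have [_ iz _] := Hz; have [_ ip _] := Hp n.
  have := intgD (Vprod_intg mz (Hs_meas (Hp n)) iz ip) (intgZ al (L2M (HsL2 Hz) (HsL2 (Hp n)))).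
  by apply: eq_intg => x; rewrite mulrDl.
apply: (@Rint_fatou _ _ _ _ (fun n x => (Vr x + al) * (z x * p n x))) => //.
- by move=> n x; rewrite mulr_ge0 ?addr_ge0 ?(ltW al0).
- by apply: measurable_funM => //; exact: measurable_funD.
- apply: filterS zpos => x zx.
  apply: cvgM; first exact: cvg_cst.
  have [z0|z0|z0] := ltgtP 0 (z x); last 2 first.
  + by move: zx; rewrite leNgt z0.
  + by rewrite -z0; under eq_fun do rewrite mul0r; exact: cvg_cst.
  by rewrite -[X in _ --> X]mulr1; apply: cvgM; [exact: cvg_cst|exact: Psi_cvg1].
move=> n; apply: (@le_trans _ _ (I (fun x => f x * p n x))).
  rewrite -(E _ _ (Hp n)); apply: Rint_le => // [|x]; first exact: en_intg.
  rewrite lerDl; apply: sumr_ge0 => i _; rewrite mulrCA -expr2 mulr_ge0 ?sqr_ge0//.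
  by rewrite mulr_ge0// dPsi_ge0.
apply: ae_Rint_le => //; first exact: L2M Lf (HsL2 (Hp n)).
by apply: filterS fpos => x fx; rewrite ler_piMr// Psi_le1.
Qed.

End Energy.

(** * Variational against distributional solutions *)

Section Energy_distributions.
Context {R : realType} {N : nat}.
Local Notation leb := (@lebesgue_rV R N).
Local Notation I f := (Rintegral leb setT f).
Local Notation L2 := (L2 leb).
Variables (O : set 'rV[R]_N) (r0 : R) (Vr : 'rV[R]_N -> R) (Y : set 'rV[R]_N).
Hypotheses (oO : open O) (rO : forall x, O x -> `|x| < r0).
Hypotheses (mV : measurable_fun setT Vr) (V0 : forall x, 0 <= Vr x).
Local Notation S1 := (S1 O).
Local Notation S2 := (S2 O).
Local Notation Hs := (Hs O Vr Y).
Local Notation af := (af Vr).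
Local Notation sol := (sol O Vr Y).
Implicit Types (z p f phi : 'rV[R]_N -> R) (g h : 'I_N -> 'rV[R]_N -> R) (al t : R).

Lemma cvg_le_bound (u : nat -> R) (l C : R) : u n @[n --> \oo] --> l -> (forall n, u n <= C) -> l <= C.
Proof.
move=> cu uC; rewrite -(cvg_lim _ cu)//; apply: limr_le; first exact: cvgP cu.
exact: nearW.
Qed.

Lemma norm_diff3 (s1 s2 s3 t1 t2 t3 b1 b2 b3 : R) : `|s1 - t1| <= b1 -> `|s2 - t2| <= b2 ->
  `|s3 - t3| <= b3 -> `|s1 + s2 - s3 - (t1 + t2 - t3)| <= b1 + b2 + b3.
Proof.
move=> h1 h2 h3.
have -> : s1 + s2 - s3 - (t1 + t2 - t3) = (s1 - t1) + (s2 - t2) - (s3 - t3) by ring.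
by rewrite (le_trans (ler_normB _ _))// lerD// (le_trans (ler_normD _ _))// lerD.
Qed.

Lemma af_shift al be z g p h : Hs z g -> Hs p h ->
  af (al + be) z g p h = af al z g p h + be * I (fun x => z x * p x).
Proof.
move=> Hz Hp; have izp := L2M (HsL2 Hz) (HsL2 Hp).
rewrite -RintZ// -RintD//; [|exact: (en_intg mV V0 al Hz Hp)|exact: intgZ].
by congr Rintegral; apply/funext => x; rewrite /en; ring.
Qed.

Lemma sol_resolvent al be f z y : sol (al + be) f z -> sol al (fun x => be * z x) y ->
  sol al f (fun x => z x + y x).
Proof.
move=> [g [Hz Lf E]] [k [Hy Lz E']]; exists (fun i x => g i x + 1 * k i x); split=> //.
  have := Hs_lin mV V0 1 Hz Hy; congr Hs; apply/funext => x; by rewrite mul1r.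
move=> p h Hp.
have -> : (fun x => z x + y x) = (fun x => z x + 1 * y x) by apply/funext => x; rewrite mul1r.
rewrite (af_lin mV V0 al 1 Hz Hy Hp) (E' _ _ Hp).
have := af_shift al be Hz Hp; rewrite (E _ _ Hp) => ->; rewrite mul1r; congr (_ + _).
rewrite -RintZ; last exact: L2M (HsL2 Hz) (HsL2 Hp).
by congr Rintegral; apply/funext => x; rewrite mulrA.
Qed.

(** A representative bounded at every point can serve as a source in turn; a <= 0 <= b keeps it
    equal to zero outside O. *)
Lemma sol_clip al f z (a b : R) : 0 < al -> a <= 0 <= b -> sol al f z ->
  {ae leb, forall x, f x <= al * b} -> {ae leb, forall x, al * a <= f x} ->
  exists2 z', sol al f z' & forall x, a <= z' x <= b.
Proof.
move=> al0 /andP[a0 b0] Sz fb fa; have zb := sol_le rO mV V0 al0 (mulr_ge0 (ltW al0) b0) Sz fb.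
have Sn := sol_lin mV V0 (-1) (sol0 O Vr Y al) Sz.
have za := sol_le rO mV V0 al0 (_ : 0 <= al * - a) Sn _.
have {}za : {ae leb, forall x, 0 + -1 * z x <= al * - a / al}.
  apply: za; first by rewrite mulr_ge0 ?(ltW al0)// oppr_ge0.
  by apply: filterS fa => x h; rewrite add0r mulN1r mulrN lerN2.
have E : {ae leb, forall x, z x = Num.max a (Num.min (z x) b)}.
  apply: filterS2 zb za => x; rewrite mulrAC divff ?gt_eqF// mul1r => h1.
  rewrite mulrAC divff ?gt_eqF// mul1r add0r mulN1r lerN2 => h2.
  by rewrite min_l// max_r.
exists (fun x => Num.max a (Num.min (z x) b)).
  have mz := sol_meas Sz; have [g [Hz [mf _] _]] := Sz.
  apply: (sol_ae mV V0 Sz mf) E; first exact: aeW.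
    by apply: measurable_maxr => //; exact: measurable_minr.
  by move=> x nO; rewrite (sol_zo Sz nO) (min_l b0) (max_r a0).
by move=> x; rewrite le_max lexx/= ge_max (le_trans a0 b0) ge_min lexx orbT.
Qed.

(** Theta (n t) / n tends to the positive part and its derivative Psi (n t) to the indicator of {t >
    0}; the summand 0 is the shape produced by [adm_aff]. *)
Lemma adm_scaled_Theta n : adm (fun t : R => n.+1%:R^-1 * Theta (n.+1%:R * t + 0))
  (fun t => Psi (n.+1%:R * t + 0)) (1 + n.+1%:R).
Proof.
have n0 : n.+1%:R != 0 :> R by rewrite pnatr_eq0.
have := admZ n.+1%:R^-1 (adm_aff n.+1%:R (Theta0 (lexx 0)) (@adm_Theta R)).
congr adm; first by apply/funext => t; rewrite mulrA mulVf// mul1r.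
have np : 0 < n.+1%:R :> R by [].
rewrite mul1r !ger0_norm ?invr_ge0 ?ler0n//; field.
by rewrite -natr1 addrC in n0 *.
Qed.

Lemma Theta_scaled_le n (t : R) : `|n.+1%:R^-1 * Theta (n.+1%:R * t + 0)| <= `|t|.
Proof.
have n0 : 0 < n.+1%:R :> R by [].
rewrite addr0 normrM ger0_norm ?invr_ge0 ?(ltW n0)// mulrC ler_pdivrMr//.
rewrite ger0_norm ?Theta_ge0//; have [t0|t0] := leP 0 t.
  by rewrite (le_trans (Theta_le _)) ?mulr_ge0 ?ler0n// mulrC ger0_norm.
by rewrite Theta0 ?mulr_ge0// mulr_ge0_le0 ?ler0n// ltW.
Qed.

Lemma Theta_scaled_cvg (t : R) : 0 <= t ->
  n.+1%:R^-1 * Theta (n.+1%:R * t + 0) @[n --> \oo] --> t.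
Proof.
move=> t0; have H n : `|t - n.+1%:R^-1 * Theta (n.+1%:R * t + 0)| <= 2 * n.+1%:R^-1.
  have n0 : 0 < n.+1%:R :> R by [].
  have nt0 : 0 <= n.+1%:R * t by rewrite mulr_ge0 ?ler0n.
  have -> : t - n.+1%:R^-1 * Theta (n.+1%:R * t + 0) =
      n.+1%:R^-1 * (n.+1%:R * t - Theta (n.+1%:R * t)).
    by rewrite addr0 [RHS]mulrBr [_^-1 * (_ * t)]mulrA mulVf ?gt_eqF// mul1r.
  rewrite normrM ger0_norm ?invr_ge0 ?ler0n// mulrC ler_wpM2r ?invr_ge0 ?ler0n//.
  by rewrite ger0_norm ?Theta_gap// subr_ge0 Theta_le.
apply/cvgrPdist_le => e e0.
have c0 : 2 * n.+1%:R^-1 @[n --> \oo] --> 2 * (0 : R).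
  by apply: cvgM; [exact: cvg_cst|exact: cvg_harmonic].
rewrite mulr0 in c0; near=> n; apply: le_trans (H n) _.
by near: n; exact: (cvgr_le _ c0 _ e0).
Unshelve. all: by end_near. Qed.

(** Test with phi Psi (n z), which lies in the form domain even when phi does not. The nonnegative
    term phi n dPsi (n z) |grad z|^2 is discarded; its limit, together with f phi on {z = 0},
    accounts for the defect. *)
Lemma sol_distr_le al f z phi : 0 < al -> sol al f z -> zo O f ->
  {ae leb, forall x, 0 <= f x} -> test_function O phi -> (forall x, 0 <= phi x) ->
  I (fun x => (Vr x + al) * z x * phi x) - I (fun x => z x * laplacian phi x) <=
  I (fun x => f x * phi x).
Proof.
move=> al0 Sz f0 fpos tphi phi0; have [g [Hz Lf E]] := Sz.
have [iVz _] := sol_L1 rO mV V0 al0 Sz f0 fpos.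
have zpos := sol_ge0 rO mV V0 al0 Sz fpos.
have mz := Hs_meas Hz; have iz := Hs_intg rO Hz.
have sphi := test_smooth tphi; have cphi := csuppT (test_csupp tphi).
have Cphi := smooth_C1 sphi; have [cp cdp _] := Cphi.
have [C1 C10 HC1] := csupp_bounded cp cphi.
have [C2 HC2] : exists C2, forall i x, `|partial i phi x| <= C2.
  have /choice[c Hc] : forall i, exists C, forall x, `|partial i phi x| <= C.
    by move=> i; have [C HC] := csupp_smooth_bound i sphi cphi; exists C => x; have [] := HC x.
  exists (\sum_i `|c i|) => i x; rewrite (le_trans (Hc i x))// (bigD1 i)//= (le_trans (ler_norm _))//.
  by rewrite lerDl sumr_ge0.
pose C := C1 + `|C2|.
have HC x : `|phi x| <= C by rewrite (le_trans (HC1 x))// lerDl.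
have HC' i x : `|partial i phi x| <= C.
  by rewrite (le_trans (HC2 i x))// (le_trans (ler_norm _))// lerDr.
have clap : continuous (laplacian phi) by exact: laplacian_cont.
have [C3 C30 HC3] := csupp_bounded clap (laplacian_csupp sphi cphi).
have mphi := continuous_measurable_rV cp; have mlap := continuous_measurable_rV clap.
pose q n x := Psi (n.+1%:R * z x + 0).
have mq n : measurable_fun setT (q n).
  have c : continuous (fun t : R => Psi (n.+1%:R * t + 0)) by
    exact: adm_cont (adm_aff n.+1%:R (Psi0 (lexx 0)) (@adm_Psi R)).
  exact: measurableT_comp (continuous_measurable_fun c) mz.
have q1 n x : `|q n x| <= 1 by exact: Psi_norm.
pose th n x := n.+1%:R^-1 * Theta (n.+1%:R * z x + 0).
have iVzp : intg leb (fun x => (Vr x + al) * z x * phi x).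
  apply: eq_intg (intgMb mphi HC iVz) => x; exact: mulrC.
have ifp : intg leb (fun x => f x * phi x).
  apply: eq_intg (intgMb mphi HC (L2_zo_intg rO f0 Lf)) => x; exact: mulrC.
have key n : I (fun x => (Vr x + al) * z x * phi x * q n x) - I (fun x => th n x * laplacian phi x) <=
    I (fun x => f x * phi x).
  have Hq := Hs_chain mV V0 (adm_aff n.+1%:R (Psi0 (lexx 0)) (@adm_Psi R)) Hz.
  have Hp := Hs_mul mV V0 Cphi HC HC' Hq.
  have Sth := S1_chain (adm_scaled_Theta n) (S2_S1 rO (HsS2 Hz)).
  have igq i : intg leb (fun x => Psi (n.+1%:R * z x + 0) * g i x * partial i phi x).
    have [_ ig _ _ _] := Sth; apply: eq_intg (intgMb (continuous_measurable_rV (cdp i)) (HC' i) (ig i)) => x.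
    exact: mulrC.
  have iVq : intg leb (fun x => (Vr x + al) * z x * phi x * q n x).
    by apply: eq_intg (intgMb (mq n) (q1 n) iVzp) => x; exact: mulrC.
  rewrite (S1_laplacian Sth sphi) => [|i]; last exact: csupp_smooth_bound.
  rewrite opprK -Rint_sum// -RintD//; last exact: intg_sum.
  have := E _ _ Hp; rewrite /af => E1.
  apply: (@le_trans _ _ (I (fun x => f x * (phi x * q n x)))); last first.
    apply: ae_Rint_le => //; first exact: L2M Lf (HsL2 Hp).
    by apply: filterS fpos => x fx; rewrite ler_wpM2l// ler_piMr// Psi_le1.
  rewrite -E1; apply: Rint_le => [||x].
  - by apply: intgD => //; exact: intg_sum.
  - exact: (en_intg mV V0 al Hz Hp).
  rewrite /en; apply: lerD; first by rewrite /q !mulrA.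
  apply: ler_sum => i _; rewrite mulrDr.
  have -> : g i x * (partial i phi x * Psi (n.+1%:R * z x + 0)) =
    Psi (n.+1%:R * z x + 0) * g i x * partial i phi x by ring.
  rewrite lerDr; have -> : g i x * (phi x * (n.+1%:R * dPsi (n.+1%:R * z x + 0) * g i x)) =
    phi x * n.+1%:R * dPsi (n.+1%:R * z x + 0) * (g i x ^+ 2) by ring.
  by rewrite mulr_ge0 ?sqr_ge0// mulr_ge0 ?dPsi_ge0// mulr_ge0.
have c1 : I (fun x => (Vr x + al) * z x * phi x * q n x) @[n --> \oo] -->
    I (fun x => (Vr x + al) * z x * phi x).
  apply: (proj2 (@Rint_dct _ _ _ _ (fun n x => (Vr x + al) * z x * phi x * q n x) _
    (fun x => `|(Vr x + al) * z x * phi x|) _ _ _ _ _)) => //.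
  - by move=> n; apply: measurable_funM => //; exact: intg_measurable iVzp.
  - exact: intg_measurable iVzp.
  - exact: intg_norm.
  - apply: filterS zpos => x zx; have [z0|z0|z0] := ltgtP 0 (z x).
    + by rewrite -[X in _ --> X]mulr1; apply: cvgM; [exact: cvg_cst|exact: Psi_cvg1].
    + by move: zx; rewrite leNgt z0.
    + by rewrite -z0 mulr0 mul0r; under eq_fun do rewrite mul0r; exact: cvg_cst.
  - by move=> n; apply: aeW => x; rewrite normrM ler_piMr.
have c2 : I (fun x => th n x * laplacian phi x) @[n --> \oo] --> I (fun x => z x * laplacian phi x).
  have izl : intg leb (fun x => `|z x| * C3).
    by apply: eq_intg (intgZ C3 (intg_norm iz)) => x; exact: mulrC.
  apply: (proj2 (@Rint_dct _ _ _ _ (fun n x => th n x * laplacian phi x) _ (fun x => `|z x| * C3) _ _ _ _ _)) => //.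
  - move=> n; apply: measurable_funM => //.
    exact: measurableT_comp (continuous_measurable_fun (adm_cont (adm_scaled_Theta n))) mz.
  - exact: measurable_funM.
  - apply: filterS zpos => x zx; apply: cvgM; last exact: cvg_cst.
    exact: Theta_scaled_cvg.
  - by move=> n; apply: aeW => x; rewrite normrM ler_pM// Theta_scaled_le.
by apply: cvg_le_bound (cvgB c1 c2) _ => n; exact: key.
Qed.

Section Bounded_solution.
Variables (v f : 'rV[R]_N -> R) (G : 'I_N -> 'rV[R]_N -> R) (M : R).
Hypotheses (Sv : S2 v G) (vM : forall x, `|v x| <= M) (v0 : {ae leb, forall x, Y x -> v x = 0}).
Hypotheses (iVv : intg leb (fun x => Vr x * v x)) (Lf : L2 f) (f0 : zo O f)
  (fM : forall x, `|f x| <= M).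
Hypothesis (eqv : forall phi, test_function O phi ->
  I (fun x => Vr x * v x * phi x) - I (fun x => v x * laplacian phi x) = I (fun x => f x * phi x)).

Let S1v := S2_S1 rO Sv.
Let iG i : intg leb (G i). Proof. by have [] := S1v. Qed.
Let iF : intg leb f. Proof. exact (L2_zo_intg rO f0 Lf). Qed.

Let bil p h := \sum_i I (fun x => G i x * h i x) + I (fun x => Vr x * v x * p x) -
  I (fun x => f x * p x).

Let intgMr (a h : 'rV[R]_N -> R) (C : R) : intg leb a -> measurable_fun setT h ->
  (forall x, `|h x| <= C) -> intg leb (fun x => a x * h x).
Proof. by move=> ia mh hC; apply: eq_intg (intgMb mh hC ia) => x; exact: mulrC. Qed.

Let bil_C1c phi : C1c O phi -> bil phi (fun i => partial i phi) = 0.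
Proof.
move=> Cp; apply/eqP; rewrite -normr_le0; apply/ler_addgt0Pr => e e0; rewrite add0r.
pose A := \sum_i I (fun x => `|G i x|) + I (fun x => `|Vr x * v x|) + I (fun x => `|f x|).
have A0 : 0 <= A.
  by rewrite !addr_ge0 ?Rint_ge0// sumr_ge0// => i _; apply: Rint_ge0.
have A1 : 0 < A + 1 by rewrite ltr_wpDl.
have [f' [tf' f1 f2 _]] := C1c_test oO rO Cp (divr_gt0 e0 A1).
have E0 : bil f' (fun i => partial i f') = 0.
  have := eqv tf'; rewrite (S1_laplacian S1v (test_smooth tf')) => [H|i]; last first.
    exact: csupp_smooth_bound (test_smooth tf') (csuppT (test_csupp tf')).
  by rewrite /bil -H; ring.
have Cf' := test_C1c tf'.
have [Ca _ HCa] := csupp_bounded (C1c_cont Cp) (proj2 Cp).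
have [Cb _ HCb] := csupp_bounded (C1c_cont Cf') (proj2 Cf').
have mphi := continuous_measurable_rV (C1c_cont Cp).
have mf' := continuous_measurable_rV (C1c_cont Cf').
have key (a b c : 'rV[R]_N -> R) : intg leb a -> continuous b -> csupp O b ->
   continuous c -> csupp O c -> (forall x, `|c x - b x| <= e / (A + 1)) ->
   `|I (fun x => a x * b x) - I (fun x => a x * c x)| <= e / (A + 1) * I (fun x => `|a x|).
  move=> ia cb sb cc sc bc.
  have [Cb' _ HCb'] := csupp_bounded cb sb; have [Cc' _ HCc'] := csupp_bounded cc sc.
  have i1 := intgMr ia (continuous_measurable_rV cb) HCb'.
  have i2 := intgMr ia (continuous_measurable_rV cc) HCc'.
  rewrite -RintB// -RintZ; last exact: intg_norm.
  apply: le_trans (Rint_norm (intgB i1 i2)) _; apply: Rint_le => [||x].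
  - exact/intg_norm/intgB.
  - exact/intgZ/intg_norm.
  by rewrite -mulrBr normrM mulrC distrC ler_wpM2r.
rewrite -(subr0 (bil _ _)) -E0 /bil.
apply: (@le_trans _ _ (e / (A + 1) * A)).
  rewrite /A mulrDr mulrDr; apply: norm_diff3; last 2 first.
  - exact: key iVv (C1c_cont Cp) (proj2 Cp) (C1c_cont Cf') (proj2 Cf') f1.
  - exact: key iF (C1c_cont Cp) (proj2 Cp) (C1c_cont Cf') (proj2 Cf') f1.
  rewrite -sumrB mulr_sumr; apply: le_trans (ler_norm_sum _ _ _) _.
  apply: ler_sum => i _.
  exact: key (iG i) (C1c_pcont (i := i) Cp) (C1c_pcsupp i Cp) (C1c_pcont (i := i) Cf') (C1c_pcsupp i Cf') (f2 i).
by rewrite mulrAC ler_pdivrMr// ler_wpM2l ?(ltW e0)// lerDl.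
Qed.

Let bil_bounded p h (C : R) : Hs p h -> 0 < C -> (forall x, `|p x| <= C) -> bil p h = 0.
Proof.
move=> Hp C0 pC; apply/eqP; rewrite -normr_le0; apply/ler_addgt0Pr => e e0; rewrite add0r.
(* C T (t / C) is the identity on [-C, C] and bounded by 3 C: it makes the C^1 approximants of p
   uniformly bounded, as required by the factor V v, which is only integrable. *)
have [T [dT [L [aT T3 T1]]]] := @truncation R.
have T0 : T 0 = 0 by have [] := aT.
have aP := admZ C (adm_aff C^-1 T0 aT).
have C1 t : `|t| <= C -> `|C^-1 * t + 0| <= 1.
  by move=> tC; rewrite addr0 normrM ger0_norm ?invr_ge0 ?(ltW C0)// mulrC ler_pdivrMr// mul1r.
have PE x : C * T (C^-1 * p x + 0) = p x.
  by have [-> _] := T1 _ (C1 _ (pC x)); rewrite addr0 mulrA divff ?mul1r// gt_eqF.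
have dPE x : C * (C^-1 * dT (C^-1 * p x + 0)) = 1.
  by have [_ ->] := T1 _ (C1 _ (pC x)); rewrite mulr1 divff// gt_eqF.
have e30 : 0 < e / 3 by rewrite divr_gt0.
have eN : 0 < e / 3 / (N%:R + 1) by rewrite divr_gt0// ltr_wpDl.
have [d1 d10 H1] : exists2 d, 0 < d & forall i k, L2 k -> I (fun x => k x ^+ 2) < d ->
    I (fun x => `|k x * G i x|) < e / 3 / (N%:R + 1).
  apply: (@fin_small _ _ (fun i d => forall k, L2 k -> I (fun x => k x ^+ 2) < d ->
    I (fun x => `|k x * G i x|) < e / 3 / (N%:R + 1))).
    by move=> i; apply: L2_weight => //; have [_ LG _ _ _] := Sv.
  by move=> i d d' _ dd' H k Lk kd; apply: H => //; exact: lt_le_trans dd'.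
have [d2 d20 H2] := bounded_L1_weight (3 * C + C) iVv e30.
have [d3 d30 H3] := L2_L1 rO d20.
have [d4 d40 H4] := L2_weight Lf e30.
pose d := Num.min d1 (Num.min d3 d4).
have d0 : 0 < d by rewrite !lt_min d10 d30.
have [k [Ck _ kz kg]] := S2_chain_appr aP (HsS2 Hp) d0.
have [Cphi _] := C1c_adm aP Ck; set phi := fun x => C * T (C^-1 * k x + 0) in Cphi kz kg.
have phip : I (fun x => (phi x - p x) ^+ 2) < d.
  by apply: le_lt_trans kz; rewrite le_eqVlt; apply/orP; left; apply/eqP; congr Rintegral;
    apply/funext => x; rewrite PE.
have dphip i : I (fun x => (partial i phi x - h i x) ^+ 2) < d.
  apply: le_lt_trans (kg i); rewrite le_eqVlt; apply/orP; left; apply/eqP; congr Rintegral.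
  by apply/funext => x; rewrite dPE mul1r.
have Lphi := C1c_L2 Cphi; have Lp := HsL2 Hp.
have Ld := L2B Lphi Lp; have Ldg i := L2B (C1c_pL2 i Cphi) (HsL2g i Hp).
have zd : zo O (fun x => phi x - p x) by exact: zoB (csupp_zo (proj2 Cphi)) (Hs_zo Hp).
have phiC x : `|phi x| <= 3 * C.
  by rewrite /phi normrM ger0_norm ?(ltW C0)// mulrC ler_wpM2r ?(ltW C0).
have dC x : `|phi x - p x| <= 3 * C + C by rewrite (le_trans (ler_normB _ _))// lerD.
move: phip; rewrite /d !lt_min => /and3P[p1 p3 p4].
have k2 : `|I (fun x => Vr x * v x * p x) - I (fun x => Vr x * v x * phi x)| <= e / 3.
  have i1 := intgMr iVv (Hs_meas Hp) pC.
  have i2 := intgMr iVv (proj1 Lphi) phiC.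
  rewrite -RintB//; apply: le_trans (Rint_norm (intgB i1 i2)) _; apply: ltW.
  apply: le_lt_trans (H2 (fun x => phi x - p x) _ dC _).
  - rewrite le_eqVlt; apply/orP; left; apply/eqP; congr Rintegral; apply/funext => x.
    by rewrite -normrN; congr (`|_|); ring.
  - exact (L2_zo_intg rO zd Ld).
  - exact: H3.
have k3 : `|I (fun x => f x * p x) - I (fun x => f x * phi x)| <= e / 3.
  have i1 := L2M Lf Lp; have i2 := L2M Lf Lphi.
  rewrite -RintB//; apply: le_trans (Rint_norm (intgB i1 i2)) _; apply: ltW.
  apply: le_lt_trans (H4 _ Ld p4).
  rewrite le_eqVlt; apply/orP; left; apply/eqP; congr Rintegral; apply/funext => x.
  by rewrite -normrN; congr (`|_|); ring.
have k1 i : `|I (fun x => G i x * h i x) - I (fun x => G i x * partial i phi x)| <= e / 3 / (N%:R + 1).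
  have [_ LG _ _ _] := Sv.
  have i1 := L2M (LG i) (HsL2g i Hp); have i2 := L2M (LG i) (C1c_pL2 i Cphi).
  rewrite -RintB//; apply: le_trans (Rint_norm (intgB i1 i2)) _; apply: ltW.
  have := dphip i; rewrite /d !lt_min => /and3P[q1 _ _].
  apply: le_lt_trans (H1 i _ (Ldg i) q1).
  rewrite le_eqVlt; apply/orP; left; apply/eqP; congr Rintegral; apply/funext => x.
  by rewrite -normrN; congr (`|_|); ring.
rewrite -(subr0 (bil _ _)) -(bil_C1c Cphi) /bil.
apply: (@le_trans _ _ (e / 3 + e / 3 + e / 3)); last by lra.
apply: norm_diff3 k2 k3.
rewrite -sumrB; apply: le_trans (ler_norm_sum _ _ _) _.
apply: (@le_trans _ _ (\sum_(i < N) e / 3 / (N%:R + 1))); first by apply: ler_sum => i _; exact: k1.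
rewrite sumr_const card_ord -[leLHS]mulr_natl [leLHS]mulrCA ler_piMr ?(ltW e30)//.
by rewrite ler_pdivrMr ?ltr_wpDl// mul1r lerDl.
Qed.

(** A bounded solution of the distributional equation can be tested with bounded elements of the
    form domain. Its difference with the clipped variational solution is such an element, so
    uniqueness applies. The shift 1 is compensated by v on the right-hand side. *)
Lemma bounded_solution : sol 1 (fun x => f x + v x) v.
Proof.
have [Lv LG vz Gz _] := Sv; have mv := proj1 Lv.
have M0 : 0 <= M by exact: le_trans (vM 0).
have Hv : Hs v G.
  split=> //; apply: (intg_le (g := fun x => M * `|Vr x * v x|)).
  - by apply: measurable_funM => //; under eq_fun do rewrite expr2; exact: measurable_funM.
  - move=> x; rewrite (Vsq_norm V0) normrM (ger0_norm (V0 x)) [leRHS]mulrCA ler_wpM2l//.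
    by rewrite -(real_normK (num_real (v x))) expr2 ler_wpM2r.
  - exact/intgZ/intg_norm.
have Lfv := L2D Lf Lv; have [z0 Sz0] := sol_ex Y rO mV V0 ltr01 Lfv.
have fvM x : `|f x + v x| <= 1 * (M + M) by rewrite mul1r (le_trans (ler_normD _ _))// lerD.
have [z Sz zM] : exists2 z, sol 1 (fun x => f x + v x) z & forall x, - (M + M) <= z x <= M + M.
  apply: sol_clip Sz0 _ _ => //; first by rewrite oppr_le0 addr_ge0.
    by apply: aeW => x; exact: le_trans (ler_norm _) (fvM x).
  apply: aeW => x; have := fvM x; rewrite ler_norml => /andP[+ _].
  by rewrite !mul1r.
have [g [Hz _ E]] := Sz.
have Hd := Hs_lin mV V0 (-1) Hv Hz.
set d := fun x => v x + -1 * z x in Hd; set k := fun i x => _ in Hd.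
have dM x : `|d x| <= M + (M + M) + 1.
  have zx : `|z x| <= M + M by rewrite ler_norml.
  rewrite /d mulN1r (le_trans (ler_normB _ _))// -addrA lerD//.
  by rewrite (le_trans zx)// lerDl.
have B0 := bil_bounded Hd (_ : 0 < _) dM.
have {}B0 : bil d k = 0 by apply: B0; rewrite ltr_wpDl// !addr_ge0.
have Av : af 1 v G d k = I (fun x => (f x + v x) * d x).
  have iVd : intg leb (fun x => Vr x * v x * d x) by exact: intgMr iVv (Hs_meas Hd) dM.
  have ivd := L2M Lv (HsL2 Hd); have ifd := L2M Lf (HsL2 Hd).
  have igk i := L2M (LG i) (HsL2g i Hd).
  have -> : I (fun x => (f x + v x) * d x) = I (fun x => f x * d x) + I (fun x => v x * d x).
    by rewrite -RintD//; congr Rintegral; apply/funext => x; ring.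
  have -> : af 1 v G d k = \sum_i I (fun x => G i x * k i x) + I (fun x => Vr x * v x * d x) +
      I (fun x => v x * d x).
    rewrite -Rint_sum// -RintD//; last exact: intg_sum.
    rewrite -RintD//; last by apply: intgD => //; exact: intg_sum.
    by congr Rintegral; apply/funext => x; rewrite /en; ring.
  by move/eqP: B0; rewrite /bil subr_eq0 => /eqP ->.
have Qd : af 1 d k d k <= 0.
  by rewrite (af_lin mV V0 1 (-1) Hv Hz Hd) Av (E _ _ Hd) mulN1r subrr.
have zv : {ae leb, forall x, z x = v x}.
  have := af_eq0 mV V0 ltr01 Hd Qd; apply: filterS => x; rewrite /d mulN1r => /eqP.
  by rewrite subr_eq0 => /eqP ->.
apply: (sol_ae mV V0 Sz) zv => //; last exact: aeW.
exact: (proj1 Lfv).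
Qed.

End Bounded_solution.

End Energy_distributions.

(** * Kato's inequality and the comparison principle *)

Section Kato.
Context {R : realType} {N : nat}.
Local Notation leb := (@lebesgue_rV R N).
Local Notation I f := (Rintegral leb setT f).
Variables (O : set 'rV[R]_N) (r0 : R) (W z : 'rV[R]_N -> R) (g : 'I_N -> 'rV[R]_N -> R).
Hypotheses (oO : open O) (rO : forall x, O x -> `|x| < r0).
Hypotheses (W0 : forall x, 0 <= W x) (Sz : S1 O z g) (iWz : intg leb (fun x => W x * z x)).
Hypothesis super : forall phi, test_function O phi -> (forall x, 0 <= phi x) ->
  0 <= I (fun x => W x * z x * phi x) - I (fun x => z x * laplacian phi x).

Let iz : intg leb z. Proof. by have [] := Sz. Qed.
Let ig i : intg leb (g i). Proof. by have [] := Sz. Qed.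
Let offz : exists r, off r z.
Proof. by exists r0; apply: (zo_off rO); have [_ _ z0 _ _] := Sz. Qed.
Let offg i : exists r, off r (g i).
Proof. by exists r0; apply: (zo_off rO); have [_ _ _ g0 _] := Sz. Qed.
Let zs s := conv (K s) z.
Let gs s i := conv (K s) (g i).

Let aN : adm (fun t : R => Psi (-1 * t + 0)) (fun t => -1 * dPsi (-1 * t + 0)) _ :=
  adm_aff (-1) (Psi0 (lexx 0)) (@adm_Psi R).
Let P t : R := Psi (-1 * t + 0).
Let P01 t : 0 <= P t <= 1. Proof. by rewrite /P Psi_ge0 Psi_le1. Qed.
Let P_norm t : `|P t| <= 1. Proof. exact: Psi_norm. Qed.
Let P_lip s t : `|P s - P t| <= `|s - t|.
Proof.
rewrite /P !addr0 !mulN1r; apply: le_trans (Psi_lip _ _) _.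
by rewrite opprK addrC distrC.
Qed.
Let cP : continuous P. Proof. exact: adm_cont aN. Qed.
Let mP : measurable_fun setT P. Proof. exact: continuous_measurable_fun. Qed.

Section fixed_test.
Variable phi : 'rV[R]_N -> R.
Hypotheses (Cphi : C1c O phi) (phi0 : forall x, 0 <= phi x).

Let eta s x := phi x * P (zs s x).

Let C1eta s : 0 < s -> C1g (eta s)
  (fun i x => phi x * (-1 * dPsi (-1 * zs s x + 0) * gs s i x) + P (zs s x) * partial i phi x).
Proof.
move=> s0; have [_ dP _ _] := aN.
exact: C1gM (proj1 Cphi) (C1g_comp (adm_dcont aN) dP (convK_C1g Sz s0)).
Qed.

Let Ceta s : 0 < s -> C1c O (eta s).
Proof. by move=> s0; split; [exact: C1gW (C1eta s0)|exact: csuppM (proj2 Cphi)]. Qed.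

Let eta0 s x : 0 <= eta s x.
Proof. by rewrite mulr_ge0//; have /andP[] := P01 (zs s x). Qed.

(** The test function is the mollification of phi P (z_s), where z_s is itself a mollification of z.
    Moving the outer one onto the gradient of z makes |grad z_s|^2 appear, with a sign that allows
    it to be dropped. *)
Let kato_s : exists2 d : R, 0 < d & forall s, 0 < s < d ->
  0 <= I (fun x => W x * z x * conv (K s) (eta s) x) +
       \sum_i I (fun x => P (zs s x) * gs s i x * partial i phi x).
Proof.
have [K0 [cK KO Kf]] := proj2 Cphi.
have [d d0 dH] := compact_open_dist cK oO KO; exists d => // s /andP[s0 sd].
have Se := S2_S1 rO (C1c_S2 (Ceta s0)); have ie := C1c_intg (Ceta s0).
have cKs := @K_cont R N s; have sKs := K_csuppT (N := N) s0.
have tf : test_function O (conv (K s) (eta s)).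
  apply: csupp_test; first exact: conv_smooth (@K_smooth R N s) sKs ie.
  pose L := [set x : 'rV[R]_N | exists2 y, K0 y & `|x - y| <= s].
  have LO : closure L `<=` O.
    move=> x clx; have [y [[k Kk yk] xy]] : L `&` ball x (d - s) !=set0.
      by apply: clx; apply: nbhsx_ballx; rewrite subr_gt0.
    apply: (dH k Kk); rewrite -ball_normE /=.
    rewrite (_ : k - x = - (y - k) - (x - y)); last by rewrite !opprB addrA subrK.
    move: xy; rewrite -ball_normE /= => xy.
    by rewrite (le_lt_trans (ler_normB _ _))// normrN; lra.
  exists (closure L); split=> //.
    have bL : closure L `<=` [set x : 'rV[R]_N | `|x - 0| <= r0].
      by move=> x /LO /rO /ltW /=; rewrite subr0.
    have bc := @closed_ball_compact R N 0 r0.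
    by apply: subclosed_compact bc bL; exact: closed_closure.
  move=> x nL; rewrite -[RHS](Rint0 leb); congr Rintegral; apply/funext => y.
  have [Ky|/Kf E] := pselect (K0 y); last by rewrite /eta E mul0r mulr0.
  rewrite K_off ?mul0r// leNgt; apply/negP => xy; apply: nL; apply: subset_closure.
  by exists y => //; exact: ltW.
have := super tf (fun x => conv_ge0 x cKs sKs ie (fun y => K_ge0 y s0) (aeW _ (eta0 s))).
rewrite (S1_laplacian Sz (test_smooth tf)) => [|i]; last first.
  exact: csupp_smooth_bound (test_smooth tf) (csuppT (test_csupp tf)).
rewrite opprK => H; apply: le_trans H _; rewrite lerD2l.
apply: ler_sum => i _; rewrite (C1gE i (convK_C1g Se s0)).
have ipe := C1c_pintg i (Ceta s0).
rewrite (conv_swap (a := g i) cKs sKs ipe (ig i) (fun x => KN s x)) -/(gs s i).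
have cg := conv_continuous cKs sKs (ig i).
have cgs : continuous (gs s i) := cg.
have czs : continuous (zs s) := conv_continuous cKs sKs iz.
have [Cb Cb0 HCb] : exists2 C, 0 <= C & forall x, `|gs s i x| <= C.
  have [off_r off_g] := offg i.
  exact: csupp_bounded cgs (off_csupp (conv_off off_g (K_off s0))).
apply: Rint_le => [||x].
- apply: eq_intg (intgMb (continuous_measurable_rV cgs) HCb ipe) => x; exact: mulrC.
- have Pz1 x : `|P (zs s x) * gs s i x| <= Cb.
    by rewrite normrM -[leRHS]mul1r ler_pM.
  apply: intgMb Pz1 (C1c_pintg i Cphi).
  apply: continuous_measurable_rV; apply: contM => //; exact: cont_comp czs cP.
rewrite (C1gE i (C1eta s0)) mulrDl.
have -> : phi x * (-1 * dPsi (-1 * zs s x + 0) * gs s i x) * gs s i x =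
  - (phi x * dPsi (-1 * zs s x + 0) * gs s i x ^+ 2) by ring.
have -> : P (zs s x) * partial i phi x * gs s i x = P (zs s x) * gs s i x * partial i phi x by ring.
by rewrite addrC gerBl mulr_ge0 ?sqr_ge0// mulr_ge0// dPsi_ge0.
Qed.

Let C1b : exists2 C, 0 <= C & forall x, `|phi x| <= C.
Proof. exact: csupp_bounded (C1c_cont Cphi) (proj2 Cphi). Qed.

(** Since - P (z) g is the gradient of Theta (- z), this says that Theta (- z) is subharmonic in O.
    The potential contributes W z P (z) <= 0, because P vanishes on nonnegative numbers. With z
    merely in W_0^{1,1}, the function phi P (z) cannot be used as a test function, hence the
    mollification. *)
Lemma kato : 0 <= \sum_i I (fun x => P (z x) * g i x * partial i phi x).
Proof.
apply/ler_addgt0Pr => e e0.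
have e20 : 0 < e / 2 by rewrite divr_gt0.
have [d0 d00 H0] := kato_s.
have [C C0 HC] := C1b; have mz := intg_measurable iz.
have mPz : measurable_fun setT (fun x => P (z x)) by exact: measurableT_comp.
have [apz apg] := S1_appr rO Sz.
pose e0' x := phi x * P (z x).
have mphi := continuous_measurable_rV (C1c_cont Cphi).
have me0 : measurable_fun setT e0' by exact: measurable_funM.
have e0C x : `|e0' x| <= C by rewrite normrM -[leRHS]mulr1 ler_pM.
have S0 : S1 O (fun x => P (z x)) _ := S1_chain aN Sz.
have ie0 : intg leb e0' by exact: intgMb mphi HC (let: And5 h _ _ _ _ := S0 in h).
have offe : exists r, off r e0'.
  have [r rz] := offz; exists r => x rx; rewrite /e0' rz// /P mulr0 add0r.
  by rewrite Psi0// mulr0.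
have ape : appr e0'.
  split=> // t t0; have C10 : 0 < C + 1 by rewrite ltr_wpDl.
  have [f [Cf fz _]] : exists f, [/\ C1c O f, I (fun x => `|f x - P (z x)|) < t / (C + 1) & True].
    by have [_ _ _ _ H] := S0; have [f [? ? _]] := H _ (divr_gt0 t0 C10); exists f.
  exists (fun x => phi x * f x); split.
  - exact: contM (C1c_cont Cphi) (C1c_cont Cf).
  - exact: csuppM (csuppT (proj2 Cphi)).
  have iPz : intg leb (fun x => P (z x)) by have [] := S0.
  have ifz := intg_norm (intgB (C1c_intg Cf) iPz).
  apply: (@le_lt_trans _ _ ((C + 1) * I (fun x => `|f x - P (z x)|))); last by rewrite mulrC -ltr_pdivlMr.
  rewrite -RintZ//; apply: Rint_le => [||x].
  - by apply/intg_norm/intgB => //; exact: intgMb mphi HC (C1c_intg Cf).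
  - exact: intgZ.
  by rewrite -mulrBr normrM distrC ler_wpM2r// (le_trans (HC x))// lerDl.
have [d1 d10 H1] := bounded_L1_weight (C + C) iWz e20.
have d120 : 0 < d1 / 2 by rewrite divr_gt0.
have [d2 d20 H2] := moll_L1 ape d120.
have dC : 0 < d1 / 2 / (C + 1) by rewrite divr_gt0// ltr_wpDl.
have [d3 d30 H3] := moll_L1 apz dC.
have /choice[Cp HCp] : forall i, exists C, forall x, `|partial i phi x| <= C.
  by move=> i; have [c _ ?] := csupp_bounded (C1c_pcont (i := i) Cphi) (C1c_pcsupp i Cphi); exists c.
pose B := \sum_i `|Cp i|; have B0 : 0 <= B by rewrite sumr_ge0.
have HB i x : `|partial i phi x| <= B.
  rewrite (le_trans (HCp i x))// (le_trans (ler_norm _))// /B (bigD1 i)//= lerDl sumr_ge0//.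
(* Each coordinate receives a share of e / 2, divided by the bound B on grad phi and then between
   two errors: the gradient and the argument of P. *)
pose t := e / 2 / (N%:R + 1) / (B + 1) / 2.
have t0 : 0 < t by rewrite !divr_gt0// ltr_wpDl.
have [d4 d40 H4] : exists2 d, 0 < d & forall i (h : 'rV[R]_N -> R), intg leb h ->
    (forall x, `|h x| <= 1 + 1) -> I (fun x => `|h x|) < d -> I (fun x => `|h x * g i x|) < t.
  apply: (@fin_small _ _ (fun i d => forall (h : 'rV[R]_N -> R), intg leb h ->
    (forall x, `|h x| <= 1 + 1) -> I (fun x => `|h x|) < d -> I (fun x => `|h x * g i x|) < t)).
    by move=> i; exact: bounded_L1_weight.
  by move=> i d d' _ dd' h k ik kL kd; apply: h => //; exact: lt_le_trans dd'.
have [d5 d50 H5] := moll_L1 apz d40.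
have [d6 d60 H6] : exists2 d, 0 < d & forall i s, 0 < s < d -> I (fun x => `|gs s i x - g i x|) < t.
  apply: (@fin_small _ _ (fun i d => forall s, 0 < s < d -> I (fun x => `|gs s i x - g i x|) < t)).
    by move=> i; exact: moll_L1.
  by move=> i d d' _ dd' H s /andP[s0 sd]; apply: H; rewrite s0 (lt_le_trans sd).
pose s := Num.min d0 (Num.min d2 (Num.min d3 (Num.min d5 d6))) / 2.
have [s0 s1] : 0 < s /\ s < Num.min d0 (Num.min d2 (Num.min d3 (Num.min d5 d6))).
  have m0 : 0 < Num.min d0 (Num.min d2 (Num.min d3 (Num.min d5 d6))) by rewrite !lt_min d00 d20 d30 d50.
  move: m0; rewrite /s; set m := Num.min _ _ => m0; split; lra.
move: s1; rewrite !lt_min => /and5P[sd0 sd2 sd3 sd5 sd6].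
have cKs := @K_cont R N s; have sKs := K_csuppT (N := N) s0.
have czs : continuous (zs s) := conv_continuous cKs sKs iz.
have izs : intg leb (zs s) by exact: convK_intg.
have mPzs : measurable_fun setT (fun x => P (zs s x)).
  by apply: continuous_measurable_rV; exact: cont_comp czs cP.
have izz : intg leb (fun x => `|zs s x - z x|) by exact/intg_norm/intgB.
have iPP : intg leb (fun x => P (zs s x) - P (z x)).
  by apply: (intg_le _ _ izz); [exact: measurable_funB|move=> x; exact: P_lip].
have offes : exists r, off r (eta s).
  by have [r _ ?] := csupp_off (proj2 (Ceta s0)); exists r.
have ies := C1c_intg (Ceta s0).
have A0 := H0 s; rewrite s0 sd0 in A0; have {}A0 := A0 isT.
have A1 : I (fun x => W x * z x * conv (K s) (eta s) x) <= e / 2.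
  pose h x := conv (K s) (eta s) x - e0' x.
  have etaC x : `|eta s x| <= C by rewrite normrM -[leRHS]mulr1 ler_pM.
  have ice := convK_intg s0 ies offes.
  have ih : intg leb h by exact: intgB.
  have hC x : `|h x| <= C + C.
    rewrite (le_trans (ler_normB _ _))// lerD//; apply: convK_norm_le => //; exact: aeW.
  have Ih : I (fun x => `|h x|) < d1.
    have idif : intg leb (fun x => eta s x - e0' x) by exact: intgB.
    have offd : exists r, off r (fun x => eta s x - e0' x).
      have [r hr] := offes; have [r' hr'] := offe; exists (Num.max r r') => x.
      by rewrite ge_max => /andP[rx rx']; rewrite hr// hr'// subrr.
    have B1 : I (fun x => `|conv (K s) (fun y => eta s y - e0' y) x|) < d1 / 2.
      apply: le_lt_trans (convK_L1 s0 idif offd) _.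
      apply: (@le_lt_trans _ _ ((C + 1) * I (fun x => `|zs s x - z x|))); last first.
        by rewrite mulrC -ltr_pdivlMr ?ltr_wpDl// H3// s0.
      rewrite -RintZ//; apply: Rint_le => [||x]; [exact: intg_norm|exact: intgZ|].
      rewrite /eta /e0' -mulrBr normrM; apply: ler_pM => //.
      by rewrite (le_trans (HC x))// lerDl.
    have B2 : I (fun x => `|conv (K s) e0' x - e0' x|) < d1 / 2 by apply: H2; rewrite s0.
    have icd := convK_intg s0 idif offd; have ice0 := convK_intg s0 ie0 offe.
    apply: (@le_lt_trans _ _ (I (fun x => `|conv (K s) (fun y => eta s y - e0' y) x|) +
      I (fun x => `|conv (K s) e0' x - e0' x|))); last by lra.
    rewrite -RintD; [|exact: intg_norm|exact/intg_norm/intgB].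
    apply: Rint_le => [||x]; first exact: intg_norm.
      by apply: intgD; [exact: intg_norm|exact/intg_norm/intgB].
    rewrite convB//; apply: le_trans (ler_normD _ _).
    rewrite le_eqVlt; apply/orP; left; apply/eqP; congr (`|_|); rewrite /h; ring.
  have iWh : intg leb (fun x => h x * (W x * z x)).
    exact: intgMb (intg_measurable ih) hC iWz.
  have iWe : intg leb (fun x => e0' x * (W x * z x)) by exact: intgMb me0 e0C iWz.
  have -> : I (fun x => W x * z x * conv (K s) (eta s) x) =
      I (fun x => h x * (W x * z x)) + I (fun x => e0' x * (W x * z x)).
    by rewrite -RintD//; congr Rintegral; apply/funext => x; rewrite /h; ring.
  rewrite -[leRHS]addr0; apply: lerD.
    by apply: le_trans (ler_norm _) _; apply: le_trans (Rint_norm iWh) _; apply/ltW/H1.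
  rewrite -oppr_ge0 -RintN//; apply: Rint_ge0 => x.
  have -> : - (e0' x * (W x * z x)) = W x * phi x * (P (z x) * - z x) by rewrite /e0'; ring.
  apply: mulr_ge0; first exact: mulr_ge0.
  by rewrite /P addr0 mulN1r mulrC; exact: Psi_mul_ge0.
have A2 i : I (fun x => P (zs s x) * gs s i x * partial i phi x) <=
    I (fun x => P (z x) * g i x * partial i phi x) + e / 2 / (N%:R + 1).
  have igg : intg leb (fun x => `|gs s i x - g i x|).
    by apply/intg_norm/intgB => //; exact: convK_intg.
  have igs : intg leb (gs s i) by exact: convK_intg.
  have ihg : intg leb (fun x => `|(P (zs s x) - P (z x)) * g i x|).
    apply/intg_norm/(intgMb (C := 1 + 1) _ _ (ig i)); first exact: measurable_funB.
    by move=> x; rewrite (le_trans (ler_normB _ _))// lerD.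
  have mdp := continuous_measurable_rV (C1c_pcont (i := i) Cphi).
  have i1 : intg leb (fun x => P (zs s x) * gs s i x * partial i phi x).
    by apply: eq_intg (intgMb mdp (HB i) (intgMb mPzs (fun x => P_norm _) igs)) => x; exact: mulrC.
  have i2 : intg leb (fun x => P (z x) * g i x * partial i phi x).
    by apply: eq_intg (intgMb mdp (HB i) (intgMb mPz (fun x => P_norm _) (ig i))) => x; exact: mulrC.
  rewrite -lerBlDl -RintB//.
  apply: (@le_trans _ _ ((B + 1) * (I (fun x => `|gs s i x - g i x|) +
     I (fun x => `|(P (zs s x) - P (z x)) * g i x|)))).
    rewrite -RintD// -RintZ; last exact: intgD.
    apply: Rint_le => [||x]; [exact: intgB|exact/intgZ/intgD|].
    have -> : P (zs s x) * gs s i x * partial i phi x - P (z x) * g i x * partial i phi x =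
      partial i phi x * (P (zs s x) * (gs s i x - g i x) + (P (zs s x) - P (z x)) * g i x) by ring.
    apply: le_trans (ler_norm _) _; rewrite normrM ler_pM//.
      by rewrite (le_trans (HB i x))// lerDl.
    by rewrite (le_trans (ler_normD _ _))// lerD// normrM ler_piMl.
  have h1 : I (fun x => `|gs s i x - g i x|) < t by apply: H6; rewrite s0.
  have h2 : I (fun x => `|(P (zs s x) - P (z x)) * g i x|) < t.
    apply: H4 => //; first by move=> x; rewrite (le_trans (ler_normB _ _))// lerD.
    apply: (@le_lt_trans _ _ (I (fun x => `|zs s x - z x|))); last by apply: H5; rewrite s0.
    by apply: Rint_le => //; exact: intg_norm.
  apply: (@le_trans _ _ ((B + 1) * (t + t))).
    by rewrite ler_wpM2l ?addr_ge0// lerD// ltW.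
  rewrite /t le_eqVlt; apply/orP; left; apply/eqP; field.
  by rewrite !gt_eqF// ltr_wpDl.
have A3 : \sum_i I (fun x => P (zs s x) * gs s i x * partial i phi x) <=
    \sum_i I (fun x => P (z x) * g i x * partial i phi x) + e / 2.
  apply: (@le_trans _ _ (\sum_i (I (fun x => P (z x) * g i x * partial i phi x) + e / 2 / (N%:R + 1)))).
    by apply: ler_sum => i _; exact: A2.
  rewrite big_split /= lerD2l sumr_const card_ord -[leLHS]mulr_natl [leLHS]mulrCA ler_piMr ?(ltW e20)//.
  by rewrite ler_pdivrMr ?ltr_wpDl// mul1r lerDl.
apply: le_trans A0 _; rewrite addrC; apply: le_trans (lerD A3 A1) _.
by rewrite -addrA -splitr.
Qed.

End fixed_test.
End Kato.

(** * Subharmonic functions up to a smooth boundary *)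

Section Subharmonic.
Context {R : realType} {N : nat}.
Local Notation leb := (@lebesgue_rV R N).
Local Notation I f := (Rintegral leb setT f).
Implicit Types (x y c : 'rV[R]_N) (f d : 'rV[R]_N -> R) (t s : R).

Lemma weighted_dct (w : 'rV[R]_N -> R) (F : nat -> 'rV[R]_N -> R) f (C : R) : intg leb w ->
  (forall n, measurable_fun setT (F n)) -> measurable_fun setT f -> (forall n x, `|F n x| <= C) ->
  (forall x, w x != 0 -> F n x @[n --> \oo] --> f x) ->
  I (fun x => w x * F n x) @[n --> \oo] --> I (fun x => w x * f x).
Proof.
move=> iw mF mf FC Ff; have mw := intg_measurable iw.
apply: (proj2 (@Rint_dct _ _ _ _ (fun n x => w x * F n x) _ (fun x => C * `|w x|) _ _ _ _ _)).
- by move=> n; exact: measurable_funM.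
- exact: measurable_funM.
- exact/intgZ/intg_norm.
- apply: aeW => x; have [->|w0] := eqVneq (w x) 0.
    by rewrite mul0r; under eq_fun do rewrite mul0r; exact: cvg_cst.
  by apply: cvgM; [exact: cvg_cst|exact: Ff].
- by move=> n; apply: aeW => x; rewrite normrM mulrC ler_wpM2r.
Qed.

Lemma cvg_natrM_large (t e : R) : 0 < t -> 0 < e -> \forall n \near \oo, e <= n.+1%:R * t.
Proof.
move=> t0 e0; have := @nbhs_infty_gtr R (e / t); apply: filterS => n.
rewrite ltr_pdivrMr// => /ltW h; rewrite (le_trans h)// ler_wpM2r ?(ltW t0)//.
by rewrite ler_nat.
Qed.

Lemma Psi_shift_cvg1 (t : R) : 0 < t -> Psi (n.+1%:R * t + -1) @[n --> \oo] --> (1 : R).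
Proof.
move=> t0; apply/cvgrPdist_le => e e0.
have := cvg_natrM_large t0 (_ : 0 < 1 + e^-1); move=> H.
have {}H : \forall n \near \oo, 1 + e^-1 <= n.+1%:R * t by apply: H; rewrite addr_gt0 ?invr_gt0.
apply: filterS H => n h; set u := _ + -1.
have u0 : e^-1 <= u by rewrite /u; lra.
have ie : 0 < e^-1 by rewrite invr_gt0.
have up : 0 < u by exact: lt_le_trans u0.
have q : 0 < 1 + u ^+ 2 by rewrite ltr_pwDl// sqr_ge0.
have -> : 1 - Psi u = (1 + u ^+ 2)^-1.
  by rewrite /Psi max_l ?(ltW up)//; field; rewrite gt_eqF.
rewrite ger0_norm ?invr_ge0 ?(ltW q)// -[leRHS]invrK lef_pV2 ?posrE//.
apply: le_trans u0 _; have := sqr_ge0 (u - 1); rewrite sqrrB; lra.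
Qed.

(* With [t] the distance to the boundary, atan (m t) is a cutoff near the boundary;
   [h1] is its defect and [h2] its derivative. *)
Definition h1 (m t : R) : R := pi / 2 - atan (m * t).
Definition h2 (m t : R) : R := m / (1 + (m * t) ^+ 2).
Definition dh2 (m t : R) : R := - (2 * m ^+ 3 * t / (1 + (m * t) ^+ 2) ^+ 2).

Let q0 (a : R) : 0 < 1 + a ^+ 2. Proof. by rewrite ltr_pwDl// sqr_ge0. Qed.

Let is_derive_lin (m t : R) : is_derive t (1 : R) (fun t => m * t) m.
Proof.
by have := is_deriveZ m (is_derive_id t (1 : R)); congr is_derive; rewrite /GRing.scale /= mulr1.
Qed.

Lemma is_derive_atan_scaled (m t : R) : is_derive t (1 : R) (fun t => atan (m * t)) (h2 m t).
Proof.
have := @is_derive1_comp R atan (fun t => m * t) t _ _ (is_derive1_atan _) (is_derive_lin m t).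
by congr is_derive; rewrite /h2 mulrC.
Qed.

Lemma is_derive_h1 (m t : R) : is_derive t (1 : R) (h1 m) (- h2 m t).
Proof.
have := is_deriveB (is_derive_cst (pi / 2) t 1) (is_derive_atan_scaled m t).
by congr is_derive; rewrite sub0r.
Qed.

Lemma is_derive_h2 (m t : R) : is_derive t (1 : R) (h2 m) (dh2 m t).
Proof.
have n0 : 1 + (m * t) ^+ 2 != 0 by rewrite gt_eqF.
have dl := is_derive_lin m t.
have d1 : is_derive t (1 : R) (fun t => 1 + (m * t) ^+ 2) (2 * m ^+ 2 * t).
  have := is_deriveD (is_derive_cst (1 : R) t 1) (@is_deriveM _ _ _ _ t 1 _ _ dl dl).
  by congr is_derive; rewrite /GRing.scale /=; ring.
have := is_deriveZ m (@is_deriveV R _ t _ _ n0 d1).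
congr is_derive; rewrite /dh2 /GRing.scale /=; by field.
Qed.

Let dcont (f df : R -> R) : (forall t, is_derive t (1 : R) f (df t)) -> continuous f.
Proof.
move=> H t; apply: differentiable_continuous; apply/derivable1_diffP.
by have [] := H t.
Qed.

Lemma h2_cont (m : R) : continuous (h2 m).
Proof. exact: dcont (is_derive_h2 m). Qed.

Lemma dh2_cont (m : R) : continuous (dh2 m).
Proof.
have cl : continuous (fun t => m * t) := dcont (is_derive_lin m).
have cq : continuous (fun t => 1 + (m * t) ^+ 2).
  by apply: contD; [exact: cst_continuous|exact (contM cl cl)].
move=> t; apply: cvgN; apply: cvgM.
  exact: (contM (@cst_continuous _ _ (2 * m ^+ 3)) (fun t => @cvg_id _ _)).
apply: cvgV; first by rewrite expf_neq0// gt_eqF.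
exact: (contM cq cq).
Qed.

Lemma atan_norm t : `|atan t| <= pi / 2 :> R.
Proof. by rewrite ler_norml !ltW ?atan_ltpi2 ?atan_gtNpi2// -mulNr. Qed.

Lemma h1_norm (m t : R) : `|h1 m t| <= pi.
Proof.
by rewrite /h1 (le_trans (ler_normB _ _))// [leRHS]splitr lerD ?atan_norm// ger0_norm// divr_ge0 ?pi_ge0.
Qed.

Lemma atan_scaled_cvg (t : R) : 0 < t -> atan (n.+1%:R * t) @[n --> \oo] --> (pi / 2 : R).
Proof.
move=> t0; apply: (@cvg_comp _ _ _ (fun n => n.+1%:R * t) atan _ (+oo%R)); last exact: cvgy_atan.
apply/cvgryPge => A; have A0 : 0 < `|A| + 1 by rewrite ltr_wpDl.
have := cvg_natrM_large t0 A0; apply: filterS => n; apply: le_trans.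
by rewrite (le_trans (ler_norm _))// lerDl.
Qed.

Variables (O : set 'rV[R]_N) (v : 'rV[R]_N -> R) (G : 'I_N -> 'rV[R]_N -> R).
Hypotheses (oO : open O) (Sv : S1 O v G) (v0 : forall x, 0 <= v x).
Hypothesis sub : forall phi, C1c O phi -> (forall x, 0 <= phi x) ->
  \sum_i I (fun x => G i x * partial i phi x) <= 0.

Let iv : intg leb v. Proof. by have [] := Sv. Qed.
Let iG i : intg leb (G i). Proof. by have [] := Sv. Qed.
Let vO x : ~ O x -> v x = 0. Proof. by have [_ _ + _ _] := Sv; apply. Qed.
Let GO i x : ~ O x -> G i x = 0. Proof. by have [_ _ _ + _] := Sv; apply. Qed.

(** The divergence of the field chi grad d. *)
Definition dflux d (chi : 'rV[R]_N -> R) x : R :=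
  \sum_i (chi x * partial i (partial i d) x + partial i d x * partial i chi x).
Definition gsq d x : R := \sum_i partial i d x ^+ 2.

Lemma flux d chi h dh : smooth d -> C1 chi -> csupp setT chi -> continuous dh ->
  (forall t : R, is_derive t (1 : R) h (dh t)) ->
  \sum_i I (fun x => G i x * (chi x * partial i d x * h (d x))) =
  - I (fun x => v x * (chi x * gsq d x * dh (d x) + h (d x) * dflux d chi x)).
Proof.
move=> sd Cchi schi cdh dh_h.
have CX i : C1g (fun x => chi x * partial i d x * h (d x)) _ :=
  C1gM (C1gM Cchi (smooth_C1 (smooth_partial i sd))) (C1g_comp cdh dh_h (smooth_C1 sd)).
have sX i : csupp setT (fun x => chi x * partial i d x * h (d x)) by apply: csuppM; exact: csuppM.
have E i : I (fun x => G i x * (chi x * partial i d x * h (d x))) =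
    - I (fun x => v x * (chi x * partial i d x * (dh (d x) * partial i d x) +
      h (d x) * (chi x * partial i (partial i d) x + partial i d x * partial i chi x))).
  have [cX cdX _] := CX i.
  have [C _ HC] := csupp_bounded cX (sX i).
  have [C' _ HC'] := csupp_bounded (cdX i) (csupp_partial i (CX i) (sX i)).
  apply: oppr_inj; rewrite opprK; apply/esym; apply: (S1_ibp (C := `|C| + `|C'|) Sv (CX i)) => x.
    by rewrite (le_trans (HC x))// (le_trans (ler_norm _))// lerDl.
  by rewrite (le_trans (HC' x))// (le_trans (ler_norm _))// lerDr.
under eq_bigr => i _ do rewrite E; rewrite sumrN -Rint_sum => [|i].
  congr (- _); congr Rintegral; apply/funext => x; rewrite -mulr_sumr big_split /= -mulr_sumr.
  congr (_ * (_ + _)); rewrite /gsq !mulr_sumr mulr_suml; apply: eq_bigr => i _; ring.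
have [_ cdX _] := CX i.
have [C' _ HC'] := csupp_bounded (cdX i) (csupp_partial i (CX i) (sX i)).
apply: eq_intg (intgMb (continuous_measurable_rV (cdX i)) HC' iv) => x; exact: mulrC.
Qed.

Lemma gsq_ge0 d x : 0 <= gsq d x.
Proof. by apply: sumr_ge0 => i _; exact: sqr_ge0. Qed.

Lemma gsq_cont d : smooth d -> continuous (gsq d).
Proof.
move=> sd; apply: cont_sum => i; have [c _ _] := smooth_C1 (smooth_partial i sd).
exact (contM c c).
Qed.

Lemma dflux_cont d chi : smooth d -> C1 chi -> continuous (dflux d chi).
Proof.
move=> sd [cc cdc _]; apply: cont_sum => i.
have [c cd _] := smooth_C1 (smooth_partial i sd).
by apply: contD; apply: contM.
Qed.

Section near_boundary.
Variables (d : 'rV[R]_N -> R) (a : 'rV[R]_N) (s c : R).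
Hypotheses (sd : smooth d) (s0 : 0 < s) (c0 : 0 < c).
Hypothesis dO : forall y, `|y - a| <= 2 * s -> (O y <-> 0 < d y).
Hypothesis dc : forall y, `|y - a| <= 2 * s -> c <= gsq d y.

(** Two scales: chi is bounded from below on the set where psi > 0, so that every term with psi or
    its flux is dominated by one with chi. *)
Let chi y : R := K (2 * s) (y - a).
Let psi y : R := K s (y - a).
Let s20 : 0 < 2 * s. Proof. by rewrite mulr_gt0. Qed.
Let le_s2 t : t <= s -> t <= 2 * s.
Proof. by move=> ts; rewrite (le_trans ts)// ler_peMl ?ler1n// ltW. Qed.
Let schi : smooth chi. Proof. by apply: smooth_shift; exact: K_smooth. Qed.
Let spsi : smooth psi. Proof. by apply: smooth_shift; exact: K_smooth. Qed.
Let cchi : csupp setT chi. Proof. exact: off_csupp_shift (K_off s20) _. Qed.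
Let cpsi : csupp setT psi. Proof. exact: off_csupp_shift (K_off s0) _. Qed.
Let chi0 y : 0 <= chi y. Proof. exact: K_ge0. Qed.
Let psi0 y : 0 <= psi y. Proof. exact: K_ge0. Qed.
Let chi_off y : 2 * s <= `|y - a| -> chi y = 0. Proof. exact: K_off. Qed.
Let psi_off y : s <= `|y - a| -> psi y = 0. Proof. exact: K_off. Qed.

Let dmin (f : 'rV[R]_N -> R) y i : smooth f -> (forall y, 0 <= f y) -> f y = 0 -> partial i f y = 0.
Proof. by move=> /smooth_C1 [_ _ H] f0; exact: is_derive_min0 (H i) f0. Qed.

Let dflux0 (f : 'rV[R]_N -> R) y : smooth f -> (forall y, 0 <= f y) -> f y = 0 -> dflux d f y = 0.
Proof.
move=> sf f0 fy; rewrite /dflux big1// => i _.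
by rewrite fy mul0r add0r (dmin i sf f0 fy) mulr0.
Qed.

Let T1 m : R := I (fun y => v y * (chi y * gsq d y * h2 m (d y))).
Let A1 m i : R := I (fun y => G i y * (chi y * partial i d y * h1 m (d y))).
Let B1 m : R := I (fun y => v y * (h1 m (d y) * dflux d chi y)).

Let cd : continuous d. Proof. by have [] := smooth_C1 sd. Qed.
Let h1_cont m : continuous (h1 m). Proof. exact: dcont (is_derive_h1 m). Qed.

Let intg_v (f : 'rV[R]_N -> R) : continuous f -> csupp setT f -> intg leb (fun y => v y * f y).
Proof.
move=> cf sf; have [C _ HC] := csupp_bounded cf sf.
by apply: eq_intg (intgMb (continuous_measurable_rV cf) HC iv) => x; exact: mulrC.
Qed.

Let csupp_dflux f : smooth f -> (forall y, 0 <= f y) -> csupp setT f -> csupp setT (dflux d f).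
Proof. by move=> sf f0; apply: csupp_le => x fx; exact: dflux0. Qed.

Let T1E m : T1 m = B1 m + \sum_i A1 m i.
Proof.
have := flux sd (smooth_C1 schi) cchi (contN (@h2_cont m)) (is_derive_h1 m) => E.
rewrite /A1 E -RintB; last 2 first.
- apply: intg_v; last by apply: csuppMr; exact: csupp_dflux.
  by apply: contM; [exact: cont_comp cd (@h1_cont m)|exact: dflux_cont sd (smooth_C1 schi)].
- apply: intg_v.
    apply: contD.
      apply: contM; last exact: cont_comp cd (contN (@h2_cont m)).
      by apply: contM; [have [] := smooth_C1 schi|exact: gsq_cont].
    by apply: contM; [exact: cont_comp cd (@h1_cont m)|exact: dflux_cont sd (smooth_C1 schi)].
  apply: csuppD; first by apply: csuppM; exact: csuppM.
  by apply: csuppMr; exact: csupp_dflux.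
congr Rintegral; apply/funext => y; ring.
Qed.

Let inO y : O y -> `|y - a| <= 2 * s -> 0 < d y.
Proof. by move=> Oy ya; apply/(dO ya). Qed.

Let h1_cvg (t : R) : 0 < t -> h1 n.+1%:R t @[n --> \oo] --> (0 : R).
Proof.
move=> t0; rewrite -(subrr (pi / 2)); apply: cvgB; first exact: cvg_cst.
exact: atan_scaled_cvg.
Qed.

(** This expresses the zero trace of v. Up to sign h2 is the derivative of h1, and integrating by
    parts without boundary term leaves only terms with h1, which is bounded by pi and tends to 0
    wherever d > 0. *)
Let T1_cvg : T1 n.+1%:R @[n --> \oo] --> (0 : R).
Proof.
have mdf := continuous_measurable_rV (dflux_cont sd (smooth_C1 schi)).
have mchi : measurable_fun setT chi by apply: continuous_measurable_rV; have [] := smooth_C1 schi.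
have mh m : measurable_fun setT (fun y => h1 m (d y)).
  by apply: continuous_measurable_rV; exact: cont_comp cd (@h1_cont m).
have cB : B1 n.+1%:R @[n --> \oo] --> (0 : R).
  have [C C0 HC] := csupp_bounded (dflux_cont sd (smooth_C1 schi)) (csupp_dflux schi chi0 cchi).
  rewrite -[X in _ --> X](Rint0 leb) (_ : (fun=> 0) = fun y => v y * 0); last by apply/funext => y; rewrite mulr0.
  apply: (@weighted_dct _ _ (fun=> 0) (pi * C) iv) => //.
  - by move=> n; exact: measurable_funM.
  - by move=> n y; rewrite normrM ler_pM// h1_norm.
  move=> y vy; have Oy : O y by apply: contrapT => /vO E; rewrite E eqxx in vy.
  have [ya|ya] := leP `|y - a| (2 * s).
    by rewrite -(mul0r (dflux d chi y)); apply: cvgM; [exact/h1_cvg/inO|exact: cvg_cst].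
  rewrite (dflux0 schi chi0 (chi_off (ltW ya))); under eq_fun do rewrite mulr0.
  exact: cvg_cst.
have cA i : A1 n.+1%:R i @[n --> \oo] --> (0 : R).
  have cp : continuous (fun y => chi y * partial i d y).
    apply: contM; first by have [] := smooth_C1 schi.
    by have [] := smooth_C1 (smooth_partial i sd).
  have [C C0 HC] := csupp_bounded cp (csuppM _ cchi).
  rewrite -[X in _ --> X](Rint0 leb) (_ : (fun=> 0) = fun y => G i y * 0); last by apply/funext => y; rewrite mulr0.
  apply: (@weighted_dct _ _ (fun=> 0) (C * pi) (iG i)) => //.
  - by move=> n; apply: measurable_funM => //; exact: continuous_measurable_rV.
  - by move=> n y; rewrite normrM ler_pM// h1_norm.
  move=> y Gy; have Oy : O y by apply: contrapT => /(GO i) E; rewrite E eqxx in Gy.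
  have [ya|ya] := leP `|y - a| (2 * s).
    by rewrite -(mulr0 (chi y * partial i d y)); apply: cvgM; [exact: cvg_cst|exact/h1_cvg/inO].
  by rewrite chi_off ?ltW//; under eq_fun do rewrite !mul0r; exact: cvg_cst.
rewrite (_ : (fun n => T1 n.+1%:R) = fun n => B1 n.+1%:R + \sum_i A1 n.+1%:R i); last first.
  by apply/funext => n; exact: T1E.
have cS : \sum_i A1 n.+1%:R i @[n --> \oo] --> \sum_(i < N) (0 : R).
  by apply: cvg_big => [|i _]; [exact: add_continuous|exact: cA].
rewrite big1_eq in cS; have E0 : (0 : R) = 0 + 0 by rewrite addr0.
by rewrite [X in _ --> X]E0; exact: cvgD cB cS.
Qed.

Let pm m y : R := psi y * atan (m * d y).

Let Cpm m : C1g (pm m) (fun i y => psi y * (h2 m (d y) * partial i d y) + atan (m * d y) * partial i psi y).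
Proof.
exact: C1gM (smooth_C1 spsi) (C1g_comp (@h2_cont m) (is_derive_atan_scaled m) (smooth_C1 sd)).
Qed.

Let psi_pos y : 0 < psi y -> `|y - a| < s.
Proof. by move=> p0; rewrite ltNge; apply/negP => /psi_off E; rewrite E ltxx in p0. Qed.

(** The function p = psi atan (m d) vanishes on the boundary without having compact support in O.
    Theta (n p - 1) / n restricts it to {n p >= 1}, a compact part of O, and the factor Psi (n p -
    1) in its gradient tends to 1 where p > 0. *)
Let sub_pm m : 0 < m ->
  \sum_i I (fun y => G i y * (psi y * (h2 m (d y) * partial i d y) + atan (m * d y) * partial i psi y)) <= 0.
Proof.
move=> m0; pose th n := fun t : R => n.+1%:R^-1 * Theta (n.+1%:R * t + -1).
have ath n : adm (th n) (fun t => n.+1%:R^-1 * (n.+1%:R * Psi (n.+1%:R * t + -1))) _ :=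
  admZ n.+1%:R^-1 (adm_aff n.+1%:R (Theta0 (lerN10 R)) (@adm_Theta R)).
have [cpm cdpm _] := Cpm m.
have spm : csupp setT (pm m) by exact: csuppM.
have key n : \sum_i I (fun y => G i y * (Psi (n.+1%:R * pm m y + -1) *
    (psi y * (h2 m (d y) * partial i d y) + atan (m * d y) * partial i psi y))) <= 0.
  have [_ dth _ _] := ath n.
  have Ct := C1g_comp (adm_dcont (ath n)) dth (Cpm m).
  have n0 : 0 < n.+1%:R :> R by [].
  have := @sub (fun y => th n (pm m y)) _ _.
  have St : C1c O (fun y => th n (pm m y)).
    split; first exact: C1gW Ct.
    exists ([set y | `|y - a| <= s] `&` [set y | 1 <= n.+1%:R * pm m y]); split.
    - apply: (@subclosed_compact _ _ [set y : 'rV[R]_N | `|y - a| <= s]).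
      + apply: closedI; first exact: compact_closed (closed_ball_compact (c := a) (r := s)).
        have cn : continuous (fun y => n.+1%:R * pm m y).
          by apply: contM => //; exact: cst_continuous.
        exact: (closed_comp (D := [set t : R | 1 <= t]) (fun y _ => cn y) (@closed_ge _ _)).
      + exact: closed_ball_compact.
      + by move=> y [].
    - move=> y [/= ys yp]; have y2 := le_s2 ys.
      apply/(dO y2); rewrite ltNge; apply/negP => d0; move: yp; rewrite leNgt => /negP; apply.
      apply: (@le_lt_trans _ _ 0) => //; apply: mulr_ge0_le0; first exact: ltW.
      apply: mulr_ge0_le0 => //; rewrite -atan0; apply: le_atan.
      by rewrite mulr_ge0_le0// ltW.
    move=> y ny; rewrite /th Theta0 ?mulr0//.
    have [ys|ys] := leP `|y - a| s.
      by have [yp|] := leP 1 (n.+1%:R * pm m y); [case: ny|lra].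
    by rewrite /pm psi_off ?(ltW ys)// mul0r mulr0 add0r lerN10.
  move=> /(_ St); rewrite /th => H.
  have {}H : \sum_i I (fun y => G i y * partial i (fun y => th n (pm m y)) y) <= 0.
    by apply: H => y; rewrite mulr_ge0 ?invr_ge0 ?(ltW n0)// Theta_ge0.
  apply: le_trans H; rewrite le_eqVlt; apply/orP; left; apply/eqP.
  apply: eq_bigr => i _; congr Rintegral; apply/funext => y; rewrite (C1gE i Ct).
  by rewrite [_^-1 * (_ * _)]mulrA mulVf ?gt_eqF// mul1r.
apply: (cvg_le_bound (u := fun n => \sum_i I (fun y => G i y * (Psi (n.+1%:R * pm m y + -1) *
    (psi y * (h2 m (d y) * partial i d y) + atan (m * d y) * partial i psi y)))) _ key).
apply: cvg_big => [|i _]; first exact: add_continuous.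
have [C C0 HC] := csupp_bounded (cdpm i) (csupp_partial i (Cpm m) spm).
have mpm := continuous_measurable_rV cpm; have mdpm := continuous_measurable_rV (cdpm i).
apply: (@weighted_dct _ _ _ (1 * C) (iG i)) => //.
- move=> n; apply: measurable_funM => //.
  apply: continuous_measurable_rV.
  exact: cont_comp cpm (adm_cont (adm_aff n.+1%:R (Psi0 (lerN10 R)) (@adm_Psi R))).
- by move=> n y; rewrite normrM ler_pM// Psi_norm.
move=> y Gy; have Oy : O y by apply: contrapT => /(GO i) E; rewrite E eqxx in Gy.
have [p0|p0] := ltP 0 (psi y); last first.
  have py : psi y = 0 by apply/le_anti; rewrite p0 psi0.
  rewrite py (dmin i spsi psi0 py) !mul0r mulr0 addr0; under eq_fun do rewrite mulr0.
  exact: cvg_cst.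
rewrite -[X in _ --> X]mul1r; apply: cvgM; last exact: cvg_cst.
apply: Psi_shift_cvg1; rewrite /pm mulr_gt0// -atan0 lt_atan//.
by rewrite mulr_gt0// inO//; exact/le_s2/ltW/psi_pos.
Qed.

(** The test function psi atan (m d) tends to pi / 2 times psi in O. Where atan is differentiated,
    an integration by parts leaves v psi |grad d|^2 dh2 (d), which is nonpositive, and v h2 (d)
    times the flux of psi, dominated by a multiple of [T1] and hence vanishing in the limit. *)
Lemma sub_boundary : \sum_i I (fun y => G i y * partial i psi y) <= 0.
Proof.
have Cd := dflux_cont sd (smooth_C1 spsi).
have [C C0 HC] := csupp_bounded Cd (csupp_dflux spsi psi0 cpsi).
pose c1 := kap (R := R) (N := N) * (2 * s)^-1 ^+ N * c.
have c10 : 0 < c1.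
  by apply: mulr_gt0 => //; apply: mulr_gt0; [exact: kap_gt0|rewrite exprn_gt0 ?invr_gt0].
have dom y : `|dflux d psi y| <= C / c1 * (chi y * gsq d y).
  have [p0|p0] := ltP 0 (psi y); last first.
    have py : psi y = 0 by apply/le_anti; rewrite p0 psi0.
    rewrite (dflux0 spsi psi0 py) normr0 mulr_ge0 ?divr_ge0 ?(ltW c10)//.
    by rewrite mulr_ge0 ?gsq_ge0.
  have ys := psi_pos p0; have y2 := le_s2 (ltW ys).
  have ny : nsq (y - a) <= (2 * s) ^+ 2 / 4.
    rewrite leNgt; apply/negP => h; have : psi y = 0; last by move=> E; rewrite E ltxx in p0.
    rewrite /psi /K /rbump bump0 ?mulr0// subr_le0 ler_pdivlMr ?exprn_gt0// mul1r.
    by apply: ltW; apply: le_lt_trans h; rewrite exprMn; lra.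
  apply: le_trans (HC y) _; rewrite -mulrA ler_peMr// mulrC ler_pdivlMr// mul1r.
  by apply: ler_pM; rewrite ?(ltW c0) ?dc// ?K_ge// mulr_ge0 ?(ltW kap_gt0)// exprn_ge0// invr_ge0 ltW.
have key m : 0 < m -> \sum_i I (fun y => G i y * (atan (m * d y) * partial i psi y)) <= C / c1 * T1 m.
  move=> m0; have [cp cdp _] := smooth_C1 spsi.
  have cat : continuous (fun y => atan (m * d y)).
    exact: cont_comp cd (dcont (is_derive_atan_scaled m)).
  have igm (f : 'rV[R]_N -> R) i : continuous f -> csupp setT f -> intg leb (fun y => G i y * f y).
    move=> cf sf; have [C' _ HC'] := csupp_bounded cf sf.
    by apply: eq_intg (intgMb (continuous_measurable_rV cf) HC' (iG i)) => x; exact: mulrC.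
  have ch : continuous (fun y => h2 m (d y)) by exact: cont_comp cd (@h2_cont m).
  have i1 i : intg leb (fun y => G i y * (psi y * partial i d y * h2 m (d y))).
    apply: igm; last by apply: csuppM; exact: csuppM.
    by apply: contM => //; apply: contM => //; have [] := smooth_C1 (smooth_partial i sd).
  have i2 i : intg leb (fun y => G i y * (atan (m * d y) * partial i psi y)).
    apply: igm; first exact: contM.
    by apply: csuppMr; exact: csupp_partial i (smooth_C1 spsi) cpsi.
  have := sub_pm m0.
  have -> : \sum_i I (fun y => G i y * (psi y * (h2 m (d y) * partial i d y) + atan (m * d y) * partial i psi y)) =
     \sum_i I (fun y => G i y * (psi y * partial i d y * h2 m (d y))) +
     \sum_i I (fun y => G i y * (atan (m * d y) * partial i psi y)).
    rewrite -big_split; apply: eq_bigr => i _ /=; rewrite -RintD//.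
    by congr Rintegral; apply/funext => y; ring.
  rewrite (flux sd (smooth_C1 spsi) cpsi (@dh2_cont m) (is_derive_h2 m)) addrC subr_le0 => H.
  apply: le_trans H _; rewrite /T1 -RintZ.
    apply: Rint_le.
    - apply: intg_v.
        apply: contD; last exact: contM.
        apply: contM; last exact: cont_comp cd (@dh2_cont m).
        by apply: contM => //; exact: gsq_cont.
      apply: csuppD; first by apply: csuppM; exact: csuppM.
      by apply: csuppMr; exact: csupp_dflux.
    - apply/intgZ/intg_v; last by apply: csuppM; exact: csuppM.
      by apply: contM => //; apply: contM; [have [] := smooth_C1 schi|exact: gsq_cont].
    move=> y; have [Oy|/vO ->] := pselect (O y); last by rewrite !mul0r mulr0.
    rewrite mulrCA ler_wpM2l//.
    have hp : 0 <= h2 m (d y) by rewrite /h2 divr_ge0 ?(ltW m0) ?(ltW (q0 _)).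
    rewrite -[leRHS]add0r lerD//.
      have [p0|p0] := ltP 0 (psi y); last first.
        have py : psi y = 0 by apply/le_anti; rewrite p0 psi0.
        by rewrite py !mul0r.
      have dy : 0 < d y by apply: inO => //; exact/le_s2/ltW/psi_pos.
      apply: mulr_ge0_le0; first by rewrite mulr_ge0 ?gsq_ge0.
      rewrite /dh2 oppr_le0 divr_ge0 ?sqr_ge0//.
      by rewrite !mulr_ge0 ?(ltW dy)// ltW.
    rewrite [leRHS]mulrA mulrC ler_wpM2r//; apply: le_trans (ler_norm _) (dom y).
  apply: intg_v; last by apply: csuppM; exact: csuppM.
  by apply: contM => //; apply: contM; [have [] := smooth_C1 schi|exact: gsq_cont].
have cA : \sum_i I (fun y => G i y * (atan (n.+1%:R * d y) * partial i psi y)) - C / c1 * T1 n.+1%:R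
    @[n --> \oo] --> \sum_i I (fun y => G i y * (pi / 2 * partial i psi y)) - C / c1 * 0.
  apply: cvgB; last by apply: cvgM; [exact: cvg_cst|exact: T1_cvg].
  apply: cvg_big => [|i _]; first exact: add_continuous.
  have [_ cdp _] := smooth_C1 spsi.
  have [C' C'0 HC'] := csupp_bounded (cdp i) (csupp_partial i (smooth_C1 spsi) cpsi).
  have mdp := continuous_measurable_rV (cdp i).
  apply: (@weighted_dct _ _ _ (pi / 2 * C') (iG i)) => //.
  - move=> n; apply: measurable_funM => //; apply: continuous_measurable_rV.
    exact: cont_comp cd (dcont (is_derive_atan_scaled n.+1%:R)).
  - exact: measurable_funM.
  - by move=> n y; rewrite normrM ler_pM// atan_norm.
  move=> y Gy; have Oy : O y by apply: contrapT => /(GO i) E; rewrite E eqxx in Gy.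
  have [p0|p0] := ltP 0 (psi y).
    apply: cvgM; last exact: cvg_cst.
    by apply: atan_scaled_cvg; apply: inO => //; exact/le_s2/ltW/psi_pos.
  have py : psi y = 0 by apply/le_anti; rewrite p0 psi0.
  by rewrite (dmin i spsi psi0 py) mulr0; under eq_fun do rewrite mulr0; exact: cvg_cst.
have H : \sum_i I (fun y => G i y * (pi / 2 * partial i psi y)) - C / c1 * 0 <= 0.
  by apply: cvg_le_bound cA _ => n; rewrite subr_le0; exact: key.
rewrite mulr0 subr0 in H.
have pi20 : 0 < pi / 2 :> R by rewrite divr_gt0// pi_gt0.
rewrite -(pmulr_rle0 _ pi20) mulr_sumr; apply: le_trans H; rewrite le_eqVlt; apply/orP; left; apply/eqP.
apply: eq_bigr => i _; rewrite -RintZ.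
  by congr Rintegral; apply/funext => y; ring.
have [_ cdp _] := smooth_C1 spsi.
have [C' _ HC'] := csupp_bounded (cdp i) (csupp_partial i (smooth_C1 spsi) cpsi).
by apply: eq_intg (intgMb (continuous_measurable_rV (cdp i)) HC' (iG i)) => x; exact: mulrC.
Qed.

End near_boundary.
End Subharmonic.

(** * The comparison principle *)

Section Comparison.
Context {R : realType} {N : nat}.
Local Notation leb := (@lebesgue_rV R N).
Local Notation I f := (Rintegral leb setT f).

Lemma Theta_eq0 (t : R) : Theta t = 0 -> t <= 0.
Proof.
move=> Tt; rewrite leNgt; apply/negP => t0; have t20 : 0 < t / 2 by rewrite divr_gt0.
have cT : {within `[t / 2, t], continuous (@Theta R)}.
  by apply: continuous_subspaceT; exact: Theta_continuous.
have t2t : t / 2 <= t by lra.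
have [c] := MVT_segment t2t (fun x _ => is_derive_Theta x) cT.
rewrite in_itv /= Tt => /andP[c1 c2] E; have := Theta_ge0 (t / 2).
have Pc : 0 < Psi c by apply: Psi_gt0; exact: lt_le_trans c1.
have : 0 < Psi c * (t - t / 2) by rewrite mulr_gt0//; lra.
by rewrite -E; lra.
Qed.

Section smooth_domain.
Variables (O : set 'rV[R]_N) (r0 : R).
Hypotheses (oO : open O) (rO : forall x, O x -> `|x| < r0) (bO : smooth_boundary O).

(** A scale uniform in x comes from the compactness of the closure of O. Near an interior point the
    kernel itself is a test function; near a boundary point d = - rho serves in [sub_boundary]; a
    kernel that does not reach O contributes nothing. *)
Lemma sub_kernels v G : S1 O v G -> (forall x, 0 <= v x) ->
  (forall phi, C1c O phi -> (forall x, 0 <= phi x) -> \sum_i I (fun x => G i x * partial i phi x) <= 0) ->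
  exists2 s0 : R, 0 < s0 & forall s x, 0 < s <= s0 ->
    \sum_i I (fun y => G i y * partial i (fun z => K s (z - x)) y) <= 0.
Proof.
move=> Sv v0 sub.
have cK : compact (closure O).
  have cl : closure O `<=` [set x : 'rV[R]_N | `|x - 0| <= r0].
    have c0 := @closed_ball_compact R N 0 r0.
    rewrite closureE; apply: smallest_sub; first exact: compact_closed.
    by move=> x /rO /ltW /=; rewrite subr0.
  have bc := @closed_ball_compact R N 0 r0.
  by apply: subclosed_compact bc cl; exact: closed_closure.
pose good s x := \sum_i I (fun y => G i y * partial i (fun z => K s (z - x)) y) <= 0.
have /(_ _ (0^'+ : set_system R) (fun (d : R) p => forall x t, 0 < t -> t <= d -> `|x - p| <= t -> good t x)) :=
  (compact_near_coveringP (closure O)).1 cK.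
have F : Filter (0^'+ : set_system R) by exact: at_right_proper_filter.
move=> /(_ F) []; first move=> p clp.
  (* The kernel of size t at x requires information on the ball of radius 2 t around x, the scale of
     chi in [sub_boundary]. *)
  have [r r00 Hr] : exists2 r : R, 0 < r & forall x t, 0 < t -> `|x - p| + 2 * t < r -> good t x.
    have [Op|nOp] := pselect (O p).
      have /nbhs_ballP [d /= d0 dH] : nbhs p O by exact: open_nbhs_nbhs.
      exists d => // x t t0 xt; apply: sub => [|y]; last exact: K_ge0.
      apply: test_C1c; apply: K_test => // y yx; apply: dH; rewrite -ball_normE /= distrC.
      have -> : y - p = (y - x) + (x - p) by rewrite addrA subrK.
      by rewrite (le_lt_trans (ler_normD _ _))//; lra.
    have [rho [U [srho [i di] [oU Up] OU]]] : exists (rho : 'rV[R]_N -> R) (U : set 'rV[R]_N),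
        [/\ smooth rho, exists i, partial i rho p != 0, open_nbhs p U &
        O `&` U = [set x | rho x < 0] `&` U].
      by apply: bO; split=> // /interior_subset.
    have /nbhs_ballP [r1 /= r10 H1] : nbhs p U by exact: open_nbhs_nbhs.
    have [cr cdr _] := smooth_C1 srho.
    have c0 : 0 < `|partial i rho p| / 2 by rewrite divr_gt0 ?normr_gt0.
    have /cvgrPdist_lt /(_ _ c0) /nbhs_ballP [r2 /= r20 H2] := cdr i p.
    have Ed := C1gZ (-1) (smooth_C1 srho).
    have sd : smooth (fun x => -1 * rho x) by exact: smoothZ.
    exists (Num.min r1 r2); first by rewrite lt_min r10.
    move=> x t t0 xt.
    have near_p y : `|y - x| <= 2 * t -> `|p - y| < r1 /\ `|p - y| < r2.
      move=> yx; apply/andP; rewrite -lt_min; apply: le_lt_trans xt.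
      have -> : p - y = - (x - p) - (y - x) by rewrite !opprB addrA subrK.
      by rewrite (le_trans (ler_normB _ _))// normrN lerD2l.
    rewrite /good; apply: (@sub_boundary _ _ O v G Sv v0 sub (fun x => -1 * rho x) x t ((`|partial i rho p| / 2) ^+ 2)) => //.
    - exact: exprn_gt0.
    - move=> y /near_p [yr1 _]; have Uy : U y by apply: H1; rewrite -ball_normE.
      have e : (O `&` U) y <-> ([set x | rho x < 0] `&` U) y by rewrite OU.
      rewrite mulN1r oppr_gt0; split=> [Oy|ry]; first by have [] := e.1 (conj Oy Uy).
      by have [] := e.2 (conj ry Uy).
    - move=> y /near_p [_ yr2]; have := H2 y; rewrite -ball_normE /= => /(_ yr2) H3.
      apply: (@le_trans _ _ (partial i (fun x => -1 * rho x) y ^+ 2)); last first.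
        by rewrite /gsq (bigD1 i)//= lerDl sumr_ge0// => k _; exact: sqr_ge0.
      rewrite (C1gE i Ed) mulN1r sqrrN.
      rewrite -[leRHS]real_normK ?num_real// lerXn2r ?nnegrE ?(ltW c0)//.
      set A := partial i rho p in H3 c0 *; set B := partial i rho y in H3 *.
      have : `|A| <= `|A - B| + `|B| by rewrite -[X in `|X| <= _](subrK B) ler_normD.
      lra.
  exists (ball p (r / 4), [set t : R | t < r / 4]).
    split; first by apply: nbhsx_ballx; rewrite divr_gt0.
    by apply: nbhs_right_lt; rewrite divr_gt0.
  move=> [q t] /= [pq tr] x u u0 ut xq; apply: Hr => //.
  have -> : x - p = (x - q) - (p - q) by rewrite opprB addrA subrK.
  move: pq; rewrite -ball_normE /= => pq.
  by have := ler_normB (x - q) (p - q); lra.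
move=> d /= d0 dH; have d20 : 0 < d / 2 by rewrite divr_gt0.
exists (d / 2) => // s x /andP[s0 sd].
have H p : closure O p -> `|x - p| <= s -> good s x.
  move=> clp xp; apply: (dH (d / 2) _ _ p clp) xp => //.
  by rewrite /= sub0r normrN gtr0_norm//; lra.
have [[p Op xp]|far] := pselect (exists2 p, O p & `|x - p| <= s).
  by apply: (H p) => //; exact: subset_closure.
rewrite big1// => i _; rewrite -[RHS](Rint0 leb); congr Rintegral; apply/funext => y.
have [Oy|nOy] := pselect (O y); last by have [_ _ _ G0 _] := Sv; rewrite G0// mul0r.
have sK : smooth (fun z => K s (z - x)) by apply: smooth_shift; exact: K_smooth.
have [_ _ dK] := smooth_C1 sK.
have -> : partial i (fun z => K s (z - x)) y = 0; last by rewrite mulr0.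
apply: (is_derive_min0 (dK i)); first by move=> z; exact: K_ge0.
apply: K_off => //; rewrite leNgt; apply/negP => yx; apply: far; exists y => //.
by rewrite distrC ltW.
Qed.

(** Integrate Delta w >= 0 against N r^2 - |x|^2, nonnegative on the support: Delta w has integral
    zero and the Laplacian of |x|^2 is 2 N, by which one divides. The factor N in N r^2 passes from
    the sup norm to the Euclidean one. *)
Lemma subharmonic_int_le0 (w : 'rV[R]_N -> R) : (0 < N)%N -> smooth w -> csupp setT w ->
  (forall x, 0 <= laplacian w x) -> I w <= 0.
Proof.
move=> N0 sw cw Lw.
have slap := laplacian_csupp sw cw; have [r r00 offL] := csupp_off slap.
have clap := laplacian_cont sw.
have Cc i : C1g (fun x : 'rV[R]_N => 2 * x 0 i) (fun j _ => 2 * (j == i)%:R) := C1gZ 2 (C1g_coord i).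
have iw := csupp_intg (let: And3 h _ _ := smooth_C1 sw in h) cw.
have iL := csupp_intg clap slap.
have [cq _ _] := @C1g_nsq R N.
have iLq : intg leb (fun x => laplacian w x * nsq x).
  by apply: csupp_intg (contM clap cq) (csuppM _ slap).
have Eq : I (fun x => laplacian w x * nsq x) = 2 * N%:R * I w.
  have E i : I (fun x => partial i (partial i w) x * nsq x - w x * 2) = 0.
    have C1 := C1gM (smooth_C1 (smooth_partial i sw)) (@C1g_nsq R N).
    have C2 := C1gM (smooth_C1 sw) (Cc i).
    have C3 := C1gD C1 (C1gZ (-1) C2).
    have s3 : csupp setT (fun x => partial i w x * nsq x + -1 * (w x * (2 * x 0 i))).
      apply: csuppD; first by apply: csuppM; exact: csupp_partial i (smooth_C1 sw) cw.
      by apply: csuppMr; exact: csuppM.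
    rewrite -[RHS](C1_ibp i C3 s3); congr Rintegral; apply/funext => x.
    rewrite eqxx mulr1; ring.
  have ii i : intg leb (fun x => partial i (partial i w) x * nsq x).
    have [_ c _] := smooth_C1 (smooth_partial i sw).
    apply: csupp_intg (contM (c i) cq) (csuppM _ _).
    exact: csupp_partial i (smooth_C1 (smooth_partial i sw)) (csupp_partial i (smooth_C1 sw) cw).
  have -> : (fun x => laplacian w x * nsq x) = fun x => \sum_i partial i (partial i w) x * nsq x.
    by apply/funext => x; rewrite mulr_suml.
  rewrite Rint_sum// (eq_bigr (fun=> 2 * I w)) => [|i _].
    by rewrite sumr_const card_ord -[LHS]mulr_natl; ring.
  have := E i; rewrite RintB//; last by apply: eq_intg (intgZ 2 iw) => x; exact: mulrC.
  move/eqP; rewrite subr_eq0 => /eqP ->; rewrite -RintZ//.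
  by congr Rintegral; apply/funext => x; exact: mulrC.
pose C := N%:R * r ^+ 2.
have : 0 <= I (fun x => C * laplacian w x - laplacian w x * nsq x).
  apply: Rint_ge0 => x; rewrite (mulrC C) -mulrBr.
  have [xr|xr] := leP r `|x|; first by rewrite offL// mul0r.
  rewrite mulr_ge0// subr_ge0 (le_trans (nsq_le_norm x))// ler_wpM2l//.
  by rewrite lerXn2r ?nnegrE ?(ltW r00)// ltW.
rewrite RintB//; last exact: intgZ.
rewrite RintZ// laplacian_int0// mulr0 sub0r oppr_ge0 Eq pmulr_rle0//.
by rewrite mulr_gt0// ltr0n.
Qed.

(** The function v = Theta (- z) is subharmonic up to the boundary, so its mollification is
    subharmonic on the whole space with compact support. Its integral, which is that of v, is
    nonpositive; as v >= 0, it vanishes. *)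
Lemma comparison W z g : (0 < N)%N -> (forall x, 0 <= W x) -> S1 O z g ->
  intg leb (fun x => W x * z x) ->
  (forall phi, test_function O phi -> (forall x, 0 <= phi x) ->
    0 <= I (fun x => W x * z x * phi x) - I (fun x => z x * laplacian phi x)) ->
  {ae leb, forall x, 0 <= z x}.
Proof.
move=> N0 W0 Sz iWz super.
have aT := adm_aff (-1) (Theta0 (lexx (0 : R))) (@adm_Theta R).
have := S1_chain aT Sz; set v := fun x => Theta _; set G := fun i x => _ => Sv.
have v0 x : 0 <= v x by exact: Theta_ge0.
have sub phi : C1c O phi -> (forall x, 0 <= phi x) -> \sum_i I (fun x => G i x * partial i phi x) <= 0.
  move=> Cp p0; have := kato oO rO W0 Sz iWz super Cp p0; rewrite -oppr_le0 -sumrN.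
  congr (_ <= _); apply: eq_bigr => i _.
  have ii : intg leb (fun x => G i x * partial i phi x).
    have [C _ HC] := csupp_bounded (C1c_pcont (i := i) Cp) (C1c_pcsupp i Cp).
    have [_ iG _ _ _] := Sv.
    by apply: eq_intg (intgMb (continuous_measurable_rV (C1c_pcont (i := i) Cp)) HC (iG i)) => x; exact: mulrC.
  apply: oppr_inj; rewrite opprK -RintN//; congr Rintegral; apply/funext => x.
  rewrite /G; ring.
have [s s0 Hs] := sub_kernels Sv v0 sub.
have iv : intg leb v by have [] := Sv.
have sK := K_csuppT (N := N) s0; have smK := @K_smooth R N s.
have offv : exists r, off r v by exists r0; apply: (zo_off rO); have [_ _ z0 _ _] := Sv.
have CKs := smooth_C1 smK.
have Lw x : 0 <= laplacian (conv (K s) v) x.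
  have := Hs s x; rewrite s0 lexx => /(_ isT); rewrite -oppr_ge0 -sumrN; congr (_ <= _).
  apply: eq_bigr => i _; rewrite (C1gE i (convK_C1g Sv s0)).
  have iGi : intg leb (G i) by have [] := Sv.
  rewrite (C1gE i (conv_C1g CKs sK iGi)) /conv.
  have [_ cdK _] := CKs.
  have CKx := C1g_shift (- x) CKs.
  have [C _ HC] := csupp_bounded (cdK i) (csupp_partial i CKs sK).
  rewrite -RintN; last first.
    rewrite (C1gE i CKx); apply: (eq_intg (f := fun y : 'rV[R]_N => partial i (K s) (y - x) * G i y)) => [y|].
      exact: mulrC.
    refine (@intgMb _ _ _ _ C (fun y : 'rV[R]_N => partial i (K s) (y - x)) _ _ (fun y => HC (y - x)) iGi).
    by apply: measurableT_comp; [exact: continuous_measurable_rV|exact: measurable_shift_rV].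
  congr Rintegral; apply/funext => y; rewrite (C1gE i CKx).
  rewrite -(opprB y x) (partial_even _ _ CKs (@KN R N s)); ring.
have sw := conv_smooth smK sK iv.
have [rv rv0] := offv.
have cw : csupp setT (conv (K s) v) by exact: off_csupp (conv_off rv0 (K_off s0)).
have := subharmonic_int_le0 N0 sw cw Lw.
rewrite (Rint_conv (@K_cont R N s) sK iv offv (fun x => KN s x)) K_mass// mulr1 => Iv.
have := Rint_eq0_ae iv v0 Iv; apply: filterS => x; rewrite /v addr0 mulN1r => /Theta_eq0.
by rewrite oppr_le0.
Qed.

End smooth_domain.
End Comparison.

(** * Lebesgue points of subsolutions *)

Section Lebesgue_points.
Context {R : realType} {N : nat}.
Local Notation leb := (@lebesgue_rV R N).
Local Notation I f := (Rintegral leb setT f).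
Implicit Types (x y a : 'rV[R]_N) (s r c : R) (v z f : 'rV[R]_N -> R) (O : set 'rV[R]_N).

Lemma euclidean_ballE x r : euclidean_ball x r = [set y | nsq (y - x) < r ^+ 2].
Proof.
have E y : nsq (y - x) = \sum_i (y 0 i - x 0 i) ^+ 2 by apply: eq_bigr => i _; rewrite !mxE.
by apply/seteqP; split=> y /=; rewrite E.
Qed.

Lemma euclidean_ball_open x r : open (euclidean_ball x r).
Proof.
have cn : continuous (fun y => nsq (y - x)).
  by have [] := C1g_shift (- x) (@C1g_nsq R N).
rewrite euclidean_ballE; exact: (open_comp (D := [set t : R | t < r ^+ 2]) (fun y _ => cn y) (@open_lt _ _)).
Qed.

Lemma euclidean_ball_norm x r y : 0 < r -> euclidean_ball x r y -> `|y - x| < r.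
Proof.
move=> r0; rewrite euclidean_ballE /= => yr; rewrite ltNge; apply/negP => h.
have : r ^+ 2 <= nsq (y - x).
  by apply: le_trans (nsq_norm _); rewrite lerXn2r ?nnegrE ?(ltW r0).
by rewrite leNgt yr.
Qed.

Definition eb x r y : R := \1_(euclidean_ball x r) y.

Lemma eb01 x r y : 0 <= eb x r y <= 1.
Proof. by rewrite /eb indicE; case: (_ \in _); rewrite ?lexx ler01. Qed.

Lemma eb_meas x r : measurable_fun setT (eb x r).
Proof. by apply: measurable_indic; apply: open_measurable_mx; exact: euclidean_ball_open. Qed.

Lemma eb_in x r y : euclidean_ball x r y -> eb x r y = 1.
Proof. by move=> h; rewrite /eb indicE mem_set. Qed.

Lemma eb_out x r y : ~ euclidean_ball x r y -> eb x r y = 0.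
Proof. by move=> h; rewrite /eb indicE memNset. Qed.

Lemma eb_intg x r : 0 < r -> intg leb (eb x r).
Proof.
move=> r0; apply: (intg_le (eb_meas x r)) (indic_ball_intg x r) => y.
have [h|h] := pselect (euclidean_ball x r y); last by rewrite eb_out// normr0 indicE.
rewrite eb_in// normr1 indicE mem_set// -ball_normE /= distrC.
exact: euclidean_ball_norm.
Qed.

Definition bm x r : R := I (eb x r).

(** Here and in [bm_ge] the measure of a ball is compared with r^N through the unit mass of K, with
    no scaling of Lebesgue measure. *)
Lemma bm_le x r : 0 < r -> kap (R := R) (N := N) * (2 * r)^-1 ^+ N * bm x r <= 1.
Proof.
move=> r0; have r20 : 0 < 2 * r by rewrite mulr_gt0.
rewrite -[leRHS](K_mass_shift x r20) -RintZ; last exact: eb_intg.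
apply: Rint_le; [exact/intgZ/eb_intg|exact: K_intg_shift|move=> y].
have [h|h] := pselect (euclidean_ball x r y); last by rewrite eb_out// mulr0 K_ge0.
rewrite eb_in// mulr1; apply: K_ge => //; rewrite -nsqN opprB.
move: h; rewrite euclidean_ballE /= => /ltW h; apply: le_trans h _.
by rewrite exprMn; lra.
Qed.

Lemma K_le_eb x s y : 0 < s ->
  K s (x - y) <= (mass0 (R := R) (N := N))^-1 * 6 * s^-1 ^+ N * eb x s y.
Proof.
move=> s0; have [h|h] := pselect (euclidean_ball x s y); first by rewrite eb_in// mulr1 K_le.
rewrite eb_out// mulr0 /K /rbump bump0 ?mulr0// subr_le0 ler_pdivlMr ?exprn_gt0// mul1r.
rewrite leNgt; apply/negP => h'; apply: h; rewrite euclidean_ballE /=.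
by rewrite -nsqN opprB.
Qed.

Lemma bm_ge x r : 0 < r -> 1 <= (mass0 (R := R) (N := N))^-1 * 6 * r^-1 ^+ N * bm x r.
Proof.
move=> r0; rewrite -[leLHS](K_mass_shift x r0) -RintZ; last exact: eb_intg.
apply: Rint_le; [exact: K_intg_shift|exact/intgZ/eb_intg|move=> y; exact: K_le_eb].
Qed.

Lemma bm_gt0 x r : 0 < r -> 0 < bm x r.
Proof.
move=> r0; rewrite ltNge; apply/negP => h; have := bm_ge x r0; rewrite leNgt => /negP; apply.
apply: le_lt_trans ltr01; apply: mulr_ge0_le0 => //.
by rewrite !mulr_ge0 ?invr_ge0 ?(ltW (@mass0_gt0 R N)) ?exprn_ge0 ?invr_ge0 ?(ltW r0).
Qed.

Definition avg v x c r : R := (bm x r)^-1 * I (fun y => eb x r y * `|v y - c|).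

Lemma eb_norm_intg v x c r : 0 < r -> intg leb v -> intg leb (fun y => eb x r y * `|v y - c|).
Proof.
move=> r0 iv; have mv := intg_measurable iv.
apply: (intg_le (g := fun y => `|v y| + `|c| * eb x r y)).
- by apply: measurable_funM; [exact: eb_meas|apply: measurableT_comp => //; exact: measurable_funB].
- move=> y; have /andP[e0 e1] := eb01 x r y.
  rewrite normrM normr_id ger0_norm//; apply: (@le_trans _ _ (eb x r y * (`|v y| + `|c|))).
    by rewrite ler_wpM2l// ler_normB.
  by rewrite mulrDr (mulrC _ `|c|) lerD2r ler_piMl.
- by apply: intgD; [exact: intg_norm|exact/intgZ/eb_intg].
Qed.

Lemma lebesgue_value_local O u v x c : open O -> O x -> (forall y, O y -> u y = v y) ->
  lebesgue_value u x c -> lebesgue_value v x c.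
Proof.
move=> oO Ox uv; rewrite /lebesgue_value.
have /nbhs_ballP [d /= d0 dH] : nbhs x O by exact: open_nbhs_nbhs.
apply: cvg_trans; apply: near_eq_cvg; near=> r; congr (_ * _)%E.
apply: eq_integral => y; rewrite inE => yr; rewrite uv//; apply: dH; rewrite -ball_normE /= distrC.
have r0 : 0 < r by near: r; exact: nbhs_right_gt.
apply: lt_trans (euclidean_ball_norm r0 yr) _.
by near: r; exact: nbhs_right_lt.
Unshelve. all: by end_near. Qed.

Lemma lebesgue_valueP v x c : intg leb v ->
  lebesgue_value v x c <-> avg v x c r @[r --> 0^'+] --> (0 : R).
Proof.
move=> iv; have mE r : measurable (euclidean_ball x r).
  by apply: open_measurable_mx; exact: euclidean_ball_open.
have E r : 0 < r -> ((leb (euclidean_ball x r))^-1 *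
    \int[leb]_(y in euclidean_ball x r) `|v y - c|%:E)%E = (avg v x c r)%:E.
  move=> r0; rewrite /avg EFinM.
  have -> : leb (euclidean_ball x r) = (bm x r)%:E.
    by rewrite /bm EFin_Rint ?eb_intg// integral_indic// setIT.
  rewrite inver gt_eqF ?bm_gt0//; congr (_ * _)%E.
  rewrite EFin_Rint; last exact: eb_norm_intg.
  rewrite [LHS]integral_mkcond; apply: eq_integral => y _; rewrite patchE.
  case: ifPn => [|/negP yr]; first by rewrite inE => yr; rewrite eb_in// mul1r.
  by rewrite eb_out ?mul0r// => h; apply: yr; rewrite inE.
have nE : \forall r \near (0 : R)^'+, (avg v x c r)%:E = ((leb (euclidean_ball x r))^-1 *
    \int[leb]_(y in euclidean_ball x r) `|v y - c|%:E)%E.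
  near=> r; rewrite E//; near: r; exact: nbhs_right_gt.
rewrite /lebesgue_value; split=> [H|H].
  have {}H : (avg v x c r)%:E @[r --> (0:R)^'+] --> 0%E.
    apply: cvg_trans H; apply: near_eq_cvg.
    by apply: filterS nE => r ->.
  by have /fine_cvgP[_] := H.
apply: cvg_trans; first exact: (near_eq_cvg nE).
by apply: cvg_EFin; [exact: nearW|exact: H].
Unshelve. all: by end_near. Qed.

Lemma avg_ge0 v x c r : 0 < r -> 0 <= avg v x c r.
Proof.
move=> r0; rewrite mulr_ge0 ?invr_ge0 ?(ltW (bm_gt0 _ _))// Rint_ge0// => y.
by rewrite mulr_ge0//; have /andP[] := eb01 x r y.
Qed.

(** K_s is at most 6 / mass0 times s^-N on the Euclidean ball of radius s, whose measure is at most
    (2 s)^N / kap. *)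
Definition cK : R := (mass0 (R := R) (N := N))^-1 * 6 * (2 ^+ N / kap (R := R) (N := N)).

Lemma K_norm_intg v x c s : 0 < s -> intg leb v -> intg leb (fun y => K s (x - y) * `|v y - c|).
Proof.
move=> s0 iv; have mv := intg_measurable iv.
have mK : measurable_fun setT (fun y => K s (x - y)) := intg_measurable (K_intg_shift x s0).
apply: (intg_le _ _ (intgZ ((mass0 (R := R) (N := N))^-1 * 6 * s^-1 ^+ N) (eb_norm_intg x c s0 iv))).
  by apply: measurable_funM => //; apply: measurableT_comp => //; exact: measurable_funB.
move=> y; rewrite normrM normr_id (ger0_norm (K_ge0 _ s0)) mulrA; apply: ler_wpM2r => //; exact: K_le_eb.
Qed.

Lemma K_avg_le v x c s : 0 < s -> intg leb v ->
  I (fun y => K s (x - y) * `|v y - c|) <= cK * avg v x c s.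
Proof.
move=> s0 iv; have ie := eb_norm_intg x c s0 iv.
pose J := I (fun y => eb x s y * `|v y - c|).
have J0 : 0 <= J by apply: Rint_ge0 => y; rewrite mulr_ge0//; have /andP[] := eb01 x s y.
have b0 := bm_gt0 x s0; have m0 := @mass0_gt0 R N; have k0 := @kap_gt0 R N.
apply: (@le_trans _ _ ((mass0 (R := R) (N := N))^-1 * 6 * s^-1 ^+ N * J)).
  rewrite -RintZ//; apply: Rint_le; [exact: K_norm_intg|exact: intgZ|move=> y].
  by rewrite mulrA; apply: ler_wpM2r => //; exact: K_le_eb.
rewrite /cK /avg -/J -!mulrA ler_wpM2l ?invr_ge0 ?(ltW m0)// ler_wpM2l// !mulrA ler_wpM2r//.
rewrite ler_pdivlMr// ler_pdivlMr//; have := bm_le x s0.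
rewrite invfM exprMn => h.
have -> : s^-1 ^+ N * bm x s * kap (R := R) (N := N) = 2 ^+ N * (kap (R := R) (N := N) * (2^-1 ^+ N * s^-1 ^+ N) * bm x s).
  by rewrite (exprVn 2); field; rewrite expf_neq0.
by rewrite ler_piMr// exprn_ge0.
Qed.

Lemma lebesgue_value_K v x c : intg leb v -> lebesgue_value v x c ->
  I (fun y => K s (x - y) * `|v y - c|) @[s --> 0^'+] --> (0 : R).
Proof.
move=> iv /(lebesgue_valueP x c iv) H.
have cH : cK * avg v x c s @[s --> 0^'+] --> (0 : R).
  have E0 : (0 : R) = cK * 0 by rewrite mulr0.
  by rewrite [X in _ --> X]E0; apply: cvgM; [exact: cvg_cst|exact: H].
apply/cvgrPdist_le => e e0; have := cvgr_le _ cH _ e0; move=> H'.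
near=> s; have s0 : 0 < s by near: s; exact: nbhs_right_gt.
rewrite sub0r normrN ger0_norm; last by apply: Rint_ge0 => y; rewrite mulr_ge0 ?K_ge0.
apply: le_trans (K_avg_le x c s0 iv) _; near: s; exact: H'.
Unshelve. all: by end_near. Qed.

Lemma conv_dist_le v x c s : 0 < s -> intg leb v ->
  `|conv (K s) v x - c| <= I (fun y => K s (x - y) * `|v y - c|).
Proof.
move=> s0 iv; have iK := K_intg_shift x s0.
have ic := conv_intg_section (@K_cont R N s) (K_csuppT s0) iv x.
have -> : conv (K s) v x - c = I (fun y => K s (x - y) * (v y - c)).
  rewrite -[X in _ - X]mulr1 -(K_mass_shift x s0) -RintZ// -RintB//; last exact: intgZ.
  by congr Rintegral; apply/funext => y; ring.
have ii : intg leb (fun y => K s (x - y) * (v y - c)).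
  apply: eq_intg (intgB ic (intgZ c iK)) => y; ring.
apply: le_trans (Rint_norm ii) _; apply: Rint_le; [exact: intg_norm|exact: K_norm_intg|move=> y].
by rewrite normrM ger0_norm ?K_ge0.
Qed.

Lemma lebesgue_value_conv v x c : intg leb v -> lebesgue_value v x c ->
  conv (K s) v x @[s --> 0^'+] --> c.
Proof.
move=> iv H; have := lebesgue_value_K iv H => /cvgrPdist_le cI; apply/cvgrPdist_le => e e0.
near=> s; have s0 : 0 < s by near: s; exact: nbhs_right_gt.
rewrite distrC; apply: le_trans (conv_dist_le x c s0 iv) _.
apply: le_trans (ler_norm _) _; rewrite -normrN -[X in `|X|]sub0r; near: s; exact: cI.
Unshelve. all: by end_near. Qed.

Lemma lebesgue_value_uniq v x c c' : intg leb v -> lebesgue_value v x c ->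
  lebesgue_value v x c' -> c = c'.
Proof.
move=> iv H H'; have h1 := lebesgue_value_conv iv H; have h2 := lebesgue_value_conv iv H'.
by rewrite -(cvg_lim _ h1)// -(cvg_lim _ h2).
Qed.

Lemma preciseE v x c : intg leb v -> lebesgue_value v x c -> precise v x = c.
Proof.
move=> iv H; rewrite /precise; case: xgetP => [c' _ H'|/(_ c)//].
exact: lebesgue_value_uniq H' H.
Qed.

(* -Delta z <= C; then z + C |x|^2 / (2 N) is subharmonic. *)
Definition superC O (C : R) z := forall f, test_function O f -> (forall x, 0 <= f x) ->
  - I (fun x => z x * laplacian f x) <= C * I f.

Lemma laplacian_shift f a x : smooth f -> laplacian (fun y => f (y + a)) x = laplacian f (x + a).
Proof.
move=> sf; apply: eq_bigr => i _.
rewrite (C1gE i (C1g_shift a (smooth_C1 sf))).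
by rewrite (C1gE i (C1g_shift a (smooth_C1 (smooth_partial i sf)))).
Qed.

Lemma superC_mono O (C : R) z x s r : intg leb z -> superC O C z -> 0 <= C ->
  0 < s -> s <= r -> (forall y, `|y - x| <= r -> O y) ->
  conv (K s) z x + C * s ^+ 2 / 4 <= conv (K r) z x + C * r ^+ 2 / 4.
Proof.
move=> iz sC C0 s0 sr rO; apply: convK_mono => // t /andP[st tr].
have t0 : 0 < t by exact: lt_le_trans st.
have tt : test_function O (fun y => Q t (y - x)).
  by apply: Q_test => // y yt; apply: rO; exact: le_trans tr.
have := sC _ tt (fun y => Q_ge0 (y - x) t0); rewrite lerNl => H; apply: le_trans (_ : _ <= - (C * I (fun y => Q t (y - x)))) _.
  rewrite lerN2 -mulrA ler_wpM2l//.
  have E : I (fun y => t / 2 * K t (x - y)) = t / 2.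
    by rewrite RintZ ?K_mass_shift ?mulr1//; exact: K_intg_shift.
  rewrite -E; apply: Rint_le.
  - by apply: csupp_intg (csuppT (test_csupp tt)); have [] := smooth_C1 (test_smooth tt).
  - exact/intgZ/K_intg_shift.
  by move=> y; rewrite -[x - y]opprB KN Q_le.
apply: le_trans H _; rewrite le_eqVlt; apply/orP; left; apply/eqP; congr Rintegral; apply/funext => y.
rewrite (laplacian_shift (- x) y (@Q_smooth R N t)) !laplacian_Q ?gt_eqF// -[x - y]opprB dKN mulrC.
by [].
Qed.

(** The mollifications tend to z in L^1, so the positive part of z - c on the ball has an integral
    below every e > 0. *)
Lemma ae_le_ball z x r c : appr z -> 0 < r ->
  (exists2 d : R, 0 < d & forall s y, 0 < s < d -> `|y - x| < r -> conv (K s) z y <= c) ->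
  {ae leb, forall y, `|y - x| < r -> z y <= c}.
Proof.
move=> az r0 [d d0 H]; have [iz offz _] := az.
have mB : measurable (ball x r) by exact: measurable_ball_rV.
pose h y : R := \1_(ball x r) y * Num.max (z y - c) 0.
have mz := intg_measurable iz.
have mh : measurable_fun setT h.
  apply: measurable_funM; first exact: measurable_indic.
  by apply: measurable_maxr => //; exact: measurable_funB.
have h0 y : 0 <= h y.
  by rewrite mulr_ge0// ?le_max ?lexx ?orbT// indicE; case: (_ \in _).
have hle s y : 0 < s < d -> h y <= `|conv (K s) z y - z y|.
  move=> sd; rewrite /h indicE; have [yb|yb] := pselect (ball x r y); last by rewrite memNset// mul0r.
  rewrite mem_set// mul1r; move: yb; rewrite -ball_normE /= distrC => yr; rewrite ge_max normr_ge0 andbT.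
  by rewrite distrC (le_trans _ (ler_norm _))// lerB// H.
have ih : intg leb h.
  have dd : 0 < d / 2 < d by apply/andP; split; lra.
  have [d2 _] := andP dd.
  apply: (intg_le mh (g := fun y => `|conv (K (d / 2)) z y - z y|)).
    by move=> y; rewrite ger0_norm// hle.
  by apply/intg_norm/intgB => //; exact: convK_intg.
have Ih : I h <= 0.
  apply/ler_addgt0Pr => e e0; rewrite add0r; have [d' d'0 H'] := moll_L1 az e0.
  pose s := Num.min d d' / 2.
  have m0 : 0 < Num.min d d' by rewrite lt_min d0.
  have s0 : 0 < s by rewrite divr_gt0.
  have sm : s < Num.min d d' by rewrite /s; move: m0; set m := Num.min _ _ => m0; lra.
  move: sm; rewrite lt_min => /andP[sd sd'].
  apply: (@le_trans _ _ (I (fun y => `|conv (K s) z y - z y|))); last by rewrite ltW// H'// s0.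
  apply: Rint_le => // [|y]; first by apply/intg_norm/intgB => //; exact: convK_intg.
  by rewrite hle// s0.
have := Rint_eq0_ae ih h0 Ih; apply: filterS => y hy yr.
move: hy; rewrite /h indicE mem_set; last by rewrite -ball_normE /= distrC.
rewrite mul1r => hy; have : z y - c <= Num.max (z y - c) 0 by rewrite le_max lexx.
by rewrite hy subr_le0.
Qed.

(** The value c is the infimum of the corrected averages, which decrease as s does. If s0 is nearly
    optimal at x, continuity of the average at s0 and monotonicity bound z by c + 2 ep almost
    everywhere near x. The averages at x stay above c up to C s^2 / 4, so z can drop below c only
    little in mean, and the mean of |z - c| is small. *)
Lemma superC_lebesgue O (C : R) z x : open O -> appr z -> {ae leb, forall y, 0 <= z y} ->
  0 <= C -> superC O C z -> O x ->
  exists c, [/\ lebesgue_value z x c, 0 <= c &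
    exists2 d : R, 0 < d & forall s, 0 < s < d -> c <= conv (K s) z x + C * s ^+ 2 / 4].
Proof.
move=> oO az z0 C0 sC Ox; have [iz offz _] := az.
have /nbhs_ballP [d /= d0 dH] : nbhs x O by exact: open_nbhs_nbhs.
pose m s := conv (K s) z x + C * s ^+ 2 / 4.
have conv0 s y : 0 < s -> 0 <= conv (K s) z y.
  by move=> s0; apply: conv_ge0 => //; [exact: K_cont|exact: K_csuppT|move=> w; exact: K_ge0].
have m0 s : 0 < s -> 0 <= m s.
  by move=> s0; rewrite addr_ge0 ?conv0// divr_ge0// mulr_ge0// sqr_ge0.
pose E := [set t | exists2 s, 0 < s < d & t = m s].
have dd : 0 < d / 2 < d by apply/andP; split; lra.
have hE : has_inf E.
  split; first by exists (m (d / 2)), (d / 2).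
  by exists 0 => _ [s /andP[s0 _] ->]; exact: m0.
pose c := inf E.
have cm s : 0 < s < d -> c <= m s by move=> sd; apply: ge_inf; [case: hE|exists s].
have c0 : 0 <= c.
  by apply: lb_le_inf; [case: hE|move=> _ [s /andP[s0 _] ->]; exact: m0].
exists c; split=> //; last by exists d.
apply/(lebesgue_valueP x c iz); apply/cvgrPdist_le => e e0.
have k0 := @kap_gt0 R N; have ms0 := @mass0_gt0 R N.
pose A := (kap (R := R) (N := N))^-1 * 2 ^+ N * ((mass0 (R := R) (N := N))^-1 * 6).
have A0 : 0 < A by rewrite !mulr_gt0 ?invr_gt0 ?exprn_gt0.
(* The final bound is ep (2 + 4 A): 2 ep from the upper bound on z, and 4 ep A from the kernel
   average of c + 2 ep - z. *)
pose ep := e / (2 + 4 * A) / 2.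
have den : 0 < 2 + 4 * A by rewrite addr_gt0// mulr_gt0.
have ep0 : 0 < ep by rewrite !divr_gt0.
have [_ [s0 /andP[s00 s0d] ->] ms] : exists2 t, E t & t < c + ep by exact: inf_adherent.
have [ym ym0 H0] : exists2 rho, 0 < rho & forall y, `|y - x| < rho ->
    conv (K s0) z y + C * s0 ^+ 2 / 4 < c + 2 * ep.
  have cc := conv_continuous (@K_cont R N s0) (K_csuppT s00) iz.
  have /cvgrPdist_lt /(_ _ ep0) /nbhs_ballP [rho /= rho0 H] := cc x.
  exists rho => // y yx; have := H y; rewrite -ball_normE /= distrC => /(_ yx).
  move: ms; rewrite /m; set a := conv _ _ x; set b := conv _ _ y; set q := C * _ / 4; move: q a b => q a b.
  by rewrite ltr_norml => ms /andP[h1 h2]; move: ms h1 h2; clear; lra.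
pose rho := Num.min ym (d - s0).
have rho0 : 0 < rho by rewrite lt_min ym0 subr_gt0.
have upper : {ae leb, forall y, `|y - x| < rho -> z y <= c + 2 * ep}.
  apply: ae_le_ball => //; exists s0 => // s y /andP[sp ss0]; rewrite lt_min => /andP[y1 y2].
  have := superC_mono (x := y) iz sC C0 sp (ltW ss0) _ => H.
  have {}H : conv (K s) z y + C * s ^+ 2 / 4 <= conv (K s0) z y + C * s0 ^+ 2 / 4.
    apply: H => w wy; apply: dH; rewrite -ball_normE /= distrC.
    have -> : w - x = (w - y) + (y - x) by rewrite addrA subrK.
    by apply: le_lt_trans (ler_normD _ _) _; lra.
  have Cs : 0 <= C * s ^+ 2 / 4 by rewrite divr_ge0// mulr_ge0// sqr_ge0.
  have := H0 y y1; move: H Cs; set a := conv (K s) z y; set q := _ / 4; set b := conv _ z y; set p := _ / 4.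
  move=> h1 h2 h3; apply: le_trans (_ : _ <= a + q) _; first by rewrite lerDl.
  exact: le_trans h1 (ltW h3).
have C10 : 0 < C + 1 by rewrite ltr_wpDl.
have e1 : 0 < 2 * ep / (C + 1) by rewrite divr_gt0// mulr_gt0.
near=> r; have r0 : 0 < r by near: r; exact: nbhs_right_gt.
have r20 : 0 < 2 * r by rewrite mulr_gt0.
have rrho : 2 * r < rho.
  by rewrite mulrC -ltr_pdivlMr//; near: r; apply: nbhs_right_lt; rewrite divr_gt0.
have rd : 2 * r < d.
  by rewrite mulrC -ltr_pdivlMr//; near: r; apply: nbhs_right_lt; rewrite divr_gt0.
have rC : C * (2 * r) ^+ 2 / 4 <= 2 * ep.
  have : r < Num.min 1 (2 * ep / (C + 1)).
    by near: r; apply: nbhs_right_lt; rewrite lt_min ltr01 e1.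
  rewrite lt_min => /andP[r1]; rewrite ltr_pdivlMr ?ltr_wpDl// => h.
  have -> : C * (2 * r) ^+ 2 / 4 = C * r ^+ 2 by field.
  by rewrite expr2; have := mulr_ge0 C0 (ltW r0); nra.
rewrite sub0r normrN ger0_norm ?avg_ge0//.
have ie := eb_norm_intg x c r0 iz.
have iK := K_intg_shift x r20.
have icv := conv_intg_section (@K_cont R N (2 * r)) (K_csuppT r20) iz x.
(* The normalization for which L K_{2 r} >= 1 on the Euclidean ball of radius r. *)
pose L := (kap (R := R) (N := N))^-1 * (2 * r) ^+ N.
have L0 : 0 < L by rewrite mulr_gt0 ?invr_gt0 ?exprn_gt0.
have iKc : intg leb (fun y => K (2 * r) (x - y) * (c + 2 * ep - z y)).
  by apply: eq_intg (intgB (intgZ (c + 2 * ep) iK) icv) => y; ring.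
have IK : I (fun y => K (2 * r) (x - y) * (c + 2 * ep - z y)) <= 4 * ep.
  have -> : I (fun y => K (2 * r) (x - y) * (c + 2 * ep - z y)) = (c + 2 * ep) - conv (K (2 * r)) z x.
    have e2 : c + 2 * ep = (c + 2 * ep) * I (fun y => K (2 * r) (x - y)) by rewrite K_mass_shift// mulr1.
    rewrite [X in X - _]e2 -RintZ// -RintB//; last exact: intgZ.
    by congr Rintegral; apply/funext => y; ring.
  by have := cm (2 * r); rewrite r20 rd => /(_ isT); rewrite /m; lra.
have J1 : I (fun y => eb x r y * `|z y - c|) <= 2 * ep * bm x r + L * (4 * ep).
  apply: (@le_trans _ _ (I (fun y => 2 * ep * eb x r y + L * (K (2 * r) (x - y) * (c + 2 * ep - z y))))).
    apply: ae_Rint_le => //.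
      by apply: intgD; [exact/intgZ/eb_intg|exact: intgZ].
    apply: filterS upper => y upy.
    have [yr|yr] := pselect (euclidean_ball x r y); last first.
      rewrite eb_out// mul0r mulr0 add0r.
      have [y2|y2] := ltP `|y - x| (2 * r).
        rewrite mulr_ge0 ?(ltW L0)// mulr_ge0 ?K_ge0// subr_ge0 upy//; exact: lt_trans rrho.
      by rewrite K_off ?mul0r ?mulr0// distrC.
    have y1 := euclidean_ball_norm r0 yr.
    have zc : z y <= c + 2 * ep by apply: upy; lra.
    rewrite eb_in// mul1r mulr1; set k := K _ _.
    have Lk : 1 <= L * k.
      have := @K_ge R N (2 * r) (x - y) r20; rewrite -/k.
      have ny : nsq (x - y) <= (2 * r) ^+ 2 / 4.
        move: yr; rewrite euclidean_ballE /= -nsqN opprB => /ltW yr; apply: le_trans yr _.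
        by rewrite exprMn; lra.
      move=> /(_ ny) h; apply: (@le_trans _ _ (L * (kap (R := R) (N := N) * (2 * r)^-1 ^+ N))); last by rewrite ler_wpM2l// ltW.
      rewrite /L exprVn le_eqVlt; apply/orP; left; apply/eqP; field.
      by apply/andP; split; rewrite ?expf_neq0 ?gt_eqF.
    apply: (@le_trans _ _ (2 * ep + (c + 2 * ep - z y))).
      by rewrite ler_norml; apply/andP; split; lra.
    by rewrite lerD2l [leRHS]mulrA ler_peMl// subr_ge0.
  rewrite RintD; [|exact/intgZ/eb_intg|exact: intgZ]; rewrite RintZ; last exact: eb_intg.
  by rewrite RintZ// lerD2l ler_wpM2l// ltW.
have bp := bm_gt0 x r0.
rewrite /avg mulrC ler_pdivrMr//; apply: le_trans J1 _.
have LA : L <= A * bm x r.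
  have := bm_ge x r0 => h; apply: (@le_trans _ _ (L * ((mass0 (R := R) (N := N))^-1 * 6 * r^-1 ^+ N * bm x r))).
    by rewrite ler_peMr// ltW.
  rewrite /L /A exprMn exprVn le_eqVlt; apply/orP; left; apply/eqP; field.
  by do ?[apply/andP; split]; rewrite ?expf_neq0 ?gt_eqF.
apply: (@le_trans _ _ (2 * ep * bm x r + A * bm x r * (4 * ep))).
  by rewrite lerD2l ler_wpM2r// mulr_ge0// ltW.
have -> : 2 * ep * bm x r + A * bm x r * (4 * ep) = (ep * (2 + 4 * A)) * bm x r by ring.
rewrite ler_wpM2r ?(ltW bp)// /ep.
have -> : e / (2 + 4 * A) / 2 * (2 + 4 * A) = e / 2 by field; rewrite gt_eqF.
by lra.
Unshelve. all: by end_near. Qed.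

End Lebesgue_points.

(** * Sources without defect *)

Section Sources_without_defect.
Context {R : realType} {N : nat}.
Local Notation leb := (@lebesgue_rV R N).
Local Notation I f := (Rintegral leb setT f).
Local Notation L2 := (L2 leb).
Variables (O : set 'rV[R]_N) (r0 : R) (Vr : 'rV[R]_N -> R) (Y : set 'rV[R]_N).
Hypotheses (oO : open O) (rO : forall x, O x -> `|x| < r0).
Hypotheses (mV : measurable_fun setT Vr) (V0 : forall x, 0 <= Vr x).
Local Notation sol := (sol O Vr Y).
Local Notation Hs := (Hs O Vr Y).
Implicit Types (z f q phi : 'rV[R]_N -> R) (al t M : R).

Definition test0 phi := test_function O phi /\ forall x, 0 <= phi x.

Definition dist al z phi : R :=
  I (fun x => (Vr x + al) * z x * phi x) - I (fun x => z x * laplacian phi x).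

(* A variational solution is in general only a distributional subsolution; [nodef]
   says that the equation holds in the sense of distributions. *)
Definition nodef al f z := forall phi, test0 phi -> I (fun x => f x * phi x) <= dist al z phi.

Definition src f := [/\ measurable_fun setT f, zo O f & exists M, forall x, 0 <= f x <= M].

(** One solution for the shift 1 suffices: [nodef_uniq] transfers the property to every other
    solution. *)
Definition ND f := src f /\ exists2 z, sol 1 f z & nodef 1 f z.

Lemma src_L2 f : src f -> L2 f.
Proof.
move=> [mf f0 [M fM]]; apply: (zo_bounded_L2 rO mf (C := M)) => // x.
by have /andP[a b] := fM x; rewrite ger0_norm.
Qed.

Lemma src_intg f : src f -> intg leb f.
Proof. by move=> Sf; have [_ f0 _] := Sf; exact (L2_zo_intg rO f0 (src_L2 Sf)). Qed.

Lemma src_ge0 f x : src f -> 0 <= f x.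
Proof. by move=> [_ _ [M fM]]; have /andP[] := fM x. Qed.

Lemma src_aege0 f : src f -> {ae leb, forall x, 0 <= f x}.
Proof. by move=> Sf; apply: aeW => x; exact: src_ge0. Qed.

Lemma srcD f q : src f -> src q -> src (fun x => f x + q x).
Proof.
move=> [mf f0 [M fM]] [mq q0 [M' qM]]; split.
- exact: measurable_funD.
- by move=> x nO; rewrite f0// q0// addr0.
- exists (M + M') => x; have /andP[a b] := fM x; have /andP[c d] := qM x.
  by rewrite addr_ge0//= lerD.
Qed.

Lemma src_le f q : src f -> measurable_fun setT q -> (forall x, 0 <= q x <= f x) -> src q.
Proof.
move=> [mf f0 [M fM]] mq qf; split=> //.
  by move=> x /f0 fx; have := qf x; rewrite fx => h; apply/le_anti; rewrite andbC.
exists M => x; have /andP[-> a] := qf x; have /andP[_ b] := fM x; exact: le_trans b.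
Qed.

Lemma src_sol al f : 0 < al -> src f -> exists2 z, sol al f z &
  src z /\ forall M, (forall x, f x <= al * M) -> forall x, z x <= M.
Proof.
move=> al0 Sf; have [mf f0 [M0 fM0]] := Sf.
have [z1 Sz1] := sol_ex Y rO mV V0 al0 (src_L2 Sf).
(* Clipping at the infimum of all admissible bounds makes one and the same representative obey every
   bound. *)
pose M := inf [set m | 0 <= m /\ forall x, f x <= al * m].
have M00 : 0 <= M0 by have /andP[a b] := fM0 0; exact: le_trans b.
have E0 : [set m | 0 <= m /\ forall x, f x <= al * m] (M0 / al).
  split; first by rewrite divr_ge0 ?(ltW al0).
  by move=> x; rewrite mulrC divfK ?gt_eqF//; have /andP[] := fM0 x.
have lb : has_lbound [set m | 0 <= m /\ forall x, f x <= al * m] by exists 0 => m [].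
have Mge0 : 0 <= M by apply: lb_le_inf; [exists (M0 / al)|move=> m []].
have fM x : f x <= al * M.
  rewrite -ler_pdivrMl//; apply: lb_le_inf; first by exists (M0 / al).
  by move=> m [_ H]; rewrite ler_pdivrMl.
have [z Sz zM] : exists2 z', sol al f z' & forall x, 0 <= z' x <= M.
  apply: (sol_clip rO mV V0 al0 _ Sz1); first by rewrite lexx.
    exact: aeW.
  by rewrite mulr0; exact: src_aege0.
exists z => //; split.
  split; [exact: sol_meas Sz|exact: sol_zo Sz|by exists M].
move=> m fm x; have /andP[zx0 zx] := zM x.
apply: le_trans zx _; have [m0|m0] := leP 0 m; first by apply: ge_inf.
have f00 y : f y = 0.
  apply/le_anti; rewrite (src_ge0 y Sf) andbT; apply: le_trans (fm y) _.
  by rewrite mulr_ge0_le0 ?(ltW al0)// ltW.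
by move: (fm 0); rewrite f00 pmulr_rge0// leNgt m0.
Qed.

Lemma test0_intg q phi : test0 phi -> intg leb q -> intg leb (fun x => q x * phi x).
Proof.
move=> [tp _] iq; have [c _ _] := smooth_C1 (test_smooth tp).
have [C _ HC] := csupp_bounded c (test_csupp tp).
by apply: eq_intg (intgMb (continuous_measurable_rV c) HC iq) => x; exact: mulrC.
Qed.

Lemma test0_lap_intg q phi : test0 phi -> intg leb q -> intg leb (fun x => q x * laplacian phi x).
Proof.
move=> [tp _] iq; have c := laplacian_cont (test_smooth tp).
have [C _ HC] := csupp_bounded c (laplacian_csupp (test_smooth tp) (test_csupp tp)).
by apply: eq_intg (intgMb (continuous_measurable_rV c) HC iq) => x; exact: mulrC.
Qed.

Lemma sol_Vintg al f z : 0 < al -> sol al f z -> src f -> intg leb (fun x => (Vr x + al) * z x).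
Proof.
move=> al0 Sz Sf; have [_ f0 _] := Sf.
by have [] := sol_L1 rO mV V0 al0 Sz f0 (src_aege0 Sf).
Qed.

Lemma sol_Vintg1 al f z : 0 < al -> sol al f z -> src f -> intg leb (fun x => Vr x * z x).
Proof.
move=> al0 Sz Sf; have := intgB (sol_Vintg al0 Sz Sf) (intgZ al (sol_intg rO Sz)).
by apply: eq_intg => x; ring.
Qed.

Lemma sol_dist_le al f z phi : 0 < al -> sol al f z -> src f -> test0 phi ->
  dist al z phi <= I (fun x => f x * phi x).
Proof.
move=> al0 Sz Sf [tp p0]; have [_ f0 _] := Sf.
exact (sol_distr_le rO mV V0 al0 Sz f0 (src_aege0 Sf) tp p0).
Qed.

Lemma sol_superC al f z (C : R) : 0 < al -> sol al f z -> src f -> 0 <= C -> (forall x, f x <= C) ->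
  superC O C z.
Proof.
move=> al0 Sz Sf C0 fC phi tp p0; have Tp : test0 phi by [].
have := sol_dist_le al0 Sz Sf Tp; rewrite /dist => H.
have ip := csupp_intg (let: And3 h _ _ := smooth_C1 (test_smooth tp) in h) (test_csupp tp).
have ifp := test0_intg Tp (src_intg Sf).
have h1 : I (fun x => f x * phi x) <= C * I phi.
  by rewrite -RintZ//; apply: Rint_le => // [|x]; [exact: intgZ|rewrite ler_wpM2r].
apply: le_trans h1; apply: le_trans H; rewrite lerDr.
apply: ae_Rint_ge0; first exact: test0_intg Tp (sol_Vintg al0 Sz Sf).
apply: filterS (sol_ge0 rO mV V0 al0 Sz (src_aege0 Sf)) => x zx.
by rewrite !mulr_ge0// addr_ge0// ltW.
Qed.

Lemma dist_lin al t z q phi : test0 phi -> intg leb z -> intg leb q ->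
  intg leb (fun x => (Vr x + al) * z x) -> intg leb (fun x => (Vr x + al) * q x) ->
  dist al (fun x => z x + t * q x) phi = dist al z phi + t * dist al q phi.
Proof.
move=> Tp iz iq iVz iVq; have i1 := test0_intg Tp iVz; have i2 := test0_intg Tp iVq.
have i3 := test0_lap_intg Tp iz; have i4 := test0_lap_intg Tp iq.
rewrite /dist mulrBr -!RintZ// addrACA -opprD -!RintD//; try exact: intgZ.
by congr (_ - _); congr Rintegral; apply/funext => x; ring.
Qed.

Lemma dist_ae al z q phi : test0 phi -> intg leb z -> measurable_fun setT q ->
  intg leb (fun x => (Vr x + al) * z x) ->
  {ae leb, forall x, z x = q x} -> dist al z phi = dist al q phi.
Proof.
move=> Tp iz mq iVz zq; have iq := ae_intg mq zq iz.
have iVq : intg leb (fun x => (Vr x + al) * q x).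
  apply: ae_intg iVz; last by apply: filterS zq => x ->.
  by apply: measurable_funM => //; exact: measurable_funD.
rewrite /dist; congr (_ - _); apply: ae_Rint_eq.
- exact: intg_measurable (test0_intg Tp iVz).
- exact: intg_measurable (test0_intg Tp iVq).
- by apply: filterS zq => x ->.
- exact: intg_measurable (test0_lap_intg Tp iz).
- exact: intg_measurable (test0_lap_intg Tp iq).
- by apply: filterS zq => x ->.
Qed.

Lemma nodef_uniq al f z z' : 0 < al -> src f -> sol al f z -> sol al f z' ->
  nodef al f z -> nodef al f z'.
Proof.
move=> al0 Sf Sz Sz' H phi Tp; rewrite -(dist_ae Tp (sol_intg rO Sz) (sol_meas Sz') (sol_Vintg al0 Sz Sf)).
  exact: H.
exact (sol_uniq mV V0 al0 Sz Sz').
Qed.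

Lemma ND_sol f z : ND f -> sol 1 f z -> nodef 1 f z.
Proof. by move=> [Sf [z' Sz' H]] Sz; exact: nodef_uniq ltr01 Sf Sz' Sz H. Qed.

Lemma ND_src f : ND f -> src f. Proof. by case. Qed.

Lemma sol_add al f z f' z' : sol al f z -> sol al f' z' ->
  sol al (fun x => f x + f' x) (fun x => z x + z' x).
Proof.
move=> S S'; have := sol_lin mV V0 1 S S'; congr sol; apply/funext => x; by rewrite mul1r.
Qed.

Lemma dist_add al z q phi : test0 phi -> intg leb z -> intg leb q ->
  intg leb (fun x => (Vr x + al) * z x) -> intg leb (fun x => (Vr x + al) * q x) ->
  dist al (fun x => z x + q x) phi = dist al z phi + dist al q phi.
Proof.
move=> Tp iz iq iVz iVq; have := dist_lin 1 Tp iz iq iVz iVq; rewrite mul1r => <-.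
by congr dist; apply/funext => x; rewrite mul1r.
Qed.

Lemma NDD f q : ND f -> ND q -> ND (fun x => f x + q x).
Proof.
move=> [Sf [z Sz Hz]] [Sq [y Sy Hy]]; split; first exact: srcD.
exists (fun x => z x + y x); first exact: sol_add.
move=> phi Tp; rewrite dist_add//; last 4 first.
- exact (sol_intg rO Sz).
- exact (sol_intg rO Sy).
- exact: sol_Vintg ltr01 Sz Sf.
- exact: sol_Vintg ltr01 Sy Sq.
have -> : (fun x => (f x + q x) * phi x) = fun x => f x * phi x + q x * phi x.
  by apply/funext => x; rewrite mulrDl.
rewrite RintD; [|exact: test0_intg Tp (src_intg Sf)|exact: test0_intg Tp (src_intg Sq)].
by rewrite lerD// ?Hz// Hy.
Qed.

(** The solutions with sources q and f - q are subsolutions, and their sum, the solution with source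
    f, has no defect; so neither has one. *)
Lemma ND_le f q : ND f -> measurable_fun setT q -> (forall x, 0 <= q x <= f x) -> ND q.
Proof.
move=> Nf mq qf; have Sf := ND_src Nf; have Sq := src_le Sf mq qf.
have [mf _ _] := Sf.
have Sd : src (fun x => f x - q x).
  apply: (src_le Sf); first exact: measurable_funB.
  by move=> x; have /andP[a b] := qf x; rewrite subr_ge0 b/= gerBl.
have [z Sz _] := src_sol ltr01 Sq; have [y Sy _] := src_sol ltr01 Sd.
split=> //; exists z => // phi Tp.
have Szy := sol_add Sz Sy.
have E : (fun x => q x + (f x - q x)) = f by apply/funext => x; ring.
rewrite E in Szy; have := ND_sol Nf Szy Tp.
rewrite dist_add//; last 4 first.
- exact (sol_intg rO Sz).
- exact (sol_intg rO Sy).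
- exact: sol_Vintg ltr01 Sz Sq.
- exact: sol_Vintg ltr01 Sy Sd.
have := sol_dist_le ltr01 Sy Sd Tp.
have -> : I (fun x => (f x - q x) * phi x) = I (fun x => f x * phi x) - I (fun x => q x * phi x).
  rewrite -RintB; [|exact: test0_intg Tp (src_intg Sf)|exact: test0_intg Tp (src_intg Sq)].
  by congr Rintegral; apply/funext => x; ring.
set a := I _; set b := I _; lra.
Qed.

Lemma dist_shift al be z phi : test0 phi -> intg leb z -> intg leb (fun x => (Vr x + al) * z x) ->
  dist (al + be) z phi = dist al z phi + be * I (fun x => z x * phi x).
Proof.
move=> Tp iz iVz; rewrite /dist addrAC -RintZ; last exact: test0_intg.
rewrite -RintD; [|exact: test0_intg|exact/intgZ/test0_intg].
by congr (_ - _); congr Rintegral; apply/funext => x; ring.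
Qed.

(* With G_al the solution operator, G_1 f = G_2 f + G_1 (G_2 f) is a sum of two
   subsolutions, so that no defect can occur in either summand. *)
Lemma ND_resolvent f z : ND f -> sol 2 f z -> src z -> nodef 2 f z /\ ND z.
Proof.
move=> Nf Sz srz; have Sf := ND_src Nf.
have [y Sy _] := src_sol ltr01 srz.
have E2 : (1 + 1 : R) = 2 by [].
have Sz' : sol (1 + 1) f z by rewrite E2.
have Sy' : sol 1 (fun x => 1 * z x) y by have := Sy; congr sol; apply/funext => x; rewrite mul1r.
have Szy := sol_resolvent mV V0 Sz' Sy'.
have iz := sol_intg rO Sz; have iVz := sol_Vintg1 (ltr0n _ 2) Sz Sf.
have iV1 : intg leb (fun x => (Vr x + 1) * z x).
  by apply: eq_intg (intgD iVz iz) => x; ring.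
have key phi : test0 phi -> I (fun x => f x * phi x) <= dist 2 z phi /\
    I (fun x => z x * phi x) <= dist 1 y phi.
  move=> Tp; have := ND_sol Nf Szy Tp; rewrite dist_add//; last 2 first.
  - exact (sol_intg rO Sy).
  - exact: sol_Vintg ltr01 Sy srz.
  have := sol_dist_le (ltr0n _ 2) Sz Sf Tp; have := sol_dist_le ltr01 Sy srz Tp.
  have := dist_shift 1 Tp iz iV1; rewrite E2 mul1r => ->.
  set a := I _; set b := dist _ _ _; set c := dist _ _ _; set e := I _.
  by move=> *; split; lra.
split=> [phi /key[]//|]; split=> //; exists y => // phi /key[]//.
Qed.

Lemma ND_max f q : ND f -> ND q -> ND (fun x => Num.max (f x) (q x)).
Proof.
move=> Nf Nq; have Sf := ND_src Nf; have Sq := ND_src Nq; have [mf _ _] := Sf; have [mq _ _] := Sq.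
apply: (ND_le (NDD Nf Nq)); first exact: measurable_maxr.
move=> x; rewrite le_max (src_ge0 x Sf)/= ge_max.
by rewrite lerDl lerDr !src_ge0.
Qed.

Lemma src0 : src (fun=> 0).
Proof. by split=> //; exists 0 => x; rewrite lexx. Qed.

Lemma ND0 : ND (fun=> 0).
Proof.
split; first exact: src0.
exists (fun=> 0); first exact: sol0.
move=> phi _; rewrite /dist.
by under eq_Rintegral do rewrite mul0r; under [in leRHS]eq_Rintegral do rewrite mulr0 mul0r;
  under [X in _ - X]eq_Rintegral do rewrite mul0r; rewrite Rint0 subr0.
Qed.

(** In G_1 f = G_1 (F n) + G_1 (f - F n) only the remainder can carry a defect. Tested with phi,
    this defect is at most a constant times the integral of f - F n, because [sol_L1] bounds the
    integral of G_1 (f - F n). *)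
Lemma ND_limit (F : nat -> 'rV[R]_N -> R) f : (forall n, ND (F n)) ->
  (forall n x, F n x <= f x) -> src f -> (forall x, F n x @[n --> \oo] --> f x) -> ND f.
Proof.
move=> NF Ff Sf cF; have [z Sz [srz _]] := src_sol ltr01 Sf.
split=> //; exists z => // phi Tp; have [tp p0] := Tp.
have clap := laplacian_cont (test_smooth tp).
have [C C0 HC] := csupp_bounded clap (laplacian_csupp (test_smooth tp) (test_csupp tp)).
have [cp _ _] := smooth_C1 (test_smooth tp).
have [C' C'0 HC'] := csupp_bounded cp (test_csupp tp).
have [mf fz _] := Sf.
have Sr n : src (fun x => f x - F n x).
  have [SF _] := NF n; have [mF _ _] := SF.
  apply: (src_le Sf); first exact: measurable_funB.
  by move=> x; rewrite subr_ge0 Ff/= gerBl src_ge0.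
pose e n := I (fun x => f x - F n x).
have e0 : e n @[n --> \oo] --> (0 : R).
  rewrite -[X in _ --> X](Rint0 leb).
  apply: (proj2 (@Rint_dct _ _ _ _ (fun n x => f x - F n x) (fun=> 0) f _ _ _ _ _)) => //.
  - by move=> n; have [m _ _] := Sr n.
  - exact: src_intg.
  - apply: aeW => x; rewrite -[X in _ --> X](subrr (f x)); apply: cvgB; first exact: cvg_cst.
    exact: cF.
  - move=> n; apply: aeW => x; rewrite ger0_norm; last by rewrite subr_ge0.
    by rewrite gerBl; have [SF _] := NF n; exact: src_ge0.
have key n : I (fun x => f x * phi x) - dist 1 z phi <= (C + C') * e n.
  have [SF _] := NF n; have [zn Szn _] := src_sol ltr01 SF; have [y Sy [sry _]] := src_sol ltr01 (Sr n).
  have Szy := sol_add Szn Sy.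
  have E : (fun x => F n x + (f x - F n x)) = f by apply/funext => x; ring.
  rewrite E in Szy.
  have izn := sol_intg rO Szn; have iy := sol_intg rO Sy.
  have iVn := sol_Vintg ltr01 Szn SF; have iVy := sol_Vintg ltr01 Sy (Sr n).
  rewrite (dist_ae (q := fun x => zn x + y x) Tp (sol_intg rO Sz) (sol_meas Szy) (sol_Vintg ltr01 Sz Sf) (sol_uniq mV V0 ltr01 Sz Szy)).
  rewrite dist_add//; have h1 := ND_sol (NF n) Szn Tp.
  have ir := src_intg (Sr n).
  have Ey : I y <= e n.
    have [_ fr _] := Sr n.
    have [_ ] := sol_L1 rO mV V0 ltr01 Sy fr (src_aege0 (Sr n)); apply: le_trans.
    apply: Rint_le => // x; rewrite mulrDl mul1r lerDr mulr_ge0//; exact: src_ge0 sry.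
  have h2 : - dist 1 y phi <= C * e n.
    apply: (@le_trans _ _ (C * I y)); last by rewrite ler_wpM2l.
    rewrite /dist opprB -RintZ//; apply: (@le_trans _ _ (I (fun x => y x * laplacian phi x))).
      rewrite gerBl; apply: Rint_ge0 => x; rewrite !mulr_ge0 ?addr_ge0//; exact: src_ge0 sry.
    apply: Rint_le; [exact: test0_lap_intg|exact: intgZ|move=> x].
    rewrite mulrC; apply: ler_wpM2r; first exact: src_ge0 sry.
    by rewrite (le_trans (ler_norm _)).
  have h3 : I (fun x => f x * phi x) <= I (fun x => F n x * phi x) + C' * e n.
    rewrite /e -RintZ// -RintD; [|exact: test0_intg Tp (src_intg SF)|exact: intgZ].
    apply: Rint_le; first exact: test0_intg Tp (src_intg Sf).
      by apply: intgD; [exact: test0_intg Tp (src_intg SF)|exact: intgZ].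
    move=> x; rewrite -lerBlDl -mulrBl mulrC ler_wpM2r ?subr_ge0//.
    by rewrite (le_trans (ler_norm _)).
  by move: h1 h2 h3; set a := I _; set b := I _; set c := dist _ _ _; set d := dist _ _ _; lra.
rewrite -subr_le0; have cE : (C + C') * e n @[n --> \oo] --> (C + C') * 0.
  by apply: cvgM; [exact: cvg_cst|].
rewrite mulr0 in cE; rewrite -(cvg_lim _ cE)//; apply: limr_ge; first exact: cvgP cE.
by apply: nearW.
Qed.

(** The integral is maximized among the sources bounded by 1. Running maxima of a maximizing
    sequence stay in the class and so does their limit; a source exceeding it on a set of positive
    measure would increase the integral through [ND_max]. *)
Lemma ND_maximal : exists fs, [/\ ND fs, forall x, fs x <= 1 &
  forall q, ND q -> (forall x, q x <= 1) -> {ae leb, forall x, q x <= fs x}].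
Proof.
pose E := [set t | exists f, [/\ ND f, forall x, f x <= 1 & t = I f]].
pose bO x : R := \1_(ball (0 : 'rV[R]_N) r0) x.
have iB : intg leb bO by exact: indic_ball_intg.
have le1 f : ND f -> (forall x, f x <= 1) -> forall x, f x <= bO x.
  move=> Nf f1 x; have [_ f0 _] := ND_src Nf.
  have [Ox|/f0 ->] := pselect (O x); last by rewrite /bO indicE; case: (_ \in _).
  by rewrite /bO indicE mem_set// -ball_normE /= sub0r normrN; exact: rO.
have hE : has_sup E.
  split; first by exists (I (fun=> 0)), (fun=> 0); split=> //; exact: ND0.
  exists (I bO) => _ [f [Nf f1 ->]]; apply: Rint_le => //; first exact: src_intg (ND_src Nf).
  exact: le1.
have /choice[F HF] : forall n, exists f, [/\ ND f, forall x, f x <= 1 & sup E - n.+1%:R^-1 < I f].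
  move=> n; have n0 : 0 < n.+1%:R^-1 :> R by rewrite invr_gt0.
  by have [_ [f [Nf f1 ->]] H] := sup_adherent n0 hE; exists f.
pose M := fix M n x := if n is m.+1 then Num.max (M m x) (F n x) else F 0%N x.
have NM n : ND (M n).
  elim: n => [|n ih]; first by have [] := HF 0%N.
  by apply: ND_max => //; have [] := HF n.+1.
have M1 n x : M n x <= 1.
  elim: n => [|n ih] /=; first by have [_ -> _] := HF 0%N.
  by rewrite ge_max ih /=; have [_ -> _] := HF n.+1.
have Mmono x : {homo (fun n => M n x) : n m / (n <= m)%N >-> n <= m}.
  by apply/nondecreasing_seqP => n /=; rewrite le_max lexx.
have FM n x : F n x <= M n x by case: n => [|n] //=; rewrite le_max lexx orbT.
have ub x : has_ubound (range (fun n => M n x)) by exists 1 => _ [n _ <-].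
have cM x := nondecreasing_is_cvgn (@Mmono x) (ub x).
pose fs x := limn (fun n => M n x).
have Mfs n x : M n x <= fs x by apply: nondecreasing_cvgn_le.
have mM n : measurable_fun setT (M n) by have [[]] := NM n.
have fs01 x : 0 <= fs x <= 1.
  rewrite (le_trans (src_ge0 x (ND_src (NM 0%N))) (Mfs 0%N x)) /=.
  by apply: limr_le; [exact: cM|exact: nearW].
have Sfs : src fs.
  split; last by exists 1.
  - by apply: (measurable_fun_cvg (h := M)) => // x _; exact: cM.
  - move=> x nO; rewrite /fs (_ : (fun n => M n x) = fun=> 0) ?lim_cst//.
    by apply/funext => n; have [[_ zM _] _] := NM n; exact: zM.
have Nfs : ND fs by apply: (ND_limit NM) => // x; exact: cM.
exists fs; split=> //; first by move=> x; have /andP[] := fs01 x.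
move=> q Nq q1; have Nm := ND_max Nfs Nq.
pose h x := Num.max (fs x) (q x) - fs x.
have ifs := src_intg Sfs; have im := src_intg (ND_src Nm).
have Ih : I h <= 0.
  rewrite RintB// subr_le0; apply: (@le_trans _ _ (sup E)).
    apply: ub_le_sup; first by case: hE.
    exists (fun x => Num.max (fs x) (q x)); split=> // x; rewrite ge_max q1 andbT.
    by have /andP[] := fs01 x.
  apply/ler_addgt0Pr => e e0.
  have [n _ Hn] : \forall n \near \oo, n.+1%:R^-1 < e := near_infty_natSinv_lt (PosNum e0).
  have [_ _ Fn] := HF n; have hn := Hn n (leqnn n).
  have : I (F n) <= I fs.
    apply: Rint_le => //; first by have [Nn _ _] := HF n; exact: src_intg (ND_src Nn).
    by move=> x; exact: le_trans (FM n x) (Mfs n x).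
  move: Fn hn; rewrite /=; set a := n.+1%:R^-1; set b := I (F n); set c := I fs; lra.
have := Rint_eq0_ae (intgB im ifs) _ Ih.
have hx x : 0 <= h x by rewrite subr_ge0 le_max lexx.
move=> /(_ hx); apply: filterS => x /eqP; rewrite subr_eq0 => /eqP E1.
by rewrite -E1 le_max lexx orbT.
Qed.

End Sources_without_defect.

(** * Splitting the largest source *)

Section Cover.
Context {R : realType} {N : nat}.
Local Notation leb := (@lebesgue_rV R N).
Local Notation I f := (Rintegral leb setT f).
Variable O : set 'rV[R]_N.
Implicit Types (f phi : 'rV[R]_N -> R).

Lemma test0_0 : test0 O (fun=> 0).
Proof.
split=> //; apply: csupp_test; last by exists set0; split=> //; exact: compact0.
have := smoothZ 0 (@K_smooth R N 1); congr smooth; apply/funext => x; exact: mul0r.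
Qed.

Lemma K_gt0 s (x : 'rV[R]_N) : 0 < s -> nsq x < s ^+ 2 -> 0 < K s x.
Proof.
move=> s0 xs; rewrite mulr_gt0 ?invr_gt0 ?mass0_gt0// mulr_gt0 ?exprn_gt0 ?invr_gt0//.
by apply: bump_gt0; rewrite subr_gt0 ltr_pdivrMr ?exprn_gt0// mul1r.
Qed.

(** Kernels with rational centres and radii 1 / (k + 1) whose supports fit in O. Countability allows
    statements that hold almost everywhere to be collected over the whole family. *)
Lemma test_cover : open O -> exists phi : nat -> 'rV[R]_N -> R,
  (forall n, test0 O (phi n)) /\ forall x, O x -> exists n, 0 < phi n x.
Proof.
move=> oO; pose ph (qk : 'rV[rat]_N * nat) : 'rV[R]_N -> R := fun x =>
  K qk.2.+1%:R^-1 (x - map_mx ratr qk.1).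
pose good (qk : 'rV[rat]_N * nat) := forall x, `|x - map_mx ratr qk.1| <= qk.2.+1%:R^-1 :> R -> O x.
exists (fun n => if unpickle n is Some qk then (if `[< good qk >] then ph qk else fun=> 0) else fun=> 0).
split=> [n|x Ox].
  case: unpickle => [qk|]; last exact: test0_0.
  case: asboolP => [g|_]; last exact: test0_0.
  split; first by apply: K_test => //; rewrite invr_gt0.
  by move=> x; apply: K_ge0; rewrite invr_gt0.
have /nbhs_ballP[e /= e0 eO] : nbhs x O by exact: open_nbhs_nbhs.
have [k ke] : exists k, k.+1%:R^-1 < e / 2 :> R.
  have e20 : 0 < e / 2 by rewrite divr_gt0.
  near \oo => k; exists k; near: k; exact: near_infty_natSinv_lt (PosNum e20).
have s0 : 0 < k.+1%:R^-1 :> R by rewrite invr_gt0.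
set s := k.+1%:R^-1 : R in ke s0.
have N1 : 0 < N%:R + 1 :> R by rewrite ltr_wpDl.
(* A centre within s / (N + 1) of x in the sup norm is within s in the Euclidean norm. *)
have d0 : 0 < s / (N%:R + 1) by rewrite divr_gt0.
have ob : open (ball x (s / (N%:R + 1))) by exact: ball_open.
have := open_bigcup_rat_ball ob => E.
have : ball x (s / (N%:R + 1)) x by exact: ballxx.
rewrite E => -[[q m] /= qb _].
have /qb : ball (map_mx ratr q : 'rV[R]_N) m.+1%:R^-1 (map_mx ratr q) by apply: ballxx; rewrite invr_gt0.
rewrite -ball_normE /= => xq.
have ds : s / (N%:R + 1) <= s by rewrite ler_pdivrMr// ler_pMr// lerDr.
exists (pickle (q, k)); rewrite pickleK; case: asboolP => [_|[]].
  apply: K_gt0 => //=; apply: le_lt_trans (nsq_le_norm _) _.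
  apply: (@le_lt_trans _ _ (N%:R * (s / (N%:R + 1)) ^+ 2)).
    by rewrite ler_wpM2l// lerXn2r ?nnegrE ?(ltW d0)// ltW.
  rewrite expr_div_n mulrCA gtr_pMr ?exprn_gt0// ltr_pdivrMr ?exprn_gt0// mul1r.
  by rewrite sqrrD expr1n mulr1; have := sqr_ge0 (N%:R : R); have := ler0n R N; set t := N%:R; lra.
move=> y /= yq; apply: eO; rewrite -ball_normE /=.
rewrite (_ : x - y = (x - map_mx ratr q) - (y - map_mx ratr q)); last by rewrite opprB addrA subrK.
apply: le_lt_trans (ler_normB _ _) _; apply: (@lt_le_trans _ _ (s + s)); last by lra.
by apply: ltr_leD => //; exact: lt_le_trans ds.
Unshelve. all: by end_near. Qed.

Lemma ae_zero_test f : open O -> intg leb f -> (forall x, 0 <= f x) -> zo O f ->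
  (forall phi, test0 O phi -> I (fun x => f x * phi x) <= 0) -> {ae leb, forall x, f x = 0}.
Proof.
move=> oO iF f0 fO H; have [phi [Tp cov]] := test_cover oO.
have E n : {ae leb, forall x, f x * phi n x = 0}.
  apply: Rint_eq0_ae; [exact: test0_intg (Tp n) iF| |exact: H].
  by move=> x; have [_ p0] := Tp n; rewrite mulr_ge0.
have := ae_foralln E; apply: filterS => x Ex.
have [Ox|/fO//] := pselect (O x); have [n pn] := cov x Ox.
by apply/eqP; have /eqP := Ex n; rewrite mulf_eq0 (gt_eqF pn) orbF.
Qed.

End Cover.

Lemma sq4_le (R : realType) (r d : R) : 0 <= r -> r <= 1 -> r <= d -> r ^+ 2 / 4 <= d / 2.
Proof. by move=> *; nra. Qed.

(** * Positive and zero part of the largest source *)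

Section Core.
Context {R : realType} {N : nat}.
Local Notation leb := (@lebesgue_rV R N).
Local Notation I f := (Rintegral leb setT f).
Local Notation L2 := (L2 leb).
Variables (O : set 'rV[R]_N) (r0 : R) (Vr : 'rV[R]_N -> R) (Y : set 'rV[R]_N).
Hypotheses (oO : open O) (rO : forall x, O x -> `|x| < r0).
Hypotheses (mV : measurable_fun setT Vr) (V0 : forall x, 0 <= Vr x).
Local Notation sol := (sol O Vr Y).
Local Notation ND := (ND O Vr Y).
Local Notation src := (src O).
Implicit Types (z f q phi : 'rV[R]_N -> R).

Lemma sol_shift al be f z : sol al f z -> sol (al + be) (fun x => f x + be * z x) z.
Proof.
move=> [g [Hz Lf H]]; have Lz := HsL2 Hz; exists g; split=> //.
  by apply: L2D => //; exact: L2Z.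
move=> p h Hp; have Lp := HsL2 Hp.
rewrite (af_shift mV V0 al be Hz Hp) (H _ _ Hp) -RintZ; last exact: L2M.
rewrite -RintD; [|exact: L2M|exact/intgZ/L2M].
by congr Rintegral; apply/funext => x; ring.
Qed.

Lemma sol_scale al t f z : sol al f z -> sol al (fun x => t * f x) (fun x => t * z x).
Proof.
move=> S; have := sol_lin mV V0 t (sol0 O Vr Y al) S.
by congr sol; apply/funext => x; rewrite add0r.
Qed.

Lemma ae_mul0 f q (iq : measurable_fun setT q) (q0 : forall x, 0 <= q x) : src f -> intg leb q ->
  I (fun x => f x * q x) <= 0 -> {ae leb, forall x, f x * q x = 0}.
Proof.
move=> Sf iq' H; apply: Rint_eq0_ae H.
  have [mf _ [M fM]] := Sf; apply: (intgMb (C := M)) => // x.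
  by have /andP[f0 fx] := fM x; rewrite ger0_norm.
by move=> x; rewrite mulr_ge0// (src_ge0 x Sf).
Qed.

Lemma src_ae_mul0 f q : src f -> src q ->
  I (fun x => f x * q x) <= 0 -> {ae leb, forall x, f x * q x = 0}.
Proof.
move=> Sf Sq; have [mq _ _] := Sq.
by apply: ae_mul0 => //; [move=> x; exact: src_ge0 Sq|exact (src_intg rO Sq)].
Qed.

Lemma src_intgM f q : src f -> src q -> intg leb (fun x => f x * q x).
Proof.
move=> Sf Sq; have [mf _ [M fM]] := Sf; apply: (intgMb (C := M)) => //.
  by move=> x; have /andP[f0 fx] := fM x; rewrite ger0_norm.
exact (src_intg rO Sq).
Qed.

Section Decomposition.
Variables (fs u : 'rV[R]_N -> R) (gu : 'I_N -> 'rV[R]_N -> R).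
Hypotheses (Nfs : ND fs) (fs1 : forall x, fs x <= 1).
Hypothesis fsmax : forall q, ND q -> (forall x, q x <= 1) -> {ae leb, forall x, q x <= fs x}.
Hypotheses (Su : S1 O u gu) (u0 : forall x, 0 <= u x) (iVu : intg leb (fun x => Vr x * u x)).

Let g x := Num.min (u x) (fs x).

Let iu : intg leb u. Proof. by have [] := Su. Qed.

Let Sfs : src fs := ND_src Nfs.

Let g_fs x : 0 <= g x <= fs x.
Proof. by rewrite /g le_min u0 (src_ge0 x Sfs)/= ge_min lexx orbT. Qed.

Let mg : measurable_fun setT g.
Proof. by apply: measurable_minr; [exact: intg_measurable iu|have [] := Sfs]. Qed.

Let Ng : ND g. Proof. exact (ND_le rO mV V0 Nfs mg g_fs). Qed.

Let Sg : src g := ND_src Ng.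

Variables (s : 'rV[R]_N -> R).
Hypotheses (Ss : sol 2 g s) (srs : src s) (s1 : forall x, s x <= 1).
Hypothesis su : {ae leb, forall x, s x <= u x}.

Let ms : measurable_fun setT s. Proof. by have [] := srs. Qed.

Let Ns : ND s. Proof. by have [] := ND_resolvent rO mV V0 Ng Ss srs. Qed.

(** Comparison yields only s <= u. The bound by fs has another origin: s = G_2 g is itself a source
    without defect, at most 1, and fs is the largest one. *)
Let s_fs : {ae leb, forall x, s x <= fs x}. Proof. exact: fsmax Ns s1. Qed.

Let s_g : {ae leb, forall x, s x <= g x}.
Proof.
apply: filterS2 su s_fs => x h1 h2; by rewrite /g le_min h1.
Qed.

Let A x : R := \1_[set y | 0 < s y] x.

Let mA : measurable_fun setT A.
Proof.
apply: measurable_indic; have := ms measurableT (measurable_itv `]0, +oo[).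
by rewrite setTI; congr measurable; apply/seteqP; split=> y /=; rewrite in_itv/= andbT.
Qed.

Let A1 x : 0 < s x -> A x = 1. Proof. by move=> h; rewrite /A indicE mem_set. Qed.

Let A0 x : s x <= 0 -> A x = 0.
Proof. by move=> h; rewrite /A indicE memNset//= => h'; move: h; rewrite leNgt h'. Qed.

Definition pos_part x := A x * fs x.
Definition zero_part x := (1 - A x) * fs x.
Local Notation a := pos_part.
Local Notation b := zero_part.

Let ab x : (0 <= a x <= fs x) /\ (0 <= b x <= fs x) /\ a x + b x = fs x.
Proof.
have f0 := src_ge0 x Sfs; rewrite /pos_part /zero_part.
by have [h|h] := ltP 0 (s x); rewrite ?(A1 h) ?(A0 h) ?subrr ?subr0 ?mul0r ?mul1r ?addr0 ?add0r ?lexx f0.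
Qed.

Lemma pos_partND : ND a.
Proof.
apply: (ND_le rO mV V0 Nfs); last by move=> x; have [] := ab x.
by apply: (measurable_funM mA); have [] := Sfs.
Qed.

Lemma zero_partND : ND b.
Proof.
apply: (ND_le rO mV V0 Nfs); last by move=> x; have [_ []] := ab x.
by apply: measurable_funM; [exact: (measurable_funB (measurable_cst _) mA)|have [] := Sfs].
Qed.

Let Sa := ND_src pos_partND.
Let Sb := ND_src zero_partND.

Variables (wA wB : 'rV[R]_N -> R).
Hypotheses (SA : sol 2 a wA) (srA : src wA) (A_1 : forall x, wA x <= 1).
Hypotheses (SB : sol 2 b wB) (srB : src wB) (B_1 : forall x, wB x <= 1).

Let wA_fs : {ae leb, forall x, wA x <= fs x}.
Proof. by apply: fsmax => //; have [] := ND_resolvent rO mV V0 pos_partND SA srA. Qed.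

Let wB_fs : {ae leb, forall x, wB x <= fs x}.
Proof. by apply: fsmax => //; have [] := ND_resolvent rO mV V0 zero_partND SB srB. Qed.

(** An approximation of [pos_part] as k grows. Since q k <= k s <= k g, the solution with this
    source is at most k G_2 g = k s. *)
Let q k x := Num.min (fs x) (k%:R * s x).

Let q_fs k x : 0 <= q k x <= fs x.
Proof. by rewrite /q le_min (src_ge0 x Sfs) mulr_ge0 ?(src_ge0 x srs)//= ge_min lexx. Qed.

Let q_a k x : q k x <= a x.
Proof.
have f0 := src_ge0 x Sfs; rewrite /q /pos_part ge_min; have [h|h] := ltP 0 (s x).
  by rewrite A1// mul1r lexx.
by rewrite A0// mul0r mulr_ge0_le0 ?orbT.
Qed.

Let Nq k : ND (q k).
Proof.
apply: (ND_le rO mV V0 Nfs (q := q k)); last exact: q_fs.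
by apply: measurable_minr; [have [] := Sfs|exact: measurable_funM].
Qed.

Let zeta_le k z : sol 2 (q k) z -> {ae leb, forall x, z x <= k%:R * s x}.
Proof.
move=> Sz; apply: (sol_mono rO mV V0 (ltr0n _ 2) Sz (sol_scale k%:R Ss)).
apply: filterS s_g => x sg; apply: (@le_trans _ _ (k%:R * s x)); last by rewrite ler_wpM2l.
by rewrite /q ge_min lexx orbT.
Qed.

Let bs x : b x * s x = 0.
Proof.
have s0 := src_ge0 x srs; rewrite /zero_part; have [h|h] := ltP 0 (s x).
  by rewrite A1// subrr !mul0r.
by rewrite (@le_anti _ _ (s x) 0) ?h ?mulr0.
Qed.

(** By symmetry of G_2 the integral of q_1 wB is that of b G_2 (q_1), and b G_2 (q_1) <= b s = 0.
    Moreover q_1 > 0 wherever a > 0. *)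
Let a_wB : {ae leb, forall x, a x * wB x = 0}.
Proof.
have [z Sz [srz _]] := src_sol Y rO mV V0 (ltr0n _ 2) (ND_src (Nq 1)).
have H : {ae leb, forall x, q 1 x * wB x = 0}.
  apply: src_ae_mul0 => //; first exact: ND_src (Nq 1).
  rewrite -(sol_symm SB Sz) -[leRHS](@Rint0 _ _ _ leb).
  apply: ae_Rint_le; [exact: src_intgM|exact: intg0|].
  apply: filterS (zeta_le Sz) => x zs; rewrite -(bs x) ler_wpM2l ?(src_ge0 x Sb)//.
  by rewrite (le_trans zs)// mul1r.
apply: filterS H => x /eqP; rewrite mulf_eq0 => /orP[/eqP q0|/eqP ->]; last by rewrite mulr0.
rewrite /pos_part; have [h|h] := ltP 0 (s x); last by rewrite A0// !mul0r.
move: q0; rewrite /q mul1r; have [_ ->|_ s00] := ltP (fs x) (s x); first by rewrite mulr0 mul0r.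
by rewrite s00 ltxx in h.
Qed.

Let b_wA : {ae leb, forall x, b x * wA x = 0}.
Proof.
apply: src_ae_mul0 => //; rewrite -(sol_symm SA SB) -[leRHS](@Rint0 _ _ _ leb).
apply: ae_Rint_le; [exact: src_intgM|exact: intg0|].
by apply: filterS a_wB => x ->.
Qed.

(** The relations a wB = 0 and b wA = 0 settle every point except those where a = b = 0. There fs =
    0, and wA <= fs vanishes. *)
Lemma parts_disjoint : {ae leb, forall x, wA x * wB x = 0}.
Proof.
apply: filterS3 a_wB b_wA wA_fs => x /eqP; rewrite mulf_eq0 => /orP[/eqP a0|/eqP ->]; last by rewrite mulr0.
move=> /eqP; rewrite mulf_eq0 => /orP[/eqP b0|/eqP ->]; last by rewrite mul0r.
have [_ [_ ]] := ab x; rewrite a0 b0 addr0 => <- wA0.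
by rewrite (@le_anti _ _ (wA x) 0) ?mul0r// wA0 (src_ge0 x srA).
Qed.

(** By symmetry the integral of g wB is that of b s, which is zero. Where g equals fs rather than u,
    the bound wB <= fs concludes. *)
Lemma zero_part_off : {ae leb, forall x, u x * wB x = 0}.
Proof.
have H : {ae leb, forall x, g x * wB x = 0}.
  apply: src_ae_mul0 => //; rewrite (sol_symm Ss SB) -[leRHS](@Rint0 _ _ _ leb).
  by apply: Rint_le; [exact: src_intgM|exact: intg0|move=> x; rewrite bs].
apply: filterS2 H wB_fs => x /eqP; rewrite mulf_eq0 => /orP[/eqP|/eqP ->]; last by rewrite mulr0.
rewrite /g; have [h ->|h ->] := ltP (u x) (fs x); first by rewrite mul0r.
by move=> h'; rewrite (@le_anti _ _ (wB x) 0) ?mulr0// h' (src_ge0 x srB).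
Qed.

(** Let p be g restricted to {s = 0} and e = G_2 p. From e <= s, the function e vanishes on {s = 0};
    from e <= wB it vanishes on {s > 0}, where a = fs >= s > 0 forces wB = 0. A source without
    defect whose solution is zero is zero, so min (u, fs) = 0 on {s = 0}, where b = fs. *)
Lemma zero_part_source_off : {ae leb, forall x, u x * b x = 0}.
Proof.
pose p x := (1 - A x) * g x.
have p0 x : 0 <= p x <= b x.
  have /andP[h1 h2] := g_fs x.
  rewrite /p /zero_part; have [h|h] := ltP 0 (s x); first by rewrite A1// subrr !mul0r lexx.
  by rewrite A0// subr0 !mul1r h1.
have pg x : p x <= g x.
  have /andP[h1 h2] := g_fs x.
  by rewrite /p; have [h|h] := ltP 0 (s x); rewrite ?(A1 h) ?(A0 h) ?subrr ?subr0 ?mul0r ?mul1r.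
have Np : ND p.
  apply: (ND_le rO mV V0 zero_partND) => //.
  exact: (measurable_funM (measurable_funB (measurable_cst _) mA) mg).
have [e Se [sre _]] := src_sol Y rO mV V0 (ltr0n _ 2) (ND_src Np).
have es : {ae leb, forall x, e x <= s x}.
  by apply: (sol_mono rO mV V0 (ltr0n _ 2) Se Ss); exact: aeW.
have eB : {ae leb, forall x, e x <= wB x}.
  apply: (sol_mono rO mV V0 (ltr0n _ 2) Se SB); apply: aeW => x.
  by have /andP[] := p0 x.
have e0 : {ae leb, forall x, e x = 0}.
  have [H1 H2] : {ae leb, forall x, a x * wB x = 0} /\ {ae leb, forall x, s x <= fs x} by [].
  apply: filterS3 (filterI es eB) H1 H2 => x [h1 h2] h3 h4; have ex := src_ge0 x sre.
  apply/le_anti; rewrite ex andbT.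
  have [h|h] := ltP 0 (s x); last by exact: le_trans h1 h.
  move: h3; rewrite /pos_part A1// mul1r => /eqP; rewrite mulf_eq0 gt_eqF ?(lt_le_trans h)//=.
  by move=> /eqP <-.
have [ne _] := ND_resolvent rO mV V0 Np Se sre.
have Sp := ND_src Np; have [mp pO _] := Sp.
have z : {ae leb, forall x, p x = 0}.
  apply: (ae_zero_test oO (src_intg rO Sp)) => // [x|phi Tp]; first exact: (src_ge0 x Sp).
  apply: le_trans (ne _ Tp) _.
  have := dist_ae mV Tp (src_intg rO sre) (q := fun=> 0) _ (sol_Vintg rO mV V0 (ltr0n _ 2) Se Sp) e0.
  move=> ->//; rewrite /dist.
  by under eq_fun do rewrite mulr0 mul0r; under [X in _ - Rintegral _ _ X]eq_fun do rewrite mul0r; rewrite Rint0 subr0.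
apply: filterS z => x; rewrite /p /zero_part; have [h|h] := ltP 0 (s x).
  by rewrite A1// subrr !mul0r mulr0.
rewrite A0// subr0 !mul1r /g; have [h' ->|h' ->] := ltP (u x) (fs x); first by rewrite mul0r.
by rewrite mulr0.
Qed.

Let qa_meas k : measurable_fun setT (fun x => a x - q k x).
Proof. by apply: measurable_funB; [have [] := Sa|have [] := ND_src (Nq k)]. Qed.

Let qa_src k : src (fun x => a x - q k x).
Proof.
apply: (src_le Sa) => // x; rewrite subr_ge0 q_a/= gerBl.
by have /andP[] := q_fs k x.
Qed.

Let qa_cvg x : a x - q k x @[k --> \oo] --> (0 : R).
Proof.
have f0 := src_ge0 x Sfs; apply: cvg_near_cst.
have [h|h] := ltP 0 (s x); last first.
  near=> k; rewrite /pos_part A0// mul0r sub0r /q.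
  by rewrite (@le_anti _ _ (s x) 0) ?h ?(src_ge0 x srs)// mulr0 min_r ?oppr0.
near=> k; rewrite /pos_part A1// mul1r /q min_l ?subrr//.
rewrite -ler_pdivrMr//; apply: ltW; near: k; exact: nbhs_infty_gtr.
Unshelve. all: by end_near. Qed.

Let qa_int : I (fun x => a x - q k x) @[k --> \oo] --> (0 : R).
Proof.
have E0 : (0 : R) = I (fun=> 0) by rewrite Rint0.
rewrite [X in _ --> X]E0.
suff [] : intg leb (fun=> 0 : R) /\
  I (fun x => a x - q k x) @[k --> \oo] --> I (fun=> 0) by [].
apply: (Rint_dct (F := fun k x => a x - q k x) (f := fun=> 0) (g := fs) qa_meas (measurable_cst _)).
- exact (src_intg rO Sfs).
- by apply: aeW => x; exact: qa_cvg.
- move=> k; apply: aeW => x.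
  have [/andP[h1 h2] _] := ab x; have /andP[h3 h4] := q_fs k x; have h5 := q_a k x.
  by rewrite ger0_norm ?subr_ge0//; apply: le_trans h2; rewrite gerBl.
Qed.

(** wA = G_2 (q k) + e is at most k u + e. Averages of u at x tend to 0, which removes k u whatever
    the size of k; those of e increase with the radius up to r^2 / 4, since - Delta e <= 1. *)
Let K_bound k r x e : 0 < r -> O x -> lebesgue_value u x 0 -> (forall y, `|y - x| <= r -> O y) ->
  sol 2 (fun x => a x - q k x) e -> src e -> forall c, lebesgue_value wA x c ->
  c <= conv (K r) e x + r ^+ 2 / 4.
Proof.
move=> r0p Ox ux xr Se sre c wc.
have [z Sz [srz _]] := src_sol Y rO mV V0 (ltr0n _ 2) (ND_src (Nq k)).
have ie := src_intg rO sre; have iwA := src_intg rO srA.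
have w_le : {ae leb, forall y, wA y <= k%:R * u y + e y}.
  have Sze := sol_add mV V0 Sz Se.
  have E : (fun y => q k y + (a y - q k y)) = a by apply/funext => y; ring.
  rewrite E in Sze.
  apply: filterS3 (sol_uniq mV V0 (ltr0n _ 2) SA Sze) (zeta_le Sz) su => y -> h1 h2.
  by rewrite lerD2r (le_trans h1)// ler_wpM2l.
have sC : superC O 1 e.
  apply: (sol_superC rO mV V0 (ltr0n _ 2) Se (qa_src k)) => // y.
  have [/andP[h1 h2] _] := ab y; have /andP[h3 h4] := q_fs k y; apply: le_trans (fs1 y).
  by rewrite lerBlDr (le_trans h2)// lerDl.
have cw := lebesgue_value_conv iwA wc; have cu := lebesgue_value_conv iu ux.
have cc : conv (K t) wA x - k%:R * conv (K t) u x @[t --> 0^'+] --> c.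
  have -> : c = c - k%:R * 0 by rewrite mulr0 subr0.
  by apply: cvgB => //; apply: cvgM => //; exact: cvg_cst.
rewrite -(cvg_lim _ cc)//; apply: limr_le; first exact: cvgP cc.
near=> t.
have t0 : 0 < t by near: t; exact: nbhs_right_gt.
have tr : t <= r by near: t; exact: nbhs_right_le.
rewrite lerBlDl; apply: (@le_trans _ _ (k%:R * conv (K t) u x + conv (K t) e x)); last first.
  rewrite lerD2l; have := superC_mono ie sC ler01 t0 tr xr; rewrite !mul1r.
  by apply: le_trans; rewrite lerDl mulr_ge0// sqr_ge0.
have cs f : intg leb f -> intg leb (fun y => K t (x - y) * f y).
  by move=> iF; exact: conv_intg_section (@K_cont R N t) (K_csuppT t0) iF x.
rewrite /conv -RintZ; last exact: cs.
rewrite -RintD; [|exact/intgZ/cs|exact: cs].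
apply: ae_Rint_le; [exact: cs|by apply: intgD; [exact/intgZ/cs|exact: cs]|].
apply: filterS w_le => y h.
rewrite (_ : _ + _ = K t (x - y) * (k%:R * u y + e y)); last by ring.
by rewrite ler_wpM2l// K_ge0.
Unshelve. all: by end_near. Qed.

Lemma pos_part_value x : O x -> lebesgue_value u x 0 -> lebesgue_value wA x 0.
Proof.
move=> Ox ux; have [gA [[S2A _ _] _ _]] := SA; have S1A := S2_S1 rO S2A.
have [aw _] := S1_appr rO S1A.
have a1 y : a y <= 1 by have [/andP[_ h] _] := ab y; exact: le_trans h (fs1 y).
have [c [wc c0 _]] := superC_lebesgue oO aw (aeW _ (fun y => src_ge0 y srA)) ler01
  (sol_superC rO mV V0 (ltr0n _ 2) SA Sa ler01 a1) Ox.
suff c00 : c <= 0 by rewrite (@le_anti _ _ c 0) ?c00 ?c0// in wc.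
apply/ler_addgt0Pr => d d0; rewrite add0r.
have /nbhs_ballP[e /= e0 eO] : nbhs x O by exact: open_nbhs_nbhs.
pose r := Num.min (e / 2) (Num.min 1 d).
have r0p : 0 < r by rewrite !lt_min divr_gt0//= ltr01.
have xr y : `|y - x| <= r -> O y.
  move=> h; apply: eO; rewrite -ball_normE /= distrC (le_lt_trans h)// /r.
  by rewrite gt_min; apply/orP; left; rewrite ltr_pdivrMr// ltr_pMr// ltr1n.
have r24 : r ^+ 2 / 4 <= d / 2.
  have h1 : r <= 1 by rewrite /r !ge_min lexx !orbT.
  have h2 : r <= d by rewrite /r !ge_min lexx !orbT.
  exact: sq4_le (ltW r0p) h1 h2.
(* The radius r is fixed before k: the bound Mr of K_r depends on r only, while the integral of e is
   at most that of a - q k, which tends to 0. *)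
pose Mr : R := (mass0 (R := R) (N := N))^-1 * 6 * r^-1 ^+ N.
have Mr0 : 0 <= Mr by rewrite !mulr_ge0 ?invr_ge0 ?(ltW (@mass0_gt0 R N)) ?exprn_ge0 ?invr_ge0 ?(ltW r0p).
have M1 : 0 < Mr + 1 by rewrite ltr_wpDl.
have : \forall k \near \oo, `|0 - I (fun x => a x - q k x)| < d / 2 / (Mr + 1).
  by move/cvgrPdist_lt: qa_int; apply; rewrite !divr_gt0.
move=> [k _ /(_ k (leqnn k))/=]; rewrite sub0r normrN => Hk.
have [et Se [sre _]] := src_sol Y rO mV V0 (ltr0n _ 2) (qa_src k).
apply: le_trans (K_bound r0p Ox ux xr Se sre wc) _; rewrite [leRHS](splitr d); apply: lerD => //.
have ie := src_intg rO sre.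
have h1 : conv (K r) et x <= Mr * I et.
  rewrite -RintZ//; apply: Rint_le => [||y].
  - exact: conv_intg_section (@K_cont R N r) (K_csuppT r0p) ie x.
  - exact: intgZ.
  - by rewrite ler_wpM2r ?(src_ge0 y sre)// K_le.
have [_ eO' _] := qa_src k.
have [i2 h2] := sol_L1 rO mV V0 (ltr0n _ 2) Se eO' (src_aege0 (qa_src k)).
have h3 : I et <= I (fun x => a x - q k x).
  apply: le_trans h2; apply: Rint_le => // y; rewrite ler_peMl ?(src_ge0 y sre)//.
  by apply: (@le_trans _ _ 2); rewrite ?ler1n// lerDr V0.
apply: le_trans h1 _; apply: (@le_trans _ _ (Mr * (d / 2 / (Mr + 1)))).
  by rewrite ler_wpM2l// (le_trans h3)// (le_trans (ler_norm _))// ltW.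
by rewrite mulrCA ler_piMr ?divr_ge0 ?(ltW d0)// ler_pdivrMr// mul1r lerDl.
Qed.

Lemma competitor_le v f G (M : R) : S2 O v G -> (forall x, 0 <= v x <= M) ->
  {ae leb, forall x, Y x -> v x = 0} -> intg leb (fun x => Vr x * v x) ->
  src f -> (forall phi, test_function O phi ->
    I (fun x => Vr x * v x * phi x) - I (fun x => v x * laplacian phi x) = I (fun x => f x * phi x)) ->
  exists2 C : R, 0 < C & {ae leb, forall x, v x <= C * (wA x + wB x)}.
Proof.
move=> Sv vM vY iVv Sf eqv; have [mf fO [Mf fMf]] := Sf.
have [[mv _] _ vO _ _] := Sv; have srv : src v by split=> //; exists M.
have iv := src_intg rO srv.
pose K1 := Num.max M Mf.
have S1v : sol 1 (fun x => f x + v x) v.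
  apply: (bounded_solution oO rO mV V0 (M := K1) Sv) => //.
  - by move=> x; have /andP[h1 h2] := vM x; rewrite ger0_norm// le_max h2.
  - exact (src_L2 rO Sf).
  - by move=> x; have /andP[h1 h2] := fMf x; rewrite ger0_norm// le_max h2 orbT.
have Nfv : ND (fun x => f x + v x).
  split; first exact: srcD.
  exists v => // phi Tp; have [tp _] := Tp; rewrite /dist.
  have i1 := test0_intg Tp iv; have i2 := test0_intg Tp iVv.
  rewrite (_ : (fun x => (Vr x + 1) * v x * phi x) = fun x => Vr x * v x * phi x + v x * phi x); last by apply/funext => x; ring.
  rewrite RintD// addrAC (eqv _ tp) -RintD//; last exact (test0_intg Tp (src_intg rO Sf)).
  by rewrite le_eqVlt; apply/orP; left; apply/eqP; congr Rintegral; apply/funext => x; ring.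
have Nv : ND v.
  by apply: (ND_le rO mV V0 Nfv) => // x; have /andP[-> _] := vM x; rewrite lerDr (src_ge0 x Sf).
have N2 := NDD rO mV V0 Nfv Nv.
have S2v : sol 2 (fun x => (f x + v x) + v x) v.
  have := sol_shift 1 S1v; rewrite (_ : 1 + 1 = 2)//.
  by congr sol; apply/funext => x; rewrite mul1r.
have M0 : 0 <= M by have /andP[h1 h2] := vM 0; exact: le_trans h2.
have Mf0 : 0 <= Mf by have /andP[h1 h2] := fMf 0; exact: le_trans h2.
(* C bounds f + 2 v, so that the rescaled source is at most 1; C >= 1 keeps it below the original
   source, and therefore free of defect by [ND_le]. *)
pose C := Mf + M + M + 1; have C1 : 1 <= C by rewrite /C; lra.
have C0 : 0 < C by lra.
exists C => //.
have Nc : ND (fun x => C^-1 * ((f x + v x) + v x)).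
  apply: (ND_le rO mV V0 N2).
    by apply: measurable_funM => //; apply: measurable_funD => //; exact: measurable_funD.
  move=> x; have := src_ge0 x Sf; have := src_ge0 x srv => h1 h2.
  have h3 : 0 <= f x + v x + v x by rewrite !addr_ge0.
  by rewrite mulr_ge0 ?invr_ge0 ?(ltW C0)//= ler_piMl// invf_le1.
have c1 : {ae leb, forall x, C^-1 * ((f x + v x) + v x) <= fs x}.
  apply: fsmax Nc _ => x; rewrite ler_pdivrMl// mulr1.
  have /andP[_ h1] := vM x; have /andP[_ h2] := fMf x; rewrite /C; lra.
have le1 : {ae leb, forall x, C^-1 * v x <= wA x + wB x}.
  apply: (sol_mono rO mV V0 (ltr0n _ 2) (sol_scale C^-1 S2v) (sol_add mV V0 SA SB)).
  by apply: filterS c1 => x; have [_ [_ ->]] := ab x.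
by apply: filterS le1 => x; rewrite ler_pdivrMl.
Qed.

End Decomposition.

End Core.

(** * Pointwise consequences of relations that hold almost everywhere *)

Section Lebesgue_values.
Context {R : realType} {N : nat}.
Local Notation leb := (@lebesgue_rV R N).
Local Notation I f := (Rintegral leb setT f).
Implicit Types (f g v : 'rV[R]_N -> R).

(** Where f = 0 the deviation |f - p| is |p|, and where g = 0 the deviation |g - q| is |q|. So their
    sum is at least min (|p|, |q|) almost everywhere, while its averages at x tend to 0. *)
Lemma lebesgue_value_mul0 f g x (p q : R) : intg leb f -> intg leb g ->
  {ae leb, forall y, f y * g y = 0} -> lebesgue_value f x p -> lebesgue_value g x q ->
  p * q = 0.
Proof.
move=> iF ig fg fp gq.
have cf := lebesgue_value_K iF fp; have cg := lebesgue_value_K ig gq.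
pose m := Num.min `|p| `|q|.
suff m0 : m <= 0.
  apply/eqP; rewrite mulf_eq0 -!normr_le0; move: m0; rewrite /m ge_min.
  by case/orP => ->; rewrite ?orbT.
have c0 : I (fun y => K s (x - y) * `|f y - p|) + I (fun y => K s (x - y) * `|g y - q|)
    @[s --> 0^'+] --> (0 : R).
  have E0 : (0 : R) = 0 + 0 by rewrite addr0.
  by rewrite [X in _ --> X]E0; exact: cvgD.
rewrite -(cvg_lim _ c0)//; apply: limr_ge; first exact: cvgP c0.
near=> s; have s0 : 0 < s by near: s; exact: nbhs_right_gt.
have i1 := K_norm_intg x p s0 iF; have i2 := K_norm_intg x q s0 ig.
rewrite -[leLHS]mulr1 -(K_mass_shift x s0) -RintZ; last exact: K_intg_shift.
rewrite -RintD//; apply: ae_Rint_le; [exact/intgZ/K_intg_shift|exact: intgD|].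
apply: filterS fg => y /eqP; rewrite mulf_eq0 mulrC -mulrDr => h.
rewrite ler_wpM2l ?K_ge0//; case/orP: h => /eqP ->; rewrite sub0r normrN /m ge_min.
  by rewrite lerDl normr_ge0.
by rewrite lerDr normr_ge0 orbT.
Unshelve. all: by end_near. Qed.

Lemma lebesgue_value_le f g v x (C p : R) : intg leb v -> intg leb f -> intg leb g ->
  {ae leb, forall y, v y <= C * (f y + g y)} -> lebesgue_value v x p ->
  lebesgue_value f x 0 -> lebesgue_value g x 0 -> p <= 0.
Proof.
move=> iv iF ig vfg vp f0 g0.
have cf := lebesgue_value_conv iF f0; have cg := lebesgue_value_conv ig g0.
have cv := lebesgue_value_conv iv vp.
have c0 : conv (K s) v x - C * (conv (K s) f x + conv (K s) g x) @[s --> 0^'+] --> p.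
  have -> : p = p - C * (0 + 0) by rewrite addr0 mulr0 subr0.
  by apply: cvgB => //; apply: cvgM; [exact: cvg_cst|exact: cvgD].
rewrite -(cvg_lim _ c0)//; apply: limr_le; first exact: cvgP c0.
near=> s; have s0 : 0 < s by near: s; exact: nbhs_right_gt.
have ck := @K_cont R N s; have sk := @K_csuppT R N s s0.
rewrite subr_le0 -convD// -convZ//; last exact: intgD.
by apply: conv_le => //; [exact/intgZ/intgD|move=> y; exact: K_ge0].
Unshelve. all: by end_near. Qed.

End Lebesgue_values.

(** * The decomposition attached to a supersolution *)

Section Decomposition.
Context {R : realType} {N : nat}.
Local Notation leb := (@lebesgue_rV R N).
Local Notation I f := (Rintegral leb setT f).
Variables (O : set 'rV[R]_N) (r0 : R) (Vr : 'rV[R]_N -> R) (Y : set 'rV[R]_N).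
Hypotheses (oO : open O) (rO : forall x, O x -> `|x| < r0) (bO : smooth_boundary O).
Hypotheses (N0 : (0 < N)%N).
Hypotheses (mV : measurable_fun setT Vr) (V0 : forall x, 0 <= Vr x).
Local Notation sol := (sol O Vr Y).
Local Notation src := (src O).
Implicit Types (u z f q phi : 'rV[R]_N -> R).

Lemma sol_value al f z x : 0 < al -> sol al f z -> src f -> (forall y, f y <= 1) -> src z ->
  O x -> exists2 c, lebesgue_value z x c & 0 <= c.
Proof.
move=> al0 Sz Sf f1 srz Ox; have [g [[S2z _ _] _ _]] := Sz.
have [az _] := S1_appr rO (S2_S1 rO S2z).
have [c [zc c0 _]] := superC_lebesgue oO az (aeW _ (fun y => src_ge0 y srz)) ler01
  (sol_superC rO mV V0 al0 Sz Sf ler01 f1) Ox.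
by exists c.
Qed.

Definition supersol u := forall phi, test0 O phi ->
  0 <= I (fun x => Vr x * u x * phi x) - I (fun x => u x * laplacian phi x).

(** The conclusion of [competitor_le] as a property of w alone, so that fs and s do not appear in
    the result of the decomposition. *)
Definition dominates w := forall v f G (M : R), S2 O v G -> (forall x, 0 <= v x <= M) ->
  {ae leb, forall x, Y x -> v x = 0} -> intg leb (fun x => Vr x * v x) ->
  src f -> (forall phi, test_function O phi ->
    I (fun x => Vr x * v x * phi x) - I (fun x => v x * laplacian phi x) = I (fun x => f x * phi x)) ->
  exists2 C : R, 0 < C & {ae leb, forall x, v x <= C * w x}.

Lemma zero_decomposition u gu : S1 O u gu -> (forall x, 0 <= u x) ->
  intg leb (fun x => Vr x * u x) -> supersol u ->
  exists a b wA wB, [/\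
    [/\ src a, src b, src wA & src wB],
    [/\ sol 2 a wA, sol 2 b wB, forall x, a x <= 1, forall x, b x <= 1 & forall x, wB x <= 1],
    {ae leb, forall x, wA x * wB x = 0},
    {ae leb, forall x, u x * wB x = 0} /\ {ae leb, forall x, u x * b x = 0} &
    (forall x, O x -> lebesgue_value u x 0 -> lebesgue_value wA x 0) /\
    dominates (fun x => wA x + wB x)].
Proof.
move=> Su u0 iVu super; have [iu _ uO _ _] := Su; have mu := intg_measurable iu.
have [fs [Nfs fs1 fsmax]] := ND_maximal Y rO mV V0.
pose g x := Num.min (u x) (fs x); have Sfs := ND_src Nfs; have [mfs _ _] := Sfs.
have Ng : ND O Vr Y g.
  apply: (ND_le rO mV V0 Nfs); first exact: measurable_minr.
  by move=> x; rewrite /g le_min u0 (src_ge0 x Sfs)/= ge_min lexx orbT.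
have Sg := ND_src Ng; have t0 : 0 < 2 :> R by [].
have [s Ss [srs sM]] := src_sol Y rO mV V0 t0 Sg.
have half f z M : (forall M, (forall x, f x <= 2 * M) -> forall x, z x <= M) ->
    (forall x, f x <= M) -> 0 <= M -> forall x : 'rV[R]_N, z x <= M.
  by move=> H fM M0; apply: H => x; apply: le_trans (fM x) _; rewrite ler_peMl// ler1n.
have g1 x : g x <= 1 by rewrite /g ge_min fs1 orbT.
have s1 := half g s 1 sM g1 ler01.
have [gs [[S2s _ _] _ _]] := Ss; have S1s := S2_S1 rO S2s.
have is_ := src_intg rO srs; have iVs := sol_Vintg rO mV V0 t0 Ss Sg.
(* The difference u - s is a supersolution for the potential V + 2, since 2 u - g >= 0. Here s
   enters only as a subsolution, so a defect of s would do no harm. *)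
have su : {ae leb, forall x, s x <= u x}.
  have H : {ae leb, forall x, 0 <= u x - s x}.
    apply: (comparison oO rO bO (W := fun x => Vr x + 2) N0 _ (S1B Su S1s)) => [x||phi tp p0].
    - by rewrite addr_ge0.
    - apply: (eq_intg (f := fun x => (Vr x * u x + 2 * u x) - (Vr x + 2) * s x)) => [x|]; first by ring.
      by apply: intgB => //; apply: intgD => //; exact: intgZ.
    - have Tp : test0 O phi by [].
      have j1 := test0_intg Tp iVu; have j2 := test0_intg Tp iu; have j3 := test0_intg Tp iVs.
      have j4 := test0_lap_intg Tp iu; have j5 := test0_lap_intg Tp is_.
      have -> : I (fun x => (Vr x + 2) * (u x - s x) * phi x) =
        I (fun x => Vr x * u x * phi x) + 2 * I (fun x => u x * phi x) -
        I (fun x => (Vr x + 2) * s x * phi x).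
        rewrite -RintZ// -RintD//; last exact: intgZ.
        rewrite -RintB//; last by apply: intgD => //; exact: intgZ.
        by congr Rintegral; apply/funext => x; ring.
      have -> : I (fun x => (u x - s x) * laplacian phi x) =
        I (fun x => u x * laplacian phi x) - I (fun x => s x * laplacian phi x).
        by rewrite -RintB//; congr Rintegral; apply/funext => x; ring.
      have := super _ Tp; have := sol_dist_le rO mV V0 t0 Ss Sg Tp; rewrite /dist.
      have h1 : I (fun x => g x * phi x) <= I (fun x => u x * phi x).
        apply: Rint_le => //; first exact: test0_intg Tp (src_intg rO Sg).
        by move=> x; rewrite ler_wpM2r// /g ge_min lexx.
      have h2 : 0 <= I (fun x => u x * phi x) by apply: Rint_ge0 => x; rewrite mulr_ge0.
      move: h1 h2; set b1 := I _; set b2 := I _; set b3 := I _; set b4 := I _; set b5 := I _; set b6 := I _.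
      by move=> *; lra.
  by apply: filterS H => x; rewrite subr_ge0.
have Na := pos_partND rO mV V0 Nfs srs; have Nb := zero_partND rO mV V0 Nfs srs.
have A01 x : 0 <= (\1_[set y | 0 < s y] x : R) <= 1.
  by rewrite indicE; case: (_ \in _); rewrite ?lexx ?ler01.
have a1 x : pos_part fs s x <= 1.
  by have /andP[h1 h2] := A01 x; rewrite /pos_part mulr_ile1// (src_ge0 x Sfs).
have b1 x : zero_part fs s x <= 1.
  have /andP[h1 h2] := A01 x; rewrite /zero_part mulr_ile1 ?subr_ge0 ?(src_ge0 x Sfs) ?gerBl//.
have [wA SA [srA AM]] := src_sol Y rO mV V0 t0 (ND_src Na).
have [wB SB [srB BM]] := src_sol Y rO mV V0 t0 (ND_src Nb).
have wA1 := half _ _ 1 AM a1 ler01; have wB1 := half _ _ 1 BM b1 ler01.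
exists (pos_part fs s), (zero_part fs s), wA, wB; split.
- by split=> //; [exact: ND_src Na|exact: ND_src Nb].
- by [].
- exact (parts_disjoint rO mV V0 Nfs fsmax Su u0 Ss srs s1 su SA srA wA1 SB srB).
- split; first exact (zero_part_off rO mV V0 Nfs fsmax Su u0 Ss srs SB srB wB1).
  exact (zero_part_source_off oO rO mV V0 Nfs fsmax Su u0 Ss srs s1 su SB srB).
- split; last exact (competitor_le oO rO mV V0 Nfs fsmax SA SB).
  exact (pos_part_value oO rO mV V0 Nfs fs1 fsmax Su u0 Ss srs s1 su SA srA).
Qed.

End Decomposition.

Lemma Rint_dct_cvg d (T : measurableType d) (R : realType)
    (mu : {measure set T -> \bar R}) (F : nat -> T -> R) (f g : T -> R) :
  (forall n, measurable_fun setT (F n)) -> measurable_fun setT f -> intg mu g ->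
  {ae mu, forall x, F n x @[n --> \oo] --> f x} ->
  (forall n, {ae mu, forall x, `|F n x| <= g x}) ->
  Rintegral mu setT (F n) @[n --> \oo] --> Rintegral mu setT f.
Proof. by move=> h1 h2 h3 h4 h5; have [] := Rint_dct h1 h2 h3 h4 h5. Qed.

(** * Testing with a mollified solution *)

Section Test_products.
Context {R : realType} {N : nat}.
Local Notation leb := (@lebesgue_rV R N).
Local Notation I f := (Rintegral leb setT f).
Implicit Types (f g p th : 'rV[R]_N -> R).

Lemma partialM f g i : smooth f -> smooth g ->
  partial i (fun x => f x * g x) = fun x => f x * partial i g x + g x * partial i f x.
Proof. by move=> sf sg; exact: C1gE i (C1gM (smooth_C1 sf) (smooth_C1 sg)). Qed.

Lemma laplacianM f g x : smooth f -> smooth g ->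
  laplacian (fun x => f x * g x) x =
  g x * laplacian f x + 2 * (\sum_i partial i f x * partial i g x) + f x * laplacian g x.
Proof.
move=> sf sg; rewrite /laplacian mulr_sumr !mulr_sumr -!big_split; apply: eq_bigr => i _ /=.
have C1 := C1gM (smooth_C1 sf) (smooth_C1 (smooth_partial i sg)).
have C2 := C1gM (smooth_C1 sg) (smooth_C1 (smooth_partial i sf)).
rewrite partialM// (C1gE i (C1gD C1 C2)).
move: (f x) (g x) (partial i f x) (partial i g x) (partial i (partial i f) x) (partial i (partial i g) x).
by clear; move=> a b c d a' b'; ring.
Qed.

Lemma laplacian_conv k z x : smooth k -> csupp setT k -> intg leb z ->
  laplacian (conv k z) x = conv (laplacian k) z x.
Proof.
move=> sk ck iz; have H f : smooth f -> csupp setT f -> forall i, partial i (conv f z) = conv (partial i f) z.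
  by move=> sf cf i; exact: C1gE i (conv_C1g (smooth_C1 sf) cf iz).
have cp i := csupp_partial i (smooth_C1 sk) ck.
rewrite /laplacian /conv -[RHS]/(I _); under [RHS]eq_Rintegral do rewrite mulr_suml.
rewrite Rint_sum => [|i]; last first.
  have sp := smooth_partial i (smooth_partial i sk).
  by apply: conv_intg_section iz x; [have [] := smooth_C1 sp|exact: csupp_partial (smooth_C1 (smooth_partial i sk)) (cp i)].
by apply: eq_bigr => i _; rewrite -/(conv k z) H// H//; exact: smooth_partial.
Qed.

Lemma partial_odd (k : 'rV[R]_N -> R) dk i (x : 'rV[R]_N) : C1g k dk -> (forall y, k (- y) = - k y) -> dk i (- x) = dk i x.
Proof.
move=> [_ _ H] ke.
have L := (is_derive_line _ _ _ _).1 (H i (- x)).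
have L2 := (is_derive_line _ _ _ _).1 (H i x).
have E : (fun t : R => k (t *: delta_mx 0 i + x)) =
    (- (fun t : R => k (t *: delta_mx 0 i + - x)) : R -> R) \o (fun t : R => - t).
  apply/funext => t; have -> : ((- (fun t : R => k (t *: delta_mx 0 i + - x)) : R -> R) \o (fun t : R => - t)) t =
    - k ((- t) *: delta_mx 0 i + - x) by [].
  by rewrite -ke opprD opprK scaleNr opprK.
have L' : is_derive ((fun t : R => - t) 0) (1 : R) (- (fun t : R => k (t *: delta_mx 0 i + - x)) : R -> R) (- dk i (- x)).
  by rewrite oppr0; exact: is_deriveN.
have dN : is_derive (0 : R) (1 : R) (fun t : R => - t) (- 1) by exact: is_deriveNid.
have L3 := @is_derive1_comp R _ (fun t : R => - t) 0 _ _ L' dN.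
rewrite -E in L3; have [_ <-] := L2; have [_ ->] := L3.
by rewrite mulrN1 opprK.
Qed.

Lemma laplacian_even (k : 'rV[R]_N -> R) (x : 'rV[R]_N) : smooth k -> (forall y, k (- y) = k y) -> laplacian k (- x) = laplacian k x.
Proof.
move=> sk ke; apply: eq_bigr => i _.
apply: (partial_odd i x (smooth_C1 (smooth_partial i sk))) => y.
exact: partial_even (smooth_C1 sk) ke.
Qed.

End Test_products.

(** * The gradient on the zero set *)

Section Gradient_on_zero_set.
Context {R : realType} {N : nat}.
Local Notation leb := (@lebesgue_rV R N).
Local Notation I f := (Rintegral leb setT f).
Variables (O : set 'rV[R]_N) (u : 'rV[R]_N -> R) (gu : 'I_N -> 'rV[R]_N -> R).
Hypotheses (Su : S1 O u gu) (u0 : forall x, 0 <= u x).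

Definition posi x : R := \1_[set y | 0 < u y] x.

Lemma posi_meas : measurable_fun setT posi.
Proof.
have [iu _ _ _ _] := Su; have mu := intg_measurable iu.
apply: measurable_indic; have := mu measurableT _ (measurable_itv `]0, +oo[).
by rewrite setTI; congr measurable; apply/seteqP; split=> y /=; rewrite in_itv/= andbT.
Qed.

Lemma posi1 x : 0 < u x -> posi x = 1.
Proof. by move=> h; rewrite /posi indicE mem_set. Qed.

Lemma posi0 x : u x = 0 -> posi x = 0.
Proof. by move=> h; rewrite /posi indicE memNset//= h ltxx. Qed.

Lemma posi_intg i : intg leb (fun x => posi x * gu i x).
Proof.
have [_ ig _ _ _] := Su; apply: (intgMb (C := 1)) (ig i); first exact: posi_meas.
by move=> x; rewrite /posi indicE; case: (_ \in _); rewrite ?normr1// normr0.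
Qed.

(* Compare the gradients of [u] and of its truncations [Theta (n u) / n]. *)
Lemma gradient_zero_set i f : test_function O f ->
  I (fun x => gu i x * f x) = I (fun x => posi x * gu i x * f x).
Proof.
move=> tf; have [iu ig _ _ _] := Su; have mu := intg_measurable iu.
have Cf := smooth_C1 (test_smooth tf); have [cf cdf _] := Cf.
have sf := csuppT (test_csupp tf).
have sdf := csupp_partial i Cf sf.
have [C0 _ HC0] := csupp_bounded cf sf; have [C1 _ HC1] := csupp_bounded (cdf i) sdf.
have HC1' x : `|f x| <= Num.max C0 C1 by rewrite le_max HC0.
have mf := continuous_measurable_rV cf; have mdf := continuous_measurable_rV (cdf i).
have bnd (h k : 'rV[R]_N -> R) (C : R) : measurable_fun setT k -> (forall x, `|k x| <= C) -> intg leb h ->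
    intg leb (fun x => h x * k x).
  by move=> mk kC ih; apply: eq_intg (intgMb mk kC ih) => x; exact: mulrC.
have [C HC HC'] : exists2 C : R, (forall x, `|f x| <= C) & forall j x, `|partial j f x| <= C.
  have /choice[F HF] j : exists C : R, forall x, `|partial j f x| <= C.
    have [D _ HD] := csupp_bounded (cdf j) (csupp_partial j Cf sf); by exists D.
  exists (C0 + \sum_j `|F j|) => [x|j x].
    by rewrite (le_trans (HC0 x))// lerDl sumr_ge0.
  rewrite (le_trans (HF j x))// (le_trans (ler_norm _))// (bigD1 j)//= addrCA lerDl.
  by rewrite addr_ge0 ?sumr_ge0// (le_trans _ (HC0 0)).
have E n : I (fun x => n.+1%:R^-1 * Theta (n.+1%:R * u x + 0) * partial i f x) =
    - I (fun x => Psi (n.+1%:R * u x + 0) * gu i x * f x).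
  have Sn := S1_chain (adm_scaled_Theta n) Su.
  exact: S1_ibp Sn Cf HC (HC' i).
have Eu : I (fun x => u x * partial i f x) = - I (fun x => gu i x * f x).
  exact: S1_ibp Su Cf HC (HC' i).
have c1 : I (fun x => n.+1%:R^-1 * Theta (n.+1%:R * u x + 0) * partial i f x) @[n --> \oo] -->
    I (fun x => u x * partial i f x).
  apply: (Rint_dct_cvg (F := fun n x => n.+1%:R^-1 * Theta (n.+1%:R * u x + 0) * partial i f x)
    (f := fun x => u x * partial i f x) (g := fun x => `|u x * partial i f x|)) => [n||||n].
  - apply: measurable_funM => //.
    exact: measurableT_comp (continuous_measurable_fun (adm_cont (adm_scaled_Theta n))) mu.
  - exact: measurable_funM.
  - by apply: intg_norm; exact: bnd iu.
  - by apply: aeW => x; apply: cvgM; [exact: Theta_scaled_cvg|exact: cvg_cst].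
  - by apply: aeW => x; rewrite !normrM ler_wpM2r// -normrM Theta_scaled_le.
have c2 : I (fun x => Psi (n.+1%:R * u x + 0) * gu i x * f x) @[n --> \oo] -->
    I (fun x => posi x * gu i x * f x).
  apply: (Rint_dct_cvg (F := fun n x => Psi (n.+1%:R * u x + 0) * gu i x * f x)
    (f := fun x => posi x * gu i x * f x) (g := fun x => `|gu i x * f x|)) => [n||||n].
  - apply: measurable_funM => //; apply: measurable_funM; last exact: intg_measurable (ig i).
    exact: measurableT_comp (continuous_measurable_fun (adm_dcont (adm_scaled_Theta n))) mu.
  - apply: measurable_funM => //; exact: intg_measurable (posi_intg i).
  - by apply: intg_norm; exact: bnd (ig i).
  - apply: aeW => x; apply: cvgM; last exact: cvg_cst.
    apply: cvgM; last exact: cvg_cst.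
    have := u0 x; rewrite le_eqVlt => /orP[/eqP h|h]; last by rewrite posi1//; exact: Psi_cvg1.
    rewrite posi0//; apply: cvg_near_cst; apply: nearW => n.
    by rewrite -h mulr0 addr0 Psi0.
  - by apply: aeW => x; rewrite -mulrA normrM ler_piMl// Psi_norm.
apply: oppr_inj; rewrite -Eu -(cvg_lim _ c1)// -(cvg_lim _ (cvgN c2))//.
by congr (limn _); apply/funext => n; exact: E.
Qed.

End Gradient_on_zero_set.

(** * The equation of u tested near the support of w *)

Section Measure_of_support.
Context {R : realType} {N : nat}.
Local Notation leb := (@lebesgue_rV R N).
Local Notation I f := (Rintegral leb setT f).
Variables (O : set 'rV[R]_N) (r0 : R) (Vr : 'rV[R]_N -> R) (Y : set 'rV[R]_N).
Hypotheses (oO : open O) (rO : forall x, O x -> `|x| < r0).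
Hypotheses (mV : measurable_fun setT Vr) (V0 : forall x, 0 <= Vr x).
Local Notation sol := (sol O Vr Y).
Local Notation src := (src O).
Variables (u : 'rV[R]_N -> R) (gu : 'I_N -> 'rV[R]_N -> R).
Hypotheses (Su : S1 O u gu) (u0 : forall x, 0 <= u x) (iVu : intg leb (fun x => Vr x * u x)).
Variables (b w : 'rV[R]_N -> R).
Hypotheses (Sw : sol 2 b w) (Sb : src b) (b1 : forall x, b x <= 1).
Hypotheses (srw : src w) (w1 : forall x, w x <= 1).
Hypotheses (uw : {ae leb, forall x, u x * w x = 0}) (ub : {ae leb, forall x, u x * b x = 0}).
Variable th : 'rV[R]_N -> R.
Hypothesis Tth : test0 O th.

Let iu : intg leb u. Proof. by have [] := Su. Qed.
Let iw : intg leb w. Proof. exact (src_intg rO srw). Qed.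
Let ib : intg leb b. Proof. exact (src_intg rO Sb). Qed.
Let sth : smooth th. Proof. by have [/test_smooth] := Tth. Qed.
Let cth : csupp O th. Proof. by have [/test_csupp] := Tth. Qed.

(* The product of th and a mollification w_d of w is a test function for the
   equation of u; after integration by parts, everything but the Laplacian of w_d
   is w_d times this density, which vanishes almost everywhere where w > 0. *)
Definition gap_density x := Vr x * u x * th x + u x * laplacian th x +
  2 * \sum_i (posi u x * gu i x) * partial i th x.

Let bnd k h : continuous k -> csupp O k -> intg leb h -> intg leb (fun x => h x * k x).
Proof.
move=> ck sk ih; have [C _ HC] := csupp_bounded ck sk.
by apply: eq_intg (intgMb (continuous_measurable_rV ck) HC ih) => x; exact: mulrC.
Qed.

Let cdth i : continuous (partial i th). Proof. by have [_ h _] := smooth_C1 sth. Qed.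
Let sdth i : csupp O (partial i th). Proof. exact: csupp_partial (smooth_C1 sth) cth. Qed.
Let clth : continuous (laplacian th). Proof. exact: laplacian_cont. Qed.
Let slth : csupp O (laplacian th). Proof. exact: laplacian_csupp. Qed.
Let ccth : continuous th. Proof. by have [h _ _] := smooth_C1 sth. Qed.

Let ith1 : intg leb (fun x => Vr x * u x * th x). Proof. exact: bnd. Qed.
Let ith2 : intg leb (fun x => u x * laplacian th x). Proof. exact: bnd. Qed.
Let ith3 i : intg leb (fun x => posi u x * gu i x * partial i th x).
Proof. by apply: bnd => //; exact: posi_intg Su i. Qed.

Let gap_intg : intg leb gap_density.
Proof. by apply: intgD; [exact: intgD|apply/intgZ/intg_sum]. Qed.

Let gap_w : {ae leb, forall x, w x * gap_density x = 0}.
Proof.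
apply: filterS uw => x /eqP; rewrite mulf_eq0 => /orP[/eqP ux|/eqP ->]; last by rewrite mul0r.
rewrite /gap_density ux (posi0 ux) mulr0 !mul0r !add0r big1 ?mulr0// => i _.
by rewrite !mul0r.
Qed.

Let ws d := conv (K d) w.

Let ws_smooth d : 0 < d -> smooth (ws d).
Proof. move=> d0; exact: conv_smooth (@K_smooth R N d) (K_csuppT d0) iw. Qed.

Let ws01 d x : 0 < d -> 0 <= ws d x <= 1.
Proof.
move=> d0; apply/andP; split.
  apply: conv_ge0 (@K_cont R N d) (K_csuppT d0) iw (fun y => K_ge0 y d0) _.
  by apply: aeW => y; exact: src_ge0 srw.
by apply: convK_le => //; exact: aeW.
Qed.

Let ws_norm d x : 0 < d -> `|ws d x| <= 1.
Proof. by move=> d0; have /andP[h1 h2] := ws01 x d0; rewrite ger0_norm. Qed.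

Let Tws d : 0 < d -> test0 O (fun x => th x * ws d x).
Proof.
move=> d0; split; last by move=> x; have [_ p] := Tth; have /andP[h _] := ws01 x d0; rewrite mulr_ge0.
apply: csupp_test; last exact: csuppM.
by apply: smoothM => //; exact: ws_smooth.
Qed.

Let cws d : 0 < d -> continuous (ws d).
Proof. by move=> /ws_smooth/smooth_C1[]. Qed.

Let mulb d h : 0 < d -> intg leb h -> intg leb (fun x => ws d x * h x).
Proof.
move=> d0 ih; apply: (intgMb (C := 1)) ih; first exact: continuous_measurable_rV (cws d0).
by move=> x; exact: ws_norm.
Qed.

Let lap_intg d : 0 < d -> intg leb (fun x => u x * th x * laplacian (ws d) x).
Proof.
move=> d0; have H := bnd (contM ccth (laplacian_cont (ws_smooth d0))) (csuppM _ cth) iu.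
by apply: eq_intg H => x; rewrite mulrA.
Qed.

(** The derivative of w_d is moved onto u partial th. Restricting the gradient of u to {u > 0} makes
    every resulting density vanish where u = 0. *)
Let ibp d i : 0 < d -> I (fun x => u x * (partial i th x * partial i (ws d) x)) =
  - I (fun x => ws d x * (posi u x * gu i x * partial i th x)) -
  I (fun x => ws d x * (u x * partial i (partial i th) x)).
Proof.
move=> d0; have sp := smooth_partial i sth; have sw := ws_smooth d0.
have T : test_function O (fun x => partial i th x * ws d x).
  by apply: csupp_test; [exact: smoothM|exact: csuppM].
have C1 := C1gM (smooth_C1 sp) (smooth_C1 sw).
have [C HC] := csupp_smooth_bound i (smooth_partial i sth) (csuppT (sdth i)).
have [cX cdX _] := C1; have sX := csuppT (test_csupp T).
have [CX _ HX] := csupp_bounded cX sX.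
have [CdX _ HdX] := csupp_bounded (cdX i) (csupp_partial i C1 sX).
have E := S1_ibp (C := Num.max CX CdX) (i := i) Su C1.
have {}E : I (fun x => u x * (partial i th x * partial i (ws d) x + ws d x * partial i (partial i th) x))
    = - I (fun x => gu i x * (partial i th x * ws d x)).
  by apply: E => x; rewrite le_max ?HX ?HdX ?orbT.
rewrite (gradient_zero_set Su u0 i T) in E.
have j1 : intg leb (fun x => ws d x * (u x * partial i (partial i th) x)).
  apply: mulb => //; apply: bnd => //; last exact: csupp_partial (smooth_C1 sp) (sdth i).
  by have [_ h _] := smooth_C1 sp; exact: h.
have j2 : intg leb (fun x => u x * (partial i th x * partial i (ws d) x)).
  apply: bnd => //; last exact: csuppM.
  by apply: contM => //; have [_ h _] := smooth_C1 sw; exact: h.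
rewrite -[LHS](addrK (I (fun x => ws d x * (u x * partial i (partial i th) x)))) -RintD//.
congr (_ - _); rewrite [X in - Rintegral _ _ X](_ : _ = fun x => posi u x * gu i x * (partial i th x * ws d x)).
  by rewrite -E; congr Rintegral; apply/funext => x; ring.
by apply/funext => x; ring.
Qed.

Let Lam phi := I (fun x => Vr x * u x * phi x) - I (fun x => u x * laplacian phi x).

(** Leibniz' rule for th w_d. The mixed term, integrated by parts, contributes twice u w_d Delta th,
    which explains the positive sign of u Delta th in [gap_density]. *)
Let Lam_ws d : 0 < d -> Lam (fun x => th x * ws d x) =
  I (fun x => ws d x * gap_density x) - I (fun x => u x * th x * laplacian (ws d) x).
Proof.
move=> d0; have sw := ws_smooth d0.
have k1 := mulb d0 ith1; have k2 := mulb d0 ith2.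
have k3 i := mulb d0 (ith3 i).
have k4 i : intg leb (fun x => u x * (partial i th x * partial i (ws d) x)).
  apply: bnd => //; last exact: csuppM.
  by apply: contM => //; have [_ h _] := smooth_C1 sw; exact: h.
have k5 := lap_intg d0.
have k6 i : intg leb (fun x => ws d x * (u x * partial i (partial i th) x)).
  have sp := smooth_partial i sth.
  apply: mulb => //; apply: bnd => //; last exact: csupp_partial (smooth_C1 sp) (sdth i).
  by have [_ h _] := smooth_C1 sp; exact: h.
have E1 : I (fun x => u x * laplacian (fun x => th x * ws d x) x) =
    I (fun x => ws d x * (u x * laplacian th x)) +
    2 * (\sum_i I (fun x => u x * (partial i th x * partial i (ws d) x))) +
    I (fun x => u x * th x * laplacian (ws d) x).
  rewrite -Rint_sum// -RintZ; last exact: intg_sum.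
  have q1 : intg leb (fun x => 2 * \sum_i u x * (partial i th x * partial i (ws d) x)).
    by apply/intgZ/intg_sum.
  rewrite -RintD// -RintD//; last exact: intgD.
  congr Rintegral; apply/funext => x; rewrite laplacianM// -mulr_sumr !mulrDr.
  by congr (_ + _ + _); rewrite ?mulrA//; [rewrite [u x * _]mulrC|rewrite [u x * _]mulrC].
have E2 : \sum_i I (fun x => u x * (partial i th x * partial i (ws d) x)) =
    - (\sum_i I (fun x => ws d x * (posi u x * gu i x * partial i th x))) -
    I (fun x => ws d x * (u x * laplacian th x)).
  have -> : I (fun x => ws d x * (u x * laplacian th x)) =
      \sum_i I (fun x => ws d x * (u x * partial i (partial i th) x)).
    rewrite -Rint_sum//; congr Rintegral; apply/funext => x.
    by rewrite /laplacian !mulr_sumr.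
  transitivity (\sum_i (- I (fun x => ws d x * (posi u x * gu i x * partial i th x)) -
      I (fun x => ws d x * (u x * partial i (partial i th) x)))).
    by apply: eq_bigr => i _; exact (ibp i d0).
  by rewrite sumrB sumrN.
have E3 : I (fun x => ws d x * gap_density x) =
    I (fun x => ws d x * (Vr x * u x * th x)) + I (fun x => ws d x * (u x * laplacian th x)) +
    2 * (\sum_i I (fun x => ws d x * (posi u x * gu i x * partial i th x))).
  rewrite -Rint_sum// -RintZ; last exact: intg_sum.
  have q1 : intg leb (fun x => 2 * \sum_i ws d x * (posi u x * gu i x * partial i th x)).
    by apply/intgZ/intg_sum.
  rewrite -RintD// -RintD//; last exact: intgD.
  congr Rintegral; apply/funext => x; rewrite /gap_density -mulr_sumr !mulrDr.
  by congr (_ + _); rewrite mulrCA.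
have EV : I (fun x => Vr x * u x * (th x * ws d x)) = I (fun x => ws d x * (Vr x * u x * th x)).
  by congr Rintegral; apply/funext => x; ring.
apply: etrans (congr2 (fun p q => p - q) EV E1) _.
by rewrite E2 E3; ring.
Qed.

(** w is a subsolution: test with the kernel at x and drop the nonnegative term (V + 2) w. *)
Let lap_ws d x : 0 < d -> (forall y, `|y - x| <= d -> O y) ->
  - laplacian (ws d) x <= conv (K d) b x.
Proof.
move=> d0 xd; have T : test0 O (fun y => K d (y - x)).
  by split; [exact: K_test|move=> y; exact: K_ge0].
have := sol_dist_le rO mV V0 (ltr0n _ 2) Sw Sb T; rewrite /dist.
have h : 0 <= I (fun y => (Vr y + 2) * w y * K d (y - x)).
  by apply: Rint_ge0 => y; rewrite mulr_ge0 ?K_ge0// mulr_ge0 ?(src_ge0 y srw)// addr_ge0 ?V0.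
have -> : I (fun y => w y * laplacian (fun z => K d (z - x)) y) = laplacian (ws d) x.
  rewrite laplacian_conv//; [|exact: K_smooth|exact: K_csuppT].
  congr Rintegral; apply/funext => y; rewrite laplacian_shift; last exact: K_smooth.
  by rewrite mulrC -(laplacian_even _ (@K_smooth R N d) (@KN R N d)) opprB.
have -> : I (fun y => b y * K d (y - x)) = conv (K d) b x.
  by congr Rintegral; apply/funext => y; rewrite mulrC -KN opprB.
by apply: le_trans; rewrite lerDr.
Qed.

(** In [Lam_ws] the integral of w_d gap_density is small because w gap_density = 0 almost
    everywhere. The other term is at most the integral of u th times the mollification of b; as the
    kernel is even, this is b against the mollification of u th, which is close to b u th = 0. *)
Lemma measure_gap e : 0 < e -> exists2 d0 : R, 0 < d0 & forall d, 0 < d < d0 ->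
  Lam (fun x => th x * ws d x) <= e.
Proof.
move=> e0; have e20 : 0 < e / 2 by rewrite divr_gt0.
have [gw [[S2w _ _] _ _]] := Sw; have [aw _] := S1_appr rO (S2_S1 rO S2w).
have [au _] := S1_appr rO Su.
have [K0 [cK KO Kf]] := cth; have [dO dO0 dOH] := compact_open_dist cK oO KO.
have [Ct Ct0 HCt] := csupp_bounded ccth cth.
have mth := continuous_measurable_rV ccth.
have iut : intg leb (fun x => u x * th x) by exact: bnd.
have aut : appr (fun x => u x * th x).
  have [_ _ H] := au; split=> //.
    have [r _ offt] := csupp_off cth; exists r => x rx; by rewrite offt ?mulr0.
  move=> t t0; have Ct1 : 0 < Ct + 1 by rewrite ltr_wpDl.
  have [f [cf sf fu]] := H (t / (Ct + 1)) (divr_gt0 t0 Ct1).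
  have iF := csupp_intg cf sf.
  exists (fun x => f x * th x); split; [exact: contM|exact: csuppM|].
  apply: (@le_lt_trans _ _ (Ct * I (fun x => `|u x - f x|))); last first.
    apply: le_lt_trans (_ : _ <= (Ct + 1) * I (fun x => `|u x - f x|)) _.
      by rewrite ler_wpM2r ?Rint_ge0// lerDl.
    by rewrite mulrC -ltr_pdivlMr.
  rewrite -RintZ; last exact/intg_norm/intgB.
  apply: Rint_le => [||x].
  - apply: intg_norm; apply: intgB => //.
    by apply: eq_intg (intgMb mth HCt iF) => x; exact: mulrC.
  - exact/intgZ/intg_norm/intgB.
  - by rewrite -mulrBl normrM mulrC ler_wpM2r.
have [d1 d10 H1] := bounded_L1_weight 2 gap_intg e20.
have [d2 d20 H2] := moll_L1 aw d10.
have [d3 d30 H3] := moll_L1 aut e20.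
exists (Num.min dO (Num.min d2 d3)); first by rewrite !lt_min dO0 d20.
move=> d /andP[d0]; rewrite !lt_min => /and3P[ddO dd2 dd3].
rewrite Lam_ws// [leRHS](splitr e); apply: lerD.
  have iws : intg leb (ws d) by apply: convK_intg => //; have [] := aw.
  apply: (@le_trans _ _ (I (fun x => `|(ws d x - w x) * gap_density x|))); last first.
    apply/ltW/H1; [exact: intgB| |by apply: H2; rewrite d0].
    move=> x; have /andP[h1 h2] := ws01 x d0; have h3 := src_ge0 x srw; have h4 := w1 x.
    by rewrite ler_norml; apply/andP; split; lra.
  have mww : measurable_fun setT (fun x => ws d x - w x) by exact: intg_measurable (intgB iws iw).
  have i1 : intg leb (fun x => (ws d x - w x) * gap_density x).
    apply: (intgMb (C := 2)) gap_intg => // x.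
    have /andP[h1 h2] := ws01 x d0; have h3 := src_ge0 x srw; have h4 := w1 x.
    by rewrite ler_norml; apply/andP; split; lra.
  apply: ae_Rint_le; [exact: mulb|exact: intg_norm|].
  by apply: filterS gap_w => x h; apply: le_trans (ler_norm _); rewrite mulrBl h subr0.
have k5 := lap_intg d0.
have ck := @K_cont R N d; have sk := K_csuppT (N := N) d0.
have ccb := conv_continuous ck sk ib.
have k6 : intg leb (fun x => u x * th x * conv (K d) b x).
  have H : intg leb (fun x => u x * (th x * conv (K d) b x)).
    by apply: bnd => //; [exact: contM|exact: csuppM].
  by apply: eq_intg H => x; rewrite mulrA.
rewrite -RintN//; apply: (@le_trans _ _ (I (fun x => u x * th x * conv (K d) b x))).
  apply: Rint_le => // [|x]; first exact: intgN.
  have [/Kf ->|Kx] := pselect (~ K0 x); first by rewrite mulr0 !mul0r oppr0.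
  rewrite -mulrN ler_wpM2l ?mulr_ge0//; first by have [_ p] := Tth.
  apply: lap_ws => // y yx; apply: (dOH x); first exact: contrapT.
  by rewrite -ball_normE /= distrC (le_lt_trans yx).
rewrite (conv_swap ck sk ib iut (@KN R N d)).
have icu : intg leb (conv (K d) (fun x => u x * th x)).
  by apply: convK_intg => //; have [] := aut.
have mb : measurable_fun setT b by have [] := Sb.
have bb x : `|b x| <= 1 by rewrite ger0_norm ?b1// (src_ge0 x Sb).
apply: (@le_trans _ _ (I (fun x => `|conv (K d) (fun x => u x * th x) x - u x * th x|))); last first.
  by apply/ltW/H3; rewrite d0.
apply: ae_Rint_le; [exact: intgMb mb bb icu|exact/intg_norm/intgB|].
apply: filterS ub => x ux.
rewrite (_ : b x * _ = b x * (conv (K d) (fun x => u x * th x) x - u x * th x)); last first.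
  by rewrite mulrBr [b x * (_ * _)]mulrA [b x * u x]mulrC ux mul0r subr0.
by apply: le_trans (ler_norm _) _; rewrite normrM ler_piMl.
Qed.

End Measure_of_support.

(** * Translation of the definitions *)

Section Norms.
Context {R : realType} {N : nat}.
Local Notation leb := (@lebesgue_rV R N).
Local Notation I f := (Rintegral leb setT f).
Implicit Types (h : 'rV[R]_N -> R).

Lemma Lnorm1_Rint h : intg leb h -> Lnorm leb 1%E (EFin \o h) = (I (fun x => `|h x|))%:E.
Proof.
by move=> ih; rewrite Lnorm1 (EFin_Rint (intg_norm ih)); apply: eq_integral.
Qed.

Lemma Lnorm2_Rint h : L2 leb h ->
  Lnorm leb 2%:E (EFin \o h) = (Num.sqrt (I (fun x => h x ^+ 2)))%:E.
Proof.
move=> [mh ih]; rewrite unlock -powR12_sqrt ?Rint_ge0// => [|x]; last exact: sqr_ge0.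
rewrite -poweR_EFin; congr (_ `^ _)%E; rewrite (EFin_Rint ih); apply: eq_integral => x _ /=.
by rewrite powR_mulrn// real_normK ?num_real.
Qed.

Lemma L2_Lfun h : L2 leb h -> h \in Lfun leb 2%:E.
Proof.
move=> Lh; have [mh _] := Lh; rewrite inE; apply/andP; split; rewrite inE//=.
by rewrite /finite_norm Lnorm2_Rint// ltry.
Qed.

Lemma Lfun_measurable p h : h \in Lfun leb p -> measurable_fun setT h.
Proof. by rewrite inE => /andP[+ _]; rewrite inE. Qed.

Lemma Lfun_L2 h : h \in Lfun leb 2%:E -> L2 leb h.
Proof.
move=> Lh; split; first exact: Lfun_measurable Lh.
exact: Lfun2_integrable_sqr.
Qed.

Lemma Lfun_bounded h : h \in Lfun leb +oo%E ->
  exists2 M : R, 0 <= M & {ae leb, forall x, `|h x| <= M}.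
Proof.
move=> Lh; have := Lh; rewrite inE => /andP[_]; rewrite inE /= /finite_norm unlock.
(* The norm of exponent +oo is the essential supremum provided that the whole space has positive
   measure. *)
have -> : (0 < leb [set: 'rV[R]_N])%E.
  apply: lt_le_trans (leb_ball_gt0 (0 : 'rV[R]_N) (@ltr01 R)) _.
  by apply: le_measure; rewrite ?inE//; exact: measurable_ball_rV.
have := ess_sup_ge leb (abse \o (EFin \o h)).
case: (ess_sup _ _) => [r| |] H // _.
  exists (Num.max r 0); first by rewrite le_max lexx orbT.
  by apply: filterS H => x /=; rewrite lee_fin => h1; rewrite le_max h1.
by exists 0 => //; apply: filterS H => x.
Qed.

Lemma L2_close (z f k : 'rV[R]_N -> R) (e : R) : L2 leb z -> L2 leb f -> L2 leb k ->
  I (fun x => (f x - z x) ^+ 2) < e / 16 -> I (fun x => (k x - f x) ^+ 2) <= e / 8 ->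
  I (fun x => (k x - z x) ^+ 2) < e.
Proof.
move=> Lz Lf Lk h1 h2; have [_ i1] := L2B Lf Lz; have [_ i2] := L2B Lk Lf; have [_ i3] := L2B Lk Lz.
have : I (fun x => (k x - z x) ^+ 2) <= 2 * I (fun x => (k x - f x) ^+ 2) + 2 * I (fun x => (f x - z x) ^+ 2).
  rewrite -!RintZ// -RintD; [|exact: intgZ|exact: intgZ].
  apply: Rint_le => // [|x]; first by apply: intgD; exact: intgZ.
  by have := sqr_ge0 ((k x - f x) - (f x - z x)); move: (k x) (f x) (z x) => a b c; nra.
move: h1 h2; set A := I _; set B := I _; set C := I _ => h1 h2 h3.
have : 0 <= A by apply: Rint_ge0 => x; exact: sqr_ge0.
by move: A B C h1 h2 h3 => A B C *; lra.
Qed.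

End Norms.

(** * The spaces W_0^{1,p} of the statement and their reformulation *)

Section Sobolev_spaces.
Context {R : realType} {N : nat}.
Local Notation leb := (@lebesgue_rV R N).
Local Notation I f := (Rintegral leb setT f).
Variables (O : set 'rV[R]_N) (r0 : R).
Hypotheses (oO : open O) (rO : forall x, O x -> `|x| < r0).
Implicit Types (u f z : 'rV[R]_N -> R).

Lemma restrict_in u x : O x -> (u \_ O) x = u x.
Proof. by move=> Ox; rewrite patchE mem_set. Qed.

Lemma restrict_zo u : zo O (u \_ O).
Proof. by move=> x nO; rewrite patchE memNset. Qed.

Lemma restrict_id z : zo O z -> z \_ O = z.
Proof.
move=> z0; apply/funext => x; have [Ox|nO] := pselect (O x); first exact: restrict_in.
by rewrite restrict_zo// z0.
Qed.

Lemma restrict_sub f u : zo O f -> (f \- u) \_ O = fun x => f x - (u \_ O) x.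
Proof.
move=> f0; apply/funext => x; have [Ox|nO] := pselect (O x); first by rewrite !restrict_in.
by rewrite !restrict_zo// f0// subr0.
Qed.

Lemma W01_S1 u : W01 1 O u -> exists g, S1 O (u \_ O) g.
Proof.
move=> [g [/Lfun1_integrable iu ig _ H]]; exists (fun i => g i \_ O).
have ig' i : intg leb (g i \_ O) by apply/Lfun1_integrable; exact: ig.
split=> // [|i|e e0]; [exact: restrict_zo|exact: restrict_zo|].
have [f [tf f1 f2]] := H e e0; have Cf := test_C1c tf; exists f; split=> // [|i].
  have := f1; rewrite /Lp_dist restrict_sub; last exact: csupp_zo (test_csupp tf).
  by rewrite Lnorm1_Rint ?lte_fin//; apply: intgB => //; exact: C1c_intg Cf.
have := f2 i; rewrite /Lp_dist restrict_sub; last exact: csupp_zo (C1c_pcsupp i Cf).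
by rewrite Lnorm1_Rint ?lte_fin//; apply: intgB => //; exact: C1c_pintg Cf.
Qed.

Lemma sqrt_lt_sq (a e : R) : 0 < e -> (Num.sqrt a < e) = (a < e ^+ 2).
Proof.
by move=> e0; rewrite -{1}[e](ger0_norm (ltW e0)) -sqrtr_sqr ltr_sqrt// exprn_gt0.
Qed.

Lemma W01_S2 u : W01 2%:E O u -> exists g, S2 O (u \_ O) g.
Proof.
move=> [g [Lu Lg _ H]]; exists (fun i => g i \_ O).
have Lu' : L2 leb (u \_ O) := Lfun_L2 Lu.
have Lg' i : L2 leb (g i \_ O) := Lfun_L2 (Lg i).
split=> // [|i|e e0]; [exact: restrict_zo|exact: restrict_zo|].
have se : 0 < Num.sqrt e by rewrite sqrtr_gt0.
have [f [tf f1 f2]] := H _ se; have Cf := test_C1c tf; exists f.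
have E : Num.sqrt e ^+ 2 = e by rewrite sqr_sqrtr// ltW.
split=> // [|i].
  have := f1; rewrite /Lp_dist restrict_sub; last exact: csupp_zo (test_csupp tf).
  by rewrite Lnorm2_Rint ?lte_fin ?sqrt_lt_sq ?E//; apply: L2B => //; exact: C1c_L2 Cf.
have := f2 i; rewrite /Lp_dist restrict_sub; last exact: csupp_zo (C1c_pcsupp i Cf).
by rewrite Lnorm2_Rint ?lte_fin ?sqrt_lt_sq ?E//; apply: L2B => //; exact: C1c_pL2 Cf.
Qed.

Lemma integral_restrict h k : zo O k -> (forall x, O x -> h x = k x) -> intg leb k ->
  (\int[leb]_(x in O) (h x)%:E = (I k)%:E)%E.
Proof.
move=> k0 hk ik; rewrite integral_mkcond EFin_Rint//; apply: eq_integral => x _.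
rewrite patchE; have [Ox|nO] := pselect (O x); first by rewrite mem_set// hk.
by rewrite memNset// k0.
Qed.

Lemma ball_mass : exists2 B : R, 0 < B & forall h (e : R), L2 leb h -> zo O h -> 0 <= e ->
  (forall x, `|h x| <= e) -> I (fun x => h x ^+ 2) <= e ^+ 2 * B.
Proof.
pose k x : R := \1_(ball (0 : 'rV[R]_N) r0) x.
have ik : intg leb k by exact: indic_ball_intg.
have k0 x : 0 <= k x by rewrite /k indicE; case: (_ \in _).
exists (I k + 1); first by rewrite ltr_wpDl// Rint_ge0.
move=> h e [mh ih] h0 e0 he; apply: (@le_trans _ _ (e ^+ 2 * I k)); last first.
  by rewrite ler_wpM2l ?exprn_ge0// lerDl.
rewrite -RintZ//; apply: Rint_le => // [|x]; first exact: intgZ.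
have [Ox|/h0 ->] := pselect (O x); last by rewrite expr0n mulr_ge0// exprn_ge0.
rewrite /k indicE mem_set ?mulr1; last by rewrite -ball_normE /= sub0r normrN; exact: rO.
by rewrite -[leLHS]real_normK ?num_real// lerXn2r ?nnegrE.
Qed.

(** This way back is required for the solutions wA and wB, whose positivity sets have to be
    Sobolev-open in the sense of the statement. The C^1 approximants become smooth by [C1c_test],
    uniformly, hence in L^2 on the bounded set O. *)
Lemma S2_W01 z g : S2 O z g -> W01 2%:E O z.
Proof.
move=> Sz; have [Lz Lg z0 g0 H] := Sz; have S1z := S2_S1 rO Sz.
have [iz ig _ _ _] := S1z.
exists g; split.
- by rewrite /Lp restrict_id//; exact: L2_Lfun.
- by move=> i; rewrite /Lp restrict_id//; exact: L2_Lfun.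
- move=> i f tf; have Cf := test_C1c tf.
  have [[cf cdf Hf] sf] := Cf; have [C _ HC] := csupp_bounded cf sf.
  have [D _ HD] := csupp_bounded (cdf i) (C1c_pcsupp i Cf).
  have E : I (fun x => z x * partial i f x) = - I (fun x => g i x * f x).
    have b1 x : `|f x| <= Num.max C D by rewrite le_max HC.
    have b2 x : `|partial i f x| <= Num.max C D by rewrite le_max HD orbT.
    exact: S1_ibp S1z (proj1 Cf) b1 b2.
  rewrite (integral_restrict (k := fun x => z x * partial i f x))//; first last.
  - apply: eq_intg (intgMb (continuous_measurable_rV (cdf i)) HD iz) => x; exact: mulrC.
  - by move=> x nO; rewrite z0// mul0r.
  rewrite (integral_restrict (k := fun x => g i x * f x))//; first last.
  - apply: eq_intg (intgMb (continuous_measurable_rV cf) HC (ig i)) => x; exact: mulrC.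
  - by move=> x nO; rewrite g0// mul0r.
  by rewrite E EFinN.
- move=> e e0; have [B B0 HB] := ball_mass.
  have e40 : 0 < e ^+ 2 / 4 by rewrite divr_gt0// exprn_gt0.
  pose d := Num.min 1 (e ^+ 2 / 8 / B).
  have d0 : 0 < d by rewrite lt_min ltr01 !divr_gt0// exprn_gt0.
  have dB : d ^+ 2 * B <= e ^+ 2 / 8.
    have d1 : d <= 1 by rewrite ge_min lexx.
    have d2 : d <= e ^+ 2 / 8 / B by rewrite ge_min lexx orbT.
    rewrite -ler_pdivlMr//; apply: le_trans d2.
    by rewrite expr2 ler_piMl// ltW.
  have e16 : e ^+ 2 / 4 / 4 <= e ^+ 2 / 16 by lra.
  have [f [Cf f1 f2]] := H _ (divr_gt0 e40 (ltr0n R 4)).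
  have [f' [tf' g1 g2 _]] := C1c_test oO rO Cf d0.
  have Cf' := test_C1c tf'; have F0 := csupp_zo (test_csupp tf').
  exists f'; split=> // [|i].
  + rewrite /Lp_dist restrict_sub// restrict_id//.
    rewrite Lnorm2_Rint; last by apply: L2B => //; exact: C1c_L2 Cf'.
    rewrite lte_fin sqrt_lt_sq//.
    apply: (L2_close Lz (C1c_L2 Cf) (C1c_L2 Cf')); first exact: lt_le_trans f1 e16.
    apply: le_trans dB; apply: HB => //; last exact: ltW.
      exact: L2B (C1c_L2 Cf') (C1c_L2 Cf).
    by move=> x nO; rewrite F0// (csupp_zo (proj2 Cf))// subr0.
  + rewrite /Lp_dist restrict_sub; last exact: csupp_zo (C1c_pcsupp i Cf').
    rewrite restrict_id// Lnorm2_Rint; last by apply: L2B => //; exact: C1c_pL2 Cf'.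
    rewrite lte_fin sqrt_lt_sq//.
    apply: (L2_close (Lg i) (C1c_pL2 i Cf) (C1c_pL2 i Cf')); first exact: lt_le_trans (f2 i) e16.
    apply: le_trans dB; apply: HB => //; last exact: ltW.
      exact: L2B (C1c_pL2 i Cf') (C1c_pL2 i Cf).
    move=> x nO; rewrite (csupp_zo (C1c_pcsupp i Cf'))// (csupp_zo (C1c_pcsupp i Cf))// subr0//.
Qed.

End Sobolev_spaces.

(** * The extended-valued potential *)

Section Potential.
Context {R : realType} {N : nat}.
Local Notation leb := (@lebesgue_rV R N).
Local Notation I f := (Rintegral leb setT f).
Variables (O : set 'rV[R]_N) (r0 : R) (V : 'rV[R]_N -> \bar R).
Hypotheses (oO : open O) (rO : forall x, O x -> `|x| < r0).
Hypotheses (mV : measurable_fun O V) (V_ge0 : forall x, O x -> (0 <= V x)%E).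
Implicit Types (u f w phi : 'rV[R]_N -> R).

Let mO : measurable O. Proof. exact: open_measurable_mx. Qed.

(** Zero outside O, and also where V is infinite, since [fine +oo] is 0; the information lost there
    is kept by [inf_pot] and enters the form domain as a constraint. *)
Definition pot x : R := fine ((V \_ O) x).

Definition inf_pot := [set x | O x /\ V x = +oo%E].

Let mVO : measurable_fun setT (V \_ O).
Proof. exact/(measurable_restrictT _ mO). Qed.

Lemma pot_measurable : measurable_fun setT pot.
Proof.
by apply: (measurable_comp (F := setT)) mVO => //; exact: fine_measurable.
Qed.

Lemma pot_ge0 x : 0 <= pot x.
Proof.
rewrite /pot patchE; case: ifPn => // /set_mem Ox; exact/fine_ge0/V_ge0.
Qed.

Lemma potE x : O x -> ~ inf_pot x -> V x = (pot x)%:E.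
Proof.
move=> Ox Yx; rewrite /pot patchE mem_set// fineK// ge0_fin_numE ?V_ge0//.
by rewrite ltey; apply/eqP => Vx; apply: Yx.
Qed.

(** An integrable function is finite almost everywhere, and where V is infinite V u is finite only
    if u = 0. The product may then be computed with the finite part of V. *)
Lemma pot_intg u : measurable_fun setT (u \_ O) ->
  leb.-integrable O (fun x => V x * (u x)%:E)%E ->
  intg leb (fun x => pot x * (u \_ O) x) /\
  {ae leb, forall x, inf_pot x -> (u \_ O) x = 0}.
Proof.
move=> mu iu.
have u0 : {ae leb, forall x, inf_pot x -> (u \_ O) x = 0}.
  apply: filterS (integrable_ae mO iu) => x H [Ox Vx]; rewrite restrict_in//.
  have := H Ox; rewrite Vx; have [h|h|//] := ltgtP (u x) 0.
    by rewrite lt0_mulye// lte_fin.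
  by rewrite gt0_mulye// lte_fin.
split=> //; have mp := pot_measurable.
have mpu : measurable_fun setT (fun x => pot x * (u \_ O) x) by exact: measurable_funM.
have /integrableP[mF iF] := (integrable_mkcond _ mO).1 iu.
apply/integrableP; split; first exact/measurable_EFinP.
move: iF; congr (_ < _)%E; apply: ae_eq_integral => //.
- exact: measurableT_comp mF.
- by apply: measurableT_comp => //; exact/measurable_EFinP.
- apply: filterS u0 => x Yx _.
  have E : ((fun x => V x * (u x)%:E)%E \_ O) x = (pot x * (u \_ O) x)%:E.
    have [Ox|nO] := pselect (O x); last by rewrite !patchE !memNset// mulr0.
    have [Yx'|Yx'] := pselect (inf_pot x).
      have := Yx Yx'; rewrite restrict_in// => ux.
      by rewrite !patchE mem_set// ux mule0 mulr0.
    by rewrite !patchE mem_set// potE// EFinM.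
  by apply: (congr1 (@abse R)); exact: E.
Qed.

(** At almost every point where V is infinite, u = 0 and the convention 0 * oo = 0 makes both
    integrands vanish; elsewhere V is a real number. *)
Lemma weak_schroedingerE u phi : intg leb (u \_ O) -> intg leb (fun x => pot x * (u \_ O) x) ->
  {ae leb, forall x, inf_pot x -> (u \_ O) x = 0} -> test_function O phi ->
  weak_schroedinger O V u phi =
  (I (fun x => pot x * (u \_ O) x * phi x) - I (fun x => (u \_ O) x * laplacian phi x))%:E.
Proof.
move=> iu ipu u0 tp; have sp := test_smooth tp; have [cp _ _] := smooth_C1 sp.
have cl := laplacian_cont sp; have cs := test_csupp tp; have ls := laplacian_csupp sp cs.
have bnd (k h : 'rV[R]_N -> R) : continuous k -> csupp O k -> intg leb h -> intg leb (fun x => h x * k x).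
  move=> ck sk ih; have [C _ HC] := csupp_bounded ck sk.
  by apply: eq_intg (intgMb (continuous_measurable_rV ck) HC ih) => x; exact: mulrC.
have i1 := bnd _ _ cp cs ipu; have i2 := bnd _ _ cl ls iu; have i3 := intgB i1 i2.
rewrite -RintB// EFin_Rint// /weak_schroedinger [LHS]integral_mkcond.
have mu' := intg_measurable iu.
have E : (fun x => (u x)%:E * ((- laplacian phi x)%:E + V x * (phi x)%:E))%E \_ O =
  (fun x => ((u \_ O) x)%:E * ((- laplacian phi x)%:E + (V \_ O) x * (phi x)%:E))%E.
  apply/funext => x; have [Ox|nO] := pselect (O x); last first.
    by rewrite !patchE !memNset// mul0e.
  by rewrite !patchE !mem_set.
rewrite E; apply: ae_eq_integral => //.
- apply: emeasurable_funM; first exact/measurable_EFinP.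
  apply: emeasurable_funD.
    apply/measurable_EFinP; apply: measurableT_comp => //; exact: continuous_measurable_rV.
  by apply: emeasurable_funM => //; apply/measurable_EFinP; exact: continuous_measurable_rV.
- by apply/measurable_EFinP; exact: intg_measurable i3.
- apply: filterS u0 => x Yx _ /=.
  have [Ox|nO] := pselect (O x); last by rewrite !patchE !memNset// !mul0e !(mulr0, mul0r) subr0.
  have [Yx'|Yx'] := pselect (inf_pot x).
    by rewrite (Yx Yx') !mul0e !(mulr0, mul0r) subr0.
  have -> : (V \_ O) x = (pot x)%:E by rewrite patchE mem_set// potE.
  transitivity ((u \_ O) x * (- laplacian phi x + pot x * phi x))%:E.
    by rewrite EFinM EFinD EFinM.
  by congr EFin; move: (pot x) ((u \_ O) x) => a b; ring.
Qed.

Hypotheses (bO : smooth_boundary O) (N0 : (0 < N)%N).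

Let mpot := pot_measurable.

Lemma nonneg_of_supersol z g : S1 O z g -> intg leb (fun x => pot x * z x) ->
  supersol O pot z -> {ae leb, forall x, 0 <= z x}.
Proof.
move=> Sz iVz sz; apply: (comparison oO rO bO N0 pot_ge0 Sz iVz) => phi tp p0; exact: sz.
Qed.

Lemma eq_ae_forms z v phi : intg leb z -> intg leb (fun x => pot x * z x) -> measurable_fun setT v ->
  {ae leb, forall x, z x = v x} -> test_function O phi ->
  I (fun x => pot x * v x * phi x) - I (fun x => v x * laplacian phi x) =
  I (fun x => pot x * z x * phi x) - I (fun x => z x * laplacian phi x).
Proof.
move=> iz iVz mv zv tp; have sp := test_smooth tp; have [cp _ _] := smooth_C1 sp.
have mp := continuous_measurable_rV cp; have ml := continuous_measurable_rV (laplacian_cont sp).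
have mz := intg_measurable iz.
congr (_ - _); apply: ae_Rint_eq.
- by apply: measurable_funM => //; exact: measurable_funM.
- by apply: measurable_funM => //; exact: measurable_funM.
- by apply: filterS zv => x ->.
- exact: measurable_funM.
- exact: measurable_funM.
- by apply: filterS zv => x ->.
Qed.

(** The definition of competitors does not ask for a sign: it comes from the comparison principle
    and f >= 0. The functions v and f of the conclusion are representatives that are nonnegative and
    bounded at every point. *)
Lemma competitor_data w : zero_set_competitor O V w -> exists v f G M,
  [/\ S2 O v G, forall x, 0 <= v x <= M, {ae leb, forall x, inf_pot x -> v x = 0} &
      intg leb (fun x => pot x * v x)] /\
  [/\ src O f, forall phi, test_function O phi ->
    I (fun x => pot x * v x * phi x) - I (fun x => v x * laplacian phi x) = I (fun x => f x * phi x) &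
    {ae leb, forall x, (w \_ O) x = v x}].
Proof.
move=> [Ww Lw iVw [f [Lf f0 eqf]]]; have [G Sw] := W01_S2 Ww.
have S1w := S2_S1 rO Sw; have [iw _ wO _ _] := S1w; have mw := intg_measurable iw.
have [M M0 wM] := Lfun_bounded Lw; have [Mf Mf0 fM] := Lfun_bounded Lf.
have mf := Lfun_measurable Lf.
have [ip wY] := pot_intg mw iVw.
have f0' x : 0 <= (f \_ O) x.
  by rewrite patchE; case: ifPn => // /set_mem /f0.
pose ff x := Num.min ((f \_ O) x) Mf.
have mff : measurable_fun setT ff by exact: measurable_minr.
have Sff : src O ff.
  split=> //; first by move=> x nO; rewrite /ff restrict_zo// min_l.
  by exists Mf => x; rewrite /ff le_min f0' Mf0 ge_min lexx orbT.
have ffE : {ae leb, forall x, ff x = (f \_ O) x}.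
  by apply: filterS fM => x h; rewrite /ff min_l// (le_trans (ler_norm _)).
have iff := src_intg rO Sff; have if' := ae_intg mf ffE iff.
have eqw phi : test_function O phi ->
    I (fun x => pot x * (w \_ O) x * phi x) - I (fun x => (w \_ O) x * laplacian phi x) = I (fun x => ff x * phi x).
  move=> tp; have [cp _ _] := smooth_C1 (test_smooth tp); have [C _ HC] := csupp_bounded cp (test_csupp tp).
  have mp := continuous_measurable_rV cp.
  have := eqf phi tp; rewrite weak_schroedingerE// (integral_restrict (k := fun x => (f \_ O) x * phi x)).
  - move=> H; rewrite (EFin_inj H); apply: ae_Rint_eq; [exact: measurable_funM|exact: measurable_funM|].
    by apply: filterS ffE => x ->.
  - by move=> x nO; rewrite restrict_zo// mul0r.
  - by move=> x Ox; rewrite restrict_in.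
  - by apply: eq_intg (intgMb mp HC if') => x; exact: mulrC.
have w0 : {ae leb, forall x, 0 <= (w \_ O) x}.
  apply: nonneg_of_supersol S1w ip _ => phi [tp p0]; rewrite eqw//.
  by apply: Rint_ge0 => x; rewrite mulr_ge0// (src_ge0 x Sff).
pose v x := Num.min (Num.max ((w \_ O) x) 0) M.
have mv : measurable_fun setT v by apply: measurable_minr => //; exact: measurable_maxr.
have vE : {ae leb, forall x, (w \_ O) x = v x}.
  apply: filterS2 wM w0 => x h1 h2; rewrite /v max_l// min_l//.
  exact: le_trans (ler_norm _) h1.
have vO : zo O v by move=> x nO; rewrite /v restrict_zo// max_l// min_l.
exists v, ff, G, M; split; split=> //.
- exact: S2_ae Sw mv vO vE.
- by move=> x; rewrite /v le_min le_max lexx orbT M0 ge_min lexx orbT.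
- by apply: filterS2 wY vE => x h <-.
- by apply: ae_intg ip; [exact: measurable_funM|apply: filterS vE => x ->].
- by move=> phi tp; rewrite (eq_ae_forms iw ip mv vE tp) eqw.
Qed.

(** U is a representative of u that is nonnegative everywhere, by comparison with mu >= 0.
    Finiteness of mu makes every test function integrable. *)
Lemma dirichlet_data (mu : {finite_measure set 'rV[R]_N -> \bar R}) u :
  dirichlet_solution O V mu u -> exists U gU,
  [/\ S1 O U gU, forall x, 0 <= U x, intg leb (fun x => pot x * U x),
      forall phi, test_function O phi -> intg mu phi /\
        I (fun x => pot x * U x * phi x) - I (fun x => U x * laplacian phi x) = Rintegral mu setT phi &
      {ae leb, forall x, (u \_ O) x = U x}].
Proof.
move=> [Wu iVu eqm]; have [g Su] := W01_S1 Wu; have [iu _ uO _ _] := Su; have m := intg_measurable iu.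
have [ip uY] := pot_intg m iVu.
have eqw phi : test_function O phi -> intg mu phi /\
    I (fun x => pot x * (u \_ O) x * phi x) - I (fun x => (u \_ O) x * laplacian phi x) = Rintegral mu setT phi.
  move=> tp; have [cp _ _] := smooth_C1 (test_smooth tp); have [C C0 HC] := csupp_bounded cp (test_csupp tp).
  have iphi : intg mu phi.
    apply: (intg_le (g := fun=> C)) => //; first exact: continuous_measurable_rV.
    by apply: finite_measure_integrable_cst.
  split=> //; have := eqm phi tp; rewrite weak_schroedingerE// => E; apply: EFin_inj; rewrite E.
  rewrite integral_mkcond EFin_Rint//; apply: eq_integral => x _; rewrite patchE.
  have [Ox|nO] := pselect (O x); first by rewrite mem_set.
  by rewrite memNset// (csupp_zo (test_csupp tp)).
have u0 : {ae leb, forall x, 0 <= (u \_ O) x}.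
  apply: nonneg_of_supersol Su ip _ => phi [tp p0]; have [_ ->] := eqw _ tp; exact: Rint_ge0.
pose U x := Num.max ((u \_ O) x) 0.
have mU : measurable_fun setT U by exact: measurable_maxr.
have UE : {ae leb, forall x, (u \_ O) x = U x} by apply: filterS u0 => x h; rewrite /U max_l.
have UO : zo O U by move=> x nO; rewrite /U restrict_zo// max_l.
exists U, g; split=> //.
- exact: S1_ae Su mU UO UE.
- by move=> x; rewrite /U le_max lexx orbT.
- by apply: ae_intg ip; [exact: measurable_funM|apply: filterS UE => x ->].
- by move=> phi tp; have [h <-] := eqw _ tp; split=> //; rewrite (eq_ae_forms iu ip mU UE tp).
Qed.

End Potential.

(** * Components and the measure *)

Section Representatives.
Context {R : realType} {N : nat}.
Local Notation leb := (@lebesgue_rV R N).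
Local Notation I f := (Rintegral leb setT f).
Implicit Types (u v z : 'rV[R]_N -> R) (O : set 'rV[R]_N).

Lemma lebesgue_value_ae u v x (c : R) : intg leb u -> measurable_fun setT v ->
  {ae leb, forall y, u y = v y} -> lebesgue_value u x c -> lebesgue_value v x c.
Proof.
move=> iu mv uv; have iv := ae_intg mv uv iu; have mu := intg_measurable iu.
move=> /(lebesgue_valueP x c iu) H; apply/(lebesgue_valueP x c iv).
suff -> : avg v x c = avg u x c by [].
apply/funext => r; rewrite /avg; congr (_ * _); apply: ae_Rint_eq.
- by apply: measurable_funM; [exact: eb_meas|apply: measurableT_comp => //; exact: measurable_funB].
- by apply: measurable_funM; [exact: eb_meas|apply: measurableT_comp => //; exact: measurable_funB].
- by apply: filterS uv => y ->.
Qed.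

Lemma precise_restrict O u x (c : R) : open O -> O x -> intg leb (u \_ O) ->
  lebesgue_value (u \_ O) x c -> lebesgue_point u x /\ precise u x = c.
Proof.
move=> oO Ox iu uc.
have uc' : lebesgue_value u x c.
  by apply: (lebesgue_value_local oO Ox _ uc) => y Oy; exact: restrict_in.
split; first by exists c.
rewrite /precise; case: xgetP => [c' _ H'|/(_ c)//].
apply: (lebesgue_value_uniq (x := x) iu) => //.
by apply: (lebesgue_value_local oO Ox _ H') => y Oy; rewrite restrict_in.
Qed.

Lemma restrict_value O u x : open O -> O x -> intg leb (u \_ O) -> lebesgue_point u x ->
  lebesgue_value (u \_ O) x (precise u x).
Proof.
move=> oO Ox iu [c uc].
have uc' : lebesgue_value (u \_ O) x c.
  by apply: (lebesgue_value_local oO Ox _ uc) => y Oy; rewrite restrict_in.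
by have [_ ->] := precise_restrict oO Ox iu uc'.
Qed.

Lemma cvg_comp_shift (F : nat -> R) m (l : R) : F n @[n --> \oo] --> l ->
  F (n + m)%N @[n --> \oo] --> l.
Proof. by move=> h; have := h; rewrite -(cvg_shiftn m). Qed.

Definition moll n z := conv (K n.+1%:R^-1) z.

Lemma moll_value z x (c : R) : intg leb z -> lebesgue_value z x c ->
  moll n z x @[n --> \oo] --> c.
Proof.
move=> iz /(lebesgue_value_conv iz) /cvg_at_rightP; apply; split; last exact: cvg_harmonic.
by move=> n; rewrite invr_gt0.
Qed.

(** On O the precise representative of xi is the pointwise limit of its mollifications, hence a
    Borel function. Monotonicity of mu on a component relies on this. *)
Lemma sobolev_open_measurable O (r0 : R) A : open O -> (forall x, O x -> `|x| < r0) ->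
  sobolev_open O A -> measurable A.
Proof.
move=> oO rO [xi [Wxi _ px ->]]; have [g Sx] := W01_S2 Wxi.
have [ix _ _ _ _] := S2_S1 rO Sx.
pose h n x : R := \1_O x * moll n (xi \_ O) x.
have mh n : measurable_fun setT (h n).
  apply: measurable_funM; first by apply: measurable_indic; exact: open_measurable_mx.
  have d0 : 0 < n.+1%:R^-1 :> R by rewrite invr_gt0.
  exact: continuous_measurable_rV (conv_continuous (@K_cont R N _) (K_csuppT d0) ix).
pose k x : R := \1_O x * precise xi x.
have hk x : h n x @[n --> \oo] --> k x.
  have [Ox|nO] := pselect (O x); last first.
    rewrite /k indicE memNset// mul0r; apply: cvg_near_cst; apply: nearW => n.
    by rewrite /h indicE memNset// mul0r.
  apply: cvgM; first exact: cvg_cst.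
  by apply: moll_value => //; apply: restrict_value => //; exact: px.
have mk : measurable_fun setT k by apply: (measurable_fun_cvg (h := h)) => // x _; exact: hk.
have := mk measurableT _ (measurable_itv `]0, +oo[); rewrite setTI; congr measurable.
apply/seteqP; split=> x /=; rewrite in_itv/= andbT /k indicE.
  by have [Ox|nO] := pselect (O x); [rewrite mem_set// mul1r|rewrite memNset// mul0r ltxx].
by move=> [Ox]; rewrite mem_set// mul1r.
Qed.

End Representatives.

(** * From mollifications to precise representatives under the measure *)

Section Null_set.
Context {R : realType} {N : nat}.
Local Notation leb := (@lebesgue_rV R N).
Variables (O : set 'rV[R]_N) (r0 : R) (mu : {finite_measure set 'rV[R]_N -> \bar R}).
Hypotheses (oO : open O) (rO : forall x, O x -> `|x| < r0).

(** The measure may charge Lebesgue-null sets, so convergence almost everywhere is not enough: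
    mollifications converge to the precise representative at every point of O, which allows Fatou's
    lemma under mu. The cutoffs th then run through the cover of [test_cover]. *)
Lemma null_of_gap w : intg leb w -> (forall x, 0 <= w x) ->
  (forall x, O x -> lebesgue_value w x (precise w x)) ->
  (forall th, test0 O th -> forall n, intg mu (fun x => th x * moll n w x)) ->
  (forall th, test0 O th -> forall e : R, 0 < e -> exists2 d0 : R, 0 < d0 & forall d, 0 < d < d0 ->
    Rintegral mu setT (fun x => th x * conv (K d) w x) <= e) ->
  {ae mu, forall x, O x -> precise w x = 0}.
Proof.
move=> iw w0 pw im gap; have [phi [Tphi cov]] := test_cover oO.
have key n : {ae mu, forall x, phi n x * precise w x = 0}.
  have T := Tphi n; have [tp p0] := T; set th := phi n in T tp p0 *.
  have cv x : th x * moll n w x @[n --> \oo] --> th x * precise w x.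
    have [Ox|nO] := pselect (O x); last first.
      rewrite (csupp_zo (test_csupp tp))// mul0r; apply: cvg_near_cst; apply: nearW => m.
      by rewrite mul0r.
    by apply: cvgM; [exact: cvg_cst|apply: moll_value => //; exact: pw].
  have mth m : measurable_fun setT (fun x => th x * moll m w x) := intg_measurable (im _ T m).
  have mlim : measurable_fun setT (fun x => th x * precise w x).
    by apply: (measurable_fun_cvg (h := fun m x => th x * moll m w x)) => // x _; exact: cv.
  have moll0 m x : 0 <= moll m w x.
    have d0 : 0 < m.+1%:R^-1 :> R by rewrite invr_gt0.
    apply: conv_ge0 (@K_cont R N _) (K_csuppT d0) iw (fun y => K_ge0 y d0) _.
    exact: aeW.
  have bound e : 0 < e -> intg mu (fun x => th x * precise w x) /\
      Rintegral mu setT (fun x => th x * precise w x) <= e.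
    move=> e0; have [d0 d00 H] := gap _ T e e0.
    have [m0 Hm0] : exists m0, forall m, (m0 <= m)%N -> m.+1%:R^-1 < d0.
      have := near_infty_natSinv_lt (PosNum d00); case=> m0 _ Hm; exists m0 => m; exact: Hm.
    apply: (Rint_fatou (F := fun m x => th x * moll (m + m0) w x)) => //.
    - by move=> m; exact: im.
    - by move=> m x; rewrite mulr_ge0.
    - apply: aeW => x; exact: (cvg_comp_shift m0 (cv x)).
    - by move=> m; apply: H; rewrite invr_gt0 ltr0n/= Hm0// leq_addl.
  have [ip _] := bound 1 ltr01.
  apply: Rint_eq0_ae => // [x|]; last first.
    by apply/ler_addgt0Pr => e e0; rewrite add0r; have [] := bound e e0.
  have := cv x => /cvg_lim <-//; apply: limr_ge; first exact: cvgP (cv x).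
  by apply: nearW => m; rewrite mulr_ge0.
have := ae_foralln key; apply: filterS => x Ex Ox; have [n pn] := cov x Ox.
by apply/eqP; have /eqP := Ex n; rewrite mulf_eq0 (gt_eqF pn).
Qed.

End Null_set.

(** * Sobolev-open supports of solutions and the zero set *)

Section Supports.
Context {R : realType} {N : nat}.
Local Notation leb := (@lebesgue_rV R N).
Local Notation I f := (Rintegral leb setT f).
Variables (O : set 'rV[R]_N) (r0 : R) (V : 'rV[R]_N -> \bar R).
Hypotheses (oO : open O) (rO : forall x, O x -> `|x| < r0).
Hypotheses (mV : measurable_fun O V) (V_ge0 : forall x, O x -> (0 <= V x)%E).
Hypotheses (bO : smooth_boundary O) (N0 : (0 < N)%N).
Local Notation Vr := (pot O V).
Local Notation Y := (inf_pot O V).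
Local Notation src := (src O).
Implicit Types (a w : 'rV[R]_N -> R).

Let mVr := pot_measurable oO mV.
Let Vr0 := pot_ge0 V_ge0.

Definition psupp w := [set x | O x /\ 0 < precise w x].

Lemma sol_precise a w x : sol O Vr Y 2 a w -> src a -> (forall y, a y <= 1) -> src w -> O x ->
  lebesgue_value w x (precise w x) /\ 0 <= precise w x.
Proof.
move=> Sw Sa a1 srw Ox; have [c wc c0] := sol_value oO rO mVr Vr0 (ltr0n _ 2) Sw Sa a1 srw Ox.
by rewrite (preciseE (src_intg rO srw) wc).
Qed.

Lemma sobolev_open_psupp a w : sol O Vr Y 2 a w -> src a -> (forall y, a y <= 1) -> src w ->
  sobolev_open O (psupp w).
Proof.
move=> Sw Sa a1 srw; have [g [[S2w _ _] _ _]] := Sw; exists w; split=> //.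
- exact: (S2_W01 oO rO S2w).
- by move=> x _; exact: src_ge0 srw.
- by move=> x Ox; exists (precise w x); have [] := sol_precise Sw Sa a1 srw Ox.
Qed.

Lemma psupp_disjoint a w b v : sol O Vr Y 2 a w -> src a -> (forall y, a y <= 1) -> src w ->
  sol O Vr Y 2 b v -> src b -> (forall y, b y <= 1) -> src v ->
  {ae leb, forall x, w x * v x = 0} -> psupp w `&` psupp v = set0.
Proof.
move=> Sw Sa a1 srw Sv Sb b1 srv wv; apply/seteqP; split=> // x [[Ox wx] [_ vx]].
have [h1 _] := sol_precise Sw Sa a1 srw Ox; have [h2 _] := sol_precise Sv Sb b1 srv Ox.
have E := lebesgue_value_mul0 (src_intg rO srw) (src_intg rO srv) wv h1 h2.
by have := mulr_gt0 wx vx; rewrite E ltxx.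
Qed.

(** Where both w and v have value 0, a competitor, being at most C (w + v) and nonnegative almost
    everywhere, has value 0 as well. Its Lebesgue value exists because its source is bounded. *)
Lemma psupp_cover a w b v : sol O Vr Y 2 a w -> src a -> (forall y, a y <= 1) -> src w ->
  sol O Vr Y 2 b v -> src b -> (forall y, b y <= 1) -> src v ->
  dominates O Vr Y (fun x => w x + v x) ->
  O `\` universal_zero_set O V `<=` psupp w `|` psupp v.
Proof.
move=> Sw Sa a1 srw Sv Sb b1 srv dom x [Ox nZ]; apply: contrapT => nP; apply: nZ; split=> // z cz.
have [h [f [G [M [[Sh hM hY iVh] [Sf eqh zh]]]]]] := competitor_data oO rO mV V_ge0 bO N0 cz.
have [C C0 hC] := dom h f G M Sh hM hY iVh Sf eqh.
have S1h := S2_S1 rO Sh; have [ih _ hO _ _] := S1h; have [ah _] := S1_appr rO S1h.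
have h0 y : 0 <= h y by have /andP[] := hM y.
have [_ _ [Mf fM]] := Sf.
have Mf0 : 0 <= Mf by have /andP[p q] := fM 0; exact: le_trans q.
have sC : superC O Mf h.
  move=> phi tp p0; have Tp : test0 O phi by [].
  have ip := csupp_intg (let: And3 c _ _ := smooth_C1 (test_smooth tp) in c) (test_csupp tp).
  have h1 : 0 <= I (fun y => Vr y * h y * phi y) by apply: Rint_ge0 => y; rewrite !mulr_ge0// Vr0.
  have h2 : I (fun y => f y * phi y) <= Mf * I phi.
    rewrite -RintZ//; apply: Rint_le => [||y]; [exact: test0_intg Tp (src_intg rO Sf)|exact: intgZ|].
    by rewrite ler_wpM2r//; have /andP[] := fM y.
  by apply: le_trans h2; rewrite -(eqh _ tp) lerDr.
have [p [hp p0 _]] := superC_lebesgue oO ah (aeW _ h0) Mf0 sC Ox.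
have zero q g : sol O Vr Y 2 q g -> src q -> (forall y, q y <= 1) -> src g -> ~ psupp g x ->
    lebesgue_value g x 0.
  move=> Sg Sq q1 srg ng; have [g1 g2] := sol_precise Sg Sq q1 srg Ox.
  suff <- : precise g x = 0 by [].
  by apply/le_anti; rewrite g2 andbT leNgt; apply/negP => g3; apply: ng.
have w0 : lebesgue_value w x 0 by apply: zero Sw Sa a1 srw _ => ?; apply: nP; left.
have v0 : lebesgue_value v x 0 by apply: zero Sv Sb b1 srv _ => ?; apply: nP; right.
have pz := lebesgue_value_le ih (src_intg rO srw) (src_intg rO srv) hC hp w0 v0.
have E : p = 0 by apply/le_anti; rewrite pz p0.
rewrite {}E in hp.
have [Wz _ _ _] := cz; have [gz Sz] := W01_S2 Wz; have [iz _ _ _ _] := S2_S1 rO Sz.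
apply: (precise_restrict oO Ox iz); apply: (lebesgue_value_ae ih (intg_measurable iz) _ hp).
by apply: filterS zh => y ->.
Qed.

End Supports.

Theorem theorem13p1 (R : realType) (N : nat) (N_gt0 : (0 < N)%N)
    (Omega : set 'rV[R]_N) (dom : smooth_bounded_domain Omega)
    (V : 'rV[R]_N -> \bar R) (mV : measurable_fun Omega V)
    (V_ge0 : forall x, Omega x -> (0 <= V x)%E)
    (J : Type) (D : J -> set 'rV[R]_N)
    (compD : sobolev_components Omega (Omega `\` universal_zero_set Omega V) D)
    (mu : {finite_measure set 'rV[R]_N -> \bar R})
    (u : 'rV[R]_N -> R) (sol : dirichlet_solution Omega V mu u) (j : J) :
  (exists x, [/\ D j x, lebesgue_point u x & precise u x = 0]) ->
  (forall y, D j y -> lebesgue_point u y -> precise u y = 0) /\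
  mu (D j) = 0%E.
Proof.
move=> [x0 [Dx0 lx0 px0]].
have [oO cO [M [_ HM]] bO] := dom; have [_ cD tD DZ] := compD; have [D0 oD [_ connD]] := cD j.
have [r0 rO] : exists r0, forall x, Omega x -> `|x| < r0.
  (* Boundedness gives a large inequality for each bound above M, such as M + 1; the second 1 makes
     it strict. *)
  exists (M + 1 + 1) => x Ox; apply: le_lt_trans (HM (M + 1) _ x Ox) _; last by rewrite ltrDl.
  by rewrite ltrDl.
have DO x : D j x -> Omega x.
  by move=> Dx; have [] : (Omega `\` universal_zero_set Omega V) x by rewrite -DZ; exists j.
have mp := pot_measurable oO mV; have p0 := pot_ge0 V_ge0.
set Vr := pot Omega V in mp p0; set Y := inf_pot Omega V.
have [U [gU [SU U0 iVU eqU UE]]] := dirichlet_data oO rO mV V_ge0 bO N_gt0 sol.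
have [gu Su] : exists gu, S1 Omega (u \_ Omega) gu by case: sol => Wu _ _; exact: W01_S1.
have [iu _ _ _ _] := Su; have [iU _ _ _ _] := SU.
have Uval y : D j y -> lebesgue_point u y -> lebesgue_value U y (precise u y).
  move=> Dy ly; apply: (lebesgue_value_ae iu (intg_measurable iU) UE).
  exact: restrict_value oO (DO _ Dy) iu ly.
have superU : supersol Omega Vr U.
  by move=> phi [tp p]; have [_ ->] := eqU _ tp; exact: Rint_ge0.
have [a [b [wA [wB [[Sa Sb srA srB] [SA SB a1 b1 wB1] wAB [UwB Ub] [A0 dAB]]]]]] :=
  zero_decomposition Y oO rO bO N_gt0 mp p0 SU U0 iVU superU.
have disj := psupp_disjoint oO rO mV V_ge0 SA Sa a1 srA SB Sb b1 srB wAB.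
have cov := psupp_cover oO rO mV V_ge0 bO N_gt0 SA Sa a1 srA SB Sb b1 srB dAB.
have DB : D j `<=` psupp Omega wB.
  have DAB : D j `<=` psupp Omega wA `|` psupp Omega wB.
    by move=> x Dx; apply: cov; rewrite -DZ; exists j.
  have oA := sobolev_open_psupp oO rO mV V_ge0 SA Sa a1 srA.
  have oB := sobolev_open_psupp oO rO mV V_ge0 SB Sb b1 srB.
  case: (connD _ _ oA oB disj DAB) => [DA|H]; last exact: H.
  have [_ wx0] := DA _ Dx0; have ux0 := Uval _ Dx0 lx0; rewrite px0 in ux0.
  have E := preciseE (src_intg rO srA) (A0 _ (DO _ Dx0) ux0).
  by exfalso; move: wx0; rewrite E ltxx.
have Bval x : Omega x -> lebesgue_value wB x (precise wB x).
  by move=> Ox; have [] := sol_precise oO rO mV V_ge0 SB Sb b1 srB Ox.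
split=> [y Dy ly|].
  have [_ wy] := DB _ Dy.
  have E := lebesgue_value_mul0 iU (src_intg rO srB) UwB (Uval _ Dy ly) (Bval _ (DO _ Dy)).
  by apply: (mulIf (lt0r_neq0 wy)); rewrite E mul0r.
have iwB := src_intg rO srB.
have Tmoll th d : test0 Omega th -> 0 < d -> test_function Omega (fun x => th x * conv (K d) wB x).
  move=> [tth _] d0; apply: csupp_test; last exact: csuppM (test_csupp tth).
  by apply: smoothM (test_smooth tth) _; exact: conv_smooth (@K_smooth R N d) (K_csuppT d0) iwB.
have null : {ae mu, forall x, Omega x -> precise wB x = 0}.
  apply: (null_of_gap oO iwB (fun x => src_ge0 x srB) Bval) => [th Tth n|th Tth e e0].
    have d0 : 0 < n.+1%:R^-1 :> R by rewrite invr_gt0.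
    by have [] := eqU _ (Tmoll _ _ Tth d0).
  have [d0 d00 H] := measure_gap oO rO mp p0 SU U0 iVU SB Sb b1 srB wB1 UwB Ub Tth e0.
  exists d0 => // d dd; have := H d dd; have /andP[dp _] := dd.
  by have [_ <-] := eqU _ (Tmoll _ _ Tth dp).
have [Z [mZ Z0 subZ]] := null.
apply/eqP; rewrite eq_le measure_ge0 andbT -Z0 le_measure// ?inE//.
  exact: sobolev_open_measurable oO rO oD.
move=> x Dx; apply: subZ => /= h; have [Ox] := DB _ Dx; by rewrite h ?ltxx.
Qed.
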